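(* Assume that for a virtual knot (or free knot) diagram $K$ with $n$ classical crossings the graph $K_{us}$ has neither bigons nor quadrilaterals. Then every knot diagram $K'$ equivalent to $K$ (as virtual knot, respectively as free knot) has a state $s$ such that $K'_s$ contains $K_{us}$ as a subgraph. This state can be treated as an element of $\mathcal M$. In particular, $K$ is minimal, and all minimal diagrams of this free knot have the same number of crossings.
   Context: **States.** Diagrams are oriented. At a classical crossing (or a node of a framed $4$-valent graph) with incoming edges $a,b$ and outgoing edges $c,d$, where $a$ continues to its opposite edge $c$ and $b$ to its opposite edge $d$, there are two local states: the oriented one (join $a$ to $d$ and $b$ to $c$), and the unoriented one (replace the crossing by a sink vertex receiving $a,b$, a source vertex emitting $c,d$, and a new edge from the source to the sink). A state $s$ of $K$ is a choice of local state at each classical crossing; $K_s$ is the resulting abstract trivalent bipartite graph, possibly with circle components (virtual crossings are ignored). $K_{us}$ denotes the graph of the state in which every crossing is resolved in the unoriented way (an edge is added at every crossing). A bigon is a pair of distinct edges joining the same two vertices; a quadrilateral is a $4$-cycle with four distinct vertices. **Equivalence.** Virtual diagrams are equivalent if related by classical Reidemeister moves and detour moves. Free knots are unicursal framed $4$-valent graphs (only the pairing of opposite edges at each node is specified) modulo flat Reidemeister moves; equivalently, virtual knots modulo virtualization (flanking a classical crossing by two virtual crossings) and crossing switches. A diagram is minimal if it has the least number of classical crossings (nodes) in its equivalence class. **The module $\mathcal M$.** $\mathcal S$ is the collection of all trivalent bipartite graphs with edges oriented from the vertices of the first part to the vertices of the second part; $\mathcal T=\{t_1,t_2,\dots\}\subset\mathcal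 S$ consists of the connected graphs having neither bigons nor quadrilaterals; $\mathcal M=\mathbb Z[A,A^{-1}][t_1,t_2,\dots]$ is the module of formal commutative products of graphs from $\mathcal T$ with Laurent polynomial coefficients. Disjoint unions of graphs are treated as products in $\mathcal M$. Graphs (with possible circle components) are identified with elements of $\mathcal M$ through the unique map $f$ sending disjoint unions to products with $f(t)=t$ for $t\in\mathcal T$, $f(\bigcirc)=A^6+1+A^{-6}$, $f(\Gamma)=(A^3+A^{-3})f(\Gamma')$ when a bigon of $\Gamma$ is resolved (its two vertices and two edges deleted and the two remaining half-edges joined), and $f(\Gamma)=f(\Gamma_1)+f(\Gamma_2)$ when a quadrilateral $v_1v_2v_3v_4$ with outer half-edges $l_i$ is deleted and one joins $l_1$ to $l_2$, $l_3$ to $l_4$ (for $\Gamma_1$) or $l_2$ to $l_3$, $l_4$ to $l_1$ (for $\Gamma_2$).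
   Formalization: ''Contains K_us as a subgraph'' is taken topologically: K'_s contains a subdivision of K_us. With literal subgraphs the claim fails for n ≥ 1: apply an antiparallel second Reidemeister move between an outgoing and an incoming edge of one crossing of K. *)

(* Defs.v *)
From HB Require Import structures.
From mathcomp Require Import all_boot all_algebra perm generic_quotient.
From mathcomp Require Import boolp.
From mathcomp.multinomials Require Import monalg.
From Stdlib Require Import Relation_Operators.

Set Implicit Arguments.
Unset Strict Implicit.
Unset Printing Implicit Defensive.

Import GRing.Theory.

(* [first_hit f P x] is the first of f x, f (f x), ... satisfying P (x itself
   counts, if f returns to it), and [before_hit f P x] lists the points strictly
   between x and it. *)
Definition first_hit (T : finType) (f : T -> T) (P : pred T) (x : T) : T :=
  nth x (orbit f (f x)) (find P (orbit f (f x))).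

Definition before_hit (T : finType) (f : T -> T) (P : pred T) (x : T) : seq T :=
  take (find P (orbit f (f x))) (orbit f (f x)).

(* Finite bipartite multigraphs, edges oriented from sources to sinks, together
   with a number of circle components. *)
Record web := Web {
  src : finType;
  snk : finType;
  edge : finType;
  org : edge -> src;
  dst : edge -> snk;
  ncirc : nat }.

Definition trivalent (G : web) : bool :=
  [forall p : src G, #|[set e | org e == p]| == 3] &&
  [forall q : snk G, #|[set e | dst e == q]| == 3].

Definition joined (G : web) (p : src G) (q : snk G) : bool :=
  [exists e : edge G, (org e == p) && (dst e == q)].

Definition has_bigon (G : web) : bool :=
  [exists e1 : edge G, exists e2 : edge G,
    [&& e1 != e2, org e1 == org e2 & dst e1 == dst e2]].

Definition has_quad (G : web) : bool :=
  [exists v1 : src G, exists v2 : snk G, exists v3 : src G, exists v4 : snk G,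
    [&& v1 != v3, v2 != v4, joined v1 v2, joined v3 v2, joined v3 v4
      & joined v1 v4]].

Definition adjacent (G : web) (x y : src G + snk G) : bool :=
  match x, y with
  | inl p, inr q | inr q, inl p => joined p q
  | _, _ => false
  end.

Definition connected (G : web) : bool :=
  [&& ncirc G == 0, 0 < #|{: src G + snk G}|
    & [forall x, forall y, connect (@adjacent G) x y]].

Definition is_iso (G H : web) (i : src G -> src H) (j : snk G -> snk H)
    (k : edge G -> edge H) : Prop :=
  [/\ bijective i, bijective j & bijective k] /\
  [/\ forall e, org (k e) = i (org e), forall e, dst (k e) = j (dst e)
    & ncirc G = ncirc H].

Definition iso (G H : web) : Prop := exists i j k, @is_iso G H i j k.

Definition empty_web : web :=
  @Web void void void id id 0.

Definition circle : web :=
  @Web void void void id id 1.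

Definition dunion (G H : web) : web :=
  @Web (src G + src H)%type (snk G + snk H)%type (edge G + edge H)%type
    (fun e => match e with inl e => inl (org e) | inr e => inr (org e) end)
    (fun e => match e with inl e => inl (dst e) | inr e => inr (dst e) end)
    (ncirc G + ncirc H).

(* Cutting an edge p -> q (or a circle, when the cut point is None) creates a new
   sink and a new source, both called None and both univalent: p -> None and
   None -> q (respectively None -> None).  Conversely G is recovered from
   [cut G x] by deleting these two vertices and joining their half-edges. *)
Definition cut (G : web) (x : option (edge G)) : web :=
  @Web (option (src G)) (option (snk G)) (option (edge G))
    (fun e => omap (@org G) e)
    (fun e => match e with
              | Some e1 => if x == Some e1 then None else Some (dst e1)
              | None => omap (@dst G) x
              end)
    (if x is None then (ncirc G).-1 else ncirc G).

Definition cuttable (G : web) (x : option (edge G)) : bool :=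
  (x != None) || (0 < ncirc G).

Definition add_edges (G : web) (I : finType) (a : I -> src G) (b : I -> snk G) :
    web :=
  @Web (src G) (snk G) (edge G + I)%type
    (fun e => match e with inl e => org e | inr i => a i end)
    (fun e => match e with inl e => dst e | inr i => b i end)
    (ncirc G).

(* Subdivision by a source and a sink: p -> q becomes p -> v <- u -> q. *)
Definition subdivide (G : web) (x : option (edge G)) : web :=
  @add_edges (cut x) unit (fun=> None) (fun=> None).

(* The graph with a bigon whose resolution gives G. *)
Definition insert_bigon (G : web) (x : option (edge G)) : web :=
  @add_edges (cut x) bool (fun=> None) (fun=> None).

(* After two cuts, the four edges of a quadrilateral are added between the new
   vertices; those of the first cut are now called [Some None]. *)
Definition insert_quad (G : web) (x : option (edge G))
    (y : option (edge (cut x))) : web :=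
  @add_edges (cut y) (bool * bool)%type
    (fun ij => if ij.1 then None else Some None)
    (fun ij => if ij.2 then None else Some None).

(* [G1] and [G2] are the two resolutions of a quadrilateral v1 v2 v3 v4 of
   [insert_quad y1]: both give the same graph with four univalent vertices when
   they are cut.  The cuts of G1 have the (source, sink) pairs (v1, v2) and
   (v3, v4), those of G2 the pairs (v1, v4) and (v3, v2). *)
Definition quad_resolutions
    (G1 : web) (x1 : option (edge G1)) (y1 : option (edge (cut x1)))
    (G2 : web) (x2 : option (edge G2)) (y2 : option (edge (cut x2))) : Prop :=
  [/\ cuttable x1, cuttable y1, cuttable x2 & cuttable y2] /\
  exists i j k, @is_iso (cut y1) (cut y2) i j k /\
    [/\ i (Some None) = Some None, i None = None,
        j (Some None) = None & j None = Some None].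

Inductive subdivision (G : web) : web -> Prop :=
| subdivision_refl : subdivision G G
| subdivision_step (H : web) (x : option (edge H)) :
    subdivision G H -> cuttable x -> subdivision G (subdivide x).

Definition embeds (H G : web) : Prop :=
  exists (i : src H -> src G) (j : snk H -> snk G) (k : edge H -> edge G),
  [/\ injective i, injective j & injective k] /\
  [/\ forall e, org (k e) = i (org e), forall e, dst (k e) = j (dst e)
    & ncirc H <= ncirc G].

(* Graphs are topological objects here (they may have circle components, and
   resolutions erase bivalent vertices), and subgraphs are taken in this sense. *)
Definition contains (G H : web) : Prop :=
  exists2 H1 : web, subdivision H H1 & embeds H1 G.

Local Open Scope ring_scope.

Definition is_laurent (x : {fraction {poly int}}) : bool :=
  `[< exists (p : {poly int}) (n : nat), x = tofrac p / tofrac 'X^n >].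

Fact is_laurent_subring : subring_closed is_laurent.
Proof.
have X0 n : tofrac ('X^n : {poly int}) != 0.
  by rewrite tofrac_eq0 monic_neq0 // monicXn.
split.
- by apply/asboolP; exists 1, 0%N; rewrite expr0 tofrac1 divr1.
- move=> x y /asboolP[p [m ->]] /asboolP[q [n ->]]; apply/asboolP.
  exists (p * 'X^n - q * 'X^m), (m + n)%N.
  by rewrite exprD tofracM tofracB !tofracM -mulNr addf_div // mulNr.
- move=> x y /asboolP[p [m ->]] /asboolP[q [n ->]]; apply/asboolP.
  by exists (p * q), (m + n)%N; rewrite exprD !tofracM mulf_div.
Qed.

HB.instance Definition _ :=
  GRing.isSubringClosed.Build {fraction {poly int}} is_laurent
    is_laurent_subring.

(* The ring Z[A, A^-1]. *)
Record laurent := Laurent {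
  laurent_val :> {fraction {poly int}};
  laurent_valP : laurent_val \in is_laurent }.

HB.instance Definition _ := [isSub for laurent_val].
HB.instance Definition _ := [Choice of laurent by <:].
HB.instance Definition _ := [SubChoice_isSubComNzRing of laurent by <:].

Fact varA_subproof : tofrac ('X : {poly int}) \in is_laurent.
Proof. by apply/asboolP; exists 'X, 0%N; rewrite expr0 tofrac1 divr1. Qed.

Fact varAV_subproof : (tofrac ('X : {poly int}))^-1 \in is_laurent.
Proof. by apply/asboolP; exists 1, 1%N; rewrite expr1 tofrac1 div1r. Qed.

Definition varA : laurent := Laurent varA_subproof.
Definition varAV : laurent := Laurent varAV_subproof.

(* Codes for the elements of T: bigon-free graphs are given by sets of edges. *)
Definition code := {m : nat & {set 'I_m * 'I_m}}.

Definition code_web (c : code) : web :=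
  @Web 'I_(tag c) 'I_(tag c) {e | e \in tagged c}
    (fun e => (val e).1) (fun e => (val e).2) 0.

Record tcode := TCode {
  tcode_val :> code;
  tcode_valP : [&& trivalent (code_web tcode_val),
                   connected (code_web tcode_val),
                   ~~ has_bigon (code_web tcode_val)
                 & ~~ has_quad (code_web tcode_val)] }.

HB.instance Definition _ := [isSub for tcode_val].
HB.instance Definition _ := [Choice of tcode by <:].

Lemma iso_refl G : iso G G.
Proof. by exists id, id, id; split; split=> //; exists id. Qed.

Lemma iso_sym G H : iso G H -> iso H G.
Proof.
move=> [i [j [k [[[i' iK i'K] [j' jK j'K] [k' kK k'K]] [Ho Hd Hc]]]]].
exists i', j', k'; split; first by split; [exists i | exists j | exists k].
split=> // e.
- by rewrite -[in RHS](k'K e) Ho iK.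
- by rewrite -[in RHS](k'K e) Hd jK.
Qed.

Lemma iso_trans G H K : iso G H -> iso H K -> iso G K.
Proof.
move=> [i [j [k [[bi bj bk] [Ho Hd Hc]]]]] [i' [j' [k' [[bi' bj' bk'] [Ho' Hd' Hc']]]]].
exists (i' \o i), (j' \o j), (k' \o k); split; first by split; apply: bij_comp.
split=> [e|e|] /=; [by rewrite Ho' Ho | by rewrite Hd' Hd | by rewrite Hc].
Qed.

Definition tcode_iso (c d : tcode) : bool :=
  `[< iso (code_web c) (code_web d) >].

Fact tcode_iso_refl : reflexive tcode_iso.
Proof. by move=> c; apply/asboolP/iso_refl. Qed.

Fact tcode_iso_sym : symmetric tcode_iso.
Proof. by move=> c d; apply/asboolP/asboolP; apply: iso_sym. Qed.

Fact tcode_iso_trans : transitive tcode_iso.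
Proof.
by move=> c d e /asboolP cd /asboolP de; apply/asboolP; apply: iso_trans de.
Qed.

Canonical tcode_equiv :=
  EquivRel tcode_iso tcode_iso_refl tcode_iso_sym tcode_iso_trans.

(* The set T of isomorphism classes, and a representative of each. *)
Definition tgraph := {eq_quot tcode_equiv}%qT.
HB.instance Definition _ := Choice.on tgraph.
HB.instance Definition _ := EqQuotient.on tgraph.

Definition tgraph_web (t : tgraph) : web := code_web (repr t : tcode).

(* Z[A, A^-1][t1, t2, ...] *)
Definition moduleM : comNzRingType := {malg laurent[{cmonom tgraph}]}.

Definition constM (a : laurent) : moduleM := mkmalgU mone a.
Definition varM (t : tgraph) : moduleM := mkmalgU (ucm t) 1.

Definition tcoef (z : moduleM) (t : tgraph) : laurent := mcoeff (ucm t) z.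

(* The values of f matter on trivalent graphs only. *)
Definition reduction_map (f : web -> moduleM) : Prop :=
  [/\ forall G H, trivalent G -> iso G H -> f G = f H,
      f empty_web = 1 /\
      forall G H, trivalent G -> trivalent H -> f (dunion G H) = f G * f H
    & forall t, f (tgraph_web t) = varM t] /\
  [/\ f circle = constM (varA ^+ 6 + 1 + varAV ^+ 6),
      forall (G : web) (x : option (edge G)), trivalent G -> cuttable x ->
        f (insert_bigon x) = constM (varA ^+ 3 + varAV ^+ 3) * f G
    & forall (G1 : web) (x1 : option (edge G1)) (y1 : option (edge (cut x1)))
             (G2 : web) (x2 : option (edge G2)) (y2 : option (edge (cut x2))),
        trivalent G1 -> trivalent G2 -> quad_resolutions y1 y2 ->
        f (insert_quad y1) = f G1 + f G2].

Local Close Scope ring_scope.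

(* Oriented framed 4-valent graphs.  The two strands through a node v are
   labelled false and true; the port (v, b) is the passage through v along the
   strand b, which enters by one edge and leaves by the opposite one.  The edge
   leaving (v, b) enters nxt (v, b). *)
Record framed := Framed {
  node : finType;
  nxt : node * bool -> node * bool }.

Notation port G := (node G * bool)%type.

(* A single closed curve; without nodes it is the circle.  The condition makes
   nxt a cyclic permutation of the ports. *)
Definition unicursal (G : framed) : Prop :=
  forall x y : port G, fconnect (@nxt G) x y.

(* Virtual diagrams: [kind v] is None at a virtual crossing, and Some b at a
   classical one where the strand b is over.  Here the labelling of the strands
   carries the plane structure: the counterclockwise order of the ends at v is
   in false, in true, out false, out true. *)
Record virt := Virt {
  shadow :> framed;
  kind : node shadow -> option bool }.

Definition classical (K : virt) : {set node K} := [set v | kind v].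

(* The end (x, true) is where the curve leaves the port x, (x, false) where it
   enters; [mate d] is the other end of the edge of d. *)
Notation dart G := (port G * bool)%type.

Definition mate (G : framed) (d : dart G) : dart G :=
  if d.2 then (nxt d.1, false) else (finv (@nxt G) d.1, true).

Definition rot (G : framed) (d : dart G) : dart G :=
  let: ((v, b), o) := d in ((v, ~~ b), b (+) o).

Definition face (G : framed) (d : dart G) : dart G := rot (mate d).

(* Euler's formula n - 2 n + #faces = 2; without nodes there are no darts. *)
Definition planar (G : framed) : bool :=
  (#|node G| == 0) || (fcard (@face G) {: dart G} == #|node G| + 2).

Record fknot := FKnot {
  fknot_graph :> framed;
  fknot_unicursal : unicursal fknot_graph }.

Record vknot := VKnot {
  vknot_virt :> virt;
  vknot_unicursal : unicursal vknot_virt;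
  vknot_planar : planar vknot_virt }.

Definition lift (G H : framed) (i : node H -> node G) (t : node H -> bool)
    (x : port H) : port G :=
  (i x.1, x.2 (+) t x.1).

(* H is G with the nodes in D erased (the curve passes straight through them);
   t accounts for the arbitrary labelling of the strands. *)
Definition erases (G H : framed) (D : {set node G})
    (i : node H -> node G) (t : node H -> bool) : Prop :=
  [/\ injective i, forall v, (v \in codom i) = (v \notin D)
    & forall x : port H, lift i t (nxt x) =
        first_hit (@nxt G) (fun y => y.1 \notin D) (lift i t x)].

(* H is G with the order of consecutive ports x1 y1, x2 y2 and x3 y3 along the
   curve exchanged. *)
Definition exchanges (G H : framed) (x1 y1 x2 y2 x3 y3 : port G)
    (i : node H -> node G) (t : node H -> bool) : Prop :=
  let tau := fun z => tperm x1 y1 (tperm x2 y2 (tperm x3 y3 z)) in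
  bijective i /\
  forall x : port H, lift i t (nxt x) = tau (nxt (tau (lift i t x))).

Definition consecutive (G : framed) (x y : port G) : bool :=
  (nxt x == y) || (nxt y == x).

Definition opposite (G : framed) (x : port G) : port G := (x.1, ~~ x.2).

Inductive flat_move (G H : framed) : Prop :=
| flat_iso i t : @erases G H set0 i t -> flat_move G H
| flat_R1 (x : port G) i t :
    nxt x = opposite x ->
    @erases G H [set x.1] i t -> flat_move G H
| flat_R2 (x y : port G) i t :
    x.1 != y.1 ->
    consecutive x y -> consecutive (opposite x) (opposite y) ->
    @erases G H [set x.1; y.1] i t -> flat_move G H
| flat_R3 (x y z : port G) i t :
    uniq [:: x.1; y.1; z.1] ->
    consecutive x (opposite y) -> consecutive y (opposite z) ->
    consecutive z (opposite x) ->
    @exchanges G H x (opposite y) y (opposite z) z (opposite x) i t ->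
    flat_move G H.

Definition free_equiv : fknot -> fknot -> Prop :=
  clos_refl_sym_trans fknot (fun K L => flat_move K L).

Definition verases (K L : virt) (D : {set node K}) (i : node L -> node K) :
    Prop :=
  erases D i (fun=> false) /\ forall v, kind v = kind (i v).

(* D consists of the virtual crossings on the arc of K between the port x and
   the next port outside D. *)
Definition virtual_arc (K : virt) (D : {set node K}) (x : port K) : Prop :=
  D = [set v in map fst (before_hit (@nxt K) (fun y => y.1 \notin D) x)].

(* Removing from K and from L an arc which has only virtual crossings, the same
   diagram N is left.  If N has no crossings then the whole curve but a point can be taken
   as arc in both. *)
Definition detour (K L : virt) : Prop :=
  exists (N : virt) (D : {set node K}) (E : {set node L}) i j,
  [/\ [disjoint D & classical K], [disjoint E & classical L],
      @verases K N D i, @verases L N E j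
    & #|node N| = 0 \/ exists x : port N,
        virtual_arc D (lift i (fun=> false) x) /\
        virtual_arc E (lift j (fun=> false) x)].

(* Is the strand through d the upper one at the node of d? *)
Definition over (K : virt) (d : dart K) : bool := kind d.1.1 == Some d.1.2.

(* Classical Reidemeister moves, performed at a face with one, two or three
    sides, and detour moves.  In the third move no cyclic overlap of the three
    strands is allowed. *)
Inductive virtual_move (K L : virt) : Prop :=
| virtual_iso i : @verases K L set0 i -> virtual_move K L
| virtual_R1 (d : dart K) i :
    face d = d -> d.1.1 \in classical K ->
    @verases K L [set d.1.1] i -> virtual_move K L
| virtual_R2 (d1 d2 : dart K) i :
    face d1 = d2 -> face d2 = d1 -> d1.1.1 != d2.1.1 ->
    [set d1.1.1; d2.1.1] \subset classical K ->
    over d1 = over (mate d1) ->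
    @verases K L [set d1.1.1; d2.1.1] i -> virtual_move K L
| virtual_R3 (d1 d2 d3 : dart K) i :
    face d1 = d2 -> face d2 = d3 -> face d3 = d1 ->
    uniq [:: d1.1.1; d2.1.1; d3.1.1] ->
    [set d1.1.1; d2.1.1; d3.1.1] \subset classical K ->
    ~~ ((over d1 == over d2) && (over d2 == over d3)) ->
    @exchanges K L d1.1 (mate d1).1 d2.1 (mate d2).1 d3.1 (mate d3).1 i
      (fun=> false) ->
    (forall v, kind v = kind (i v)) -> virtual_move K L
| virtual_detour : detour K L -> virtual_move K L.

Definition virtual_equiv : vknot -> vknot -> Prop :=
  clos_refl_sym_trans vknot (fun K L => virtual_move K L).

Definition free_minimal (K : fknot) : Prop :=
  forall L : fknot, free_equiv K L -> #|node K| <= #|node L|.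

Definition virtual_minimal (K : vknot) : Prop :=
  forall L : vknot, virtual_equiv K L -> #|classical K| <= #|classical L|.

Section Resolve.

(* C is the set of nodes to be resolved, U that of those resolved in the
   unoriented way. *)
Variables (G : framed) (C U : {set node G}).

(* The edge leaving x is followed to the next port y; if y is resolved in the
   oriented way then the curve leaves along the other strand. *)
Definition walk (x : port G) : port G :=
  let y := nxt x in if y.1 \in C :\: U then opposite y else y.

(* Each node u in U gives a source and a sink.  The edge (u, None) joins them, and
   (u, Some b) is the one leaving u along the strand b. *)
Definition resolve : web :=
  @Web {u | u \in U} {u | u \in U} ({u | u \in U} * option bool)%type
    (fun e => e.1)
    (fun e => if e.2 is Some b then
       insubd e.1 (first_hit walk (fun y => y.1 \in U) (val e.1, b)).1
     else e.1)
    (if #|node G| == 0 then 1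
     else fcard walk [pred x | all (fun y => y.1 \notin U) (orbit walk x)]).

End Resolve.

(* States are given by the set of nodes resolved in the unoriented way. *)
Definition free_state (K : framed) (s : {set node K}) : web := resolve setT s.

Definition virtual_state (K : virt) (s : {set node K}) : web :=
  resolve (classical K) s.

Definition free_us (K : framed) : web := @free_state K setT.

Definition virtual_us (K : virt) : web := virtual_state (classical K).

(* Main.v *)
From HB Require Import structures.
From mathcomp Require Import all_boot all_algebra perm generic_quotient.
From mathcomp Require Import boolp.
From mathcomp.multinomials Require Import monalg.
From Stdlib Require Import Relation_Operators.
From mathcomp Require Import zify ring.
Require Import Defs.

(** Every trivalent graph is evaluated by erasing bigons and quadrilaterals; the
    value is a polynomial in the irreducible graphs t_i.  Read modulo 2 and at
    A = 1, a bigon is worth 0 and a circle 1, and the coefficient of a fixed t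
    becomes an F_2-valued function of graphs.  Summed over all the states of a
    diagram, this function is invariant under the Reidemeister moves: each move
    is an identity between a few local pictures, in which the upper and the lower
    strand are not distinguished.  Virtual crossings are not resolved, so that detour
    moves, and erasing virtual crossings in general, do nothing to the sum.

    Now let K have crossings and K_us neither bigons nor quadrilaterals; it is
    connected since K is one curve, so that it is one of the t.  In the state sum
    of K the state K_us contributes 1.  A state with fewer unoriented crossings has
    fewer vertices; reducing a graph only removes vertices, so that the
    coefficient of t in it vanishes.  The sum is thus 1 for K, hence 1 for every
    equivalent K', and some state of K' has a nonzero coefficient at t.  A graph
    with a nonzero coefficient at t contains t: undoing a reduction subdivides
    edges and adds others, and t survives in one of the two resolutions of a
    quadrilateral ([tcoef_contains]).  Counting vertices gives minimality.

    Graphs are handled through nets: lists of stars of named edges, together with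
    wires which identify two names, so that joining half-edges, erasing nodes and
    applying local moves become operations on lists.  The main steps are the
    confluence of the reductions ([confluent]), which gives the reduction map
    ([web_value_reduction]) and an induction principle for trivalent graphs
    ([trivalent_ind]), hence uniqueness ([reduction_map_unique]); the local
    identities behind the three moves ([Z_R1], [Z_R2], [Z_R2'], [Z_R3_cyclic],
    [Z_R3_acyclic]); their transfer to diagrams ([ZG_erases], [ZG_R3]); and the
    identification of the terms of the state sum with the values of the graphs of
    the states ([resolve_value]).  If K has no crossings, K_us is a circle and
    every K' has a state with a circle, the one without unoriented crossings. *)

Set Implicit Arguments.
Unset Strict Implicit.
Unset Printing Implicit Defensive.

Import GRing.Theory.

(** * Nets of named edges *)

(** A net is given by two lists of stars S and T, the names of the edges at each
    source and at each sink, and by a list of wires.  A wire (a, b) means that the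
    strand called a goes on under the name b, as a half-edge does when two
    half-edges are joined. *)
Notation names := (seq (seq nat)).
Notation wires := (seq (nat * nat)).

(** Multiplicities as recursive functions, which compute to sums of comparisons of
    names on explicit lists; [lia] then decides the linear consequences. *)
Fixpoint cm (x : nat) (v : seq nat) : nat :=
  if v is y :: v' then (y == x) + cm x v' else 0.

Fixpoint occ (x : nat) (S : names) : nat :=
  if S is v :: S' then cm x v + occ x S' else 0.

Fixpoint in1 (x : nat) (w : wires) : nat :=
  if w is e :: w' then (e.1 == x) + in1 x w' else 0.

Fixpoint in2 (x : nat) (w : wires) : nat :=
  if w is e :: w' then (e.2 == x) + in2 x w' else 0.

(** A name is emitted by a source or at the end of a wire and it is consumed by a
    sink or at the beginning of a wire; in a net without free ends each name occurs
    at most once on either side. *)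
Definition outn (x : nat) (S : names) (w : wires) : nat := occ x S + in2 x w.

Definition inn (x : nat) (T : names) (w : wires) : nat := occ x T + in1 x w.

Definition linear (S T : names) (w : wires) : Prop :=
  forall x, outn x S w = inn x T w /\ inn x T w <= 1.

Definition cubic (S : names) : bool := all (fun v => size v == 3) S.

Definition wf (S T : names) (w : wires) : Prop :=
  [/\ linear S T w, cubic S & cubic T].

(** Neither the order of the vertices nor that of the edges at a vertex matters.
    Sorting the stars makes this equivalence a boolean one. *)
Definition eqv (S S' : names) : bool :=
  perm_eq (map (sort leq) S) (map (sort leq) S').

Infix "≡" := eqv (at level 70).

Definition ren (r : nat -> nat) (S : names) : names := map (map r) S.

Ltac ifs := repeat match goal with
  | |- context [if ?a == ?b then _ else _] =>
    lazymatch a with context [if _ then _ else _] => fail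
    | _ => case: (eqVneq a b) => ? end
  end.

Lemma eqv_refl S : S ≡ S. Proof. exact: perm_refl. Qed.
Hint Resolve eqv_refl : core.

Lemma eqv_sym S S' : (S ≡ S') = (S' ≡ S). Proof. exact: perm_sym. Qed.

Lemma eqv_trans S1 S2 S3 : S1 ≡ S2 -> S2 ≡ S3 -> S1 ≡ S3.
Proof. exact: perm_trans. Qed.

Lemma sort_perm (v v' : seq nat) : (sort leq v == sort leq v') = perm_eq v v'.
Proof.
by apply/eqP/idP => [/(perm_sortP leq_total leq_trans anti_leq)|]//;
   move/(perm_sortP leq_total leq_trans anti_leq).
Qed.

Lemma eqv_perm S S' : perm_eq S S' -> S ≡ S'.
Proof. exact: perm_map. Qed.

Lemma eqv_cons v v' S S' : perm_eq v v' -> S ≡ S' -> v :: S ≡ v' :: S'.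
Proof. by rewrite -sort_perm /eqv /= => /eqP-> ?; rewrite perm_cons. Qed.

Lemma eqv_cat S S' R R' : S ≡ S' -> R ≡ R' -> S ++ R ≡ S' ++ R'.
Proof. by rewrite /eqv !map_cat; apply: perm_cat. Qed.

Lemma eqv_swap v v' S : v :: v' :: S ≡ v' :: v :: S.
Proof. by apply: eqv_perm; rewrite (perm_catCA [:: v] [:: v']). Qed.

Lemma perm_sort_in v (S : names) :
  sort leq v \in map (sort leq) S -> exists2 S', S ≡ v :: S' & size S = (size S').+1.
Proof.
case/mapP=> u uS /eqP; rewrite sort_perm => vu.
exists (rem u S).
  rewrite (eqv_trans (eqv_perm (perm_to_rem uS))) // eqv_sym.
  exact: eqv_cons.
by rewrite (perm_size (perm_to_rem uS)).
Qed.

Lemma eqv_cons_inj v v' S S' : perm_eq v v' -> (v :: S ≡ v' :: S') = (S ≡ S').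
Proof. by rewrite -sort_perm /eqv /= => /eqP ->; rewrite perm_cons. Qed.

(** Two descriptions of the same collection of stars, each with a chosen star:
    either the chosen stars agree, or each one occurs in the remainder of the other.
    The overlaps of two reductions are enumerated by means of this alternative. *)
Lemma eqv_consP v v' S S' : v :: S ≡ v' :: S' ->
  (perm_eq v v' /\ S ≡ S') \/
  exists R, S ≡ v' :: R /\ S' ≡ v :: R.
Proof.
case: (boolP (perm_eq v v')) => [vv|nvv] E.
  by left; split=> //; rewrite -(eqv_cons_inj _ _ vv).
right; have : sort leq v' \in map (sort leq) (v :: S).
  by rewrite (perm_mem E) /= inE eqxx.
rewrite /= inE eq_sym sort_perm (negbTE nvv) /= => /perm_sort_in [R SR _].
exists R; split=> //.
rewrite -(eqv_cons_inj _ _ (perm_refl v')) eqv_sym.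
apply: eqv_trans (eqv_swap _ _ _) _; apply: eqv_trans _ E.
by rewrite eqv_cons_inj // eqv_sym.
Qed.

Lemma eqv_size S S' : S ≡ S' -> size S = size S'.
Proof. by move/perm_size; rewrite !size_map. Qed.

Lemma cmE x v : cm x v = count_mem x v.
Proof. by elim: v => //= y v ->. Qed.

Lemma in1E x w : in1 x w = count (fun e => e.1 == x) w.
Proof. by elim: w => //= y w ->. Qed.

Lemma in2E x w : in2 x w = count (fun e => e.2 == x) w.
Proof. by elim: w => //= y w ->. Qed.

Lemma perm_cm v v' x : perm_eq v v' -> cm x v = cm x v'.
Proof. by rewrite !cmE => /seq.permP ->. Qed.

Lemma perm_in1 (w w' : wires) x : perm_eq w w' -> in1 x w = in1 x w'.
Proof. by rewrite !in1E => /seq.permP ->. Qed.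

Lemma perm_in2 (w w' : wires) x : perm_eq w w' -> in2 x w = in2 x w'.
Proof. by rewrite !in2E => /seq.permP ->. Qed.

Lemma occE x S : occ x S = count_mem x (flatten S).
Proof. by elim: S => //= v S ->; rewrite cmE count_cat. Qed.

Lemma occ_cat x S S' : occ x (S ++ S') = occ x S + occ x S'.
Proof. by elim: S => //= v S ->; rewrite addnA. Qed.

Lemma in1_cat x v v' : in1 x (v ++ v') = in1 x v + in1 x v'.
Proof. by rewrite !in1E count_cat. Qed.

Lemma in2_cat x v v' : in2 x (v ++ v') = in2 x v + in2 x v'.
Proof. by rewrite !in2E count_cat. Qed.

Lemma occ_sort x S : occ x (map (sort leq) S) = occ x S.
Proof.
elim: S => //= v S ->; congr (_ + _).
by apply: perm_cm; rewrite perm_sort.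
Qed.

Lemma perm_occ (S S' : names) x : perm_eq S S' -> occ x S = occ x S'.
Proof.
have H R : occ x R = sumn (map (cm x) R) by elim: R => //= v R ->.
by move=> E; rewrite !H; apply: perm_sumn; apply: perm_map.
Qed.

Lemma eqv_occ x S S' : S ≡ S' -> occ x S = occ x S'.
Proof. by move=> E; rewrite -occ_sort -[RHS]occ_sort; apply: perm_occ. Qed.

Lemma eqv_cubic S S' : S ≡ S' -> cubic S = cubic S'.
Proof.
have H R : cubic R = cubic (map (sort leq) R).
  by rewrite /cubic all_map; apply: eq_all => v /=; rewrite size_sort.
by move=> E; rewrite H (H S') /cubic; apply: perm_all.
Qed.

Lemma sort_map r v : sort leq (map r v) = sort leq (map r (sort leq v)).
Proof. by apply/eqP; rewrite sort_perm perm_map // perm_sym perm_sort. Qed.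

Lemma eqv_ren r S S' : S ≡ S' -> ren r S ≡ ren r S'.
Proof.
move=> E; rewrite /eqv /ren -!map_comp.
have H R : map (sort leq \o map r) R = map (sort leq \o map r) (map (sort leq) R).
  by rewrite -[RHS]map_comp; apply: eq_map => v /=; rewrite sort_map.
by rewrite H (H S'); apply: perm_map.
Qed.

Lemma occ_gt0 x S : (0 < occ x S) = (x \in flatten S).
Proof. by rewrite -has_pred1 has_count occE. Qed.

Lemma eq_ren r r' S : (forall x, 0 < occ x S -> r x = r' x) -> ren r S = ren r' S.
Proof.
move=> H; apply/eq_in_map => v vS; apply/eq_in_map => x xv; apply: H.
by rewrite occ_gt0; apply/flattenP; exists v.
Qed.

Lemma ren_id S r : (forall x, 0 < occ x S -> r x = x) -> ren r S = S.
Proof. by move/(@eq_ren r id)->; rewrite /ren (eq_map (@map_id _)) map_id. Qed.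

Lemma ren_comp r r' S : ren r (ren r' S) = ren (r \o r') S.
Proof. by rewrite /ren -map_comp; apply: eq_map => v /=; rewrite -map_comp. Qed.

Lemma cubic_ren r S : cubic (ren r S) = cubic S.
Proof. by rewrite /cubic all_map; apply: eq_all => v /=; rewrite size_map. Qed.

Lemma size_ren r S : size (ren r S) = size S.
Proof. exact: size_map. Qed.

(** The effect of the wire (a, b) on a consumed name: what consumed b now consumes
    what a stands for. *)
Definition ren1 (b a c : nat) : nat := if c == b then a else c.

(** Following the wires backwards from a consumed name to where its strand comes
    from. *)
Fixpoint root (w : wires) (x : nat) : nat :=
  if w is (a, b) :: w' then ren1 b (root w' a) (root w' x) else x.

(** The circles which close up when the wires are connected one after the other. *)
Fixpoint loops (w : wires) : nat :=
  if w is (a, b) :: w' then (root w' a == b) + loops w' else 0.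

Definition refst (r : nat -> nat) (w : wires) : wires :=
  map (fun e => (r e.1, e.2)) w.

Lemma root_cat v w x : root (v ++ w) x = root (refst (root w) v) (root w x).
Proof. by elim: v x => //= -[a b] v IH x; rewrite /= !IH. Qed.

Lemma loops_cat v w : loops (v ++ w) = loops (refst (root w) v) + loops w.
Proof. by elim: v => //= -[a b] v IH; rewrite /= root_cat IH addnA. Qed.

Lemma refst_comp r r' w : refst r (refst r' w) = refst (r \o r') w.
Proof. by rewrite /refst -map_comp. Qed.

Definition uniq1 (w : wires) : Prop := forall x, in1 x w <= 1.
Definition uniq2 (w : wires) := forall x, in2 x w <= 1.

Lemma root_inj w x y : uniq1 w -> uniq2 w ->
  in1 x w = 0 -> in1 y w = 0 ->
  root w x = root w y -> x = y.
Proof.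
elim: w x y => //= -[a b] w IH x y u1 u2 /= x0 y0.
have v1 : uniq1 w by move=> z; have /= := u1 z; lia.
have v2 : uniq2 w by move=> z; have /= := u2 z; lia.
have a0 : in1 a w = 0 by have /= := u1 a; rewrite eqxx; lia.
have xa : (a == x) = false by lia.
have ya : (a == y) = false by lia.
have {}x0 : in1 x w = 0 by lia.
have {}y0 : in1 y w = 0 by lia.
rewrite /ren1; case: (eqVneq (root w x) b) => [xb|xb]; case: (eqVneq (root w y) b) => [yb|yb].
- by move=> _; apply: IH; rewrite // xb yb.
- by move/(IH _ _ v1 v2 a0 y0)=> E; rewrite E eqxx in ya.
- by move/esym/(IH _ _ v1 v2 a0 x0)=> E; rewrite E eqxx in xa.
- exact: IH.
Qed.

(** The order in which two wires are connected is irrelevant; with [loops_swap] this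
    makes a list of wires behave as a multiset. *)
Lemma root_swap a1 b1 a2 b2 w x :
  uniq1 ((a1, b1) :: (a2, b2) :: w) -> uniq2 ((a1, b1) :: (a2, b2) :: w) ->
  in1 x ((a1, b1) :: (a2, b2) :: w) = 0 ->
  root ((a1, b1) :: (a2, b2) :: w) x = root ((a2, b2) :: (a1, b1) :: w) x.
Proof.
move=> u1 u2 /= x0.
have v1 : uniq1 w by move=> z; have /= := u1 z; lia.
have v2 : uniq2 w by move=> z; have /= := u2 z; lia.
have a10 : in1 a1 w = 0 by have /= := u1 a1; rewrite eqxx; lia.
have a20 : in1 a2 w = 0 by have /= := u1 a2; rewrite eqxx; lia.
have a12 : a1 != a2 by apply/eqP=> E; have /= := u1 a1; rewrite E eqxx; lia.
have b12 : b1 != b2 by apply/eqP=> E; have /= := u2 b1; rewrite E eqxx; lia.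
have xw : in1 x w = 0 by lia.
have xa1 : root w x != root w a1.
  by apply/eqP=> /(root_inj v1 v2 xw a10) E; rewrite E eqxx in x0.
have xa2 : root w x != root w a2.
  by apply/eqP=> /(root_inj v1 v2 xw a20) E; rewrite E eqxx /= addnC in x0.
have aa : root w a1 != root w a2.
  by apply/eqP=> /(root_inj v1 v2 a10 a20) E; rewrite E eqxx in a12.
move: xa1 xa2 aa b12; move: (root w x) (root w a1) (root w a2) => x' a1' a2'.
clear; rewrite /ren1 => xa1 xa2 aa bb.
by ifs; lia.
Qed.

Lemma loops_swap a1 b1 a2 b2 w : b1 != b2 ->
  loops ((a1, b1) :: (a2, b2) :: w) = loops ((a2, b2) :: (a1, b1) :: w).
Proof.
move=> b12 /=; rewrite /ren1 !addnA; congr (_ + _).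
have b21 : b2 != b1 by rewrite eq_sym.
by ifs; lia.
Qed.

Lemma uniq12_perm (w w' : wires) : perm_eq w w' -> (uniq1 w -> uniq1 w') /\ (uniq2 w -> uniq2 w').
Proof.
by move=> E; split=> H x; rewrite -?(perm_in1 _ E) -?(perm_in2 _ E).
Qed.

(** Permutations are generated by exchanges of neighbours. *)
Lemma perm_wires_ind (P : wires -> wires -> Prop) :
  (forall w, P w w) ->
  (forall w1 w2 w3, perm_eq w1 w2 -> P w1 w2 -> P w2 w3 -> P w1 w3) ->
  (forall e w w', perm_eq w w' -> P w w' -> P (e :: w) (e :: w')) ->
  (forall e e' w, P (e :: e' :: w) (e' :: e :: w)) ->
  forall w w', perm_eq w w' -> P w w'.
Proof.
move=> Pr Pt Pc Ps; elim=> [|e w IH] w'; first by rewrite perm_sym => /perm_nilP->.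
move=> E; have ew' : e \in w' by rewrite -(perm_mem E) mem_head.
have [w1 [w2 Ew']] : exists w1 w2, w' = w1 ++ e :: w2.
  by case/splitPr: ew' => w1 w2; exists w1, w2.
subst w'.
have E' : perm_eq w (w1 ++ w2).
  by move: E; rewrite perm_sym -cat1s perm_catCA perm_cons perm_sym.
apply: (Pt _ _ _ _ (Pc e _ _ E' (IH _ E'))); first by rewrite perm_cons.
move=> {E E' ew' IH}; elim: w1 => [|d w1 IHw] /=; first exact: Pr.
apply: (Pt _ _ _ _ (Ps _ _ _)); first by rewrite (perm_catCA [:: e] [:: d]).
by apply: Pc => //; apply/permPl; apply: (perm_catCA [:: e] w1 w2).
Qed.

Lemma root_perm w w' x : perm_eq w w' -> uniq1 w -> uniq2 w ->
  in1 x w = 0 -> root w x = root w' x.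
Proof.
move=> E; move: w w' E x.
apply: (@perm_wires_ind (fun w w' => forall x, uniq1 w -> uniq2 w ->
  in1 x w = 0 -> root w x = root w' x)) => //.
- move=> w1 w2 w3 E IH1 IH2 x u1 u2 x0; rewrite IH1 // IH2 //.
  + exact: (uniq12_perm E).1.
  + exact: (uniq12_perm E).2.
  + by rewrite -(perm_in1 _ E).
- move=> [a b] w w' _ IH x u1 u2 /= x0.
  have v1 : uniq1 w by move=> z; have /= := u1 z; lia.
  have v2 : uniq2 w by move=> z; have /= := u2 z; lia.
  have a0 : in1 a w = 0 by have /= := u1 a; rewrite eqxx; lia.
  by rewrite !IH //; lia.
- by move=> [a1 b1] [a2 b2] w x; apply: root_swap.
Qed.

Lemma loops_perm w w' : perm_eq w w' -> uniq1 w -> uniq2 w -> loops w = loops w'.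
Proof.
move: w w'.
apply: (@perm_wires_ind (fun w w' => uniq1 w -> uniq2 w -> loops w = loops w')) => //.
- move=> w1 w2 w3 E IH1 IH2 u1 u2; rewrite IH1 // IH2 //.
  + exact: (uniq12_perm E).1.
  + exact: (uniq12_perm E).2.
- move=> [a b] w w' E IH u1 u2 /=.
  have v1 : uniq1 w by move=> z; have /= := u1 z; lia.
  have v2 : uniq2 w by move=> z; have /= := u2 z; lia.
  have a0 : in1 a w = 0 by have /= := u1 a; rewrite eqxx; lia.
  by rewrite IH // (root_perm E).
- move=> [a1 b1] [a2 b2] w u1 u2; apply: loops_swap.
  by apply/eqP=> E; have /= := u2 b1; rewrite E eqxx; lia.
Qed.

(** * Well-formed nets *)

Lemma wf_uniq1 S T w : linear S T w -> uniq1 w.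
Proof. by move=> L x; have := L x; rewrite /inn; lia. Qed.

Lemma wf_uniq2 S T w : linear S T w -> uniq2 w.
Proof. by move=> L x; have := L x; rewrite /inn /outn; lia. Qed.

Lemma wf_eqv S S' T T' w w' : wf S T w -> S ≡ S' -> T ≡ T' -> perm_eq w w' ->
  wf S' T' w'.
Proof.
case=> L cS cT ES ET Ew; split; last 2 first.
- by rewrite -(eqv_cubic ES).
- by rewrite -(eqv_cubic ET).
by move=> x; have := L x; rewrite /inn /outn -(eqv_occ x ES) -(eqv_occ x ET) -(perm_in1 x Ew) -(perm_in2 x Ew).
Qed.

Lemma occ_ren1 b a y S : a != b ->
  occ y (ren (ren1 b a) S) =
  if y == b then 0 else occ y S + (y == a) * occ b S.
Proof.
move=> ab; elim: S => [|v S IH] /=; first by case: ifP => //; rewrite muln0.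
rewrite IH /=.
have -> : cm y (map (ren1 b a) v) =
  if y == b then 0 else cm y v + (y == a) * cm b v.
  elim: v => [|c v IHv] /=; first by case: ifP => //; rewrite muln0.
  by rewrite IHv /ren1; ifs; lia.
by ifs; lia.
Qed.

Lemma count_refst b a y w : a != b ->
  in1 y (refst (ren1 b a) w) =
  if y == b then 0 else
  in1 y w + (y == a) * in1 b w.
Proof.
move=> ab; elim: w => [|[c d] w IH] /=; first by case: ifP => //; rewrite muln0.
by rewrite IH /ren1 /=; ifs; lia.
Qed.

Lemma count_refst2 r y w :
  in2 y (refst r w) = in2 y w.
Proof. by elim: w => //= -[c d] w ->. Qed.

Lemma linear_wire S T w a b : linear S T ((a, b) :: w) -> a != b ->
  linear S (ren (ren1 b a) T) (refst (ren1 b a) w).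
Proof.
move=> L ab y; have := L y; have := L a; have := L b.
rewrite /outn /inn /= occ_ren1 // count_refst // count_refst2 !eqxx.
have ab' : b != a by rewrite eq_sym.
rewrite (negbTE ab) (negbTE ab').
by ifs; lia.
Qed.

Lemma linear_loop S T w a : linear S T ((a, a) :: w) -> linear S T w.
Proof. by move=> L y; have := L y; rewrite /inn /outn /=; lia. Qed.

Lemma root_rcons w a b x :
  root (rcons w (a, b)) x = root (refst (ren1 b a) w) (ren1 b a x).
Proof. by rewrite -cats1 root_cat. Qed.

Lemma ren1_id a x : ren1 a a x = x.
Proof. by rewrite /ren1; case: eqP. Qed.

Lemma linear_perm S T w w' : perm_eq w w' -> linear S T w -> linear S T w'.
Proof.
move=> E L x; have := L x.
by rewrite /inn /outn (perm_in1 x E) (perm_in2 x E).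
Qed.

(** Once the wires are connected, only stars remain. *)
Lemma linear_root S T w : linear S T w -> linear S (ren (root w) T) [::].
Proof.
elim: {w}(size w) {-2}w (erefl (size w)) T => [|n IH] w.
  by case: w => // _ T L; rewrite ren_id.
case/lastP: w => // w [a b]; rewrite size_rcons => -[sw] T L.
have L' : linear S T ((a, b) :: w) by apply: linear_perm L; rewrite perm_rcons.
have -> : ren (root (rcons w (a, b))) T =
    ren (root (refst (ren1 b a) w)) (ren (ren1 b a) T).
  by rewrite ren_comp; apply: eq_ren => x _; rewrite root_rcons.
apply: IH; first by rewrite size_map.
case: (eqVneq a b) => [ab|ab]; last exact: linear_wire.
subst b; rewrite ren_id; last by move=> x _; rewrite ren1_id.
rewrite /refst (eq_map (g:=id)) ?map_id; first exact: linear_loop L'.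
by case=> c d /=; rewrite ren1_id.
Qed.

Lemma wf_root S T w : wf S T w -> wf S (ren (root w) T) [::].
Proof. by case=> L cS cT; split=> //; rewrite ?cubic_ren //; apply: linear_root. Qed.

Lemma root_id w x : in2 x w = 0 -> root w x = x.
Proof.
elim: w => //= -[a b] w IH /= x0.
rewrite /ren1 IH; last lia.
by have -> : (x == b) = false by rewrite eq_sym; lia.
Qed.

(** Renaming the edges does not change the graph: the following lemmas carry a
    renaming, injective on the names in use, through the connection of the wires. *)
Definition renw (r : nat -> nat) (w : wires) : wires :=
  map (fun e => (r e.1, r e.2)) w.

Lemma root_renw (A : nat -> Prop) r w x :
  (forall y z, A y -> A z -> r y = r z -> y = z) ->
  (forall y, 0 < in1 y w + in2 y w -> A y) -> A x ->
  root (renw r w) (r x) = r (root w x) /\ A (root w x).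
Proof.
move=> inj; elim: w x => [|[a b] w IH] x //= Aw Ax.
have Aw' y : 0 < in1 y w + in2 y w -> A y by move=> H; apply: Aw; lia.
have [Ea Aa] := IH a Aw' (Aw a ltac:(rewrite eqxx; lia)).
have [Ex Axx] := IH x Aw' Ax.
have Ab : A b by apply: Aw; rewrite eqxx; lia.
rewrite Ea Ex /ren1; case: (eqVneq (root w x) b) => [->|xb]; first by rewrite eqxx.
by case: eqP => // /inj E; rewrite E ?eqxx in xb.
Qed.

Lemma loops_renw (A : nat -> Prop) r w :
  (forall y z, A y -> A z -> r y = r z -> y = z) ->
  (forall y, 0 < in1 y w + in2 y w -> A y) ->
  loops (renw r w) = loops w.
Proof.
move=> inj; elim: w => [|[a b] w IH] //= Aw.
have Aw' y : 0 < in1 y w + in2 y w -> A y by move=> H; apply: Aw; lia.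
have [Ea Aa] := root_renw inj Aw' (Aw a ltac:(rewrite eqxx; lia)).
have Ab : A b by apply: Aw; rewrite eqxx; lia.
rewrite Ea IH //; congr (nat_of_bool _ + _).
by apply/eqP/eqP => [/inj->|->].
Qed.

Lemma cm_gt0 x v : (0 < cm x v) = (x \in v).
Proof. by rewrite cmE -has_count has_pred1. Qed.

Lemma occ_ren_inj (A : nat -> Prop) r S x :
  (forall y z, A y -> A z -> r y = r z -> y = z) ->
  (forall y, 0 < occ y S -> A y) -> A x -> occ (r x) (ren r S) = occ x S.
Proof.
move=> inj AS Ax; elim: S AS => //= v S IH AS.
rewrite IH; last by move=> y yS; apply: AS; lia.
congr (_ + _).
have {}AS y : 0 < cm y v -> A y by move=> H; apply: AS; lia.
elim: v AS => //= y v IHv AS; rewrite IHv; last by move=> z zv; apply: AS; lia.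
congr (nat_of_bool _ + _); apply/eqP/eqP => [/inj->|->] //.
by apply: AS; rewrite eqxx.
Qed.

Lemma in_ren_inj (A : nat -> Prop) r w x :
  (forall y z, A y -> A z -> r y = r z -> y = z) ->
  (forall y, 0 < in1 y w + in2 y w -> A y) -> A x ->
  in1 (r x) (renw r w) = in1 x w /\ in2 (r x) (renw r w) = in2 x w.
Proof.
move=> inj; elim: w => [|[a b] w IH] //= Aw Ax.
have [||-> ->] // := IH; first by move=> y H; apply: Aw; lia.
have Aa : A a by apply: Aw; rewrite eqxx; lia.
have Ab : A b by apply: Aw; rewrite eqxx; lia.
by split; congr (nat_of_bool _ + _); apply/eqP/eqP => [/inj->|->].
Qed.

Lemma occ_ren_ex r S x : 0 < occ x (ren r S) -> exists2 y, 0 < occ y S & x = r y.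
Proof.
rewrite occ_gt0 => /flattenP[_ /mapP[v vS ->] /mapP[y yv ->]].
by exists y => //; rewrite occ_gt0; apply/flattenP; exists v.
Qed.

Lemma in_renw_ex r w x : 0 < in1 x (renw r w) + in2 x (renw r w) ->
  exists2 y, 0 < in1 y w + in2 y w & x = r y.
Proof.
elim: w => //= -[a b] w IH /= H.
case: (eqVneq (r a) x) => [<-|ax]; first by exists a => //; rewrite eqxx; lia.
case: (eqVneq (r b) x) => [<-|bx]; first by exists b => //; rewrite eqxx; lia.
have [|y y0 ->] := IH; first by lia.
by exists y => //; lia.
Qed.

Definition injon (r : nat -> nat) (S : names) (w : wires) : Prop :=
  forall x y, 0 < outn x S w -> 0 < outn y S w -> r x = r y -> x = y.

Lemma wf_ren r S T w : wf S T w -> injon r S w -> wf (ren r S) (ren r T) (renw r w).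
Proof.
case=> L cS cT inj; split; rewrite ?cubic_ren //.
pose A x := 0 < outn x S w.
have AS y : 0 < occ y S -> A y by rewrite /A /outn; lia.
have AT y : 0 < occ y T -> A y by have := L y; rewrite /A /inn; lia.
have Aw y : 0 < in1 y w + in2 y w -> A y.
  by have := L y; rewrite /A /outn /inn; lia.
move=> x; have [[y Ay ->]|nx] := pselect (exists2 y, A y & x = r y).
  rewrite /outn /inn (occ_ren_inj inj) // (occ_ren_inj inj) //.
  by have [-> ->] := in_ren_inj inj Aw Ay; apply: L.
have S0 : occ x (ren r S) = 0.
  apply/eqP; rewrite -leqn0 leqNgt; apply/negP=> /occ_ren_ex[y /AS Ay E].
  by apply: nx; exists y.
have T0 : occ x (ren r T) = 0.
  apply/eqP; rewrite -leqn0 leqNgt; apply/negP=> /occ_ren_ex[y /AT Ay E].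
  by apply: nx; exists y.
have w0 : in1 x (renw r w) + in2 x (renw r w) = 0.
  apply/eqP; rewrite -leqn0 leqNgt; apply/negP=> /in_renw_ex[y /Aw Ay E].
  by apply: nx; exists y.
by rewrite /outn /inn; lia.
Qed.

Lemma ren_root (A : nat -> Prop) r w T :
  (forall y z, A y -> A z -> r y = r z -> y = z) ->
  (forall y, 0 < in1 y w + in2 y w -> A y) ->
  (forall y, 0 < occ y T -> A y) ->
  ren (root (renw r w)) (ren r T) = ren r (ren (root w) T).
Proof.
move=> inj Aw AT; rewrite !ren_comp; apply: eq_ren => x /AT Ax.
by have [] := root_renw inj Aw Ax.
Qed.

(** An injective renaming can be undone, so that invariance under renaming has to be
    proved in one direction only. *)
Lemma ren_inv r S T : linear S T [::] -> injon r S [::] ->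
  exists r', ren r' (ren r S) = S /\ ren r' (ren r T) = T.
Proof.
move=> L inj; pose s := flatten S.
exists (fun y => nth 0 s (index y (map r s))).
have H x : 0 < occ x S -> nth 0 s (index (r x) (map r s)) = x.
  rewrite occ_gt0 => xs; have rs : r x \in map r s by apply: map_f.
  have i : index (r x) (map r s) < size s by rewrite -(size_map r) index_mem.
  apply: inj; rewrite /outn /= ?addn0 ?occ_gt0 ?mem_nth //.
  by rewrite -(nth_map _ 0) // nth_index.
rewrite !ren_comp; split; apply: ren_id => x x0 /=; apply: H => //.
by have := L x; rewrite /outn /inn /=; lia.
Qed.

Lemma uniq_occ S : (forall x, occ x S <= 1) -> uniq (flatten S).
Proof.
move=> H; apply/count_mem_uniq => x; rewrite -occE -occ_gt0.
by have := H x; case: (occ x S) => [|[]].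
Qed.

Lemma wf_uniqS S T S' w : wf S T w -> S ≡ S' -> uniq (flatten S').
Proof.
case=> L _ _ E; apply: uniq_occ => x; rewrite -(eqv_occ _ E).
by have := L x; rewrite /outn /inn; lia.
Qed.

Lemma wf_uniqT S T T' w : wf S T w -> T ≡ T' -> uniq (flatten T').
Proof.
case=> L _ _ E; apply: uniq_occ => x; rewrite -(eqv_occ _ E).
by have := L x; rewrite /outn /inn; lia.
Qed.

Lemma perm2P (x y x' y' : nat) : perm_eq [:: x; y] [:: x'; y'] ->
  (x' = x /\ y' = y) \/ (x' = y /\ y' = x).
Proof.
move=> E; have := perm_mem E x'; rewrite !inE eqxx /= => /orP[] /eqP E'; subst x'.
  by left; split=> //; have := perm_cm y' E; rewrite /= eqxx; lia.
by right; split=> //; have := perm_cm y' E; rewrite /= eqxx; lia.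
Qed.

Lemma perm3P (a b c a' b' c' : nat) : perm_eq [:: a; b; c] [:: a'; b'; c'] ->
  [\/ [/\ a' = a, b' = b & c' = c], [/\ a' = a, b' = c & c' = b]
    | [\/ [/\ a' = b, b' = a & c' = c], [/\ a' = b, b' = c & c' = a]
      , [/\ a' = c, b' = a & c' = b] | [/\ a' = c, b' = b & c' = a] ] ].
Proof.
move=> E; have := perm_mem E a'; rewrite !inE eqxx /= => /or3P[] /eqP E'; subst a'.
- by move: E; rewrite perm_cons => /perm2P[[-> ->]|[-> ->]]; [apply: Or31 | apply: Or32].
- have : perm_eq [:: b; a; c] [:: b; b'; c'].
    by apply: perm_trans E; apply/permPl; apply: (perm_catCA [:: b] [:: a] [:: c]).
  by rewrite perm_cons => /perm2P[[-> ->]|[-> ->]]; apply: Or33; [apply: Or41 | apply: Or42].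
- have : perm_eq [:: c; a; b] [:: c; b'; c'].
    by apply: perm_trans E; apply/permPl; apply: (perm_catC [:: c] [:: a; b]).
  by rewrite perm_cons => /perm2P[[-> ->]|[-> ->]]; apply: Or33; [apply: Or43 | apply: Or44].
Qed.

Lemma eqv_cons2P s u v S S1 S2 : S ≡ s :: S1 -> S ≡ u :: v :: S2 ->
  [\/ perm_eq s u /\ S1 ≡ v :: S2, perm_eq s v /\ S1 ≡ u :: S2
    | exists R, [/\ S ≡ s :: u :: v :: R, S1 ≡ u :: v :: R & S2 ≡ s :: R] ].
Proof.
move=> H1 H2; have E := H1; rewrite eqv_sym in E; have {E}E := eqv_trans E H2.
case: (eqv_consP E) => [[p F]|[R [F1 F2]]]; first by apply: Or31.
case: (eqv_consP F2) => [[p F]|[Q [G1 G2]]].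
  apply: Or32; split; first by rewrite perm_sym.
  by apply: eqv_trans F1 _; rewrite eqv_cons_inj // eqv_sym.
apply: Or33; exists Q; split=> //.
  apply: eqv_trans H1 _; rewrite eqv_cons_inj //.
  by apply: eqv_trans F1 _; rewrite eqv_cons_inj // eqv_sym.
by apply: eqv_trans F1 _; rewrite eqv_cons_inj // eqv_sym.
Qed.

(** * Evaluation of nets *)

(** Equality tests of names are replaced by unknown naturals before calling [lia],
    which would otherwise distinguish cases on each of them. *)
Ltac glia := rewrite ?eqxx; change (nat_of_bool true) with 1%N;
  change (nat_of_bool false) with 0%N; repeat match goal with
  |- context [nat_of_bool ?b] => move: (nat_of_bool b) => ? end; lia.

Ltac pm := solve [clear; apply/seq.permP => ? /=; glia].

(** The six matchings of two stars. *)
Ltac perm3 H := case: (perm3P H) => [[? ? ?]|[? ? ?]|[] [? ? ?]]; subst.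

(** Refutes a list of distinct names in which two entries have been identified. *)
Ltac uq := solve [repeat match goal with H : is_true (uniq _) |- _ => move: H end;
  rewrite /= ?in_cons ?in_nil ?eqxx /= ?orbT /= ?andbF //=].

(** bg is the factor of a bigon and lp that of a circle; the relation between them is
    forced by a bigon which has an edge in common with a quadrilateral, see
    [bigon_quad_edge]. *)
Section Evaluation.
Local Open Scope ring_scope.

Variables (M : comNzRingType) (bg lp : M).
Hypothesis bgE : bg * bg = lp + 1.
Variable base : names -> names -> M.

(** Edges a and b form a bigon; joining the two remaining half-edges adds the wire
    (d, c). *)
Definition bigon_at S T (a b c d : nat) S' T' : Prop :=
  S ≡ [:: a; b; c] :: S' /\ T ≡ [:: a; b; d] :: T'.

(** The cycle of edges a, b, c, d is a quadrilateral; p, r are the remaining edges at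
    the two sources, q, o those at the two sinks.  Its resolutions add the wires
    (q, p), (o, r) or the wires (q, r), (o, p). *)
Definition quad_at S T (a b c d p q r o : nat) S' T' : Prop :=
  S ≡ [:: a; b; p] :: [:: c; d; r] :: S' /\
  T ≡ [:: b; c; q] :: [:: d; a; o] :: T'.

Definition bigon_free S T : Prop := forall a b c d S' T', ~ bigon_at S T a b c d S' T'.

Definition quad_free S T : Prop :=
  forall a b c d p q r o S' T', ~ quad_at S T a b c d p q r o S' T'.

(** All the values obtained by reducing a net in any order; [base] gives the values
    of reduced nets.  The circles created when half-edges are joined are counted by
    [loops]. *)
Inductive ev : names -> names -> M -> Prop :=
| ev_base S T : bigon_free S T -> quad_free S T -> ev S T (base S T)
| ev_bigon S T a b c d S' T' v : bigon_at S T a b c d S' T' ->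
    ev S' (ren (root [:: (d, c)]) T') v ->
    ev S T (bg * (lp ^+ loops [:: (d, c)] * v))
| ev_quad S T a b c d p q r o S' T' v1 v2 :
    quad_at S T a b c d p q r o S' T' ->
    ev S' (ren (root [:: (q, p); (o, r)]) T') v1 ->
    ev S' (ren (root [:: (q, r); (o, p)]) T') v2 ->
    ev S T (lp ^+ loops [:: (q, p); (o, r)] * v1 +
            lp ^+ loops [:: (q, r); (o, p)] * v2).

Hypothesis base_eqv : forall S S' T T',
  S ≡ S' -> T ≡ T' -> base S T = base S' T'.
Hypothesis base_ren : forall r S T, wf S T [::] -> injon r S [::] ->
  base (ren r S) (ren r T) = base S T.

Lemma bigon_at_eqv S T S2 T2 a b c d S' T' : S ≡ S2 -> T ≡ T2 ->
  bigon_at S T a b c d S' T' -> bigon_at S2 T2 a b c d S' T'.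
Proof.
move=> ES ET [HS HT]; split; [apply: eqv_trans HS | apply: eqv_trans HT];
  by rewrite eqv_sym.
Qed.

Lemma quad_at_eqv S T S2 T2 a b c d p q r o S' T' : S ≡ S2 -> T ≡ T2 ->
  quad_at S T a b c d p q r o S' T' -> quad_at S2 T2 a b c d p q r o S' T'.
Proof.
move=> ES ET [HS HT]; split; [apply: eqv_trans HS | apply: eqv_trans HT];
  by rewrite eqv_sym.
Qed.

Lemma bigon_free_eqv S T S2 T2 : S ≡ S2 -> T ≡ T2 -> bigon_free S T -> bigon_free S2 T2.
Proof.
rewrite eqv_sym => ES; rewrite eqv_sym => ET H a b c d S' T'.
by move/(bigon_at_eqv ES ET); apply: H.
Qed.

Lemma quad_free_eqv S T S2 T2 : S ≡ S2 -> T ≡ T2 -> quad_free S T -> quad_free S2 T2.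
Proof.
rewrite eqv_sym => ES; rewrite eqv_sym => ET H a b c d p q r o S' T'.
by move/(quad_at_eqv ES ET); apply: H.
Qed.

Lemma ev_eqv S T S' T' v : ev S T v -> S ≡ S' -> T ≡ T' -> ev S' T' v.
Proof.
move=> H ES ET; case: H ES ET => {S T v}.
- move=> S T bf qf ES ET; rewrite (base_eqv ES ET); apply: ev_base.
    exact: bigon_free_eqv bf.
  exact: quad_free_eqv qf.
- move=> S T a b c d S1 T1 v H E ES ET; apply: ev_bigon E.
  exact: bigon_at_eqv H.
- move=> S T a b c d p q r o S1 T1 v1 v2 H E1 E2 ES ET.
  apply: ev_quad E1 E2; exact: quad_at_eqv H.
Qed.

Lemma wf_bigon a b c d S T w :
  wf ([:: a; b; c] :: S) ([:: a; b; d] :: T) w -> wf S T ((d, c) :: w).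
Proof.
case=> L /andP[_ cS] /andP[_ cT]; split=> // x.
by have := L x; rewrite /outn /inn /=; glia.
Qed.

Lemma wf_quad1 a b c d p q r o S T w :
  wf ([:: a; b; p] :: [:: c; d; r] :: S) ([:: b; c; q] :: [:: d; a; o] :: T) w ->
  wf S T ((q, p) :: (o, r) :: w).
Proof.
case=> L /and3P[_ _ cS] /and3P[_ _ cT]; split=> // x.
by have := L x; rewrite /outn /inn /=; glia.
Qed.

Lemma wf_quad2 a b c d p q r o S T w :
  wf ([:: a; b; p] :: [:: c; d; r] :: S) ([:: b; c; q] :: [:: d; a; o] :: T) w ->
  wf S T ((q, r) :: (o, p) :: w).
Proof.
case=> L /and3P[_ _ cS] /and3P[_ _ cT]; split=> // x.
by have := L x; rewrite /outn /inn /=; glia.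
Qed.

Lemma wf_eqv0 S S' T T' w : wf S T w -> S ≡ S' -> T ≡ T' -> wf S' T' w.
Proof. by move=> H ES ET; apply: wf_eqv H _ _ _. Qed.

(** Each reduction removes stars. *)
Lemma ev_total S T : wf S T [::] -> exists v, ev S T v.
Proof.
elim: {S}(size S) {-2}S (leqnn (size S)) T => [|n IH] S sS T W;
  have [[a [b [c [d [S' [T' H]]]]]]|nb] := pselect (exists a b c d S' T', bigon_at S T a b c d S' T').
- by case: H => /eqv_size /=; lia.
- have bf : bigon_free S T.
    by move=> a b c d S' T' H; apply: nb; exists a, b, c, d, S', T'.
  exists (base S T); apply: ev_base => // a b c d p q r o S' T' [].
  by move=> /eqv_size /=; lia.
- have [HS HT] := H.
  have [|v E] := IH S' _ _ (wf_root (wf_bigon (wf_eqv0 W HS HT))).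
    by move/eqv_size: HS => /=; lia.
  by eexists; apply: ev_bigon H E.
- have bf : bigon_free S T.
    by move=> a b c d S' T' H; apply: nb; exists a, b, c, d, S', T'.
  have [[a [b [c [d [p [q [r [o [S' [T' H]]]]]]]]]]|nq] := pselect (exists a b c d p q r o S' T', quad_at S T a b c d p q r o S' T').
    have [HS HT] := H.
    have [|v1 E1] := IH S' _ _ (wf_root (wf_quad1 (wf_eqv0 W HS HT))).
      by move/eqv_size: HS => /=; lia.
    have [|v2 E2] := IH S' _ _ (wf_root (wf_quad2 (wf_eqv0 W HS HT))).
      by move/eqv_size: HS => /=; lia.
    by eexists; apply: ev_quad H E1 E2.
  exists (base S T); apply: ev_base => // a b c d p q r o S' T' H.
  by apply: nq; exists a, b, c, d, p, q, r, o, S', T'.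
Qed.

Lemma bigon_free_ren r S T : wf S T [::] -> injon r S [::] ->
  bigon_free S T -> bigon_free (ren r S) (ren r T).
Proof.
case=> L _ _ inj bf a b c d S' T' [HS HT].
have [r' [ES ET]] := ren_inv L inj.
apply: (bf (r' a) (r' b) (r' c) (r' d) (ren r' S') (ren r' T')).
by split; [rewrite -ES; apply: eqv_ren HS | rewrite -ET; apply: eqv_ren HT].
Qed.

Lemma quad_free_ren r S T : wf S T [::] -> injon r S [::] ->
  quad_free S T -> quad_free (ren r S) (ren r T).
Proof.
case=> L _ _ inj bf a b c d p q u o S' T' [HS HT].
have [r' [ES ET]] := ren_inv L inj.
apply: (bf (r' a) (r' b) (r' c) (r' d) (r' p) (r' q) (r' u) (r' o) (ren r' S') (ren r' T')).
by split; [rewrite -ES; apply: eqv_ren HS | rewrite -ET; apply: eqv_ren HT].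
Qed.

Lemma wf_names S T w : wf S T w ->
  (forall y, 0 < in1 y w + in2 y w -> 0 < outn y S w)%N /\
  (forall y, 0 < occ y T -> 0 < outn y S w)%N.
Proof. by case=> L _ _; split=> y; have := L y; rewrite /outn /inn; lia. Qed.

Lemma injon_root r S T w : wf S T w -> injon r S w -> injon r S [::].
Proof. by move=> _ inj x y; rewrite /outn /= => Hx Hy; apply: inj; rewrite /outn; lia. Qed.

Lemma ren_rootw r S T w : wf S T w -> injon r S w ->
  ren (root (renw r w)) (ren r T) = ren r (ren (root w) T) /\
  loops (renw r w) = loops w.
Proof.
move=> W inj; have [H1 H2] := wf_names W; split; last exact: loops_renw inj H1.
exact: ren_root inj H1 H2.
Qed.

Lemma ev_ren r S T v : ev S T v -> wf S T [::] -> injon r S [::] ->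
  ev (ren r S) (ren r T) v.
Proof.
move=> H; elim: H r => {S T v}.
- move=> S T bf qf r W inj; rewrite -(base_ren W inj); apply: ev_base.
    exact: bigon_free_ren.
  exact: quad_free_ren.
- move=> S T a b c d S' T' v [HS HT] E IH r W inj.
  have W' := wf_bigon (wf_eqv0 W HS HT).
  have inj' : injon r S' [:: (d, c)].
    move=> x y Hx Hy; apply: inj; rewrite /outn (eqv_occ _ HS) /=;
    move: Hx Hy; rewrite /outn /=; glia.
  have [E1 E2] := ren_rootw W' inj'.
  rewrite -E2; apply: ev_bigon.
    by split; [apply: eqv_ren HS | apply: eqv_ren HT].
  rewrite -[[:: (r d, r c)]]/(renw r [:: (d, c)]) E1; apply: IH.
    exact: wf_root W'.
  exact: injon_root W' inj'.
- move=> S T a b c d p q u o S' T' v1 v2 [HS HT] E1 IH1 E2 IH2 r W inj.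
  have W1 := wf_quad1 (wf_eqv0 W HS HT).
  have W2 := wf_quad2 (wf_eqv0 W HS HT).
  have inj1 : injon r S' [:: (q, p); (o, u)].
    move=> x y Hx Hy; apply: inj; rewrite /outn (eqv_occ _ HS) /=;
    move: Hx Hy; rewrite /outn /=; glia.
  have inj2 : injon r S' [:: (q, u); (o, p)].
    move=> x y Hx Hy; apply: inj; rewrite /outn (eqv_occ _ HS) /=;
    move: Hx Hy; rewrite /outn /=; glia.
  have [F1 G1] := ren_rootw W1 inj1.
  have [F2 G2] := ren_rootw W2 inj2.
  rewrite -G1 -G2; apply: ev_quad.
  - by split; [apply: eqv_ren HS | apply: eqv_ren HT].
  - rewrite -[[:: (r q, r p); _]]/(renw r [:: (q, p); (o, u)]) F1; apply: IH1.
      exact: wf_root W1.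
    exact: injon_root W1 inj1.
  - rewrite -[[:: (r q, r u); _]]/(renw r [:: (q, u); (o, p)]) F2; apply: IH2.
      exact: wf_root W2.
    exact: injon_root W2 inj2.
Qed.

Definition F0 S T : M :=
  if pselect (exists v, ev S T v) is left h then projT1 (cid h) else 0.

(** The value of a net with wires: connect the wires, evaluate what remains. *)
Definition Fw S T w : M := lp ^+ loops w * F0 S (ren (root w) T).

(** Confluence below a given size: the induction hypothesis for the comparison of
    two overlapping reductions, whose results are smaller nets. *)
Definition confluent_below n : Prop := forall S T v v', (size S < n)%N -> wf S T [::] ->
  ev S T v -> ev S T v' -> v = v'.

Section Confluence.
Variable n : nat.
Hypothesis conf_n : confluent_below n.

Lemma F0_ev S T : wf S T [::] -> ev S T (F0 S T).
Proof.
by move=> W; rewrite /F0; case: pselect => [h|[]]; [case: cid | exact: ev_total].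
Qed.

Lemma F0E S T v : (size S < n)%N -> wf S T [::] -> ev S T v -> F0 S T = v.
Proof. by move=> sS W; apply: conf_n => //; apply: F0_ev. Qed.

Lemma Fw_nil S T : Fw S T [::] = F0 S T.
Proof. by rewrite /Fw expr0 mul1r ren_id. Qed.

Lemma F0_eqv S S' T T' : (size S < n)%N -> wf S T [::] -> S ≡ S' -> T ≡ T' ->
  F0 S T = F0 S' T'.
Proof.
move=> sS W ES ET; apply: esym; apply: F0E.
- by rewrite -(eqv_size ES).
- exact: wf_eqv0 W ES ET.
- exact: ev_eqv (F0_ev W) ES ET.
Qed.

Lemma Fw_eqv S S' T T' w w' : (size S < n)%N -> wf S T w ->
  S ≡ S' -> T ≡ T' -> perm_eq w w' -> Fw S T w = Fw S' T' w'.
Proof.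
move=> sS W ES ET Ew; have [L _ _] := W.
rewrite /Fw (loops_perm Ew (wf_uniq1 L) (wf_uniq2 L)); congr (_ * _).
apply: F0_eqv => //; first exact: wf_root.
have -> : ren (root w) T = ren (root w') T.
  apply: eq_ren => x x0.
  by apply: root_perm (wf_uniq1 L) (wf_uniq2 L) _ => //; have := L x; rewrite /inn; lia.
exact: eqv_ren.
Qed.

Lemma Fw_ren r S T w : (size S < n)%N -> wf S T w -> injon r S w ->
  Fw (ren r S) (ren r T) (renw r w) = Fw S T w.
Proof.
move=> sS W inj; have [E1 E2] := ren_rootw W inj.
rewrite /Fw E1 E2; congr (_ * _); apply: F0E.
- by rewrite size_ren.
- by apply: (@wf_ren r _ _ [::]); [exact: wf_root | exact: injon_root W inj].
- apply: ev_ren; first exact: F0_ev (wf_root W).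
    exact: wf_root.
  exact: injon_root W inj.
Qed.

(** Connecting the wires in two stages.  This is how the rules for a first reduction
    are obtained in the presence of other wires. *)
Lemma Fw_cat S T v w : Fw S T (v ++ w) =
  lp ^+ loops w * Fw S (ren (root w) T) (refst (root w) v).
Proof.
rewrite /Fw loops_cat addnC exprD mulrA; congr (_ * F0 _ _).
by rewrite ren_comp; apply: eq_ren => x _; rewrite root_cat.
Qed.

Lemma Fw_loop S T w a : wf S T ((a, a) :: w) -> Fw S T ((a, a) :: w) = lp * Fw S T w.
Proof.
case=> L _ _; rewrite /Fw /= root_id; last by have := L a; rewrite /outn /inn /= eqxx; lia.
rewrite eqxx exprS mulrA; congr (_ * F0 _ _).
by apply: eq_ren => x _; rewrite /ren1; case: eqP.
Qed.

Lemma Fw_wire S T w a b : (size S < n)%N -> wf S T ((a, b) :: w) -> a != b ->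
  Fw S T ((a, b) :: w) = Fw S (ren (ren1 b a) T) (refst (ren1 b a) w).
Proof.
move=> sS W ab; rewrite (@Fw_eqv S S T T _ (w ++ [:: (a, b)])) //.
  rewrite Fw_cat /= (negbTE ab) expr0 mul1r; congr Fw.
by rewrite cats1 perm_sym perm_rcons.
Qed.

Lemma Fw_bigon a b c d S T w : (size S < n.-1)%N ->
  wf ([:: a; b; c] :: S) ([:: a; b; d] :: T) w ->
  Fw ([:: a; b; c] :: S) ([:: a; b; d] :: T) w = bg * Fw S T ((d, c) :: w).
Proof.
move=> sS W; have [L _ _] := W.
have ab : root w a = a /\ root w b = b.
  split; apply: root_id.
    by have := L a; rewrite /outn /inn /= eqxx; lia.
  by have := L b; rewrite /outn /inn /= eqxx; lia.
rewrite -[(d, c) :: w]/([:: (d, c)] ++ w) Fw_cat mulrCA /Fw; congr (_ * _).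
have W1 : wf S (ren (root w) T) [:: (root w d, c)].
  have := wf_root W; rewrite /= ab.1 ab.2; exact: wf_bigon.
rewrite (@F0E _ _ (bg * (lp ^+ loops [:: (root w d, c)] *
    F0 S (ren (root [:: (root w d, c)]) (ren (root w) T))))) //=.
- by lia.
- exact: wf_root W.
- apply: (@ev_bigon _ _ a b c (root w d)).
    by split=> //=; rewrite ab.1 ab.2.
  apply: F0_ev; exact: wf_root W1.
Qed.

Lemma Fw_quad a b c d p q r o S T w : (size S < n.-2)%N ->
  wf ([:: a; b; p] :: [:: c; d; r] :: S) ([:: b; c; q] :: [:: d; a; o] :: T) w ->
  Fw ([:: a; b; p] :: [:: c; d; r] :: S) ([:: b; c; q] :: [:: d; a; o] :: T) w =
  Fw S T ((q, p) :: (o, r) :: w) + Fw S T ((q, r) :: (o, p) :: w).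
Proof.
move=> sS W; have [L _ _] := W.
have [ra rb rc rd] : [/\ root w a = a, root w b = b, root w c = c & root w d = d].
  split; apply: root_id.
  - by have := L a; rewrite /outn /inn /= eqxx; glia.
  - by have := L b; rewrite /outn /inn /= eqxx; glia.
  - by have := L c; rewrite /outn /inn /= eqxx; glia.
  - by have := L d; rewrite /outn /inn /= eqxx; glia.
rewrite -[(q, p) :: _]/([:: (q, p); (o, r)] ++ w) Fw_cat.
rewrite -[(q, r) :: _]/([:: (q, r); (o, p)] ++ w) Fw_cat /= -mulrDr /Fw; congr (_ * _).
have WW : wf ([:: a; b; p] :: [:: c; d; r] :: S)
    ([:: b; c; root w q] :: [:: d; a; root w o] :: ren (root w) T) [::].
  by have := wf_root W; rewrite /= ra rb rc rd.
have W1 := wf_quad1 WW; have W2 := wf_quad2 WW.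
apply: F0E => /=; first lia.
  exact: wf_root W.
rewrite ra rb rc rd.
apply: (@ev_quad _ _ a b c d p (root w q) r (root w o)); first by split.
  by apply: F0_ev; apply: wf_root W1.
by apply: F0_ev; apply: wf_root W2.
Qed.

Lemma ren1_id0 b a T : (occ b T = 0)%N -> ren (ren1 b a) T = T.
Proof.
move=> H; apply: ren_id => x x0; rewrite /ren1; case: eqP => // E.
by rewrite E H in x0.
Qed.

Lemma refst1_id0 b a w : (in1 b w = 0)%N -> refst (ren1 b a) w = w.
Proof.
elim: w => //= -[x y] w IH /= H; rewrite IH; last lia.
by rewrite /ren1; case: eqP => // E; move: H; rewrite E eqxx.
Qed.

Lemma ren1_id1 b a v : (cm b v = 0)%N -> map (ren1 b a) v = v.
Proof.
elim: v => //= y v IH H; rewrite IH; last lia.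
by rewrite /ren1; case: eqP => // E; move: H; rewrite E eqxx.
Qed.

Lemma Fw_in S T w a b v : (size S < n)%N -> wf S ((b :: v) :: T) ((a, b) :: w) ->
  Fw S ((b :: v) :: T) ((a, b) :: w) = Fw S ((a :: v) :: T) w.
Proof.
move=> sS W; have [L _ _] := W.
have H : (a != b) && (occ b T + in1 b w + cm b v == 0)%N.
  by have := L b; rewrite /outn /inn /= eqxx; case: (a == b); lia.
case/andP: H => ab /eqP H; rewrite Fw_wire //= ren1_id0 ?ren1_id1 ?refst1_id0 //; try lia.
by rewrite /ren1 eqxx.
Qed.

Lemma Fw_ww S T w a b c : (size S < n)%N -> wf S T ((a, b) :: (b, c) :: w) ->
  Fw S T ((a, b) :: (b, c) :: w) = Fw S T ((a, c) :: w).
Proof.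
move=> sS W; have [L _ _] := W.
have H : (a != b) && (occ b T + in1 b w == 0)%N.
  by have := L b; rewrite /outn /inn /= eqxx; case: (a == b); lia.
case/andP: H => ab /eqP H; rewrite Fw_wire //= ren1_id0 ?refst1_id0 //; try lia.
by rewrite /ren1 eqxx.
Qed.

Definition resnd (r : nat -> nat) (w : wires) : wires :=
  map (fun e => (e.1, r e.2)) w.

(** A wire may be absorbed on the emitting side as well: up to the names, it makes no
    difference which end of the joined edge keeps its name. *)
Lemma Fw_wire2 S T w a b : (size S < n)%N -> wf S T ((a, b) :: w) -> a != b ->
  Fw S T ((a, b) :: w) = Fw (ren (ren1 a b) S) T (resnd (ren1 a b) w).
Proof.
move=> sS W ab; have [L cS cT] := W.
have W' : wf S (ren (ren1 b a) T) (refst (ren1 b a) w).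
  by split; rewrite ?cubic_ren //; apply: linear_wire.
have b0 : (occ b S + in2 b w = 0)%N.
  by have := L b; rewrite /outn /inn /= eqxx; glia.
have a0 : (occ a T + in1 a w = 0)%N.
  by have := L a; rewrite /outn /inn /= eqxx; glia.
rewrite Fw_wire // -(@Fw_ren (ren1 a b)) //; last first.
  move=> x y; rewrite /outn !count_refst2 /ren1.
  case: (eqVneq x a) => [xa|xa]; case: (eqVneq y a) => [ya|ya] H1 H2 E.
  - by rewrite xa ya.
  - by move: H2; rewrite -E; lia.
  - by move: H1; rewrite E; lia.
  - by [].
congr Fw.
  rewrite ren_comp; apply: ren_id => x x0 /=; rewrite /ren1.
  case: (eqVneq x b) => [->|xb]; first by rewrite eqxx.
  by case: eqP => // E; move: x0; rewrite E; lia.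
rewrite /renw /refst /resnd -map_comp; apply/eq_in_map => -[x y] xy /=.
congr (_, _); rewrite /ren1; case: (eqVneq x b) => [->|xb]; first by rewrite eqxx.
case: eqP => // E; subst x.
have : (0 < in1 a w)%N.
  by rewrite in1E -has_count; apply/hasP; exists (a, y) => /=.
lia.
Qed.

Lemma resnd1_id0 b a w : (in2 b w = 0)%N -> resnd (ren1 b a) w = w.
Proof.
elim: w => //= -[x y] w IH /= H; rewrite IH; last lia.
by rewrite /ren1; case: eqP => // E; move: H; rewrite E eqxx.
Qed.

Lemma Fw_out S T w a b v : (size S < n.-1)%N -> wf ((a :: v) :: S) T ((a, b) :: w) ->
  Fw ((a :: v) :: S) T ((a, b) :: w) = Fw ((b :: v) :: S) T w.
Proof.
move=> sS W; have [L _ _] := W.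
have H : (a != b) && (occ a S + in2 a w + cm a v == 0)%N.
  by have := L a; rewrite /outn /inn /= eqxx (eq_sym b); case: (a == b); lia.
case/andP: H => ab /eqP H; rewrite Fw_wire2 //=; last lia.
rewrite ren1_id0 ?ren1_id1 ?resnd1_id0 //; try lia.
by rewrite /ren1 eqxx.
Qed.

(** Two distinct bigons which are not disjoint have both vertices in common: the
    component is a theta graph, and either reduction closes its third edge to a
    circle. Disjoint bigons are reduced independently. *)
Lemma bigon_bigon S T a b c d S1 T1 a' b' c' d' S2 T2 : (size S <= n)%N ->
  wf S T [::] -> bigon_at S T a b c d S1 T1 -> bigon_at S T a' b' c' d' S2 T2 ->
  Fw S1 T1 [:: (d, c)] = Fw S2 T2 [:: (d', c')].
Proof.
move=> sS W [HS HT] [HS' HT'].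
have W1 := wf_bigon (wf_eqv0 W HS HT).
have sz := eqv_size HS; rewrite /= in sz.
have ES := HS; rewrite eqv_sym in ES; have {ES}ES := eqv_trans ES HS'.
have ET := HT; rewrite eqv_sym in ET; have {ET}ET := eqv_trans ET HT'.
have sz' := eqv_size ES; rewrite /= in sz'.
have s1 : (size S1 < n)%N by move: sS sz; clear; lia.
have s2 : (size S2 < n)%N by move: s1 sz'; clear; lia.
have U1 := wf_uniqS W HS; have U2 := wf_uniqT W HT.
case: (eqv_consP ES) (eqv_consP ET) => [[p12 E12]|[R [ER1 ER2]]] [[q12 F12]|[Q [EQ1 EQ2]]].
- have EE : Fw S1 T1 [:: (d, c)] = Fw S2 T2 [:: (d, c)] by apply: Fw_eqv.
  have EL : d = c -> Fw S2 T2 [:: (d, c)] = lp * Fw S2 T2 [::].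
    by move=> dc; subst d; apply: Fw_loop; apply: wf_eqv0 W1 _ _.
  have EL' : d' = c' -> Fw S2 T2 [:: (d', c')] = lp * Fw S2 T2 [::].
    by move=> dc; subst d'; apply: Fw_loop; have := wf_bigon (wf_eqv0 W HS' HT').
  case: (perm3P p12) => [[? ? ?]|[? ? ?]|[] [? ? ?]];
    subst a' b' c'; perm3 q12; try uq; rewrite EE // EL // EL' //.
- have UT := wf_uniqT W (eqv_trans HT (eqv_cons (perm_refl _) EQ1)).
  by perm3 p12; uq.
- have US := wf_uniqS W (eqv_trans HS (eqv_cons (perm_refl _) ER1)).
  by perm3 q12; uq.
have sR := eqv_size ER1; rewrite /= in sR.
have ER1' : [:: a'; b'; c'] :: [:: a; b; c] :: R ≡ S.
  rewrite eqv_sym; apply: eqv_trans HS' _; rewrite eqv_cons_inj //.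
have EQ1' : [:: a'; b'; d'] :: [:: a; b; d] :: Q ≡ T.
  rewrite eqv_sym; apply: eqv_trans HT' _; rewrite eqv_cons_inj //.
have WR : wf ([:: a'; b'; c'] :: [:: a; b; c] :: R) ([:: a'; b'; d'] :: [:: a; b; d] :: Q) [::].
  by apply: wf_eqv0 W _ _; rewrite eqv_sym.
have WR' : wf ([:: a; b; c] :: [:: a'; b'; c'] :: R) ([:: a; b; d] :: [:: a'; b'; d'] :: Q) [::].
  by apply: wf_eqv0 WR _ _; apply: eqv_swap.
have V := wf_bigon WR'; have V' := wf_bigon WR.
rewrite (@Fw_eqv S1 ([:: a'; b'; c'] :: R) T1 ([:: a'; b'; d'] :: Q) _ [:: (d, c)]) //.
rewrite (@Fw_eqv S2 ([:: a; b; c] :: R) T2 ([:: a; b; d] :: Q) _ [:: (d', c')]) //; last first.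
  exact: wf_bigon (wf_eqv0 W HS' HT').
have sR' : (size R < n.-1)%N by move: s1 sR; clear; lia.
rewrite !Fw_bigon //; congr (_ * _); apply: Fw_eqv => //.
- by move: sR'; clear; lia.
- exact: wf_bigon V.
by apply/permPl; apply: (perm_catC [:: (d', c')] [:: (d, c)]).
Qed.

(** The two resolutions of a quadrilateral. *)
Definition Qval S T p q r o : M :=
  Fw S T [:: (q, p); (o, r)] + Fw S T [:: (q, r); (o, p)].

Lemma perm2 (T : eqType) (x y : T) : perm_eq [:: x; y] [:: y; x].
Proof. by apply/permPl; apply: (perm_catC [:: x] [:: y]). Qed.

(** The symmetries of a quadrilateral reduce the possible overlaps to a few. *)
Lemma quad_rot S T a b c d p q r o S' T' :
  quad_at S T a b c d p q r o S' T' -> quad_at S T c d a b r o p q S' T'.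
Proof. by move=> [HS HT]; split; [apply: eqv_trans HS _ | apply: eqv_trans HT _]; apply: eqv_swap. Qed.

Lemma perm12 (x y z : nat) : perm_eq [:: x; y; z] [:: y; x; z].
Proof. by apply/permPl; apply: (perm_catCA [:: x] [:: y] [:: z]). Qed.

Lemma quad_refl S T a b c d p q r o S' T' :
  quad_at S T a b c d p q r o S' T' -> quad_at S T b a d c p o r q S' T'.
Proof.
move=> [HS HT]; split.
  apply: eqv_trans HS _.
  by do 2?[apply: eqv_cons; first exact: perm12].
apply: eqv_trans HT _; apply: eqv_trans (eqv_swap _ _ _) _.
by do 2?[apply: eqv_cons; first exact: perm12].
Qed.

Lemma wf_quad S T a b c d p q r o S' T' w : wf S T w -> quad_at S T a b c d p q r o S' T' ->
  [/\ wf S' T' ((q, p) :: (o, r) :: w), wf S' T' ((q, r) :: (o, p) :: w)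
    & (size S = (size S').+2)%N].
Proof.
move=> W [HS HT]; have W' := wf_eqv0 W HS HT.
by split; [exact: wf_quad1 W' | exact: wf_quad2 W' | rewrite (eqv_size HS)].
Qed.

Lemma Qval_rot S T a b c d p q r o S' T' : (size S <= n)%N -> wf S T [::] ->
  quad_at S T a b c d p q r o S' T' -> Qval S' T' r o p q = Qval S' T' p q r o.
Proof.
move=> sS W /(wf_quad W)[W1 W2 sz]; apply: esym.
by congr (_ + _); apply: Fw_eqv => //; try lia; apply: perm2.
Qed.

Lemma Qval_refl S T a b c d p q r o S' T' : (size S <= n)%N -> wf S T [::] ->
  quad_at S T a b c d p q r o S' T' -> Qval S' T' p o r q = Qval S' T' p q r o.
Proof.
move=> sS W /(wf_quad W)[W1 W2 sz]; apply: esym; rewrite /Qval addrC.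
by congr (_ + _); apply: Fw_eqv => //; try lia; apply: perm2.
Qed.

Lemma perm23 (x y z : nat) : perm_eq [:: x; y; z] [:: x; z; y].
Proof. by rewrite perm_cons perm2. Qed.

(** A bigon sharing one edge b with a quadrilateral: its vertices are two neighbours
    in the quadrilateral.  Reducing the bigon leaves another bigon, whereas resolving
    the quadrilateral leaves a circle and an edge, or an edge: this is where the
    relation bg * bg = lp + 1 is needed. *)
Lemma bigon_quad_edge a b c d p r o S T : (size S < n.-1)%N ->
  wf ([:: a; b; p] :: [:: c; d; r] :: S) ([:: b; c; p] :: [:: d; a; o] :: T) [::] ->
  bg * Fw ([:: c; d; r] :: S) ([:: d; a; o] :: T) [:: (c, a)] = Qval S T p p r o.
Proof.
move=> sS W; have W1 := wf_quad1 W; have W2 := wf_quad2 W.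
have W3 : wf ([:: c; d; r] :: S) ([:: a; d; o] :: T) [:: (c, a)].
  apply: (@wf_bigon b p).
  apply: wf_eqv0 W _ _; apply: eqv_cons => //.
  - by apply/permPl; apply: (perm_catC [:: a] [:: b; p]).
  - by apply: perm23.
  - apply: eqv_cons => //; exact: perm12.
have E1 : Fw ([:: c; d; r] :: S) ([:: d; a; o] :: T) [:: (c, a)] = bg * Fw S T [:: (o, r)].
  have E : [:: d; a; o] :: T ≡ [:: a; d; o] :: T by apply: eqv_cons => //; exact: perm12.
  rewrite (@Fw_eqv _ ([:: c; d; r] :: S) _ ([:: a; d; o] :: T) _ [:: (c, a)]) //=; try lia.
    rewrite Fw_in //=; last lia.
    rewrite Fw_bigon //.
    case: W3 => L cS cT; split=> // x.
    by have := L x; rewrite /outn /inn /=; glia.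
  by apply: wf_eqv0 W3 _ _ => //; rewrite eqv_sym.
rewrite E1 mulrA bgE /Qval Fw_loop // mulrDl mul1r; congr (_ + _).
rewrite (@Fw_eqv S S T T [:: (p, r); (o, p)] [:: (o, p); (p, r)]) //; last 2 first.
- by move: sS; clear; lia.
- exact: perm2.
rewrite Fw_ww //; first by move: sS; clear; lia.
by apply: wf_eqv W2 _ _ _ => //; apply: perm2.
Qed.

(** If both vertices of the bigon belong to the quadrilateral, the bigon consists of a
    side and of a further edge joining the same vertices, so that the remaining
    half-edges p and q are one edge. *)
Lemma bigon_quad_shared S T a b c d S1 T1 a' b' c' d' p q r o S2 T2 : (size S <= n)%N ->
  wf S T [::] -> bigon_at S T a b c d S1 T1 ->
  quad_at S T a' b' c' d' p q r o S2 T2 ->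
  perm_eq [:: a; b; c] [:: a'; b'; p] -> perm_eq [:: a; b; d] [:: b'; c'; q] ->
  bg * Fw S1 T1 [:: (d, c)] = Qval S2 T2 p q r o.
Proof.
move=> sS W H1 H2 ps pt; have [HS HT] := H2.
have pq : p = q.
  have US := wf_uniqS W HS; have UT := wf_uniqT W HT.
  by clear -US UT ps pt; perm3 ps; case: (perm3P pt) => [[? ? ?]|[? ? ?]|[] [? ? ?]]; subst => //; uq.
subst q.
have H3 : bigon_at S T b' p a' c' ([:: c'; d'; r] :: S2) ([:: d'; a'; o] :: T2).
  split.
    apply: eqv_trans HS _; apply: eqv_cons => //.
    by apply/permPl; apply: (perm_catC [:: a'] [:: b'; p]).
  by apply: eqv_trans HT _; apply: eqv_cons => //; apply: perm23.
rewrite (bigon_bigon sS W H1 H3) (@bigon_quad_edge a' b' c' d' p) //; last exact: wf_eqv0 W HS HT.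
by move/eqv_size: HS sS => /= ->; clear; lia.
Qed.

Lemma bigon_quad S T a b c d S1 T1 a' b' c' d' p q r o S2 T2 : (size S <= n)%N ->
  wf S T [::] -> bigon_at S T a b c d S1 T1 ->
  quad_at S T a' b' c' d' p q r o S2 T2 ->
  bg * Fw S1 T1 [:: (d, c)] = Qval S2 T2 p q r o.
Proof.
move=> sS W H1 H2.
have shared1 a1 b1 c1 d1 p1 q1 r1 o1 : quad_at S T a1 b1 c1 d1 p1 q1 r1 o1 S2 T2 ->
    perm_eq [:: a; b; c] [:: a1; b1; p1] ->
    bg * Fw S1 T1 [:: (d, c)] = Qval S2 T2 p1 q1 r1 o1.
  move=> H ps; have [HS1 HT1] := H1; have [HS HT] := H.
  case: (eqv_cons2P HT1 HT) => [[pt _]|[pt _]|[Q [EQ _ _]]].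
  - exact: bigon_quad_shared H1 H ps pt.
  - have H' := quad_refl H.
    rewrite -(Qval_refl sS W H).
    apply: bigon_quad_shared H1 H' _ _ => //.
      apply: perm_trans ps _; exact: perm12.
    apply: perm_trans pt _; exact: perm12.
  - have UT := wf_uniqT W EQ; exfalso.
    by clear -UT ps; perm3 ps; uq.
have [HS1 HT1] := H1; have [HS HT] := H2.
case: (eqv_cons2P HS1 HS) => [[ps _]|[ps _]|[R [ER R1 R2]]].
- exact: shared1 H2 ps.
- by rewrite -(Qval_rot sS W H2); apply: shared1 (quad_rot H2) ps.
have UR := wf_uniqS W ER.
case: (eqv_cons2P HT1 HT) => [[pt _]|[pt _]|[Q [EQ Q1 Q2]]].
- exfalso; clear -UR pt.
  by perm3 pt; uq.
- exfalso; clear -UR pt.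
  by perm3 pt; uq.
have WR := wf_eqv0 W ER EQ.
have sR : (size R < n.-2)%N by move/eqv_size: ER sS => /= ->; clear; lia.
have [V1 V2 _] := wf_quad (wf_bigon (wf_eqv0 W HS1 HT1)) (conj R1 Q1).
have WR' : wf ([:: a'; b'; p] :: [:: c'; d'; r] :: [:: a; b; c] :: R)
    ([:: b'; c'; q] :: [:: d'; a'; o] :: [:: a; b; d] :: Q) [::].
  apply: wf_eqv0 WR _ _; apply: eqv_trans (eqv_swap _ _ _) _;
    by apply: eqv_cons => //; apply: eqv_swap.
have X1 := wf_quad1 WR'; have X2 := wf_quad2 WR'.
rewrite (@Fw_eqv S1 ([:: a'; b'; p] :: [:: c'; d'; r] :: R) T1
   ([:: b'; c'; q] :: [:: d'; a'; o] :: Q) _ [:: (d, c)]) //; last 2 first.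
- by move/eqv_size: R1 sR => /= ->; clear; lia.
- exact: wf_bigon (wf_eqv0 W HS1 HT1).
rewrite Fw_quad //; last exact: wf_bigon WR.
rewrite /Qval !(@Fw_eqv S2 ([:: a; b; c] :: R) T2 ([:: a; b; d] :: Q) _ _ _ _ R2 Q2 (perm_refl _)) //; first last.
- exact: wf_quad1 (wf_eqv0 W HS HT).
- by move/eqv_size: R2 sR => /= ->; clear; lia.
- exact: wf_quad2 (wf_eqv0 W HS HT).
- by move/eqv_size: R2 sR => /= ->; clear; lia.
have sR1 : (size R < n.-1)%N by move: sR; clear; lia.
have sR0 : (size R < n)%N by move: sR; clear; lia.
rewrite !Fw_bigon // -mulrDr; congr (_ * (_ + _)); apply: Fw_eqv => //.
- by apply/permPl; apply: (perm_catC [:: (q, p); (o, r)] [:: (d, c)]).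
- by apply/permPl; apply: (perm_catC [:: (q, r); (o, p)] [:: (d, c)]).
Qed.

(** In a net without bigons two stars share at most one name. *)
Lemma bigon_free2 S T s t S1 T1 x y : wf S T [::] -> bigon_free S T ->
  S ≡ s :: S1 -> T ≡ t :: T1 -> x \in s -> y \in s -> x \in t -> y \in t -> x = y.
Proof.
move=> W nb HS HT xs ys xt yt; apply/eqP/negP => /negP xy.
have [_ cS cT] := wf_eqv0 W HS HT.
have two v : size v == 3 -> x \in v -> y \in v -> exists c, perm_eq v [:: x; y; c].
  move=> sv xv yv; have yv' : y \in rem x v.
    have := yv; rewrite (perm_mem (perm_to_rem xv)) inE eq_sym (negbTE xy) //.
  have E := perm_to_rem xv; have E' := perm_to_rem yv'.
  have := perm_size E; have := perm_size E'; rewrite (eqP sv) /=.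
  case R : (rem y (rem x v)) => [|c [|]] //= s1; rewrite ?s1 // => _.
  exists c; apply: perm_trans E _; rewrite perm_cons.
  by apply: perm_trans E' _; rewrite perm_cons R.
have /andP[ss _] := cS; have /andP[st _] := cT.
have [c Ec] := two s ss xs ys; have [d Ed] := two t st xt yt.
apply: (nb x y c d S1 T1); split.
  by apply: eqv_trans HS _; apply: eqv_cons.
by apply: eqv_trans HT _; apply: eqv_cons.
Qed.

Lemma wf_in S T w a b v : wf S ((b :: v) :: T) ((a, b) :: w) ->
  wf S ((a :: v) :: T) w.
Proof.
case=> L cS cT; split=> // x; have := L b; have := L x.
rewrite /outn /inn /= eqxx; case: (eqVneq b x) => [<-|bx]; glia.
Qed.

Lemma wf_out S T w a b v : wf ((a :: v) :: S) T ((a, b) :: w) ->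
  wf ((b :: v) :: S) T w.
Proof.
case=> L cS cT; split=> // x; have := L a; have := L x.
rewrite /outn /inn /= eqxx; case: (eqVneq a x) => [<-|bx]; glia.
Qed.

Lemma eqv_hd v v' S : perm_eq v v' -> v :: S ≡ v' :: S.
Proof. by move=> E; apply: eqv_cons. Qed.

Lemma quad_edge1 p q r o d' r' o' S T : (size S < n.-2)%N ->
  wf ([:: q; d'; r'] :: S) ([:: d'; p; o'] :: T) [:: (q, p); (o, r)] ->
  Fw ([:: q; d'; r'] :: S) ([:: d'; p; o'] :: T) [:: (q, p); (o, r)] =
  bg * Fw S T [:: (o', r'); (o, r)].
Proof.
move=> sS W.
have s0 : (size S < n.-1)%N by move: sS; clear; lia.
have s1 : (size ([:: p; d'; r'] :: S) < n)%N by move: sS; clear => /=; lia.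
have W1 := wf_out W.
have E : [:: d'; p; o'] :: T ≡ [:: p; d'; o'] :: T by apply: eqv_hd; exact: perm12.
rewrite Fw_out // (Fw_eqv s1 W1 (eqv_refl _) E (perm_refl _)) Fw_bigon //.
exact: wf_eqv0 W1 (eqv_refl _) E.
Qed.

Lemma quad_edge2 p q r o d' r' o' S T : (size S < n.-2)%N ->
  wf ([:: q; d'; r'] :: S) ([:: d'; p; o'] :: T) [:: (q, r); (o, p)] ->
  wf ([:: r; d'; r'] :: S) ([:: o; d'; o'] :: T) [::] /\
  Fw ([:: q; d'; r'] :: S) ([:: d'; p; o'] :: T) [:: (q, r); (o, p)] =
  Fw ([:: r; d'; r'] :: S) ([:: o; d'; o'] :: T) [::].
Proof.
move=> sS W.
have s0 : (size S < n.-1)%N by move: sS; clear; lia.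
have s1 : (size ([:: r; d'; r'] :: S) < n)%N by move: sS; clear => /=; lia.
have W1 := wf_out W.
have E : [:: d'; p; o'] :: T ≡ [:: p; d'; o'] :: T by apply: eqv_hd; exact: perm12.
have W2 := wf_eqv0 W1 (eqv_refl _) E; split; first exact: wf_in W2.
by rewrite Fw_out // (Fw_eqv s1 W1 (eqv_refl _) E (perm_refl _)) Fw_in.
Qed.

(** Two quadrilaterals with exactly one common edge b. One resolution of either of them
    makes the other one a bigon, and reducing it leads to the same net on both sides;
    the two other resolutions differ in the name of one edge. *)
Lemma quad_quad_edge a b c d p q r o d' r' o' S T : (size S < n.-2)%N ->
  wf ([:: a; b; p] :: [:: c; d; r] :: [:: q; d'; r'] :: S)
     ([:: b; c; q] :: [:: d; a; o] :: [:: d'; p; o'] :: T) [::] ->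
  Qval ([:: q; d'; r'] :: S) ([:: d'; p; o'] :: T) p q r o =
  Qval ([:: c; d; r] :: S) ([:: d; a; o] :: T) a c r' o'.
Proof.
move=> sS W.
have W' : wf ([:: p; b; a] :: [:: q; d'; r'] :: [:: c; d; r] :: S)
     ([:: b; q; c] :: [:: d'; p; o'] :: [:: d; a; o] :: T) [::].
  apply: wf_eqv0 W _ _.
    apply: (eqv_trans _ (eqv_cons (perm_refl _) (eqv_swap _ _ _))).
    by apply: eqv_hd; pm.
  apply: (eqv_trans _ (eqv_cons (perm_refl _) (eqv_swap _ _ _))).
  by apply: eqv_hd; pm.
have X1 := wf_quad1 W; have X2 := wf_quad2 W.
have X1' := wf_quad1 W'; have X2' := wf_quad2 W'.
have [Y1 E1] := quad_edge2 sS X2; have [Y2 E2] := quad_edge2 sS X2'.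
have s0 : (size S < n)%N by move: sS; clear; lia.
have s1 : (size S < n.-1)%N by move: sS; clear; lia.
rewrite /Qval !quad_edge1 // E1 E2; congr (_ * _ + _).
  apply: Fw_eqv => //; last by pm.
  have E : [:: d'; p; o'] :: T ≡ [:: p; d'; o'] :: T by apply: eqv_hd; exact: perm12.
  exact: wf_bigon (wf_eqv0 (wf_out X1) (eqv_refl _) E).
have dd : d' != d by apply/eqP=> E; have [L _ _] := W; have := L d; rewrite E /outn /inn /= eqxx; glia.
have dn : (outn d ([:: r; d'; r'] :: S) [::] = 0)%N.
  case: W => L _ _; have := L d.
  have rd : r != d by apply/eqP=> E; have := L d; rewrite E /outn /inn /= eqxx; glia.
  by rewrite /outn /inn /= eqxx (negbTE dd) (negbTE rd); glia.
have inj : injon (ren1 d' d) ([:: r; d'; r'] :: S) [::].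
  move=> x y Hx Hy; rewrite /ren1.
  case: (eqVneq x d') => [xd|xd]; case: (eqVneq y d') => [yd|yd] E.
  - by rewrite xd yd.
  - by move: Hy; rewrite -E dn.
  - by move: Hx; rewrite E dn.
  - by [].
have R0 : [/\ (r == d') = false, (r' == d') = false, (o == d') = false & (o' == d') = false].
  by split; apply/negP=> /eqP E; have [L _ _] := Y1; have := L d'; rewrite E /outn /inn /= ?eqxx; glia.
case: R0 => R1 R2 R3 R4.
have O : (occ d' S = 0 /\ occ d' T = 0)%N.
  by have [L _ _] := Y1; have := L d'; rewrite /outn /inn /= eqxx; glia.
have s2 : (size ([:: r; d'; r'] :: S) < n)%N by move: sS; clear => /=; lia.
rewrite -(Fw_ren s2 Y1 inj) /= /ren1 R1 R2 R3 R4 eqxx -/(ren1 d' d) !ren1_id0; try by case: O.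
apply: esym; apply: Fw_eqv => //; apply: eqv_hd; pm.
Qed.

(** Two quadrilaterals with three common vertices, two of them sinks: each of the four
    resolutions leaves the same source in the place of the three. *)
Lemma quad_quad_sinks c d p q r o r' S T : (size S < n.-2)%N ->
  wf ([:: q; o; r'] :: S) T [:: (q, p); (o, r)] ->
  wf ([:: c; d; r] :: S) T [:: (c, p); (d, r')] ->
  wf ([:: q; o; r'] :: S) T [:: (q, r); (o, p)] ->
  wf ([:: c; d; r] :: S) T [:: (c, r'); (d, p)] ->
  Qval ([:: q; o; r'] :: S) T p q r o = Qval ([:: c; d; r] :: S) T p c r' d.
Proof.
have half x y z u v S1 : (size S1 < n.-2)%N -> wf ([:: x; y; z] :: S1) T [:: (x, u); (y, v)] ->
    wf ([:: u; v; z] :: S1) T [::] /\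
    Fw ([:: x; y; z] :: S1) T [:: (x, u); (y, v)] = Fw ([:: u; v; z] :: S1) T [::].
  move=> sS W; have s1 : (size S1 < n.-1)%N by move: sS; clear; lia.
  have s0 : (size ([:: u; y; z] :: S1) < n)%N by move: sS; clear => /=; lia.
  have E : [:: u; y; z] :: S1 ≡ [:: y; u; z] :: S1 by apply: eqv_hd; pm.
  have E' : [:: v; u; z] :: S1 ≡ [:: u; v; z] :: S1 by apply: eqv_hd; pm.
  have s2 : (size ([:: v; u; z] :: S1) < n)%N by move: sS; clear => /=; lia.
  have W1 := wf_out W; have W2 := wf_eqv0 W1 E (eqv_refl _).
  split; first by apply: wf_eqv0 (wf_out W2) E' (eqv_refl _).
  rewrite Fw_out // (Fw_eqv s0 W1 E (eqv_refl _) (perm_refl _)) Fw_out //.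
  by rewrite (Fw_eqv s2 (wf_out W2) E' (eqv_refl _) (perm_refl _)).
move=> sS W1 W2 W3 W4.
have [X1 E1] := half _ _ _ _ _ _ sS W1; have [X2 E2] := half _ _ _ _ _ _ sS W2.
have [X3 E3] := half _ _ _ _ _ _ sS W3; have [X4 E4] := half _ _ _ _ _ _ sS W4.
have s0 v : (size (v :: S : names) < n)%N by move: sS; clear => /=; lia.
rewrite /Qval E1 E2 E3 E4; congr (_ + _).
  by apply: Fw_eqv => //; apply: eqv_hd; pm.
by apply: Fw_eqv => //; apply: eqv_hd; pm.
Qed.

Lemma quad_quad_sources a d p q r o o' S T : (size S < n)%N ->
  wf S ([:: r; p; o'] :: T) [:: (q, p); (o, r)] ->
  wf S ([:: d; a; o] :: T) [:: (q, a); (o', d)] ->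
  wf S ([:: r; p; o'] :: T) [:: (q, r); (o, p)] ->
  wf S ([:: d; a; o] :: T) [:: (q, d); (o', a)] ->
  Qval S ([:: r; p; o'] :: T) p q r o = Qval S ([:: d; a; o] :: T) a q d o'.
Proof.
have half x y z u v T1 : (size S < n)%N -> wf S ([:: x; y; z] :: T1) [:: (u, x); (v, y)] ->
    wf S ([:: u; v; z] :: T1) [::] /\
    Fw S ([:: x; y; z] :: T1) [:: (u, x); (v, y)] = Fw S ([:: u; v; z] :: T1) [::].
  move=> sS W.
  have E : [:: u; y; z] :: T1 ≡ [:: y; u; z] :: T1 by apply: eqv_hd; pm.
  have E' : [:: v; u; z] :: T1 ≡ [:: u; v; z] :: T1 by apply: eqv_hd; pm.
  have W1 := wf_in W; have W2 := wf_eqv0 W1 (eqv_refl _) E.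
  split; first by apply: wf_eqv0 (wf_in W2) (eqv_refl _) E'.
  rewrite Fw_in // (Fw_eqv sS W1 (eqv_refl _) E (perm_refl _)) Fw_in //.
  by rewrite (Fw_eqv sS (wf_in W2) (eqv_refl _) E' (perm_refl _)).
move=> sS W1 W2 W3 W4.
have half' x y z u v T1 : (size S < n)%N -> wf S ([:: x; y; z] :: T1) [:: (u, y); (v, x)] ->
    wf S ([:: v; u; z] :: T1) [::] /\
    Fw S ([:: x; y; z] :: T1) [:: (u, y); (v, x)] = Fw S ([:: v; u; z] :: T1) [::].
  move=> _ W; have P := perm2 (u, y) (v, x).
  have W' := wf_eqv W (eqv_refl _) (eqv_refl _) P.
  by rewrite (Fw_eqv sS W (eqv_refl _) (eqv_refl _) P); apply: half.
have [X1 E1] := half' _ _ _ _ _ _ sS W1; have [X2 E2] := half' _ _ _ _ _ _ sS W2.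
have [X3 E3] := half _ _ _ _ _ _ sS W3; have [X4 E4] := half _ _ _ _ _ _ sS W4.
rewrite /Qval E1 E2 E3 E4; congr (_ + _).
  by apply: Fw_eqv => //; apply: eqv_hd; pm.
by apply: Fw_eqv => //; apply: eqv_hd; pm.
Qed.

Lemma Qval_eqv S S' T T' p q r o : (size S < n)%N ->
  wf S T [:: (q, p); (o, r)] -> wf S T [:: (q, r); (o, p)] -> S ≡ S' -> T ≡ T' ->
  Qval S T p q r o = Qval S' T' p q r o.
Proof. by move=> sS W1 W2 ES ET; congr (_ + _); apply: Fw_eqv. Qed.

(** A common vertex forces a common edge, since each quadrilateral uses two of its three
    edges. Here the common source has the star a, b, p and b is the common edge. *)
Lemma quad_quad_shared S T a b c d p q r o S1 T1 a' c' d' p' q' r' o' S2 T2 :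
  (size S <= n)%N -> wf S T [::] -> bigon_free S T ->
  quad_at S T a b c d p q r o S1 T1 -> quad_at S T a' b c' d' p' q' r' o' S2 T2 ->
  perm_eq [:: a; b; p] [:: a'; b; p'] ->
  Qval S1 T1 p q r o = Qval S2 T2 p' q' r' o'.
Proof.
move=> sS W nb H H' ps; have [HS HT] := H; have [HS' HT'] := H'.
have [W1 W2 sz] := wf_quad W H; have [W1' W2' sz'] := wf_quad W H'.
have s1 : (size S1 < n)%N by move: sS sz; clear; lia.
have s2 : (size S2 < n)%N by move: sS sz'; clear; lia.
have US := wf_uniqS W HS; have UT := wf_uniqT W HT.
have US' := wf_uniqS W HS'; have UT' := wf_uniqT W HT'.
have ps2 : (a' = a /\ p' = p) \/ (a' = p /\ p' = a).
  clear -ps US; perm3 ps; try uq;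
  by auto.
have HS2 := eqv_trans HS (eqv_swap _ _ _); have HT2 := eqv_trans HT (eqv_swap _ _ _).
(* The remaining edge of a vertex of the quadrilateral does not end at another of its
   vertices, as there would be a bigon. *)
have nq : q \in [:: c; d; r] -> False.
  move=> qs; have cq : c = q.
    by apply: (bigon_free2 W nb HS2 HT) => //; rewrite !inE eqxx ?orbT.
  by subst; uq.
have np : p \in [:: d; a; o] -> False.
  move=> qs; have ap : a = p.
    by apply: (bigon_free2 W nb HS HT2) => //; rewrite !inE eqxx ?orbT.
  by subst; uq.
have nr : r \in [:: d; a; o] -> False.
  move=> qs; have ap : d = r.
    by apply: (bigon_free2 W nb HS2 HT2) => //; rewrite !inE eqxx ?orbT.
  by subst; uq.
have ES : [:: c; d; r] :: S1 ≡ [:: c'; d'; r'] :: S2.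
  rewrite -(eqv_cons_inj _ _ ps); apply: eqv_trans HS'; by rewrite eqv_sym.
have ET0 : [:: b; c; q] :: [:: d; a; o] :: T1 ≡ [:: b; c'; q'] :: [:: d'; a'; o'] :: T2.
  by apply: eqv_trans HT'; rewrite eqv_sym.
case: (eqv_consP ET0) => [[pt ET]|[Q [Q1 Q2]]]; last first.
  have UQ := wf_uniqT W (eqv_trans HT (eqv_cons (perm_refl _) Q1)).
  by exfalso; clear -UQ; uq.
have pt2 : (c' = c /\ q' = q) \/ (c' = q /\ q' = c).
  clear -pt UT; perm3 pt; try uq;
  by auto.
(* Besides b, the second quadrilateral uses either the same edge as the first one, or
   the remaining edge, at either end of b. *)
move: ps2 pt2 => [[? ?]|[? ?]] [[? ?]|[? ?]]; subst a' p' c' q'.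
- case: (eqv_consP ES) => [[p3 E12]|[R [R1 R2]]]; last first.
    have UR := wf_uniqS W (eqv_trans HS (eqv_cons (perm_refl _) (eqv_cons (perm_refl _) R1))).
    by exfalso; clear -UR; uq.
  case: (eqv_consP ET) => [[p4 F12]|[Q [Q1 Q2]]]; last first.
    have UR := wf_uniqT W (eqv_trans HT (eqv_cons (perm_refl _) (eqv_cons (perm_refl _) Q1))).
    by exfalso; clear -UR; uq.
  have [[? [? ?]]|rr] : (d' = d /\ r' = r /\ o' = o) \/ r \in [:: d; a; o].
    have p3' : perm_eq [:: d; r] [:: d'; r'] by rewrite perm_cons in p3.
    have p4' : perm_eq [:: d; o] [:: d'; o'].
      rewrite -(perm_cons a); apply: perm_trans (perm12 _ _ _) _.
      by apply: perm_trans p4 (perm12 _ _ _).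
    case: (perm2P p3') => [[? ?]|[? ?]]; subst d' r'.
      by case: (perm2P p4') => [[_ ->]|[E ->]]; left.
    by case: (perm2P p4') => [[E _]|[E _]]; right; rewrite E !inE eqxx ?orbT.
  + by subst d' r' o'; apply: Qval_eqv.
  + by case: (nr rr).
- case: (eqv_consP ES) => [[p3 E12]|[R [R1 R2]]].
    by case: nq; rewrite (perm_mem p3) !inE eqxx.
  case: (eqv_consP ET) => [[p4 F12]|[Q [Q1 Q2]]]; last first.
    have UR := wf_uniqT W (eqv_trans HT (eqv_cons (perm_refl _) (eqv_cons (perm_refl _) Q1))).
    by exfalso; clear -UR; uq.
  have UR := wf_uniqS W (eqv_trans HS (eqv_cons (perm_refl _) (eqv_cons (perm_refl _) R1))).
  have [? ?] : d' = o /\ o' = d.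
    have p4' : perm_eq [:: d; o] [:: d'; o'].
      rewrite -(perm_cons a); apply: perm_trans (perm12 _ _ _) _.
      by apply: perm_trans p4 (perm12 _ _ _).
    case: (perm2P p4') => [[? ?]|[? ?]] //; subst d' o'.
    by clear -UR; uq.
  subst d' o'.
  rewrite (Qval_eqv s1 W1 W2 R1 (eqv_refl _)).
  have F21 : T2 ≡ T1 by rewrite eqv_sym.
  rewrite (Qval_eqv s2 W1' W2' R2 F21).
  have sR : (size R < n.-2)%N by move/eqv_size: R1 sz sS => /= ->; clear; lia.
  apply: quad_quad_sinks => //.
  + exact: wf_eqv0 W1 R1 (eqv_refl _).
  + exact: wf_eqv0 W1' R2 F21.
  + exact: wf_eqv0 W2 R1 (eqv_refl _).
  + exact: wf_eqv0 W2' R2 F21.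
- case: (eqv_consP ET) => [[p4 F12]|[Q [Q1 Q2]]].
    by case: np; rewrite (perm_mem p4) !inE eqxx ?orbT.
  case: (eqv_consP ES) => [[p3 E12]|[R [R1 R2]]]; last first.
    have UR := wf_uniqS W (eqv_trans HS (eqv_cons (perm_refl _) (eqv_cons (perm_refl _) R1))).
    by exfalso; clear -UR; uq.
  have UR := wf_uniqT W (eqv_trans HT (eqv_cons (perm_refl _) (eqv_cons (perm_refl _) Q1))).
  have [? ?] : d' = r /\ r' = d.
    have p3' : perm_eq [:: d; r] [:: d'; r'] by rewrite perm_cons in p3.
    case: (perm2P p3') => [[? ?]|[? ?]] //; subst d' r'.
    by clear -UR; uq.
  subst d' r'.
  rewrite (Qval_eqv s1 W1 W2 (eqv_refl _) Q1).
  have E21 : S2 ≡ S1 by rewrite eqv_sym.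
  rewrite (Qval_eqv s2 W1' W2' E21 Q2).
  apply: quad_quad_sources => //.
  + exact: wf_eqv0 W1 (eqv_refl _) Q1.
  + exact: wf_eqv0 W1' E21 Q2.
  + exact: wf_eqv0 W2 (eqv_refl _) Q1.
  + exact: wf_eqv0 W2' E21 Q2.
- case: (eqv_consP ES) => [[p3 E12]|[R [R1 R2]]].
    by case: nq; rewrite (perm_mem p3) !inE eqxx.
  case: (eqv_consP ET) => [[p4 F12]|[Q [Q1 Q2]]].
    by case: np; rewrite (perm_mem p4) !inE eqxx ?orbT.
  have sR : (size R < n.-2)%N by move/eqv_size: R1 sz sS => /= ->; clear; lia.
  rewrite (Qval_eqv s1 W1 W2 R1 Q1) (Qval_eqv s2 W1' W2' R2 Q2).
  apply: (@quad_quad_edge a b) => //.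
  apply: wf_eqv0 W _ _.
    by apply: eqv_trans HS _; do 2!apply: eqv_cons => //.
  by apply: eqv_trans HT _; do 2!apply: eqv_cons => //.
Qed.

Lemma quad_quad S T a b c d p q r o S1 T1 a' b' c' d' p' q' r' o' S2 T2 :
  (size S <= n)%N -> wf S T [::] -> bigon_free S T ->
  quad_at S T a b c d p q r o S1 T1 -> quad_at S T a' b' c' d' p' q' r' o' S2 T2 ->
  Qval S1 T1 p q r o = Qval S2 T2 p' q' r' o'.
Proof.
move=> sS W nb H1 H2.
(* With a source in common, the quadrilaterals have an edge in common there; reflections
   bring this edge to the same position in both. *)
have shared x y z t u v w0 w1 x' y' z' t' u' v' w0' w1' :
    quad_at S T x y z t u v w0 w1 S1 T1 ->
    quad_at S T x' y' z' t' u' v' w0' w1' S2 T2 ->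
    perm_eq [:: x; y; u] [:: x'; y'; u'] ->
    Qval S1 T1 u v w0 w1 = Qval S2 T2 u' v' w0' w1'.
  move=> K1 K2 ps.
  have US := wf_uniqS W K1.1.
  have [? | [? | [? | ?]]] : y' = y \/ x' = y \/ y' = x \/ x' = x.
    clear -ps US; perm3 ps; try uq; by auto.
  - by subst y'; apply: quad_quad_shared K1 K2 ps.
  - subst x'; rewrite -(Qval_refl sS W K2); apply: quad_quad_shared K1 (quad_refl K2) _ => //.
    by apply: perm_trans ps (perm12 _ _ _).
  - subst y'; rewrite -(Qval_refl sS W K1); apply: quad_quad_shared (quad_refl K1) K2 _ => //.
    by apply: perm_trans ps; apply: perm12.
  - subst x'; rewrite -(Qval_refl sS W K1) -(Qval_refl sS W K2).
    apply: quad_quad_shared (quad_refl K1) (quad_refl K2) _ => //.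
    apply: perm_trans (perm12 _ _ _).
    by apply: perm_trans ps; apply: perm12.
have [HS HT] := H1; have [HS' HT'] := H2.
case: (eqv_cons2P HS HS') => [[ps _]|[ps _]|[R [ER R1 R2]]].
- exact: shared H1 H2 ps.
- by rewrite -(Qval_rot sS W H2); apply: shared H1 (quad_rot H2) ps.
case: (eqv_cons2P (eqv_refl _) R1) => [[ps _]|[ps _]|[Q [EQ Q1 Q2]]].
- by rewrite -(Qval_rot sS W H1); apply: shared (quad_rot H1) H2 ps.
- rewrite -(Qval_rot sS W H1) -(Qval_rot sS W H2).
  exact: shared (quad_rot H1) (quad_rot H2) ps.
(* From here on no source is common, hence no edge, hence no sink: the two
   resolutions commute. *)
have {EQ}ES := eqv_trans HS (eqv_cons (perm_refl _) EQ).
have {Q2}R2 := eqv_trans R2 (eqv_cons (perm_refl _) Q2).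
have US := wf_uniqS W ES.
case: (eqv_cons2P HT HT') => [[pt _]|[pt _]|[V [EV V1 V2]]].
- by exfalso; clear -US pt; perm3 pt; uq.
- by exfalso; clear -US pt; perm3 pt; uq.
case: (eqv_cons2P (eqv_refl _) V1) => [[pt _]|[pt _]|[P [EP P1 P2]]].
- by exfalso; clear -US pt; perm3 pt; uq.
- by exfalso; clear -US pt; perm3 pt; uq.
have ET := eqv_trans HT (eqv_cons (perm_refl _) EP).
have V3 := eqv_trans V2 (eqv_cons (perm_refl _) P2).
have WW := wf_eqv0 W ES ET.
have sz := eqv_size ES; rewrite /= in sz.
have sQ : (size Q < n.-2)%N by move: sz sS; clear; lia.
have [W1 W2 _] := wf_quad W H1; have [W1' W2' _] := wf_quad W H2.
have s1 : (size S1 < n)%N by move/eqv_size: Q1 sz sS => /= ->; clear; lia.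
have s2 : (size S2 < n)%N by move/eqv_size: R2 sz sS => /= ->; clear; lia.
rewrite (Qval_eqv s1 W1 W2 Q1 P1) (Qval_eqv s2 W1' W2' R2 V3) /Qval.
have X1 := wf_eqv0 W1 Q1 P1; have X2 := wf_eqv0 W2 Q1 P1.
have X1' := wf_eqv0 W1' R2 V3; have X2' := wf_eqv0 W2' R2 V3.
have s0 : (size Q < n)%N by move: sQ; clear; lia.
rewrite !Fw_quad // addrACA.
congr (_ + _ + (_ + _)); apply: Fw_eqv => //; try pm.
- exact: wf_quad1 X1.
- exact: wf_quad1 X2.
- exact: wf_quad2 X1.
- exact: wf_quad2 X2.
Qed.

(** Local confluence: any two first reductions of a net lead to the same value. *)
Lemma confluent_step S T v v' : (size S <= n)%N -> wf S T [::] ->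
  ev S T v -> ev S T v' -> v = v'.
Proof.
move=> sS W.
have evB a b c d S1 T1 u : bigon_at S T a b c d S1 T1 ->
    ev S1 (ren (root [:: (d, c)]) T1) u ->
    bg * (lp ^+ loops [:: (d, c)] * u) = bg * Fw S1 T1 [:: (d, c)].
  move=> [HS HT] E; rewrite /Fw; congr (_ * (_ * _)); apply: esym; apply: F0E E.
    by move/eqv_size: HS sS => /= ->.
  exact: wf_root (wf_bigon (wf_eqv0 W HS HT)).
have evQ a b c d p q r o S1 T1 u1 u2 : quad_at S T a b c d p q r o S1 T1 ->
    ev S1 (ren (root [:: (q, p); (o, r)]) T1) u1 ->
    ev S1 (ren (root [:: (q, r); (o, p)]) T1) u2 ->
    lp ^+ loops [:: (q, p); (o, r)] * u1 + lp ^+ loops [:: (q, r); (o, p)] * u2 =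
    Qval S1 T1 p q r o.
  move=> H E1 E2; have [W1 W2 sz] := wf_quad W H.
  have s1 : (size S1 < n)%N by move: sS sz; clear; lia.
  by rewrite /Qval /Fw; congr (_ * _ + _ * _); apply: esym;
    [apply: F0E E1 => //; apply: wf_root W1 | apply: F0E E2 => //; apply: wf_root W2].
case: (pselect (exists a b c d S1 T1, bigon_at S T a b c d S1 T1)) => [[a [b [c [d [S1 [T1 B]]]]]]|nb].
  have all u : ev S T u -> u = bg * Fw S1 T1 [:: (d, c)].
    move=> E; case: E sS W evB evQ B => {S T u}.
    - by move=> S T bf _ _ _ _ _ /bf.
    - move=> S T a' b' c' d' S' T' u B' E sS W evB evQ B.
      by rewrite (evB _ _ _ _ _ _ _ B' E) (bigon_bigon sS W B' B).
    - move=> S T a' b' c' d' p q r o S' T' u1 u2 B' E1 E2 sS W evB evQ B.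
      by rewrite (evQ _ _ _ _ _ _ _ _ _ _ _ _ B' E1 E2) (bigon_quad sS W B B').
  by move=> /all -> /all ->.
have bf : bigon_free S T.
  by move=> a b c d S1 T1 H; apply: nb; exists a, b, c, d, S1, T1.
move=> E E'; case: E sS W evB evQ bf E' => {S T v nb}.
- move=> S T _ qf sS W _ _ bf E; case: E qf bf => {S T v' sS W} //.
  + by move=> S T a b c d S' T' u B _ _ /(_ _ _ _ _ _ _ B).
  + by move=> S T a b c d p q r o S' T' u1 u2 B _ _ /(_ _ _ _ _ _ _ _ _ _ _ B).
- by move=> S T a b c d S' T' u B _ _ _ _ _ /(_ _ _ _ _ _ _ B).
- move=> S T a b c d p q r o S1 T1 u1 u2 B E1 E2 sS W evB evQ bf E.
  rewrite (evQ _ _ _ _ _ _ _ _ _ _ _ _ B E1 E2).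
  case: E sS W evB evQ bf B => {S T v' E1 E2}.
  + by move=> S T _ /(_ _ _ _ _ _ _ _ _ _ _) qf _ _ _ _ _ /qf.
  + by move=> S T a' b' c' d' S' T' u B' _ _ _ _ _ /(_ _ _ _ _ _ _ B').
  + move=> S T a' b' c' d' p' q' r' o' S' T' v1 v2 B' E1 E2 sS W evB evQ bf B.
    by rewrite (evQ _ _ _ _ _ _ _ _ _ _ _ _ B' E1 E2) (quad_quad sS W bf B B').
Qed.

End Confluence.

Lemma confluent n : confluent_below n.
Proof.
elim: n => [|n IH] S T v v' //; rewrite ltnS => sS W.
exact: confluent_step IH _ _ _ _ sS W.
Qed.

(** * Rules for the value of a net *)

(** Confluence at all sizes removes the bounds from the rules proved above. *)
Lemma F_eqv S S' T T' w w' : wf S T w ->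
  S ≡ S' -> T ≡ T' -> perm_eq w w' -> Fw S T w = Fw S' T' w'.
Proof. exact: (Fw_eqv (confluent (n := (size S).+1))). Qed.

Lemma F_ren r S T w : wf S T w -> injon r S w ->
  Fw (ren r S) (ren r T) (renw r w) = Fw S T w.
Proof. exact: (Fw_ren (confluent (n := (size S).+1))). Qed.

Lemma F_wire S T w a b : wf S T ((a, b) :: w) -> a != b ->
  Fw S T ((a, b) :: w) = Fw S (ren (ren1 b a) T) (refst (ren1 b a) w).
Proof. exact: (Fw_wire (confluent (n := (size S).+1))). Qed.

Lemma F_wire2 S T w a b : wf S T ((a, b) :: w) -> a != b ->
  Fw S T ((a, b) :: w) = Fw (ren (ren1 a b) S) T (resnd (ren1 a b) w).
Proof. exact: (Fw_wire2 (confluent (n := (size S).+1))). Qed.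

Lemma F_in S T w a b v : wf S ((b :: v) :: T) ((a, b) :: w) ->
  Fw S ((b :: v) :: T) ((a, b) :: w) = Fw S ((a :: v) :: T) w.
Proof. exact: (Fw_in (confluent (n := (size S).+1))). Qed.

Lemma F_ww S T w a b c : wf S T ((a, b) :: (b, c) :: w) ->
  Fw S T ((a, b) :: (b, c) :: w) = Fw S T ((a, c) :: w).
Proof. exact: (Fw_ww (confluent (n := (size S).+1))). Qed.

Lemma F_out S T w a b v : wf ((a :: v) :: S) T ((a, b) :: w) ->
  Fw ((a :: v) :: S) T ((a, b) :: w) = Fw ((b :: v) :: S) T w.
Proof. exact: (Fw_out (confluent (n := (size S).+2))). Qed.

Lemma F_bigon a b c d S T w : wf ([:: a; b; c] :: S) ([:: a; b; d] :: T) w ->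
  Fw ([:: a; b; c] :: S) ([:: a; b; d] :: T) w = bg * Fw S T ((d, c) :: w).
Proof. exact: (Fw_bigon (confluent (n := (size S).+2))). Qed.

Lemma F_quad a b c d p q r o S T w :
  wf ([:: a; b; p] :: [:: c; d; r] :: S) ([:: b; c; q] :: [:: d; a; o] :: T) w ->
  Fw ([:: a; b; p] :: [:: c; d; r] :: S) ([:: b; c; q] :: [:: d; a; o] :: T) w =
  Fw S T ((q, p) :: (o, r) :: w) + Fw S T ((q, r) :: (o, p) :: w).
Proof. exact: (Fw_quad (confluent (n := (size S).+3))). Qed.

Lemma F_base S T : wf S T [::] -> bigon_free S T -> quad_free S T ->
  Fw S T [::] = base S T.
Proof.
move=> W bf qf; rewrite Fw_nil; apply: (F0E (confluent (n := (size S).+1))) => //.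
exact: ev_base.
Qed.

Lemma F_root S T w : Fw S T w = lp ^+ loops w * Fw S (ren (root w) T) [::].
Proof. by rewrite Fw_nil. Qed.

(** * Disjoint unions of nets *)

Lemma eqv_catP S1 S2 v S' : S1 ++ S2 ≡ v :: S' ->
  (exists R, S1 ≡ v :: R /\ S' ≡ R ++ S2) \/ (exists R, S2 ≡ v :: R /\ S' ≡ S1 ++ R).
Proof.
move=> E; have : sort leq v \in map (sort leq) (S1 ++ S2).
  by rewrite (perm_mem E) mem_head.
rewrite map_cat mem_cat => /orP[] /perm_sort_in [R ER _]; [left|right]; exists R; split=> //.
  rewrite -(eqv_cons_inj _ _ (perm_refl v)) eqv_sym; apply: eqv_trans E.
  by rewrite -cat_cons eqv_sym; apply: eqv_cat.
rewrite -(eqv_cons_inj _ _ (perm_refl v)) eqv_sym; apply: eqv_trans E.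
rewrite eqv_sym; apply: (@eqv_trans _ (S1 ++ v :: R)); first exact: eqv_cat.
by apply: eqv_perm; rewrite perm_catC /= perm_cons perm_catC.
Qed.

Definition apart S1 S2 : Prop := forall x, occ x S1 = 0%N \/ occ x S2 = 0%N.

Lemma eqv_occ_hd S v R x : S ≡ v :: R -> x \in v -> (0 < occ x S)%N.
Proof. by move=> E xv; rewrite (eqv_occ _ E) /= addn_gt0 cm_gt0 xv. Qed.

(** A bigon or a quadrilateral of a disjoint union lies in one of the two parts, since
    its edges connect its vertices. *)
Lemma bigon_free_cat S1 T1 S2 T2 : apart S1 T2 -> apart S2 T1 ->
  bigon_free S1 T1 -> bigon_free S2 T2 -> bigon_free (S1 ++ S2) (T1 ++ T2).
Proof.
move=> A1 A2 b1 b2 a b c d S' T' [HS HT].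
have aS v : a \in [:: a; b; v] by rewrite mem_head.
case/eqv_catP: HS => -[R [E1 E2]]; case/eqv_catP: HT => -[Q [F1 F2]].
- exact: (b1 a b c d R Q).
- by have := eqv_occ_hd E1 (aS _); have := eqv_occ_hd F1 (aS _); case: (A1 a) => ->.
- by have := eqv_occ_hd E1 (aS _); have := eqv_occ_hd F1 (aS _); case: (A2 a) => ->.
- exact: (b2 a b c d R Q).
Qed.

Lemma quad_free_cat S1 T1 S2 T2 : apart S1 T2 -> apart S2 T1 ->
  quad_free S1 T1 -> quad_free S2 T2 -> quad_free (S1 ++ S2) (T1 ++ T2).
Proof.
move=> A1 A2 b1 b2 a b c d p q r o S' T' [HS HT].
have side1 v t R R' x : S1 ≡ v :: R -> T2 ≡ t :: R' -> x \in v -> x \in t -> False.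
  by move=> E F xv xt; have := eqv_occ_hd E xv; have := eqv_occ_hd F xt; case: (A1 x) => ->.
have side2 v t R R' x : S2 ≡ v :: R -> T1 ≡ t :: R' -> x \in v -> x \in t -> False.
  by move=> E F xv xt; have := eqv_occ_hd E xv; have := eqv_occ_hd F xt; case: (A2 x) => ->.
have HS2 := eqv_trans HS (eqv_swap _ _ _); have HT2 := eqv_trans HT (eqv_swap _ _ _).
case/eqv_catP: HS => -[R [E1 E2]].
  case/eqv_catP: HT => -[Q [F1 F2]]; last first.
    by apply: (side1 _ _ _ _ b E1 F1); rewrite !inE eqxx ?orbT.
  case/eqv_catP: HT2 => -[Q' [F1' F2']]; last first.
    by apply: (side1 _ _ _ _ a E1 F1'); rewrite !inE eqxx ?orbT.
  case/eqv_catP: HS2 => -[R' [E1' E2']]; last first.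
    by apply: (side2 _ _ _ _ c E1' F1); rewrite !inE eqxx ?orbT.
  move: E2; rewrite eqv_sym => /eqv_catP[] [R2 [G1 _]]; last first.
    by apply: (side2 _ _ _ _ c G1 F1); rewrite !inE eqxx ?orbT.
  move: F2; rewrite eqv_sym => /eqv_catP[] [Q2 [K1 _]]; last first.
    by apply: (side1 _ _ _ _ a E1 K1); rewrite !inE eqxx ?orbT.
  apply: (b1 a b c d p q r o R2 Q2); split.
    by apply: eqv_trans E1 _; apply: eqv_cons.
  by apply: eqv_trans F1 _; apply: eqv_cons.
case/eqv_catP: HT => -[Q [F1 F2]].
  by apply: (side2 _ _ _ _ b E1 F1); rewrite !inE eqxx ?orbT.
case/eqv_catP: HT2 => -[Q' [F1' F2']].
  by apply: (side2 _ _ _ _ a E1 F1'); rewrite !inE eqxx ?orbT.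
case/eqv_catP: HS2 => -[R' [E1' E2']].
  by apply: (side1 _ _ _ _ c E1' F1); rewrite !inE eqxx ?orbT.
move: E2; rewrite eqv_sym => /eqv_catP[] [R2 [G1 _]].
  by apply: (side1 _ _ _ _ c G1 F1); rewrite !inE eqxx ?orbT.
move: F2; rewrite eqv_sym => /eqv_catP[] [Q2 [K1 _]].
  by apply: (side2 _ _ _ _ a E1 K1); rewrite !inE eqxx ?orbT.
apply: (b2 a b c d p q r o R2 Q2); split.
  by apply: eqv_trans E1 _; apply: eqv_cons.
by apply: eqv_trans F1 _; apply: eqv_cons.
Qed.

Hypothesis base_cat : forall S1 T1 S2 T2,
  wf S1 T1 [::] -> wf S2 T2 [::] -> apart S1 S2 ->
  base (S1 ++ S2) (T1 ++ T2) = base S1 T1 * base S2 T2.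

Lemma apart_sym S1 S2 : apart S1 S2 -> apart S2 S1.
Proof. by move=> A x; case: (A x); auto. Qed.

Lemma wf_cat S1 T1 S2 T2 w : wf S1 T1 w -> wf S2 T2 [::] ->
  (forall x, outn x S1 w = 0%N \/ occ x S2 = 0%N) ->
  wf (S1 ++ S2) (T1 ++ T2) w.
Proof.
case=> L1 cS1 cT1 [L2 cS2 cT2] A; split; rewrite /cubic ?all_cat.
- move=> x; have := L1 x; have := L2 x; have := A x.
  by rewrite /inn /outn !occ_cat /=; lia.
- by apply/andP.
- by apply/andP.
Qed.

Lemma F_cat_root S1 T1 S2 T2 w : wf S1 T1 w -> wf S2 T2 [::] ->
  (forall x, outn x S1 w = 0%N \/ occ x S2 = 0%N) ->
  Fw (S1 ++ S2) (ren (root w) T1 ++ T2) [::] =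
    Fw S1 (ren (root w) T1) [::] * Fw S2 T2 [::] ->
  Fw (S1 ++ S2) (T1 ++ T2) w = Fw S1 T1 w * Fw S2 T2 [::].
Proof.
move=> W1 [L2 _ _] A E; rewrite F_root (F_root _ _ w) -mulrA -E; congr (_ * Fw _ _ _).
rewrite /ren map_cat -/(ren _ T2) ren_id // => x x0; apply: root_id.
case: (A x); rewrite /outn; first lia.
by have := L2 x; rewrite /outn /inn /=; lia.
Qed.

(** Induction on the first net.  A reduction of it is a reduction of the union, which
    leaves the case in which the first net is reduced. *)
Lemma F_cat1 n S1 T1 S2 T2 : (size S1 < n)%N ->
  wf S1 T1 [::] -> wf S2 T2 [::] -> apart S1 S2 ->
  (forall S T, wf S T [::] -> apart S S2 -> bigon_free S T -> quad_free S T ->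
     Fw (S ++ S2) (T ++ T2) [::] = Fw S T [::] * Fw S2 T2 [::]) ->
  Fw (S1 ++ S2) (T1 ++ T2) [::] = Fw S1 T1 [::] * Fw S2 T2 [::].
Proof.
elim: n S1 T1 => // n IH S1 T1 s1 W1 W2 A H.
have WC : wf (S1 ++ S2) (T1 ++ T2) [::].
  by apply: wf_cat => // x; rewrite /outn /= addn0.
have sub S' w : (forall x, outn x S' w <= occ x S1)%N ->
    (forall x, outn x S' w = 0%N \/ occ x S2 = 0%N) /\ apart S' S2.
  move=> le; split=> x; case: (A x) => E; auto; left; have := le x;
    rewrite /outn; lia.
case: (pselect (exists a b c d S' T', bigon_at S1 T1 a b c d S' T')) => [[a [b [c [d [S' [T' B]]]]]]|nb].
  have [HS HT] := B.
  have W' := wf_bigon (wf_eqv0 W1 HS HT).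
  have [A1 A2] : (forall x, outn x S' [:: (d, c)] = 0%N \/ occ x S2 = 0%N) /\ apart S' S2.
    by apply: sub => x; rewrite (eqv_occ _ HS) /outn /=; clear; glia.
  rewrite (F_eqv WC (eqv_cat HS (eqv_refl S2)) (eqv_cat HT (eqv_refl T2)) (perm_refl _)).
  rewrite (F_eqv W1 HS HT (perm_refl _)) !F_bigon; first last.
  - exact: wf_eqv0 W1 HS HT.
  - exact: wf_eqv0 WC (eqv_cat HS (eqv_refl S2)) (eqv_cat HT (eqv_refl T2)).
  rewrite -mulrA (F_cat_root W' W2 A1) //; apply: IH => //.
    by move/eqv_size: HS s1 => /= ->; clear; lia.
  exact: wf_root.
case: (pselect (exists a b c d p q r o S' T', quad_at S1 T1 a b c d p q r o S' T')) => [[a [b [c [d [p [q [r [o [S' [T' B]]]]]]]]]]|nq].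
  have [W1' W2' sz] := wf_quad W1 B; have [HS HT] := B.
  have [A1 A2] : (forall x, outn x S' [:: (q, p); (o, r)] = 0%N \/ occ x S2 = 0%N) /\ apart S' S2.
    by apply: sub => x; rewrite (eqv_occ _ HS) /outn /=; clear; glia.
  have [A3 _] : (forall x, outn x S' [:: (q, r); (o, p)] = 0%N \/ occ x S2 = 0%N) /\ apart S' S2.
    by apply: sub => x; rewrite (eqv_occ _ HS) /outn /=; clear; glia.
  rewrite (F_eqv WC (eqv_cat HS (eqv_refl S2)) (eqv_cat HT (eqv_refl T2)) (perm_refl _)).
  rewrite (F_eqv W1 HS HT (perm_refl _)) !F_quad; first last.
  - exact: wf_eqv0 W1 HS HT.
  - exact: wf_eqv0 WC (eqv_cat HS (eqv_refl S2)) (eqv_cat HT (eqv_refl T2)).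
  have s' : (size S' < n)%N by move: sz s1; clear; lia.
  rewrite mulrDl (F_cat_root W1' W2 A1) ?(F_cat_root W2' W2 A3) //; apply: IH => //;
    exact: wf_root.
apply: H => //.
  by move=> a b c d S' T' B; apply: nb; exists a, b, c, d, S', T'.
by move=> a b c d p q r o S' T' B; apply: nq; exists a, b, c, d, p, q, r, o, S', T'.
Qed.

(** The induction is run on both nets in turn, so that only the product of two reduced
    nets remains, which is the hypothesis on [base]. *)
Lemma F_cat S1 T1 S2 T2 : wf S1 T1 [::] -> wf S2 T2 [::] -> apart S1 S2 ->
  Fw (S1 ++ S2) (T1 ++ T2) [::] = Fw S1 T1 [::] * Fw S2 T2 [::].
Proof.
move=> W1 W2 A; apply: (F_cat1 (ltnSn _) W1 W2 A) => {W1 A} S T W A bf qf.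
have WC S' T' : wf S' T' [::] -> apart S S' -> wf (S ++ S') (T ++ T') [::].
  by move=> W' A'; apply: wf_cat => // x; rewrite /outn /= addn0.
have AT S' T' : wf S' T' [::] -> apart S S' -> apart S T' /\ apart S' T.
  move=> [L' _ _] A'; have [L _ _] := W.
  by split=> x; have := L' x; have := L x; rewrite /outn /inn /=; case: (A' x); lia.
have swap S' T' : wf S' T' [::] -> apart S S' ->
    Fw (S ++ S') (T ++ T') [::] = Fw (S' ++ S) (T' ++ T) [::].
  by move=> W' A'; apply: F_eqv (WC _ _ W' A') _ _ _ => //; apply: eqv_perm;
    apply/permPl; apply: perm_catC.
rewrite swap // mulrC; apply: (F_cat1 (ltnSn _) W2 W (apart_sym A)) => S' T' W' A' bf' qf'.
have A'' := apart_sym A'; have [A1 A2] := AT _ _ W' A''.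
rewrite -swap // mulrC !F_base ?base_cat //; first exact: WC.
- exact: bigon_free_cat.
- exact: quad_free_cat.
Qed.

End Evaluation.

(** * Webs and nets *)

(** The stars of the vertices in sV, formed with the edges in sE. *)
Definition stars (V E : eqType) (h : E -> V) (sV : seq V) (sE : seq E) (nu : E -> nat) : names :=
  [seq [seq nu e | e <- sE & h e == p] | p <- sV].

Definition srcs (G : web) (nu : edge G -> nat) : names :=
  stars (@org G) (enum (src G)) (enum (edge G)) nu.

Definition snks (G : web) (nu : edge G -> nat) : names :=
  stars (@dst G) (enum (snk G)) (enum (edge G)) nu.

Lemma eqv_map (X : eqType) (f g : X -> seq nat) (s : seq X) :
  (forall x, x \in s -> perm_eq (f x) (g x)) -> map f s ≡ map g s.
Proof.
elim: s => // x s IH H /=; apply: eqv_cons; first by apply: H; rewrite mem_head.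
by apply: IH => y ys; apply: H; rewrite inE ys orbT.
Qed.

Lemma stars_perm (V E : eqType) (h : E -> V) sV sV' sE sE' nu :
  perm_eq sV sV' -> perm_eq sE sE' -> stars h sV sE nu ≡ stars h sV' sE' nu.
Proof.
move=> pV pE; apply: (@eqv_trans _ (stars h sV sE' nu)).
  by apply: eqv_map => p _; apply: perm_map; apply: perm_filter.
by apply: eqv_perm; apply: perm_map.
Qed.

Lemma occ_stars (V : finType) (E : eqType) (h : E -> V) sE nu x :
  occ x (stars h (enum V) sE nu) = count (fun e => nu e == x) sE.
Proof.
rewrite occE count_flatten sumnE /stars -map_comp big_map.
transitivity (\sum_(p <- enum V) \sum_(e <- sE | (nu e == x) && (h e == p)) 1).
  apply: eq_bigr => p _ /=; rewrite count_map -sum1_count big_filter_cond.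
  by apply: eq_bigl => e; rewrite andbC.
by rewrite big_enum -sum1_count; apply: esym; apply: partition_big.
Qed.

Lemma size_star (V E : finType) (h : E -> V) p :
  size [seq e <- enum E | h e == p] = #|[set e | h e == p]|.
Proof. by rewrite cardsE cardE enumT /enum_mem; congr size; apply: eq_filter. Qed.

Lemma count_inj (E : finType) (nu : E -> nat) x : injective nu ->
  count (fun e => nu e == x) (enum E) = [exists e, nu e == x] :> nat.
Proof.
move=> inj; case: (boolP [exists e, nu e == x]) => [/existsP[e /eqP <-]|/existsPn H].
  rewrite (@eq_count _ _ (pred1 e)) ?count_uniq_mem ?enum_uniq ?mem_enum //.
  by move=> e' /=; rewrite (inj_eq inj).
by apply/eqP; rewrite -leqn0 leqNgt -has_count; apply/hasPn => e _; apply: H.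
Qed.

Lemma occ_srcs G nu x : injective nu -> occ x (@srcs G nu) = [exists e, nu e == x].
Proof. by move=> inj; rewrite occ_stars count_inj. Qed.

Lemma occ_snks G nu x : injective nu -> occ x (@snks G nu) = [exists e, nu e == x].
Proof. by move=> inj; rewrite occ_stars count_inj. Qed.

Lemma linear_web G nu : injective nu -> linear (@srcs G nu) (@snks G nu) [::].
Proof.
by move=> inj x; rewrite /outn /inn /= !addn0 occ_srcs // occ_snks //; case: [exists _, _].
Qed.

Lemma cubic_stars (V E : finType) (h : E -> V) nu :
  cubic (stars h (enum V) (enum E) nu) = [forall p, #|[set e | h e == p]| == 3].
Proof.
rewrite /cubic all_map; apply/allP/forallP => H p; have := H p.
  by rewrite mem_enum /= size_map size_star; apply.
by rewrite /= size_map size_star.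
Qed.

Lemma trivalentE G nu : trivalent G = cubic (@srcs G nu) && cubic (@snks G nu).
Proof. by rewrite !cubic_stars. Qed.

Lemma wf_web G nu : injective nu -> trivalent G -> wf (@srcs G nu) (@snks G nu) [::].
Proof.
by move=> inj; rewrite (trivalentE nu) => /andP[? ?]; split=> //; apply: linear_web.
Qed.

(** The net (S, T) describes the edges of G, named by nu, at each vertex.  Circles
    are not described. *)
Definition presents (G : web) (nu : edge G -> nat) (S T : names) : Prop :=
  [/\ injective nu, S ≡ srcs nu & T ≡ snks nu].

Lemma presents_wf G nu S T : @presents G nu S T -> trivalent G -> wf S T [::].
Proof.
by case=> inj ES ET tG; apply: wf_eqv0 (wf_web inj tG) _ _; rewrite eqv_sym.
Qed.

Lemma presents_trivalent G nu S T : @presents G nu S T -> cubic S -> cubic T -> trivalent G.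
Proof.
by case=> inj ES ET; rewrite (eqv_cubic ES) (eqv_cubic ET) (trivalentE nu) => -> ->.
Qed.

Lemma presents_eqv G nu S T S' T' : S ≡ S' -> T ≡ T' ->
  @presents G nu S T -> presents nu S' T'.
Proof.
move=> ES ET [inj HS HT]; split=> //; [apply: eqv_trans HS|apply: eqv_trans HT]; by rewrite eqv_sym.
Qed.

Lemma stars_ren (V E : finType) (h : E -> V) nu r :
  ren r (stars h (enum V) (enum E) nu) = stars h (enum V) (enum E) (r \o nu).
Proof. by rewrite /ren /stars -map_comp; apply: eq_map => p /=; rewrite -map_comp. Qed.

Lemma presents_names G nu S T : @presents G nu S T ->
  forall x, (0 < occ x S) = [exists e, nu e == x].
Proof. by case=> inj ES _ x; rewrite (eqv_occ _ ES) occ_srcs // lt0b. Qed.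

Lemma presents_ren r G nu S T : @presents G nu S T -> injon r S [::] ->
  presents (r \o nu) (ren r S) (ren r T).
Proof.
move=> P inj; have H := presents_names P; case: P => nuI ES ET; split.
- move=> e e' /= E; apply: nuI; apply: inj E; rewrite /outn addn0 H; apply/existsP.
    by exists e.
  by exists e'.
- by rewrite /srcs -stars_ren; apply: eqv_ren.
- by rewrite /snks -stars_ren; apply: eqv_ren.
Qed.

Lemma mem_star (V E : finType) (h : E -> V) (nu : E -> nat) p x :
  (x \in [seq nu e | e <- enum E & h e == p]) = [exists e, (h e == p) && (nu e == x)].
Proof.
apply/mapP/existsP => [[e]|[e /andP[ep /eqP <-]]].
  by rewrite mem_filter => /andP[ep _] ->; exists e; rewrite ep eqxx.
by exists e => //; rewrite mem_filter ep mem_enum.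
Qed.

(** * Webs and their presentations *)

(** An isolated vertex has an empty star, so that vertices are recovered from a net
    only if each has an edge. *)
Definition full (G : web) : Prop :=
  (forall p : src G, exists e, org e = p) /\ (forall q : snk G, exists e, dst e = q).

Lemma trivalent_full G : trivalent G -> full G.
Proof.
case/andP=> /forallP H1 /forallP H2; split=> p; apply: contrapT => nex.
  have := H1 p; rewrite (eq_card0 (A := [set e | org e == p])) // => e.
  by rewrite inE; apply/negP=> /eqP E; apply: nex; exists e.
have := H2 p; rewrite (eq_card0 (A := [set e | dst e == p])) // => e.
by rewrite inE; apply/negP=> /eqP E; apply: nex; exists e.
Qed.

Lemma stars_match (V W E F : finType) (h : E -> V) (g : F -> W) nu mu :
  stars h (enum V) (enum E) nu ≡ stars g (enum W) (enum F) mu ->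
  forall p, exists q, perm_eq [seq nu e | e <- enum E & h e == p] [seq mu e | e <- enum F & g e == q].
Proof.
move=> /perm_mem H p; have := H (sort leq [seq nu e | e <- enum E & h e == p]).
rewrite map_f; last by apply: map_f; rewrite mem_enum.
move/esym/mapP=> [u /mapP[q _ ->] /eqP]; rewrite sort_perm => pq.
by exists q.
Qed.

Lemma stars_bij (V W E F : finType) (h : E -> V) (g : F -> W) nu mu
    (k : E -> F) (k' : F -> E) :
  injective nu -> injective mu -> (forall e, mu (k e) = nu e) -> (forall e, nu (k' e) = mu e) ->
  (forall p, exists e, h e = p) -> (forall p, exists e, g e = p) ->
  stars h (enum V) (enum E) nu ≡ stars g (enum W) (enum F) mu ->
  exists i : V -> W, bijective i /\ forall e, g (k e) = i (h e).
Proof.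
move=> nuI muI kE k'E hs gs ES.
have kK : cancel k k' by move=> e; apply: nuI; rewrite k'E kE.
have k'K : cancel k' k by move=> e; apply: muI; rewrite kE k'E.
have [i iE] := choice (stars_match ES).
have ES' := ES; rewrite eqv_sym in ES'; have [i' i'E] := choice (stars_match ES').
have Ei e : g (k e) = i (h e).
  have : nu e \in [seq mu e' | e' <- enum F & g e' == i (h e)].
    by rewrite -(perm_mem (iE _)) mem_star; apply/existsP; exists e; rewrite !eqxx.
  by rewrite mem_star => /existsP[e' /andP[/eqP <- /eqP]]; rewrite -kE => /muI ->.
have Ei' e : h (k' e) = i' (g e).
  have : mu e \in [seq nu e' | e' <- enum E & h e' == i' (g e)].
    by rewrite -(perm_mem (i'E _)) mem_star; apply/existsP; exists e; rewrite !eqxx.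
  by rewrite mem_star => /existsP[e' /andP[/eqP <- /eqP]]; rewrite -k'E => /nuI ->.
exists i; split=> //; exists i' => p.
  by have [e <-] := hs p; rewrite -Ei -Ei' kK.
by have [e <-] := gs p; rewrite -Ei' -Ei k'K.
Qed.

(** A net determines the web: equal names match the edges, and the stars match their
    ends. *)
Lemma presents_iso G H nu mu S T : full G -> full H ->
  @presents G nu S T -> @presents H mu S T -> ncirc G = ncirc H ->
  exists i j k, @is_iso G H i j k /\ forall e, mu (k e) = nu e.
Proof.
move=> [oG dG] [oH dH] P Q nc.
have HP := presents_names P; have HQ := presents_names Q.
case: P => nuI ES ET; case: Q => muI ES' ET'.
have /choice[k kE] e : exists e', mu e' = nu e.
  have : 0 < occ (nu e) S by rewrite HP; apply/existsP; exists e.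
  by rewrite HQ => /existsP[e' /eqP]; exists e'.
have /choice[k' k'E] e : exists e', nu e' = mu e.
  have : 0 < occ (mu e) S by rewrite HQ; apply/existsP; exists e.
  by rewrite HP => /existsP[e' /eqP]; exists e'.
have ESS : srcs nu ≡ srcs mu by apply: eqv_trans ES'; rewrite eqv_sym.
have ETT : snks nu ≡ snks mu by apply: eqv_trans ET'; rewrite eqv_sym.
have [i [bi iE]] := stars_bij nuI muI kE k'E oG oH ESS.
have [j [bj jE]] := stars_bij nuI muI kE k'E dG dH ETT.
exists i, j, k; split=> //; split=> //; split=> //.
exists k' => e; first by apply: nuI; rewrite k'E kE.
by apply: muI; rewrite kE k'E.
Qed.

Lemma stars_net (R : names) (N : nat) (nu : 'I_N -> nat) (h : 'I_N -> 'I_(size R)) :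
  injective nu -> uniq (flatten R) -> (forall x, x \in flatten R -> exists e, nu e = x) ->
  (forall e, nu e \in nth [::] R (h e)) ->
  R ≡ stars h (enum 'I_(size R)) (enum 'I_N) nu.
Proof.
move=> nuI uR sR hE.
have RE : R = [seq nth [::] R (val p) | p <- enum 'I_(size R)].
  by rewrite (map_comp (nth [::] R) val) val_enum_ord map_nth_iota0 // take_size.
have mem_fl (Q : names) i x : i < size Q -> x \in nth [::] Q i -> x \in flatten Q.
  by move=> iQ xi; apply/flattenP; exists (nth [::] Q i) => //; apply: mem_nth.
have uniqR (Q : names) i j x : uniq (flatten Q) -> i < size Q -> j < size Q ->
    x \in nth [::] Q i -> x \in nth [::] Q j -> i = j.
  elim: Q i j => //= v Q IH [|i] [|j] //=;
    rewrite cat_uniq => /and3P[_ /hasPn dj uQ] iR jR xi xj.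
  - by have := dj x (mem_fl _ _ _ jR xj); rewrite /= xi.
  - by have := dj x (mem_fl _ _ _ iR xi); rewrite /= xj.
  - by congr _.+1; apply: IH.
have uniqn (Q : names) i : uniq (flatten Q) -> uniq (nth [::] Q i).
  elim: Q i => [|v Q IH] [|i] //=; rewrite cat_uniq => /and3P[] // _ _.
  exact: IH.
rewrite {1}RE; apply: eqv_map => p _; apply: uniq_perm.
- exact: uniqn.
- by rewrite map_inj_uniq // filter_uniq // enum_uniq.
move=> x; rewrite mem_star; apply/idP/existsP => [xp|[e /andP[/eqP <- /eqP <-]]]; last exact: hE.
have [e ex] := sR x (mem_fl _ _ _ (ltn_ord p) xp).
exists e; rewrite ex eqxx andbT; apply/eqP/val_inj.
apply: (uniqR R _ _ x uR (ltn_ord _) (ltn_ord _) _ xp).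
by rewrite -ex.
Qed.

(** Number the names and take the positions in the two lists as vertices. *)
Lemma net_web S T n : wf S T [::] -> exists G nu, @presents G nu S T /\ ncirc G = n.
Proof.
move=> W; have uS := wf_uniqS W (eqv_refl _); have uT := wf_uniqT W (eqv_refl _).
have [L _ _] := W.
have ST x : (x \in flatten S) = (x \in flatten T).
  by rewrite -!occ_gt0; have := L x; rewrite /outn /inn /= !addn0 => -[->].
pose nu (e : 'I_(size (flatten S))) := nth 0 (flatten S) e.
have nuI : injective nu.
  by move=> e e' /eqP; rewrite nth_uniq // => /eqP/val_inj.
have nuS e : nu e \in flatten S by apply: mem_nth.
have ex (R : names) x : x \in flatten R -> exists i : 'I_(size R), x \in nth [::] R i.
  case/flattenP=> v /(nthP [::])[i iR <-] xv; by exists (Ordinal iR).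
have /choice[o oE] e := ex S _ (nuS e).
have /choice[d dE] e : exists i : 'I_(size T), nu e \in nth [::] T i.
  by apply: ex; rewrite -ST.
have sR x : x \in flatten S -> exists e, nu e = x.
  by case/(nthP 0)=> i iS <-; exists (Ordinal iS).
exists (@Web _ _ _ o d n), nu; split=> //; split=> //; apply: stars_net => //.
by move=> x; rewrite -ST; apply: sR.
Qed.

Lemma stars_iso (V W E F : finType) (h : E -> V) (g : F -> W) nu (i : V -> W) (k : E -> F) :
  bijective i -> bijective k -> (forall e, g (k e) = i (h e)) ->
  stars h (enum V) (enum E) (nu \o k) ≡ stars g (enum W) (enum F) nu.
Proof.
move=> bi bk E0; have ii := bij_inj bi; have ki := bij_inj bk.
have pi : perm_eq (enum W) (map i (enum V)).
  apply: uniq_perm; rewrite ?(map_inj_uniq ii) ?enum_uniq // => x.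
  by rewrite mem_enum; case: bi => i' _ i'K; rewrite -[x]i'K map_f ?mem_enum.
have pk : perm_eq (enum F) (map k (enum E)).
  apply: uniq_perm; rewrite ?(map_inj_uniq ki) ?enum_uniq // => x.
  by rewrite mem_enum; case: bk => i' _ i'K; rewrite -[x]i'K map_f ?mem_enum.
rewrite eqv_sym; apply: eqv_trans (stars_perm g nu pi pk) _.
rewrite /stars -map_comp; apply: eqv_map => p _ /=.
rewrite filter_map -map_comp (@eq_filter _ _ (fun e => h e == p)) // => e /=.
by rewrite E0 (inj_eq ii).
Qed.

Lemma iso_presents G H i j k (nu : edge H -> nat) : @is_iso G H i j k -> injective nu ->
  presents (nu \o k) (srcs nu) (snks nu).
Proof.
move=> [[bi bj bk] [E1 E2 _]] inj; split.
- by apply: inj_comp => //; apply: bij_inj.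
- by rewrite eqv_sym; apply: stars_iso E1.
- by rewrite eqv_sym; apply: stars_iso E2.
Qed.

Lemma iso_trivalent G H : iso G H -> trivalent H -> trivalent G.
Proof.
move=> [i [j [k I]]] tH.
pose nu (e : edge H) := val (enum_rank e).
have nuI : injective nu by move=> e e' /val_inj /enum_rank_inj.
have := presents_trivalent (iso_presents I nuI).
by move: tH; rewrite (trivalentE nu) => /andP[-> ->]; apply.
Qed.

(** * Nets of unions, cuts and insertions *)

(** The constructions on webs use sums and options; their enumerations are
    permutations of the expected lists, which suffices for nets. *)
Lemma enum_sum_perm (A B : finType) :
  perm_eq (enum {: A + B}) (map inl (enum A) ++ map inr (enum B)).
Proof.
apply: uniq_perm; rewrite ?enum_uniq //.
  have il : injective (@inl A B) by move=> ? ? [].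
  have ir : injective (@inr A B) by move=> ? ? [].
  rewrite cat_uniq (map_inj_uniq il) (map_inj_uniq ir) !enum_uniq andbT.
  by apply/hasPn => _ /mapP[b _ ->]; apply/mapP => -[].
by case=> x; rewrite mem_enum mem_cat; apply: esym; apply/orP;
  [left|right]; rewrite map_f ?mem_enum.
Qed.

Lemma enum_option_perm (A : finType) :
  perm_eq (enum {: option A}) (None :: map Some (enum A)).
Proof.
apply: uniq_perm; rewrite ?enum_uniq //=.
  have iS : injective (@Some A) by move=> ? ? [].
  by rewrite (map_inj_uniq iS) enum_uniq andbT; apply/mapP => -[].
by case=> [x|]; rewrite mem_enum in_cons //= map_f ?mem_enum.
Qed.

Lemma stars_sum (V W E F : finType) (h : E -> V) (g : F -> W) (nu : E + F -> nat) :
  stars (fun e => match e with inl e => inl (h e) | inr e => inr (g e) end)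
    (enum {: V + W}) (enum {: E + F}) nu ≡
  stars h (enum V) (enum E) (nu \o inl) ++ stars g (enum W) (enum F) (nu \o inr).
Proof.
apply: eqv_trans (stars_perm _ _ (enum_sum_perm V W) (enum_sum_perm E F)) _.
rewrite /stars map_cat -!map_comp; apply: eqv_cat; apply: eqv_map => p _ /=;
  rewrite filter_cat !filter_map map_cat -!map_comp.
  rewrite [X in _ ++ X](_ : _ = [::]) ?cats0 //.
  by rewrite (@eq_filter _ _ pred0) ?filter_pred0.
rewrite [X in X ++ _](_ : _ = [::]) //.
by rewrite (@eq_filter _ _ pred0) ?filter_pred0.
Qed.

Lemma presents_dunion G H nu mu S T S' T' : @presents G nu S T -> @presents H mu S' T' ->
  apart S S' ->
  @presents (dunion G H) (fun e => match e with inl e => nu e | inr e => mu e end) (S ++ S') (T ++ T').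
Proof.
move=> P Q A; have HP := presents_names P; have HQ := presents_names Q.
case: P => nuI ES ET; case: Q => muI ES' ET'.
have ne e e' : nu e <> mu e'.
  move=> E; have := HP (nu e); have := HQ (mu e'); rewrite -E.
  have -> : [exists e0, nu e0 == nu e] by apply/existsP; exists e.
  have -> : [exists e0, mu e0 == nu e] by apply/existsP; exists e'; rewrite E.
  by case: (A (nu e)) => ->.
split.
- by move=> [e|e] [e'|e'] // E; [rewrite (nuI _ _ E) | case: (ne _ _ E) | case: (ne _ _ (esym E)) | rewrite (muI _ _ E)].
- by rewrite eqv_sym; apply: eqv_trans (stars_sum _ _ _) _; apply: eqv_cat; rewrite eqv_sym.
- by rewrite eqv_sym; apply: eqv_trans (stars_sum _ _ _) _; apply: eqv_cat; rewrite eqv_sym.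
Qed.

Lemma srcs_cut G x (nu : edge (@cut G x) -> nat) :
  srcs nu ≡ [:: nu None] :: srcs (nu \o Some).
Proof.
apply: eqv_trans (stars_perm _ _ (enum_option_perm _) (enum_option_perm _)) _.
rewrite /stars /= -map_comp; apply: eqv_cons.
  by rewrite filter_map (@eq_filter _ _ pred0) ?filter_pred0.
apply: eqv_map => p _ /=; rewrite filter_map -map_comp.
by rewrite (@eq_filter _ _ (fun e => org e == p)).
Qed.

Lemma snks_cut_circ G (nu : edge (@cut G None) -> nat) :
  snks nu ≡ [:: nu None] :: snks (nu \o Some).
Proof.
apply: eqv_trans (stars_perm _ _ (enum_option_perm _) (enum_option_perm _)) _.
rewrite /stars /= -map_comp; apply: eqv_cons.
  by rewrite filter_map (@eq_filter _ _ pred0) ?filter_pred0.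
apply: eqv_map => p _ /=; rewrite filter_map -map_comp.
by rewrite (@eq_filter _ _ (fun e => dst e == p)).
Qed.

(** Cutting an edge: its old name now ends at the new sink, and its end takes over
    the name of the new edge. *)
Lemma snks_cut_edge G e0 (nu : edge (@cut G (Some e0)) -> nat) : injective nu ->
  snks nu ≡ [:: nu (Some e0)] :: ren (ren1 (nu (Some e0)) (nu None)) (snks (nu \o Some)).
Proof.
move=> inj; pose s := rem e0 (enum (edge G)).
have Es : perm_eq (enum (edge G)) (e0 :: s) by apply: perm_to_rem; rewrite mem_enum.
have e0s : e0 \notin s by have := enum_uniq (edge G); rewrite (perm_uniq Es) => /andP[].
have Es' : perm_eq (enum {: option (edge G)}) [:: None, Some e0 & map Some s].
  by apply: perm_trans (enum_option_perm _) _; rewrite perm_cons; apply: perm_map Es.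
apply: eqv_trans (stars_perm _ _ (enum_option_perm _) Es') _.
rewrite /snks stars_ren /stars /= eqxx -map_comp; apply: eqv_cons.
  rewrite eqxx filter_map (@eq_in_filter _ _ pred0) ?filter_pred0 // => e es /=.
  by case: (eqVneq (Some e0) (Some e)) => [[E]|//]; rewrite E es in e0s.
apply: eqv_map => p _.
have := perm_map (ren1 (nu (Some e0)) (nu None) \o (nu \o Some)) (perm_filter (fun e => dst e == p) Es).
rewrite perm_sym => /(perm_trans _); apply.
have inE0 e : (nu (Some e) == nu (Some e0)) = (e == e0) by rewrite (inj_eq inj).
have Ef : [seq e <- map Some s | (match e with Some e1 => if Some e0 == Some e1 then None else Some (dst e1) | None => Some (dst e0) end) == Some p] = map Some [seq e <- s | dst e == p].
  rewrite filter_map; congr map; apply: eq_in_filter => e es /=.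
  by case: (eqVneq (Some e0) (Some e)) => [[E]|//]; rewrite E es in e0s.
rewrite /= Ef /=; have -> : (Some (dst e0) == Some p) = (dst e0 == p) by [].
have Er : map (ren1 (nu (Some e0)) (nu None) \o (nu \o Some)) [seq e <- s | dst e == p] =
    map nu (map Some [seq e <- s | dst e == p]).
  rewrite -!map_comp; apply/eq_in_map => e; rewrite mem_filter => /andP[_ es] /=.
  by rewrite /ren1 inE0; case: eqP => // E; rewrite -E es in e0s.
by case: ifP => _ /=; rewrite Er // /ren1 eqxx.
Qed.

Lemma srcs_add G (I : finType) (a : I -> src G) (b : I -> snk G)
    (nu : edge (add_edges a b) -> nat) :
  srcs nu ≡ [seq [seq nu (inl e) | e <- enum (edge G) & org e == p] ++
                 [seq nu (inr i) | i <- enum I & a i == p] | p <- enum (src G)].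
Proof.
apply: eqv_trans (stars_perm _ _ (perm_refl _) (enum_sum_perm _ _)) _.
apply: eqv_map => p _ /=.
by rewrite filter_cat !filter_map map_cat -!map_comp.
Qed.

Lemma snks_add G (I : finType) (a : I -> src G) (b : I -> snk G)
    (nu : edge (add_edges a b) -> nat) :
  snks nu ≡ [seq [seq nu (inl e) | e <- enum (edge G) & dst e == p] ++
                 [seq nu (inr i) | i <- enum I & b i == p] | p <- enum (snk G)].
Proof.
apply: eqv_trans (stars_perm _ _ (perm_refl _) (enum_sum_perm _ _)) _.
apply: eqv_map => p _ /=.
by rewrite filter_cat !filter_map map_cat -!map_comp.
Qed.

Lemma snks_cut G x (nu : edge (@cut G x) -> nat) : injective nu ->
  snks nu ≡ [:: nu x] :: ren (ren1 (nu x) (nu None)) (snks (nu \o Some)).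
Proof.
case: x nu => [e0|] nu inj; first exact: snks_cut_edge.
by rewrite [ren _ _]ren_id; [exact: snks_cut_circ | move=> x _; apply: ren1_id].
Qed.

Lemma dst_cut_None G x (e : edge (@cut G x)) : dst e = None -> e = x.
Proof.
case: e => [e|] /=; last by case: x.
by case: eqP => // ->.
Qed.

Lemma dst_cut_x G x : dst (x : edge (@cut G x)) = None.
Proof. by case: x => [e|] //=; rewrite eqxx. Qed.

Lemma org_cut_None G x (e : edge (@cut G x)) : org e = None -> e = None.
Proof. by case: e. Qed.

Lemma star1 (V E : finType) (h : E -> V) (nu : E -> nat) p e0 : injective nu ->
  (forall e, h e = p <-> e = e0) -> perm_eq [seq nu e | e <- enum E & h e == p] [:: nu e0].
Proof.
move=> inj H; apply: uniq_perm => //.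
  by rewrite (map_inj_uniq inj) filter_uniq // enum_uniq.
move=> x; rewrite mem_star inE; apply/existsP/eqP => [[e /andP[/eqP/H -> /eqP]] //|->].
by exists e0; rewrite eqxx andbT; apply/eqP/H.
Qed.

(** Adding edges at one new vertex, respectively at the two new vertices of a double
    cut, changes the stars of these vertices only. *)
Lemma stars_add (V E I : finType) (h : E -> option V) (g : I -> option V) nu mu v R :
  stars h (enum {: option V}) (enum E) nu ≡ v :: R ->
  perm_eq [seq nu e | e <- enum E & h e == None] v ->
  (forall i, g i = None) ->
  [seq [seq nu e | e <- enum E & h e == p] ++ [seq mu i | i <- enum I & g i == p]
    | p <- enum {: option V}] ≡ (v ++ [seq mu i | i <- enum I]) :: R.
Proof.
move=> ES pv gN.
have ES' : stars h (None :: map Some (enum V)) (enum E) nu ≡ v :: R.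
  by apply: eqv_trans ES; rewrite eqv_sym; apply: stars_perm => //; apply: enum_option_perm.
apply: eqv_trans (eqv_perm (perm_map _ (enum_option_perm V))) _ => /=.
apply: eqv_cons.
  apply: perm_cat => //; rewrite (@eq_filter _ _ predT) ?filter_predT // => i.
  by rewrite gN eqxx.
move: ES'; rewrite /stars /= eqv_cons_inj // => ES'.
apply: eqv_trans ES'; rewrite -!map_comp; apply: eqv_map => p _ /=.
rewrite [X in _ ++ X](_ : _ = [::]) ?cats0 //.
by rewrite (@eq_filter _ _ pred0) ?filter_pred0 // => i; rewrite gN.
Qed.

Lemma stars_add2 (V E I : finType) (h : E -> option (option V)) (g : I -> option (option V))
    nu mu u v R :
  stars h (enum {: option (option V)}) (enum E) nu ≡ u :: v :: R ->
  perm_eq [seq nu e | e <- enum E & h e == None] u ->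
  perm_eq [seq nu e | e <- enum E & h e == Some None] v ->
  (forall i p, g i <> Some (Some p)) ->
  [seq [seq nu e | e <- enum E & h e == p] ++ [seq mu i | i <- enum I & g i == p]
    | p <- enum {: option (option V)}] ≡
  (u ++ [seq mu i | i <- enum I & g i == None]) ::
  (v ++ [seq mu i | i <- enum I & g i == Some None]) :: R.
Proof.
move=> ES pu pv gN.
have pE : perm_eq (enum {: option (option V)}) [:: None, Some None & map Some (map Some (enum V))].
  apply: perm_trans (enum_option_perm _) _; rewrite perm_cons.
  exact: (perm_map Some (enum_option_perm V)).
have ES' : stars h [:: None, Some None & map Some (map Some (enum V))] (enum E) nu ≡ u :: v :: R.
  by apply: eqv_trans ES; rewrite eqv_sym; apply: stars_perm.
apply: eqv_trans (eqv_perm (perm_map _ pE)) _ => /=.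
apply: eqv_cons; first exact: perm_cat.
apply: eqv_cons; first exact: perm_cat.
move: ES'; rewrite /stars /= eqv_cons_inj // eqv_cons_inj // => ES'.
apply: eqv_trans ES'; rewrite -!map_comp; apply: eqv_map => p _ /=.
rewrite [X in _ ++ X](_ : _ = [::]) ?cats0 //.
rewrite (@eq_filter _ _ pred0) ?filter_pred0 // => i /=.
by apply/eqP; apply: gN.
Qed.

Lemma enum_bool_perm : perm_eq (enum {: bool}) [:: true; false].
Proof. by apply: uniq_perm; rewrite ?enum_uniq // => -[]; rewrite mem_enum. Qed.

Lemma srcs_insert_bigon G x (nu : edge (@insert_bigon G x) -> nat) : injective nu ->
  srcs nu ≡ [:: nu (inr true); nu (inr false); nu (inl None)] :: srcs (nu \o inl \o Some).
Proof.
move=> inj; have injl : injective (nu \o inl) by move=> e e' /inj [].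
apply: eqv_trans (srcs_add _) _.
apply: (eqv_trans (@stars_add (src G) _ bool _ (fun=> None) (nu \o inl) (nu \o inr) _ _
  (srcs_cut (nu \o inl)) _ _)) => //.
  by apply: star1 => // -[e|].
apply: eqv_hd; apply: perm_trans (perm_cat (perm_refl _) (perm_map _ enum_bool_perm)) _.
pm.
Qed.

Lemma snks_insert_bigon G x (nu : edge (@insert_bigon G x) -> nat) : injective nu ->
  snks nu ≡ [:: nu (inr true); nu (inr false); nu (inl x)] ::
    ren (ren1 (nu (inl x)) (nu (inl None))) (snks (nu \o inl \o Some)).
Proof.
move=> inj; have injl : injective (nu \o inl) by move=> e e' /inj [].
apply: eqv_trans (snks_add _) _.
apply: (eqv_trans (@stars_add (snk G) _ bool _ (fun=> None) (nu \o inl) (nu \o inr) _ _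
  (snks_cut injl) _ _)) => //.
  apply: star1 => // e; split; first exact: dst_cut_None.
  by move->; apply: dst_cut_x.
apply: eqv_hd; apply: perm_trans (perm_cat (perm_refl _) (perm_map _ enum_bool_perm)) _.
pm.
Qed.

Lemma enum_bool2_perm :
  perm_eq (enum {: bool * bool}) [:: (true, true); (true, false); (false, true); (false, false)].
Proof. by apply: uniq_perm; rewrite ?enum_uniq // => -[[] []]; rewrite mem_enum. Qed.

Section Quad.
Variables (G : web) (x : option (edge G)) (y : option (edge (cut x))).
Variable ka : edge (cut y) -> nat.
Hypothesis kaI : injective ka.

(** The edge which ends at the sink of the first cut: Some x, or None if the second cut
    was made on this very edge. *)
Definition cut_in1 := ren1 (ka y) (ka None) (ka (Some x)).
Definition cut_snks :=
  ren (ren1 (ka y) (ka None)) (ren (ren1 (ka (Some x)) (ka (Some None))) (snks (ka \o Some \o Some))).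

Lemma srcs_cut2 : srcs ka ≡ [:: ka None] :: [:: ka (Some None)] :: srcs (ka \o Some \o Some).
Proof. by apply: eqv_trans (srcs_cut ka) _; apply: eqv_cons => //; apply: srcs_cut. Qed.

Lemma snks_cut2 : snks ka ≡ [:: ka y] :: [:: cut_in1] :: cut_snks.
Proof.
apply: eqv_trans (snks_cut kaI) _; apply: eqv_cons => //.
have inj : injective (ka \o Some) by move=> e e' /kaI [].
exact: (eqv_ren (ren1 (ka y) (ka None)) (snks_cut inj)).
Qed.

Lemma cut_in1P (e : edge (cut y)) : dst e = Some None -> ka e = cut_in1.
Proof.
rewrite /cut_in1 /ren1; case: e => [e|] /=.
  case: eqP => // ye [/dst_cut_None ex]; rewrite -ex (inj_eq kaI).
  by case: eqP => // E; case: ye.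
case: y => [e|] //= [/dst_cut_None ->].
by rewrite eqxx.
Qed.

Lemma ex_cut_in1 : exists e, dst e = Some None :> snk (cut y).
Proof.
have [->|ne] := eqVneq y (Some x); first by exists None; congr Some; apply: dst_cut_x.
exists (Some x) => /=; rewrite (negbTE ne); congr Some; exact: dst_cut_x.
Qed.

End Quad.

Lemma srcs_insert_quad G x (y : option (edge (@cut G x))) (nu : edge (insert_quad y) -> nat) :
  injective nu ->
  srcs nu ≡ [:: nu (inr (true, false)); nu (inr (true, true)); nu (inl None)] ::
    [:: nu (inr (false, true)); nu (inr (false, false)); nu (inl (Some None))] ::
    srcs (nu \o inl \o Some \o Some).
Proof.
move=> inj; have injl : injective (nu \o inl) by move=> e e' /inj [].
apply: eqv_trans (srcs_add _) _.
apply: (eqv_trans (@stars_add2 (src G) _ _ _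
  (fun ij : bool * bool => if ij.1 then None else Some None) (nu \o inl) (nu \o inr) _ _ _
  (srcs_cut2 (nu \o inl)) _ _ _)) => //.
- by apply: star1 => // -[e|].
- by apply: star1 => // -[[e|]|].
- by case=> [[] b] p.
apply: eqv_cons; last apply: eqv_hd;
  apply: perm_trans (perm_cat (perm_refl _) (perm_map _ (perm_filter _ enum_bool2_perm))) _;
  rewrite /=; pm.
Qed.

Lemma snks_insert_quad G x (y : option (edge (@cut G x))) (nu : edge (insert_quad y) -> nat) :
  injective nu ->
  snks nu ≡ [:: nu (inr (true, true)); nu (inr (false, true)); nu (inl y)] ::
    [:: nu (inr (false, false)); nu (inr (true, false)); @cut_in1 G x y (nu \o inl)] ::
    @cut_snks G x y (nu \o inl).
Proof.
move=> inj; have injl : injective (nu \o inl) by move=> e e' /inj [].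
apply: eqv_trans (snks_add _) _.
apply: (eqv_trans (@stars_add2 (snk G) _ _ _
  (fun ij : bool * bool => if ij.2 then None else Some None) (nu \o inl) (nu \o inr) _ _ _
  (snks_cut2 injl) _ _ _)) => //.
- apply: star1 => // e; split; first by move/(@dst_cut_None _ y e).
  by move->; apply: (@dst_cut_x _ y).
- have [e0 E0] := ex_cut_in1 y; rewrite -(cut_in1P injl E0).
  apply: star1 => // e; split=> [E|-> //]; apply: (injl).
  by rewrite (cut_in1P injl E0) (cut_in1P injl E).
- by case=> [a []] p.
apply: eqv_cons; last apply: eqv_hd;
  apply: perm_trans (perm_cat (perm_refl _) (perm_map _ (perm_filter _ enum_bool2_perm))) _;
  rewrite /=; pm.
Qed.

(** The wire (d, c) passes through an edge of G, or through a circle if d = c.  Cutting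
    there turns the wire into two univalent vertices. *)
Lemma uncut G nu S T c d n : linear S T [:: (d, c)] ->
  @presents G nu S (ren (root [:: (d, c)]) T) -> ncirc G = n + loops [:: (d, c)] ->
  exists (x : option (edge G)) (ka : edge (cut x) -> nat),
    [/\ cuttable x, presents ka ([:: c] :: S) ([:: d] :: T), ncirc (cut x) = n,
      ka None = c & ka x = d /\ ka \o Some = nu].
Proof.
move=> L P nc; have HP := presents_names P; case: P => inj ES ET.
have c0 : occ c S = 0 by have := L c; rewrite /outn /inn /= eqxx; case: (d == c); lia.
pose ka e := if e is Some e then nu e else c.
have nc0 e : nu e <> c.
  move=> E; have := HP c; rewrite c0; case: existsP => // -[]; exists e; by apply/eqP.
have kaI : injective ka.
  by move=> [e|] [e'|] //=; [move/inj-> | move/nc0 | move/esym/nc0].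
case: (eqVneq d c) => [dc|dc].
  subst d; exists None, ka; split=> //=.
  - by rewrite /cuttable nc /= eqxx; case: (n).
  - split=> //; rewrite eqv_sym.
      by apply: eqv_trans (srcs_cut _) _; apply: eqv_cons; rewrite // eqv_sym.
    apply: eqv_trans (snks_cut_circ _) _; apply: eqv_cons; rewrite // eqv_sym.
    apply: eqv_trans ET; rewrite ren_id // => x _ /=; exact: ren1_id.
  - by rewrite nc /= eqxx addn1.
have d1 : 0 < occ d S by have := L d; rewrite /outn /inn /= eqxx [c == d]eq_sym (negbTE dc); lia.
have dT : occ d T = 0 by have := L d; rewrite /outn /inn /= eqxx [c == d]eq_sym (negbTE dc); lia.
move: d1; rewrite HP => /existsP[e /eqP ed].
exists (Some e), ka; split=> //=; last by rewrite nc /= (negbTE dc) !addn0.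
split=> //; rewrite eqv_sym.
  by apply: eqv_trans (srcs_cut _) _; apply: eqv_cons; rewrite // eqv_sym.
apply: eqv_trans (snks_cut_edge kaI) _; rewrite /= ed; apply: eqv_cons => //.
apply: (@eqv_trans _ (ren (ren1 d c) (ren (root [:: (d, c)]) T))).
  by apply: eqv_ren; rewrite eqv_sym.
rewrite ren_comp ren_id // => x x0 /=; rewrite /ren1.
case: (eqVneq x c) => [->|xc]; first by rewrite eqxx.
by case: eqP => // E; rewrite E dT in x0.
Qed.

(** * Connected components *)

(** Two sources with a common sink.  For trivalent webs the classes of sources
    determine the connected components. *)
Definition linked (G : web) : rel (src G) := fun p p' =>
  [exists e, exists e', [&& org e == p, org e' == p' & dst e == dst e']].

Definition compo (G : web) (p : src G) : {set src G} := [set p' | connect (@linked G) p p'].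

Definition comps (G : web) : {set {set src G}} := [set compo p | p : src G].

Definition nbrs (G : web) (C : {set src G}) : {set snk G} :=
  [set q | [exists e, (dst e == q) && (org e \in C)]].

Lemma dst_nbrs (G : web) (C : {set src G}) (e : {e | org e \in C}) : dst (val e) \in nbrs C.
Proof. by rewrite inE; apply/existsP; exists (val e); rewrite eqxx; case: e. Qed.

(** The union of the components of the sources in C, if C is a union of classes; the
    circles are left out. *)
Definition subweb (G : web) (C : {set src G}) : web :=
  @Web {p | p \in C} {q | q \in nbrs C} {e | org e \in C}
    (fun e => Sub (org (val e)) (valP e)) (fun e => Sub (dst (val e)) (dst_nbrs e)) 0.

(** Embeddings as a union of components: no further edge is attached to the image.
    Isomorphisms and the two injections into a disjoint union are the cases needed. *)
Definition clopen (G H : web) (i : src G -> src H) (j : snk G -> snk H)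
    (k : edge G -> edge H) : Prop :=
  [/\ injective i, injective j & injective k] /\
  [/\ forall e, org (k e) = i (org e), forall e, dst (k e) = j (dst e),
      forall p e', org e' = i p -> exists e, e' = k e
    & forall q e', dst e' = j q -> exists e, e' = k e].

Section Clopen.
Variables (G H : web) (i : src G -> src H) (j : snk G -> snk H) (k : edge G -> edge H).
Hypothesis cl : clopen i j k.

Lemma linked_clopen p p' : linked p p' -> linked (i p) (i p').
Proof.
case: cl => _ [E1 E2 _ _] /existsP[e /existsP[e' /and3P[/eqP <- /eqP <- /eqP E]]].
by apply/existsP; exists (k e); apply/existsP; exists (k e'); rewrite !E1 !E2 E !eqxx.
Qed.

Lemma linked_clopenE p p' : linked (i p) p' -> exists2 p2, p' = i p2 & linked p p2.
Proof.
case: cl => [[ii ji ki] [E1 E2 E3 E4]].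
case/existsP=> e /existsP[e' /and3P[/eqP e1 /eqP <- /eqP E]].
have [f fe] := E3 _ _ e1; subst e; rewrite E2 in E; have [f' fe'] := E4 _ _ (esym E); subst e'.
exists (org f'); first by rewrite E1.
apply/existsP; exists f; apply/existsP; exists f'; rewrite eqxx.
rewrite E2 in E; rewrite E1 in e1.
by rewrite (ii _ _ e1) (ji _ _ E) !eqxx.
Qed.

Lemma compo_clopen p : compo (i p) = i @: compo p.
Proof.
have [[ii _ _] _] := cl.
apply/setP => x; rewrite inE; apply/idP/imsetP => [|[y]].
  case/connectP=> s; elim: s p => [|y s IH] p /=.
    by move=> _ ->; exists p => //; rewrite inE.
  case/andP=> /linked_clopenE[p2 -> pp2] /IH{}IH /IH [z zp ->].
  by exists z => //; move: zp; rewrite !inE; apply: connect_trans; apply: connect1.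
rewrite inE => /connectP[s]; elim: s p => [|z s IH] p /=; first by move=> _ -> ->.
case/andP=> pz sz ly xy; apply: (connect_trans (connect1 (linked_clopen pz))).
exact: IH.
Qed.

Lemma nbrs_clopen (C : {set src G}) : nbrs (i @: C) = j @: nbrs C.
Proof.
have [[ii ji ki] [E1 E2 E3 E4]] := cl.
apply/setP => q; rewrite inE; apply/existsP/imsetP => [[e /andP[/eqP <-]]|[q']].
  case/imsetP=> p pC ep; have [f fe] := E3 _ _ ep; subst e.
  exists (dst f) => //; rewrite inE; apply/existsP; exists f; rewrite eqxx.
  by move: ep; rewrite E1 => /ii ->.
rewrite inE => /existsP[e /andP[/eqP <- eC]] ->; exists (k e); rewrite E2 eqxx.
by rewrite E1 imset_f.
Qed.

Lemma subweb_clopen (C : {set src G}) : iso (subweb C) (subweb (i @: C)).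
Proof.
have [[ii ji ki] [E1 E2 E3 E4]] := cl.
have hi (p : {p | p \in C}) : i (val p) \in i @: C by apply: imset_f; case: p.
have hj (q : {q | q \in nbrs C}) : j (val q) \in nbrs (i @: C).
  by rewrite nbrs_clopen; apply: imset_f; case: q.
have hk (e : {e | org e \in C}) : org (k (val e)) \in i @: C.
  by rewrite E1; apply: imset_f; case: e.
exists (fun p => Sub (i (val p)) (hi p)), (fun q => Sub (j (val q)) (hj q)),
  (fun e => Sub (k (val e)) (hk e)).
split; split=> //; try by move=> e; apply: val_inj; rewrite /= ?E1 ?E2.
- apply: inj_card_bij; first by move=> p p' /(congr1 val) /= /ii /val_inj.
  by rewrite !card_sig (@eq_card _ (fun x => x \in i @: C) (mem (i @: C))) // card_imset.
- apply: inj_card_bij; first by move=> p p' /(congr1 val) /= /ji /val_inj.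
  rewrite !card_sig (@eq_card _ (fun x => x \in nbrs (i @: C)) (mem (nbrs (i @: C)))) //.
  by rewrite nbrs_clopen card_imset.
- have inj : injective (fun e : {e | org e \in C} => Sub (k (val e)) (hk e) : {e | org e \in i @: C}).
    by move=> p p' /(congr1 val) /= /ki /val_inj.
  apply: inj_card_bij => //.
  rewrite !card_sig -(card_imset (fun x => org x \in C) ki).
  apply: subset_leq_card; apply/subsetP => e'; rewrite !inE => /imsetP[p pC ep].
  have [f fe] := E3 _ _ ep; subst e'; apply: imset_f; change (is_true (org f \in C)).
  by move: ep; rewrite E1 => /ii ->.
Qed.

End Clopen.

Lemma iso_clopen G H i j k : @is_iso G H i j k -> clopen i j k.
Proof.
case=> [[bi bj bk] [E1 E2 _]]; split; first by split; apply: bij_inj.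
by split=> // _ e' _; case: bk => k' _ k'K; exists (k' e').
Qed.

Lemma inl_clopen G H : @clopen G (dunion G H) inl inl inl.
Proof.
split; first by split=> ? ? [].
by split=> // p [e|e] //=; exists e.
Qed.

Lemma inr_clopen G H : @clopen H (dunion G H) inr inr inr.
Proof.
split; first by split=> ? ? [].
by split=> // p [e|e] //=; exists e.
Qed.

Lemma comps_iso G H i j k : @is_iso G H i j k -> comps H = [set i @: (C : {set src G}) | C in comps G].
Proof.
move=> I; have cl := iso_clopen I; case: I => [[[i' iK i'K] _ _] _].
apply/setP => C; apply/imsetP/imsetP => [[p _ ->]|[D /imsetP[p _ ->] ->]].
  exists (compo (i' p)); first by apply: imset_f.
  by rewrite -(compo_clopen cl) i'K.
by exists (i p) => //; rewrite (compo_clopen cl).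
Qed.

Lemma comps_dunion G H : comps (dunion G H) =
  [set (@inl _ (src H)) @: (C : {set src G}) | C in comps G] :|:
  [set (@inr (src G) _) @: (C : {set src H}) | C in comps H].
Proof.
apply/setP => C; rewrite in_setU; apply/imsetP/orP.
  case=> -[p|p] _ ->; [left|right].
    by rewrite (compo_clopen (inl_clopen G H)); do 2!apply: imset_f.
  by rewrite (compo_clopen (inr_clopen G H)); do 2!apply: imset_f.
case=> /imsetP[D /imsetP[p _ ->] ->].
  by exists (inl p) => //; rewrite (compo_clopen (inl_clopen G H)).
by exists (inr p) => //; rewrite (compo_clopen (inr_clopen G H)).
Qed.

Lemma compo_refl G (p : src G) : p \in compo p.
Proof. by rewrite inE. Qed.

Section Monomial.
Local Open Scope ring_scope.
Variables (M : comNzRingType) (val_of : web -> M).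
Hypothesis val_iso : forall G H, iso G H -> val_of G = val_of H.

(** The product of the values of the components: the value of a web without bigons
    and quadrilaterals. *)
Definition mon (G : web) : M := \prod_(C in comps G) val_of (subweb C).

Lemma mon_iso G H : iso G H -> mon G = mon H.
Proof.
move=> [i [j [k I]]]; rewrite /mon (comps_iso I) [RHS]big_imset /=.
  by apply: eq_bigr => C _; apply: val_iso; apply: subweb_clopen (iso_clopen I) _.
by move=> C D _ _; apply: imset_inj; case: I => [[/bij_inj]].
Qed.

Lemma mon_dunion G H : mon (dunion G H) = mon G * mon H.
Proof.
rewrite /mon comps_dunion (big_setID [set (@inl _ (src H)) @: (C : {set src G}) | C in comps G]) /=.
rewrite (setIidPr (subsetUl _ _)) setDUl setDv set0U (setDidPl _); last first.
  rewrite disjoint_sym disjoints_subset; apply/subsetP => C /imsetP[D /imsetP[p _ ->] ->].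
  rewrite inE; apply/imsetP => -[D' /imsetP[p' _ ->]] /setP /(_ (inl p)).
  rewrite imset_f ?compo_refl // => /esym /imsetP[x _] //.
congr (_ * _); rewrite big_imset /=.
- by apply: eq_bigr => C _; apply/esym/val_iso/subweb_clopen/inl_clopen.
- by move=> C D _ _; apply: imset_inj => ? ? [].
- by apply: eq_bigr => C _; apply/esym/val_iso/subweb_clopen/inr_clopen.
- by move=> C D _ _; apply: imset_inj => ? ? [].
Qed.

Lemma subweb_setT G : trivalent G -> ncirc G = 0%N -> iso (subweb (setT : {set src G})) G.
Proof.
move=> /trivalent_full[_ dG] nc.
exists val, val, val; split; split=> //.
- by exists (fun p => Sub p (in_setT p)) => p //; apply: val_inj.
- have h q : q \in nbrs [set: src G].
    by rewrite inE; have [e <-] := dG q; apply/existsP; exists e; rewrite eqxx in_setT.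
  by exists (fun q => Sub q (h q)) => p //; apply: val_inj.
- by exists (fun e => Sub e (in_setT (org e))) => p //; apply: val_inj.
Qed.

Lemma connected_linked G (p p' : src G) : connected G -> connect (@linked G) p p'.
Proof.
case/and3P=> _ _ /forallP/(_ (inl p))/forallP/(_ (inl p')) /connectP[s].
pose P (y : src G + snk G) := match y with
  | inl p' => connect (@linked G) p p'
  | inr q => [exists e, (dst e == q) && connect (@linked G) p (org e)] end.
suff H : forall x, P x -> path (@adjacent G) x s -> P (last x s).
  by move=> ps ls; have := H (inl p) (connect0 _ _) ps; rewrite -ls.
elim: s => //= y s IH x Px /andP[xy ys]; apply: IH => //.
case: x y Px xy {ys} => [x|x] [y|y] //= Px.
  by case/existsP=> e /andP[/eqP ex ey]; apply/existsP; exists e; rewrite ey ex.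
case/existsP=> e /andP[/eqP ey ex]; case/existsP: Px => e' /andP[/eqP ex' pe].
apply: connect_trans pe (connect1 _); apply/existsP; exists e'; apply/existsP; exists e.
by rewrite eqxx ey eqxx ex' eq_sym.
Qed.

Lemma mon_connected G : trivalent G -> connected G -> mon G = val_of G.
Proof.
move=> tG cG; have /and3P[/eqP nc n0 _] := cG.
have [p0] : exists p : src G, True.
  have [fo _] := trivalent_full tG; have [_ fd] := trivalent_full tG.
  move/card_gt0P: n0 => [[p|q] _]; first by exists p.
  by have [e _] := fd q; exists (org e).
move=> _; rewrite /mon; have -> : comps G = [set setT].
  apply/setP => C; rewrite inE; apply/imsetP/eqP => [[p _ ->]|->].
    by apply/setP => x; rewrite !inE connected_linked.
  by exists p0 => //; apply/setP => x; rewrite !inE connected_linked.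
by rewrite big_set1; apply: val_iso; apply: subweb_setT.
Qed.

End Monomial.

Lemma mon_empty (M : comNzRingType) (v : web -> M) : mon v empty_web = 1%R.
Proof.
rewrite /mon big_pred0 // => C; apply/imsetP => -[] [].
Qed.

(** * Bigons and quadrilaterals of webs and of nets *)

Lemma star_of (V E : finType) (h : E -> V) nu v S' :
  stars h (enum V) (enum E) nu ≡ v :: S' ->
  exists p, perm_eq v [seq nu e | e <- enum E & h e == p].
Proof.
move/perm_mem/(_ (sort leq v)); rewrite /= mem_head => /mapP[u /mapP[p _ ->] /eqP].
by rewrite sort_perm; exists p.
Qed.

Lemma star_mem (V E : finType) (h : E -> V) (nu : E -> nat) p v x :
  perm_eq v [seq nu e | e <- enum E & h e == p] -> x \in v ->
  exists2 e, h e = p & nu e = x.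
Proof.
move=> E0; rewrite (perm_mem E0) mem_star => /existsP[e /andP[/eqP ? /eqP ?]].
by exists e.
Qed.

Lemma presents_bigon G nu S T a b c d S' T' : trivalent G -> @presents G nu S T ->
  bigon_at S T a b c d S' T' -> has_bigon G.
Proof.
move=> tG P [HS HT]; have W := presents_wf P tG; have := wf_uniqS W HS.
case: P => nuI ES ET; rewrite eqv_sym in ES; rewrite eqv_sym in ET.
have [p /star_mem Ep] := star_of (eqv_trans ES HS).
have [q /star_mem Eq] := star_of (eqv_trans ET HT) => U.
have [e1 p1 n1] := Ep a ltac:(by rewrite !inE eqxx).
have [e2 p2 n2] := Ep b ltac:(by rewrite !inE eqxx ?orbT).
have [e3 q1 n3] := Eq a ltac:(by rewrite !inE eqxx).
have [e4 q2 n4] := Eq b ltac:(by rewrite !inE eqxx ?orbT).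
have ? : e3 = e1 by apply: nuI; rewrite n1.
have ? : e4 = e2 by apply: nuI; rewrite n2.
subst e3 e4; apply/existsP; exists e1; apply/existsP; exists e2.
rewrite p1 p2 q1 q2 !eqxx !andbT; apply/eqP => E; move: n2 U; rewrite -E n1 => ->.
by rewrite /= inE eqxx.
Qed.

Lemma presents_quad G nu S T a b c d p q r o S' T' : trivalent G -> @presents G nu S T ->
  quad_at S T a b c d p q r o S' T' -> has_quad G.
Proof.
move=> tG P [HS HT]; have W := presents_wf P tG.
have US := wf_uniqS W HS; have UT := wf_uniqT W HT.
case: P => nuI ES ET; rewrite eqv_sym in ES; rewrite eqv_sym in ET.
have HS2 := eqv_trans HS (eqv_swap _ _ _); have HT2 := eqv_trans HT (eqv_swap _ _ _).
have [v1 p1] := star_of (eqv_trans ES HS); have E1 := star_mem p1.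
have [v3 p3] := star_of (eqv_trans ES HS2); have E3 := star_mem p3.
have [v2 p2] := star_of (eqv_trans ET HT); have E2 := star_mem p2.
have [v4 p4] := star_of (eqv_trans ET HT2); have E4 := star_mem p4.
have [ea o1 n1] := E1 a ltac:(by rewrite !inE eqxx).
have [eb o2 n2] := E1 b ltac:(by rewrite !inE eqxx ?orbT).
have [ec o3 n3] := E3 c ltac:(by rewrite !inE eqxx ?orbT).
have [ed o4 n4] := E3 d ltac:(by rewrite !inE eqxx ?orbT).
have [eb' d2 n2'] := E2 b ltac:(by rewrite !inE eqxx ?orbT).
have [ec' d3 n3'] := E2 c ltac:(by rewrite !inE eqxx ?orbT).
have [ed' d4 n4'] := E4 d ltac:(by rewrite !inE eqxx ?orbT).
have [ea' d1 n1'] := E4 a ltac:(by rewrite !inE eqxx ?orbT).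
have ? : ea' = ea by apply: nuI; rewrite n1.
have ? : eb' = eb by apply: nuI; rewrite n2.
have ? : ec' = ec by apply: nuI; rewrite n3.
have ? : ed' = ed by apply: nuI; rewrite n4.
subst ea' eb' ec' ed'.
apply/existsP; exists v1; apply/existsP; exists v2; apply/existsP; exists v3.
apply/existsP; exists v4; apply/and5P; split.
- apply/eqP => E; have : a \in [:: c; d; r].
    by rewrite (perm_mem p3) -E -(perm_mem p1) mem_head.
  by clear -US; rewrite !inE => /or3P[] /eqP E; subst; uq.
- apply/eqP => E; have : b \in [:: d; a; o].
    by rewrite (perm_mem p4) -E -(perm_mem p2) mem_head.
  by clear -UT; rewrite !inE => /or3P[] /eqP E; subst; uq.
- by apply/existsP; exists eb; rewrite o2 d2 !eqxx.
- by apply/existsP; exists ec; rewrite o3 d3 !eqxx.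
- apply/andP; split; apply/existsP; first by exists ed; rewrite o4 d4 !eqxx.
  by exists ea; rewrite o1 d1 !eqxx.
Qed.

Lemma perm_two (v : seq nat) x y : size v == 3 -> x \in v -> y \in v -> x != y ->
  exists c, perm_eq v [:: x; y; c].
Proof.
move=> sv xv yv xy; have yv' : y \in rem x v.
  by have := yv; rewrite (perm_mem (perm_to_rem xv)) inE eq_sym (negbTE xy).
have E := perm_to_rem xv; have E' := perm_to_rem yv'.
have := perm_size E; have := perm_size E'; rewrite (eqP sv) /=.
case R : (rem y (rem x v)) => [|c [|]] //= s1; rewrite ?s1 // => _.
exists c; apply: perm_trans E _; rewrite perm_cons.
by apply: perm_trans E' _; rewrite perm_cons R.
Qed.

Lemma star_to (V E : finType) (h : E -> V) nu p :
  stars h (enum V) (enum E) nu ≡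
    [seq nu e | e <- enum E & h e == p] :: stars h (rem p (enum V)) (enum E) nu.
Proof. by apply: eqv_perm; apply: (perm_map _ (perm_to_rem _)); rewrite mem_enum. Qed.

Lemma star_to2 (V E : finType) (h : E -> V) nu p q : p != q ->
  exists R, stars h (enum V) (enum E) nu ≡
    [seq nu e | e <- enum E & h e == p] :: [seq nu e | e <- enum E & h e == q] :: R.
Proof.
move=> pq; exists (stars h (rem q (rem p (enum V))) (enum E) nu).
apply: eqv_trans (star_to _ _ p) _; apply: eqv_cons => //.
apply: eqv_perm; apply: (perm_map _ (perm_to_rem _)).
by rewrite mem_rem_uniq ?enum_uniq // inE eq_sym pq mem_enum.
Qed.

Lemma star_mem2 (V E : finType) (h : E -> V) (nu : E -> nat) p e : h e = p ->
  nu e \in [seq nu e | e <- enum E & h e == p].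
Proof. by move=> ep; rewrite mem_star; apply/existsP; exists e; rewrite ep !eqxx. Qed.

Lemma has_bigon_net G nu S T : trivalent G -> @presents G nu S T -> has_bigon G ->
  exists a b c d S' T', bigon_at S T a b c d S' T'.
Proof.
move=> tG [nuI ES ET] /existsP[e1 /existsP[e2 /and3P[ne /eqP o12 /eqP d12]]].
have /andP[/forallP t1 /forallP t2] := tG.
have n12 : nu e1 != nu e2 by rewrite (inj_eq nuI).
have [c Ec] : exists c, perm_eq [seq nu e | e <- enum (edge G) & org e == org e1] [:: nu e1; nu e2; c].
  by apply: perm_two => //; [rewrite size_map size_star | exact: star_mem2 | exact: star_mem2].
have [d Ed] : exists c, perm_eq [seq nu e | e <- enum (edge G) & dst e == dst e1] [:: nu e1; nu e2; c].
  by apply: perm_two => //; [rewrite size_map size_star | exact: star_mem2 | exact: star_mem2].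
do 6!eexists; split.
  apply: eqv_trans ES _; apply: eqv_trans (star_to _ _ _) _; exact: eqv_cons Ec (eqv_refl _).
apply: eqv_trans ET _; apply: eqv_trans (star_to _ _ _) _; exact: eqv_cons Ed (eqv_refl _).
Qed.

Lemma has_quad_net G nu S T : trivalent G -> @presents G nu S T -> has_quad G ->
  exists a b c d p q r o S' T', quad_at S T a b c d p q r o S' T'.
Proof.
move=> tG [nuI ES ET] /existsP[v1 /existsP[v2 /existsP[v3 /existsP[v4]]]].
case/and5P=> n13 n24 /existsP[eb /andP[/eqP ob /eqP db]] /existsP[ec /andP[/eqP oc /eqP dc]].
case/andP=> /existsP[ed /andP[/eqP od /eqP dd]] /existsP[ea /andP[/eqP oa /eqP da]].
have /andP[/forallP t1 /forallP t2] := tG.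
have ne e e' : dst e != dst e' -> nu e != nu e' by apply: contraNneq => /nuI ->.
have ne' e e' : org e != org e' -> nu e != nu e' by apply: contraNneq => /nuI ->.
have [p Ep] : exists c, perm_eq [seq nu e | e <- enum (edge G) & org e == v1] [:: nu ea; nu eb; c].
  apply: perm_two; [by rewrite size_map size_star | exact: star_mem2 | exact: star_mem2 |].
  by apply: ne; rewrite da db eq_sym.
have [r Er] : exists c, perm_eq [seq nu e | e <- enum (edge G) & org e == v3] [:: nu ec; nu ed; c].
  apply: perm_two; [by rewrite size_map size_star | exact: star_mem2 | exact: star_mem2 |].
  by apply: ne; rewrite dc dd.
have [q Eq] : exists c, perm_eq [seq nu e | e <- enum (edge G) & dst e == v2] [:: nu eb; nu ec; c].
  apply: perm_two; [by rewrite size_map size_star | exact: star_mem2 | exact: star_mem2 |].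
  by apply: ne'; rewrite ob oc.
have [o Eo] : exists c, perm_eq [seq nu e | e <- enum (edge G) & dst e == v4] [:: nu ed; nu ea; c].
  apply: perm_two; [by rewrite size_map size_star | exact: star_mem2 | exact: star_mem2 |].
  by apply: ne'; rewrite od oa eq_sym.
have [R1 H1] := star_to2 (@org G) nu n13; have [R2 H2] := star_to2 (@dst G) nu n24.
exists (nu ea), (nu eb), (nu ec), (nu ed), p, q, r, o, R1, R2; split.
  apply: eqv_trans ES _; apply: eqv_trans H1 _; apply: eqv_cons => //; exact: eqv_cons.
apply: eqv_trans ET _; apply: eqv_trans H2 _; apply: eqv_cons => //; exact: eqv_cons.
Qed.

(** * Values of webs in a ring *)

Section Reduction.
Local Open Scope ring_scope.
Variables (M : comNzRingType) (bg lp : M).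
Hypothesis bgE : bg * bg = lp + 1.
Variable val_of : web -> M.
Hypothesis val_iso : forall G H, iso G H -> val_of G = val_of H.

(** The value of a reduced net is that of any web which it presents; the choice is
    harmless by [presents_iso]. *)
Definition base (S T : names) : M :=
  if pselect (exists G, exists2 nu, @presents G nu S T & trivalent G /\ ncirc G = 0%N) is left h
  then mon val_of (projT1 (cid h)) else 0.

Lemma base_presents G nu S T : @presents G nu S T -> trivalent G -> ncirc G = 0%N ->
  base S T = mon val_of G.
Proof.
move=> P tG nG; rewrite /base; case: pselect => [h|[]]; last by exists G, nu.
case: cid => H [mu Q [tH nH]] /=; apply: mon_iso => //.
have [i [j [k [I _]]]] := presents_iso (trivalent_full tH) (trivalent_full tG) Q P (etrans nH (esym nG)).
by exists i, j, k.
Qed.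

Lemma base_eqv S S' T T' : S ≡ S' -> T ≡ T' -> base S T = base S' T'.
Proof.
move=> ES ET; have ES' := ES; have ET' := ET; rewrite eqv_sym in ES'; rewrite eqv_sym in ET'.
have [[G [nu P [tG nG]]]|ne] := pselect (exists G, exists2 nu, @presents G nu S T & trivalent G /\ ncirc G = 0%N).
  by rewrite (base_presents P tG nG) (base_presents (presents_eqv ES ET P) tG nG).
rewrite /base; case: pselect => [[G [nu P [tG nG]]]|_]; first by case: ne; exists G, nu.
case: pselect => // -[G [nu P [tG nG]]]; case: ne; exists G, nu => //.
exact: presents_eqv P.
Qed.

Lemma net_trivalent S T n : wf S T [::] ->
  exists G nu, [/\ @presents G nu S T, trivalent G & ncirc G = n].
Proof.
move=> W; have [G [nu [P nG]]] := net_web n W; have [_ cS cT] := W.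
by exists G, nu; split=> //; apply: presents_trivalent P cS cT.
Qed.

Lemma base_ren r S T : wf S T [::] -> injon r S [::] ->
  base (ren r S) (ren r T) = base S T.
Proof.
move=> W inj; have [G [nu [P tG nG]]] := net_trivalent 0 W.
by rewrite (base_presents P tG nG) (base_presents (presents_ren P inj) tG nG).
Qed.

Lemma trivalent_dunion G H : trivalent G -> trivalent H -> trivalent (dunion G H).
Proof.
pose nu K (e : edge K) := val (enum_rank e).
have nuI K : injective (@nu K) by move=> e e' /val_inj /enum_rank_inj.
pose mu (e : edge (dunion G H)) := val (enum_rank e).
have muI : injective mu by move=> e e' /val_inj /enum_rank_inj.
rewrite (trivalentE mu) => tG tH.
rewrite (eqv_cubic (stars_sum _ _ _)) (eqv_cubic (stars_sum _ _ _)) /cubic !all_cat -/(cubic _) -!/(cubic _).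
by move: tG tH; rewrite (trivalentE (mu \o inl)) (trivalentE (mu \o inr)) => /andP[-> ->] /andP[-> ->].
Qed.

Lemma base_cat S1 T1 S2 T2 : wf S1 T1 [::] -> wf S2 T2 [::] -> apart S1 S2 ->
  base (S1 ++ S2) (T1 ++ T2) = base S1 T1 * base S2 T2.
Proof.
move=> W1 W2 A; have [G [nu [P tG nG]]] := net_trivalent 0 W1.
have [H [mu [Q tH nH]]] := net_trivalent 0 W2.
rewrite (base_presents P tG nG) (base_presents Q tH nH) -mon_dunion //.
apply: base_presents (presents_dunion P Q A) _ _; first exact: trivalent_dunion.
by rewrite /= nG nH.
Qed.

Local Notation F := (Fw bg lp base).

Definition name0 G (e : edge G) : nat := val (enum_rank e).

Lemma name0_inj G : injective (@name0 G).
Proof. by move=> e e' /val_inj /enum_rank_inj. Qed.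

Lemma presents_self G nu : injective nu -> @presents G nu (srcs nu) (snks nu).
Proof. by []. Qed.

Definition reduce (G : web) : M :=
  lp ^+ ncirc G * F (srcs (@name0 G)) (snks (@name0 G)) [::].

(** Any presentation may be used to compute the value of a web. *)
Lemma reduce_presents G nu S T : @presents G nu S T -> trivalent G ->
  reduce G = lp ^+ ncirc G * F S T [::].
Proof.
move=> P tG; congr (_ * _); have W := presents_wf P tG.
have HP := presents_names P; have [nuI ES ET] := P.
pose r x := if [pick e | nu e == x] is Some e then name0 e else 0%N.
have rE e : r (nu e) = name0 e.
  by rewrite /r; case: pickP => [e' /eqP /nuI -> //|/(_ e)]; rewrite eqxx.
have inj : injon r S [::].
  move=> x y; rewrite /outn !addn0 !HP => /existsP[e /eqP <-] /existsP[e' /eqP <-].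
  by rewrite !rE => /name0_inj ->.
rewrite -(F_ren bgE base_eqv base_ren W inj); apply: esym.
apply: (F_eqv bgE base_eqv base_ren) => //.
- exact: wf_ren.
- apply: eqv_trans (eqv_ren r ES) _; rewrite /srcs stars_ren.
  by rewrite /stars (eq_map (g := fun p => [seq name0 e | e <- enum (edge G) & org e == p])) // => p;
    apply: eq_map => e /=.
- apply: eqv_trans (eqv_ren r ET) _; rewrite /snks stars_ren.
  by rewrite /stars (eq_map (g := fun p => [seq name0 e | e <- enum (edge G) & dst e == p])) // => p;
    apply: eq_map => e /=.
Qed.

Lemma reduce_iso G H : trivalent G -> iso G H -> reduce G = reduce H.
Proof.
move=> tG I; have [i [j [k I']]] := I; have [_ [_ _ nc]] := I'.
rewrite (reduce_presents (iso_presents I' (@name0_inj H)) tG) nc //.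
Qed.

Lemma reduce_empty : reduce empty_web = 1.
Proof.
rewrite /reduce expr0 mul1r.
have E1 : srcs (@name0 empty_web) = [::].
  by apply: size0nil; rewrite size_map -cardE card_void.
have E2 : snks (@name0 empty_web) = [::].
  by apply: size0nil; rewrite size_map -cardE card_void.
rewrite E1 E2 F_base //.
- have P := presents_self (@name0_inj empty_web); rewrite E1 E2 in P.
  rewrite (base_presents P) ?mon_empty //.
  by apply/andP; split; apply/forallP => -[].
- exact: base_eqv.
- exact: base_ren.
- by move=> a b c d S' T' [/eqv_size].
- by move=> a b c d p q r o S' T' [/eqv_size].
Qed.

Lemma reduce_dunion G H : trivalent G -> trivalent H ->
  reduce (dunion G H) = reduce G * reduce H.
Proof.
move=> tG tH; pose nu e := (2 * @name0 G e)%N; pose mu e := (2 * @name0 H e).+1%N.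
have nuI : injective nu by move=> e e' E; apply: name0_inj; move: E; rewrite /nu; lia.
have muI : injective mu by move=> e e' E; apply: name0_inj; move: E; rewrite /mu; lia.
have P := presents_self nuI; have Q := presents_self muI.
have A : apart (srcs nu) (srcs mu).
  move=> x; rewrite !occ_srcs //.
  case: existsP => [[e /eqP E]|_]; last by left.
  case: existsP => [[e' /eqP E']|_]; last by right.
  by exfalso; move: E E'; rewrite /nu /mu; lia.
rewrite (reduce_presents P tG) (reduce_presents Q tH).
rewrite (reduce_presents (presents_dunion P Q A) (trivalent_dunion tG tH)) /= exprD.
rewrite (F_cat bgE base_eqv base_ren base_cat) //; first by rewrite mulrACA.
- exact: wf_web.
- exact: wf_web.
Qed.

Lemma trivalent_circle n : trivalent (@Web void void void id id n).
Proof. by apply/andP; split; apply/forallP => -[]. Qed.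

Lemma reduce_circle : reduce circle = lp.
Proof.
have -> : reduce circle = lp * reduce empty_web by rewrite /reduce expr0 expr1 mul1r.
by rewrite reduce_empty mulr1.
Qed.

(** Closing up a cut: the wire from the new sink back to the new source restores the
    edge, or restores the circle if the cut was made on a circle. *)
Lemma F_fuse S T w c d : wf S T w -> occ c T = 0%N -> in1 c w = 0%N ->
  wf S (ren (ren1 d c) T) ((d, c) :: refst (ren1 d c) w) ->
  F S (ren (ren1 d c) T) ((d, c) :: refst (ren1 d c) w) = lp ^+ (d == c) * F S T w.
Proof.
move=> W cT cw; case: (eqVneq d c) => [->|dc] W'.
  have E1 : ren (ren1 c c) T = T by apply: ren_id => x _; apply: ren1_id.
  have E2 : refst (ren1 c c) w = w by apply: refst1_id0.
  by rewrite E1 E2 Fw_loop ?expr1 //; rewrite E1 E2 in W'.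
rewrite (F_wire bgE base_eqv base_ren W' dc) expr0 mul1r ren_comp refst_comp.
have H x : x != c -> (ren1 c d \o ren1 d c) x = x.
  move=> xc; rewrite /ren1 /=; case: (eqVneq x d) => [->|xd]; first by rewrite eqxx.
  by rewrite (negbTE xc).
congr Fw.
  by apply: ren_id => x x0; apply: H; apply: contraTN x0 => /eqP ->; rewrite cT.
rewrite /refst -[RHS]map_id; apply/eq_in_map => -[x y] xy; congr (_, _); apply: H.
apply/negP => /eqP /= E; subst x.
have : (0 < in1 c w)%N by rewrite in1E -has_count; apply/hasP; exists (c, y) => /=.
by rewrite cw.
Qed.

Lemma ncirc_cut (G : web) (x : option (edge G)) : cuttable x ->
  (ncirc (cut x) + (x == None) = ncirc G)%N.
Proof. by case: x => [e|] //= cN; [rewrite addn0 | rewrite addn1 prednK]. Qed.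

Lemma reduce_bigon (G : web) (x : option (edge G)) : trivalent G -> cuttable x ->
  reduce (insert_bigon x) = bg * reduce G.
Proof.
move=> tG cx; pose nu := @name0 (insert_bigon x); have nuI : injective nu by apply: name0_inj.
pose c := nu (inl None); pose d := nu (inl x).
have muI : injective (nu \o inl \o Some) by move=> e e' /= /nuI [].
have ES := srcs_insert_bigon nuI; have ET := snks_insert_bigon nuI.
rewrite -/c -/d in ES ET.
have tI : trivalent (insert_bigon x).
  rewrite (trivalentE nu) (eqv_cubic ES) (eqv_cubic ET) /= cubic_ren.
  by move: tG; rewrite (trivalentE (nu \o inl \o Some)).
have W := wf_web nuI tI; have W' := wf_eqv0 W ES ET.
have cT : occ c (snks (nu \o inl \o Some)) = 0%N.
  rewrite occ_snks //; case: existsP => // -[e /eqP /nuI] //.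
rewrite {1}/reduce -/nu (F_eqv bgE base_eqv base_ren W ES ET (perm_refl _)).
rewrite (F_bigon bgE base_eqv base_ren) //.
have EF : F (srcs (nu \o inl \o Some)) (ren (ren1 d c) (snks (nu \o inl \o Some))) [:: (d, c)] =
    lp ^+ (d == c) * F (srcs (nu \o inl \o Some)) (snks (nu \o inl \o Some)) [::].
  apply: (@F_fuse _ _ [::]) => //; [exact: wf_web | exact: wf_bigon W'].
rewrite EF (reduce_presents (presents_self muI) tG) -(ncirc_cut cx).
have -> : (d == c) = (x == None) by rewrite (inj_eq nuI).
move: (F _ _ _) => z; rewrite exprD /=; ring.
Qed.

Section Cuts.
Variables (G : web) (x : option (edge G)) (y : option (edge (cut x))) (ka : edge (cut y) -> nat).
Hypotheses (kaI : injective ka) (tG : trivalent G) (cx : cuttable x) (cy : cuttable y).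

Let S0 := srcs (ka \o Some \o Some).
Let T0 := cut_snks ka.

Lemma wf_cut2 : wf S0 T0 [:: (ka y, ka None); (cut_in1 ka, ka (Some None))].
Proof.
have muI : injective (ka \o Some \o Some) by move=> e e' /= /kaI [].
have [_ cS cT] := wf_web muI tG; split=> //; last by rewrite /T0 /cut_snks !cubic_ren.
move=> z; have := linear_web kaI z.
rewrite /inn /outn (eqv_occ _ (srcs_cut2 ka)) (eqv_occ _ (snks_cut2 kaI)) /=.
by rewrite -/S0 -/T0; glia.
Qed.

(** Closing up both cuts of a web gives back its value.  The two resolutions of a
    quadrilateral are obtained in this way from the same net with four univalent
    vertices. *)
Lemma reduce_cut2 : lp ^+ ncirc (cut y) *
    F S0 T0 [:: (ka y, ka None); (cut_in1 ka, ka (Some None))] = reduce G.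
Proof.
have muI : injective (ka \o Some \o Some) by move=> e e' /= /kaI [].
have laI : injective (ka \o Some) by move=> e e' /= /kaI [].
have W := wf_web muI tG.
pose T1 := ren (ren1 (ka (Some x)) (ka (Some None))) (snks (ka \o Some \o Some)).
have W1 : wf S0 T1 [:: (ka (Some x), ka (Some None))].
  case: W => _ cS cT; split=> //; last by rewrite /T1 cubic_ren.
  move=> z; have := linear_web laI z.
  by rewrite /inn /outn (eqv_occ _ (srcs_cut _)) (eqv_occ _ (snks_cut laI)) /= -/S0 -/T1; glia.
have n1 : occ (ka (Some None)) (snks (ka \o Some \o Some)) = 0%N.
  by rewrite occ_snks //; case: existsP => // -[e /eqP /kaI].
have n2 : (occ (ka None) T1 + in1 (ka None) [:: (ka (Some x), ka (Some None))] = 0)%N.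
  have : occ (ka None) (snks (ka \o Some)) = 0%N.
    by rewrite occ_snks //; case: existsP => // -[e /eqP /kaI].
  by rewrite (eqv_occ _ (snks_cut laI)) /= -/T1; glia.
have E2 : F S0 T0 [:: (ka y, ka None); (cut_in1 ka, ka (Some None))] =
    lp ^+ (ka y == ka None) * F S0 T1 [:: (ka (Some x), ka (Some None))].
  by apply: (@F_fuse S0 T1 [:: (ka (Some x), ka (Some None))]) => //; [lia | lia | exact: wf_cut2].
have E1 : F S0 T1 [:: (ka (Some x), ka (Some None))] =
    lp ^+ (ka (Some x) == ka (Some None)) * F S0 (snks (ka \o Some \o Some)) [::].
  by apply: (@F_fuse S0 _ [::]) W n1 _ W1.
rewrite E2 E1 (reduce_presents (presents_self muI) tG) -/S0.
move: (F _ _ _) => z; rewrite !(inj_eq kaI) -(ncirc_cut cx) -(ncirc_cut cy) !exprD.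
have -> : (Some x == Some None :> option (option (edge G))) = (x == None) by [].
ring.
Qed.

End Cuts.

(** The two resolutions have the same net after being cut, and the rule for the
    quadrilateral connects its four free ends in the two possible ways. *)
Lemma reduce_quad (G1 : web) (x1 : option (edge G1)) (y1 : option (edge (cut x1)))
    (G2 : web) (x2 : option (edge G2)) (y2 : option (edge (cut x2))) :
  trivalent G1 -> trivalent G2 -> quad_resolutions y1 y2 ->
  reduce (insert_quad y1) = reduce G1 + reduce G2.
Proof.
move=> t1 t2 [[cx1 cy1 cx2 cy2] [i [j [k [I [i1 i2 j1 j2]]]]]].
have [[bi bj bk] [E1 E2 nc]] := I; have [k' kK k'K] := bk.
pose nu := @name0 (insert_quad y1); have nuI : injective nu by apply: name0_inj.
pose ka := nu \o inl; have kaI : injective ka by move=> e e' /= /nuI [].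
pose la := ka \o k'; have laI : injective la.
  by apply: inj_comp => //; apply: can_inj k'K.
have ES := srcs_insert_quad nuI; have ET := snks_insert_quad nuI.
have tI : trivalent (insert_quad y1).
  rewrite (trivalentE nu) (eqv_cubic ES) (eqv_cubic ET) /= /cut_snks !cubic_ren.
  by move: t1; rewrite (trivalentE (nu \o inl \o Some \o Some)).
have W := wf_web nuI tI; have W' := wf_eqv0 W ES ET.
rewrite {1}/reduce -/nu (F_eqv bgE base_eqv base_ren W ES ET (perm_refl _)).
rewrite (F_quad bgE base_eqv base_ren) //.
rewrite mulrDr; congr (_ + _).
  exact: (reduce_cut2 kaI t1 cx1 cy1).
rewrite -(reduce_cut2 laI t2 cx2 cy2) -nc; congr (_ * _).
have la0 : la None = ka None.
  rewrite /la /=; congr ka; apply: (canLR kK); apply/esym/org_cut_None.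
  by rewrite E1.
have la1 : la (Some None) = ka (Some None).
  rewrite /la /=; congr ka; apply: (canLR kK).
  have : org (k (Some None)) = Some None by rewrite E1.
  by case: (k (Some None)) => [e|] //= [/org_cut_None ->].
have la2 : la y2 = cut_in1 ka.
  rewrite /la /=; apply: (cut_in1P kaI); apply: (bij_inj bj).
  by rewrite -E2 k'K j1; apply: (@dst_cut_x _ y2).
have la3 : cut_in1 la = ka y1.
  have [e e0] := ex_cut_in1 y2; rewrite -(cut_in1P laI e0) /la /=; congr ka.
  by apply: dst_cut_None; apply: (bij_inj bj); rewrite -E2 k'K j2.
have kaE : ka = la \o k by apply/funext => e; rewrite /la /= kK.
have S2 : srcs (ka \o Some \o Some) ≡ srcs (la \o Some \o Some).
  have : srcs ka ≡ srcs la by rewrite {1}kaE; apply: stars_iso E1.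
  rewrite eqv_sym => /eqv_trans /(_ (srcs_cut2 ka)); rewrite eqv_sym.
  move/eqv_trans/(_ (srcs_cut2 la)); rewrite la0 la1.
  by rewrite eqv_cons_inj // eqv_cons_inj.
have T2 : cut_snks ka ≡ cut_snks la.
  have : snks ka ≡ snks la by rewrite {1}kaE; apply: stars_iso E2.
  rewrite eqv_sym => /eqv_trans /(_ (snks_cut2 kaI)); rewrite eqv_sym.
  move/eqv_trans/(_ (snks_cut2 laI)); rewrite la2 la3.
  move/eqv_trans/(_ (eqv_swap _ _ _)).
  by rewrite eqv_cons_inj // eqv_cons_inj.
rewrite la0 la1 la2 la3.
apply: (F_eqv bgE base_eqv base_ren) => //; first exact: wf_quad2 W'.
exact: perm2.
Qed.

Lemma reduce_connected G : trivalent G -> connected G -> ~~ has_bigon G -> ~~ has_quad G ->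
  reduce G = val_of G.
Proof.
move=> tG cG nb nq; have /and3P[/eqP nc _ _] := cG.
have P := presents_self (@name0_inj G).
rewrite /reduce nc expr0 mul1r (F_base bgE base_eqv base_ren).
- by rewrite (base_presents P) // (mon_connected val_iso).
- exact: wf_web (@name0_inj G) tG.
- by move=> a b c d S' T' /(presents_bigon tG P); apply/negP.
- by move=> a b c d p q r o S' T' /(presents_quad tG P); apply/negP.
Qed.

End Reduction.

(** * Decomposition of trivalent webs *)

Lemma presents_size G nu S T : @presents G nu S T -> size S = #|src G|.
Proof. by case=> _ /eqv_size -> _; rewrite size_map -cardE. Qed.

Lemma full_cut G x : full G -> full (@cut G x).
Proof.
case=> fo fd; split=> [[p|]|[q|]].
- by have [e <-] := fo p; exists (Some e).
- by exists None.
- have [e <-] := fd q; case: (eqVneq x (Some e)) => [->|ne]; first by exists None.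
  by exists (Some e) => /=; rewrite (negbTE ne).
- by exists x; apply: dst_cut_x.
Qed.

(** Connecting two wires gives a web in which each wire passes through an edge or a
    circle; cutting at these two places separates the four ends again. *)
Lemma two_cuts S T c1 d1 c2 d2 n : wf S T [:: (d1, c1); (d2, c2)] ->
  exists (G : web) (x : option (edge G)) (y : option (edge (cut x))) (ka : edge (cut y) -> nat),
  [/\ trivalent G, cuttable x, cuttable y, #|src G| = size S & ncirc G <= n + 2] /\
  [/\ presents ka ([:: c2] :: [:: c1] :: S) ([:: d2] :: [:: d1] :: T), ncirc (cut y) = n,
      ka None = c2 /\ ka (Some None) = c1, ka y = d2 & cut_in1 ka = d1].
Proof.
move=> W; have [L cS cT] := W; pose w := [:: (d2, c2)]; pose d1' := root w d1.
have L2 : linear ([:: c1] :: S) ([:: d1] :: T) w.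
  by move=> z; have := L z; rewrite /inn /outn /=; glia.
have L1 : linear S (ren (root w) T) [:: (d1', c1)].
  by move=> z; have := linear_root L2 z; rewrite /inn /outn /=; glia.
have W1 := wf_root W.
have [G [nu [P nG]]] := net_web (n + loops [:: (d1, c1); (d2, c2)]) W1.
have E : ren (root [:: (d1, c1); (d2, c2)]) T = ren (root [:: (d1', c1)]) (ren (root w) T).
  by rewrite ren_comp; apply: eq_ren.
have tG := presents_trivalent P cS _; rewrite cubic_ren in tG; have {}tG := tG cT.
have P0 := P; rewrite E in P.
have [|x [ka1 [cx P1 n1 kN [kx kS]]]] := @uncut _ _ _ _ _ _ (n + loops w) L1 P.
  by rewrite nG /d1' /w /=; glia.
have [||y [ka [cy P2 n2 kN2 [ky2 kS2]]]] := @uncut (cut x) ka1 ([:: c1] :: S) ([:: d1] :: T) c2 d2 n L2.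
- exact: P1.
- exact: n1.
have k1 : ka (Some None) = c1 by rewrite -kN -kS2.
exists G, x, y, ka; split; split=> //.
- by rewrite -(presents_size P0).
- by rewrite nG leq_add2l /=; case: (_ == _); case: (_ == _).
have [kaI _ ET] := P2.
have := eqv_trans ET (snks_cut2 kaI); rewrite ky2 eqv_cons_inj //.
case/eqv_consP => [[pe _]|[R [HR _]]].
  by have := perm_cm d1 pe; rewrite /= eqxx; case: eqP.
by have := eqv_cubic HR; rewrite cT.
Qed.

(** Reduce the bigon of the net, present the result by a web, and insert the bigon
    again where the new wire passes. *)
Lemma bigon_case G a b c d S' T' : trivalent G ->
  bigon_at (srcs (@name0 G)) (snks (@name0 G)) a b c d S' T' ->
  exists (G' : web) (x : option (edge G')), [/\ trivalent G', cuttable x, iso G (insert_bigon x),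
    (#|src G'|).+1 = #|src G| & ncirc G' <= (ncirc G).+1].
Proof.
move=> tG [HS HT]; have W := wf_web (@name0_inj G) tG.
have W0 := wf_eqv0 W HS HT; have W1 := wf_bigon W0.
have [G' [nu [P nG]]] := net_web (ncirc G + loops [:: (d, c)]) (wf_root W1).
have [L1 cS cT] := W1.
have tG' : trivalent G' by apply: presents_trivalent P cS _; rewrite cubic_ren.
have [x [ka [cx Q nx kN [kx kS]]]] := uncut L1 P nG.
have HQ := presents_names Q.
pose la (e : edge (insert_bigon x)) := match e with inl e => ka e | inr i => if i then a else b end.
have ab : a != b /\ occ a ([:: c] :: S') + occ b ([:: c] :: S') = 0.
  have := W0 => -[L _ _]; have := L a; have := L b; rewrite /inn /outn /= eqxx.
  by case: (eqVneq a b) => [->|]; rewrite ?eqxx /=; glia.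
case: ab => ab ab0.
have na e : ka e != a.
  by apply/eqP => E; have := HQ a; rewrite (_ : occ a _ = 0); last lia;
    case: existsP => // -[]; exists e; apply/eqP.
have nb e : ka e != b.
  by apply/eqP => E; have := HQ b; rewrite (_ : occ b _ = 0); last lia;
    case: existsP => // -[]; exists e; apply/eqP.
have [kaI ES ET] := Q.
have laI : injective la.
  move=> [e|[]] [e'|[]] //= E; first by rewrite (kaI _ _ E).
  - by have := na e; rewrite E eqxx.
  - by have := nb e; rewrite E eqxx.
  - by have := na e'; rewrite E eqxx.
  - by move: ab; rewrite E eqxx.
  - by have := nb e'; rewrite E eqxx.
  - by move: ab; rewrite E eqxx.
have PI : presents la (srcs (@name0 G)) (snks (@name0 G)).
  split=> //.
    apply: eqv_trans HS _; rewrite eqv_sym; apply: eqv_trans (srcs_insert_bigon laI) _.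
    rewrite /= kN; apply: eqv_cons => //.
    by have := eqv_trans ES (srcs_cut ka); rewrite kN eqv_cons_inj // eqv_sym.
  apply: eqv_trans HT _; rewrite eqv_sym; apply: eqv_trans (snks_insert_bigon laI) _.
  rewrite /= kx; apply: eqv_cons => //.
  by have := eqv_trans ET (snks_cut kaI); rewrite kx eqv_cons_inj // eqv_sym.
exists G', x; split=> //.
- have tI : trivalent (insert_bigon x).
    by have [_ cS' cT'] := W; apply: presents_trivalent PI cS' cT'.
  have [i [j [k [I _]]]] := presents_iso (trivalent_full tG) (trivalent_full tI)
     (presents_self (@name0_inj G)) PI (esym nx).
  by exists i, j, k.
- by rewrite -(presents_size P) -(presents_size (presents_self (@name0_inj G))) (eqv_size HS).
- by rewrite nG /= addn0 -addn1 leq_add2l; case: (d == c).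
Qed.

(** The two resolutions become equal after being cut at the places where the new wires
    pass, as [quad_resolutions] requires.  The ends of the wires are matched in the
    order of the cuts, hence the permutation of the two wires in the second
    resolution. *)
Lemma quad_case G a b c d p q r o S' T' : trivalent G ->
  quad_at (srcs (@name0 G)) (snks (@name0 G)) a b c d p q r o S' T' ->
  exists (G1 : web) (x1 : option (edge G1)) (y1 : option (edge (cut x1)))
         (G2 : web) (x2 : option (edge G2)) (y2 : option (edge (cut x2))),
    [/\ trivalent G1, trivalent G2, quad_resolutions y1 y2 & iso G (insert_quad y1)] /\
    [/\ (#|src G1|).+2 = #|src G|, (#|src G2|).+2 = #|src G|,
       ncirc G1 <= ncirc G + 2 & ncirc G2 <= ncirc G + 2].
Proof.
move=> tG H; have W := wf_web (@name0_inj G) tG; have [HS HT] := H.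
have [W1 W2 sz] := wf_quad W H; have W0 := wf_eqv0 W HS HT.
have [G1 [x1 [y1 [ka [[t1 cx1 cy1 s1 n1] [P1 nc1 [kN kS] ky ki]]]]]] := two_cuts (ncirc G) W1.
have W2' := wf_eqv W2 (eqv_refl _) (eqv_refl _) (perm2 (q, r) (o, p)).
have [G2 [x2 [y2 [la [[t2 cx2 cy2 s2 n2] [P2 nc2 [lN lS] ly li]]]]]] := two_cuts (ncirc G) W2'.
have sG : size (srcs (@name0 G)) = #|src G| by exact: presents_size (presents_self (@name0_inj G)).
exists G1, x1, y1, G2, x2, y2; split; last by rewrite s1 s2 -sG sz.
split=> //.
  split=> //.
  have P2' := presents_eqv (eqv_refl _) (eqv_swap _ _ _) P2.
  have [i [j [k [I kE]]]] := presents_iso (full_cut y1 (full_cut x1 (trivalent_full t1)))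
    (full_cut y2 (full_cut x2 (trivalent_full t2))) P1 P2' (etrans nc1 (esym nc2)).
  exists i, j, k; split=> //; have [_ [E1 E2 _]] := I.
  have [kaI _ _] := P1; have [laI _ _] := P2.
  have k1 : k (Some None) = Some None by apply: (laI); rewrite kE kS lS.
  have k0 : k None = None by apply: (laI); rewrite kE kN lN.
  have [e1 d1] := ex_cut_in1 y1; have [e2 d2] := ex_cut_in1 y2.
  have k2 : k y1 = e2 by apply: (laI); rewrite kE ky (cut_in1P laI d2).
  have k3 : k e1 = y2 by apply: (laI); rewrite kE ly (cut_in1P kaI d1).
  split.
  - by have := E1 (Some None); rewrite k1.
  - by have := E1 None; rewrite k0.
  - have := E2 e1; rewrite k3 d1 => <-; exact: (@dst_cut_x _ y2).
  - have := E2 y1; rewrite k2 d2.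
    by have -> : dst (y1 : edge (cut y1)) = None by exact: dst_cut_x.
have HQ := presents_names P1; have [kaI ES ET] := P1.
pose nu (e : edge (insert_quad y1)) := match e with
  | inl e => ka e
  | inr (true, true) => d
  | inr (true, false) => c
  | inr (false, true) => a
  | inr (false, false) => b end.
have [U U0] : uniq [:: a; b; c; d] /\ forall z, z \in [:: a; b; c; d] ->
    occ z ([:: r] :: [:: p] :: S') = 0.
  have US := wf_uniqS W HS; split.
    move: US; rewrite (_ : flatten _ = [:: a; b; p; c; d] ++ r :: flatten S') // cat_uniq => /andP[+ _].
    by rewrite (perm_uniq (_ : perm_eq _ (p :: [:: a; b; c; d]))) ?cons_uniq => [/andP[]|]; last pm.
  move=> z zi; have [L _ _] := W0; have := L z; rewrite /inn /outn /=.
  have : 0 < cm z [:: a; b; c; d] by rewrite cm_gt0.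
  by rewrite /=; clear; glia.
have nn e z : z \in [:: a; b; c; d] -> ka e != z.
  move=> zi; apply/eqP => E; have := HQ z; rewrite (U0 z zi).
  by case: existsP => // -[]; exists e; apply/eqP.
have nuI : injective nu.
  have mi : {subset [:: d; c; a; b] <= [:: a; b; c; d]}.
    by move=> z; rewrite !inE => /or4P[] ->; rewrite ?orbT.
  have Ho e ij : nu (inl e) <> nu (inr ij).
    move=> E; have zi : nu (inr ij) \in [:: a; b; c; d].
      by case: ij {E} => -[] []; rewrite /= !inE eqxx ?orbT.
    by move/negP: (nn e _ zi); apply; apply/eqP.
  move=> [e|ij] [e'|ij'] E; first by rewrite (kaI _ _ E).
  - by case: (Ho e ij').
  - by case: (Ho e' ij).
  congr inr; move: E U; case: ij => -[] []; case: ij' => -[] [] //= ->;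
    by rewrite !inE !eqxx ?orbT ?andbF.
have PI : presents nu (srcs (@name0 G)) (snks (@name0 G)).
  split=> //.
    apply: eqv_trans HS _; rewrite eqv_sym; apply: eqv_trans (srcs_insert_quad nuI) _.
    rewrite /= kN kS; apply: eqv_trans (eqv_swap _ _ _) _; do 2!apply: eqv_cons => //.
    have := eqv_trans ES (srcs_cut2 ka); rewrite kN kS eqv_cons_inj // eqv_cons_inj //.
    by rewrite eqv_sym.
  apply: eqv_trans HT _; rewrite eqv_sym; apply: eqv_trans (snks_insert_quad nuI) _.
  rewrite /= ky; have -> : cut_in1 (nu \o inl) = q by exact: ki.
  apply: eqv_trans (eqv_swap _ _ _) _; do 2!apply: eqv_cons => //.
  have := eqv_trans ET (snks_cut2 kaI); rewrite ky ki eqv_cons_inj // eqv_cons_inj //.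
  by rewrite eqv_sym.
have tI : trivalent (insert_quad y1).
  by have [_ cS' cT'] := W; apply: presents_trivalent PI cS' cT'.
have [i [j [k [I _]]]] := presents_iso (trivalent_full tG) (trivalent_full tI)
   (presents_self (@name0_inj G)) PI (esym nc1).
by exists i, j, k.
Qed.

(** * Splitting off a component *)

Lemma linked_sym G (p p' : src G) : linked p p' = linked p' p.
Proof.
by apply/existsP/existsP => -[e /existsP[e' /and3P[h1 h2 h3]]];
  exists e'; apply/existsP; exists e; rewrite h2 h1 eq_sym h3.
Qed.

Lemma compo_closed G (p0 p p' : src G) : linked p p' -> (p \in compo p0) = (p' \in compo p0).
Proof.
move=> pp; rewrite !inE; apply/idP/idP => H; apply: connect_trans H (connect1 _) => //.
by rewrite linked_sym.
Qed.

Lemma card_sub_sum (X : finType) (A B : {set X}) : #|{: {x | x \in A} + {x | x \in B}}| = #|A| + #|B|.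
Proof.
rewrite card_sum !card_sig; congr (_ + _); exact: eq_card.
Qed.

Lemma sum_sub_inj (X : Type) (P Q : pred X) : (forall x, P x -> Q x -> False) ->
  injective (fun p : {x | P x} + {x | Q x} => match p with inl p => val p | inr p => val p end).
Proof.
move=> dis [[x Px]|[x Px]] [[y Py]|[y Py]] /= E; subst y.
- by congr inl; apply: val_inj.
- by case: (dis x).
- by case: (dis x).
- by congr inr; apply: val_inj.
Qed.

(** A component and the union of all the others share no vertex. *)
Lemma subweb_dunion G (p0 : src G) : trivalent G -> ncirc G = 0 ->
  iso G (dunion (subweb (compo p0)) (subweb (~: compo p0))).
Proof.
move=> tG nc; apply: iso_sym; set C := compo p0.
have [fo fd] := trivalent_full tG.
pose i (p : {p | p \in C} + {p | p \in ~: C}) := match p with inl p => val p | inr p => val p end.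
pose j (p : {p | p \in nbrs C} + {p | p \in nbrs (~: C)}) := match p with inl p => val p | inr p => val p end.
pose k (p : {e | org e \in C} + {e | org e \in ~: C}) := match p with inl p => val p | inr p => val p end.
exists i, j, k; split; split.
- apply: inj_card_bij; last by rewrite card_sub_sum cardsC.
  by apply: sum_sub_inj => x xC; rewrite inE xC.
- have dis q : q \in nbrs C -> q \in nbrs (~: C) -> False.
    rewrite !inE => /existsP[e /andP[/eqP eq eC]] /existsP[e' /andP[/eqP e'q]].
    rewrite inE -(compo_closed p0 (p := org e)) ?eC //.
    by apply/existsP; exists e; apply/existsP; exists e'; rewrite eq e'q !eqxx.
  apply: inj_card_bij; first exact: sum_sub_inj.
  rewrite card_sub_sum (leq_trans _ (leq_card_setU _ _)) //.
  apply: subset_leq_card; apply/subsetP => q _; have [e <-] := fd q.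
  rewrite in_setU; case: (boolP (org e \in C)) => eC; apply/orP; [left|right];
    by rewrite [dst e \in _]inE; apply/existsP; exists e; rewrite eqxx ?in_setC.
- apply: inj_card_bij; first by apply: sum_sub_inj => x xC; rewrite inE xC.
  rewrite [X in _ <= X]card_sum !card_sig.
  rewrite -[X in _ <= X + _]cardsE -[X in _ <= _ + X]cardsE (leq_trans _ (leq_card_setU [set e | org e \in C] [set e | org e \in ~: C])) //.
  apply: subset_leq_card; apply/subsetP => e _; rewrite !inE.
  by rewrite orbN.
- by case.
- by case.
- by rewrite /= nc.
Qed.

Lemma trivalent_dunionE G H : trivalent (dunion G H) -> trivalent G /\ trivalent H.
Proof.
pose mu (e : edge (dunion G H)) := val (enum_rank e).
rewrite (trivalentE mu) (eqv_cubic (stars_sum _ _ _)) (eqv_cubic (stars_sum _ _ _)).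
rewrite /cubic !all_cat => /andP[/andP[h1 h2] /andP[h3 h4]].
split; [rewrite (trivalentE (mu \o inl)) | rewrite (trivalentE (mu \o inr))].
  by apply/andP.
by apply/andP.
Qed.

(** * The irreducible graphs *)

(** Both sides count a third of the edges. *)
Lemma card_src_snk G : trivalent G -> #|src G| = #|snk G|.
Proof.
move=> tG; have W := wf_web (@name0_inj G) tG; have [L cS cT] := W.
have sz S : cubic S -> size (flatten S) = 3 * size S.
  by elim: S => //= v S IH /andP[/eqP sv /IH E]; rewrite size_cat sv E mulnS.
have : perm_eq (flatten (srcs (@name0 G))) (flatten (snks (@name0 G))).
  apply/seq.allP => x _ /=; rewrite -!occE; have := L x.
  by rewrite /inn /outn /= !addn0 => -[-> _]; apply/eqP.
have -> : #|src G| = size (srcs (@name0 G)) by rewrite size_map -cardE.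
have -> : #|snk G| = size (snks (@name0 G)) by rewrite size_map -cardE.
move/perm_size; rewrite !sz //; lia.
Qed.

(** Without bigons, an edge is determined by its ends. *)
Lemma ex_code G : trivalent G -> ncirc G = 0 -> ~~ has_bigon G -> exists c : code, iso G (code_web c).
Proof.
move=> tG nc nb; pose m := #|src G|.
have cS : #|snk G| = m by rewrite -card_src_snk.
pose i (p : src G) : 'I_m := enum_rank p.
pose j (q : snk G) : 'I_m := cast_ord cS (enum_rank q).
have bi : bijective i by apply: enum_rank_bij.
have bj : bijective j.
  by apply: bij_comp (enum_rank_bij _); exists (cast_ord (esym cS)); [exact: cast_ordK | exact: cast_ordKV].
pose A := [set (i (org e), j (dst e)) | e : edge G].
have hk e : (i (org e), j (dst e)) \in A by apply: imset_f.
exists (Tagged (fun m => {set 'I_m * 'I_m}) A), i, j, (fun e => exist _ (i (org e), j (dst e)) (hk e)).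
split; split=> //.
have inj : injective (fun e => (i (org e), j (dst e))).
  move=> e e' E; have /= /(bij_inj bi) E1 := congr1 fst E; have /= /(bij_inj bj) E2 := congr1 snd E; apply/eqP; apply: contraNT nb => ne.
  by apply/existsP; exists e; apply/existsP; exists e'; rewrite ne E1 E2 !eqxx.
apply: inj_card_bij; first by move=> e e' /(congr1 val) /=; apply: inj.
rewrite card_sig (@eq_card _ _ (mem A)) // card_imset //.
Qed.

Lemma iso_bigon G H : iso G H -> has_bigon H -> has_bigon G.
Proof.
move=> [i [j [k [[bi bj [k' kK k'K]] [E1 E2 _]]]]] /existsP[e /existsP[e' /and3P[ne /eqP o /eqP d]]].
apply/existsP; exists (k' e); apply/existsP; exists (k' e'); apply/and3P; split.
- by rewrite (inj_eq (can_inj k'K)).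
- by rewrite -(inj_eq (bij_inj bi)) -!E1 !k'K o.
- by rewrite -(inj_eq (bij_inj bj)) -!E2 !k'K d.
Qed.

Lemma iso_joined G H i j k p q : @is_iso G H i j k -> joined (i p) (j q) = joined p q.
Proof.
move=> [[bi bj [k' kK k'K]] [E1 E2 _]].
apply/existsP/existsP => -[e /andP[/eqP o /eqP d]].
  exists (k' e); rewrite -(inj_eq (bij_inj bi)) -(inj_eq (bij_inj bj)) -E1 -E2 k'K o d.
  by rewrite !eqxx.
by exists (k e); rewrite E1 E2 o d !eqxx.
Qed.

Lemma iso_quad G H : iso G H -> has_quad H -> has_quad G.
Proof.
move=> [i [j [k I]]]; have [[[i' iK i'K] [j' jK j'K] _] _] := I.
case/existsP=> v1 /existsP[v2 /existsP[v3 /existsP[v4]]].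
rewrite -(i'K v1) -(i'K v3) -(j'K v2) -(j'K v4) !(iso_joined _ _ I).
rewrite (inj_eq (can_inj iK)) (inj_eq (can_inj jK)) => Q.
apply/existsP; exists (i' v1); apply/existsP; exists (j' v2).
by apply/existsP; exists (i' v3); apply/existsP; exists (j' v4).
Qed.

Lemma iso_connected G H : iso G H -> connected G -> connected H.
Proof.
move=> [i [j [k I]]]; have [[[i' iK i'K] [j' jK j'K] _] [E1 E2 nc]] := I.
case/and3P=> nG cG /forallP aG.
pose h (x : src G + snk G) := match x with inl p => inl (i p) | inr q => inr (j q) end : src H + snk H.
have hs y : exists x, h x = y.
  by case: y => [p|q]; [exists (inl (i' p)); rewrite /= i'K | exists (inr (j' q)); rewrite /= j'K].
apply/and3P; split; first by rewrite -nc.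
  move/card_gt0P: cG => [x _]; apply/card_gt0P; by exists (h x).
apply/forallP => y1; apply/forallP => y2.
have [x1 <-] := hs y1; have [x2 <-] := hs y2.
have /forallP/(_ x2)/connectP[s] := aG x1.
elim: s x1 => [|z s IH] x1 /=; first by move=> _ ->.
case/andP=> xz zs ls; apply: connect_trans (connect1 _) (IH z zs ls).
by case: x1 z xz {zs ls} => [p|q] [p'|q'] //=; rewrite (iso_joined _ _ I).
Qed.

Lemma ex_tgraph G : trivalent G -> connected G -> ~~ has_bigon G -> ~~ has_quad G ->
  exists t, iso G (tgraph_web t).
Proof.
move=> tG cG nb nq; have /and3P[/eqP nc _ _] := cG.
have [c I] := ex_code tG nc nb.
have cP : [&& trivalent (code_web c), connected (code_web c),
    ~~ has_bigon (code_web c) & ~~ has_quad (code_web c)].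
  have I' := iso_sym I; apply/and4P; split.
  - exact: iso_trivalent I' tG.
  - exact: iso_connected I cG.
  - by apply: contra nb; apply: iso_bigon.
  - by apply: contra nq; apply: iso_quad.
exists (\pi_(tgraph)%qT (TCode cP)); apply: iso_trans I _.
rewrite /tgraph_web.
have : tcode_iso (TCode cP) (repr (\pi_(tgraph)%qT (TCode cP))).
  by apply/eqmodP; rewrite reprK.
by move/asboolP.
Qed.

Lemma tgraphP t : [/\ trivalent (tgraph_web t), connected (tgraph_web t),
  ~~ has_bigon (tgraph_web t) & ~~ has_quad (tgraph_web t)].
Proof. by apply/and4P; apply: tcode_valP. Qed.

Lemma tgraph_inj t t' : iso (tgraph_web t) (tgraph_web t') -> t = t'.
Proof.
move=> I; rewrite -[t]reprK -[t']reprK; apply/eqmodP; apply/asboolP; exact: I.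
Qed.

(** * Induction on trivalent webs *)

Lemma linked_connected G : trivalent G -> ncirc G = 0 -> (exists p : src G, True) ->
  (forall p p' : src G, connect (@linked G) p p') -> connected G.
Proof.
move=> tG nc [p0 _] H; have [fo fd] := trivalent_full tG.
apply/and3P; split; first by rewrite nc.
  by apply/card_gt0P; exists (inl p0).
have adj e : connect (@adjacent G) (inl (org e)) (inr (dst e)) /\
             connect (@adjacent G) (inr (dst e)) (inl (org e)).
  by split; apply: connect1; apply/existsP; exists e; rewrite !eqxx.
have SS p p' : connect (@adjacent G) (inl p) (inl p').
  have /connectP[s] := H p p'; elim: s p => [|z s IH] p /=; first by move=> _ ->.
  case/andP=> /existsP[e /existsP[e' /and3P[/eqP <- /eqP <- /eqP E]]] zs ls.
  apply: connect_trans (adj e).1 _; rewrite E; apply: connect_trans (adj e').2 _.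
  exact: IH.
apply/forallP => -[p|q]; apply/forallP => -[p'|q'] //.
- have [e <-] := fd q'; exact: connect_trans (SS _ _) (adj e).1.
- have [e <-] := fd q; exact: connect_trans (adj e).2 (SS _ _).
- have [e <-] := fd q; have [e' <-] := fd q'.
  apply: connect_trans (adj e).2 _; exact: connect_trans (SS _ _) (adj e').1.
Qed.

Lemma no_bigon_net G : trivalent G -> ~ (exists a b c d S' T', bigon_at (srcs (@name0 G)) (snks (@name0 G)) a b c d S' T') ->
  ~~ has_bigon G.
Proof.
move=> tG nb; apply/negP => hb; apply: nb.
exact: has_bigon_net tG (presents_self (@name0_inj G)) hb.
Qed.

Lemma no_quad_net G : trivalent G -> ~ (exists a b c d p q r o S' T',
    quad_at (srcs (@name0 G)) (snks (@name0 G)) a b c d p q r o S' T') ->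
  ~~ has_quad G.
Proof.
move=> tG nb; apply/negP => hb; apply: nb.
exact: has_quad_net tG (presents_self (@name0_inj G)) hb.
Qed.

Definition circles_cut (G : web) : web := @Web (src G) (snk G) (edge G) (@org G) (@dst G) (ncirc G).-1.

Lemma iso_circle G : 0 < ncirc G -> iso G (dunion (circles_cut G) circle).
Proof.
move=> nc; exists inl, inl, inl; split; split=> //=.
- by exists (fun p => match p with inl p => p | inr v => of_void _ v end) => // -[].
- by exists (fun p => match p with inl p => p | inr v => of_void _ v end) => // -[].
- by exists (fun p => match p with inl p => p | inr v => of_void _ v end) => // -[].
- by rewrite addn1 prednK.
Qed.

Lemma iso_empty G : trivalent G -> ncirc G = 0 -> #|src G| = 0 -> iso G empty_web.
Proof.
move=> tG nc s0; have [fo fd] := trivalent_full tG.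
have ns (p : src G) : void by have := card0_eq s0 p.
have ne (e : edge G) : void := ns (org e).
have nq (q : snk G) : void.
  have q0 : #|snk G| = 0 by rewrite -card_src_snk.
  by have := card0_eq q0 q.
exists ns, nq, ne; split; split=> //.
- by exists (fun v : void => match v with end) => // p; case: (ns p).
- by exists (fun v : void => match v with end) => // p; case: (nq p).
- by exists (fun v : void => match v with end) => // p; case: (ne p).
Qed.

Lemma card_subweb G (C : {set src G}) : #|src (subweb C)| = #|C|.
Proof. by rewrite /= card_sig; apply: eq_card. Qed.

(** Induction on twice the number of sources plus the number of circles.  Resolving a
    bigon removes one source and may create one circle; a quadrilateral costs two
    sources and may create two circles, whence the factor 2. *)
Lemma trivalent_ind (P : web -> Prop) :
  (forall G H, trivalent G -> iso G H -> P H -> P G) ->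
  P empty_web -> P circle -> (forall t, P (tgraph_web t)) ->
  (forall G H, trivalent G -> trivalent H -> P G -> P H -> P (dunion G H)) ->
  (forall G (x : option (edge G)), trivalent G -> cuttable x -> P G -> P (insert_bigon x)) ->
  (forall G1 (x1 : option (edge G1)) (y1 : option (edge (cut x1)))
          G2 (x2 : option (edge G2)) (y2 : option (edge (cut x2))),
     trivalent G1 -> trivalent G2 -> quad_resolutions y1 y2 -> P G1 -> P G2 -> P (insert_quad y1)) ->
  forall G, trivalent G -> P G.
Proof.
move=> Hi He Hc Ht Hu Hb Hq G.
have [n] := ubnP (2 * #|src G| + ncirc G); elim: n G => // n IH G ltn tG.
have [nc|nc] := posnP (ncirc G); last first.
  apply: (Hi _ _ tG (iso_circle nc)); have tc : trivalent (circles_cut G) by [].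
  apply: Hu => //; first exact: trivalent_circle.
  have lt : 2 * #|src G| + (ncirc G).-1 < n by lia.
  exact: IH.
have [[a [b [c [d [S' [T' H]]]]]]|nb] := pselect (exists a b c d S' T',
    bigon_at (srcs (@name0 G)) (snks (@name0 G)) a b c d S' T').
  have [G' [x [tG' cx I sG nG]]] := bigon_case tG H.
  by apply: (Hi _ _ tG I); apply: Hb => //; apply: IH => //; lia.
have [[a [b [c [d [p [q [r [o [S' [T' H]]]]]]]]]]|nq] := pselect (exists a b c d p q r o S' T',
    quad_at (srcs (@name0 G)) (snks (@name0 G)) a b c d p q r o S' T').
  have [G1 [x1 [y1 [G2 [x2 [y2 [[t1 t2 Q I] [s1 s2 n1 n2]]]]]]]] := quad_case tG H.
  by apply: (Hi _ _ tG I); apply: Hq Q _ _ => //; apply: IH => //; lia.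
have [s0|] := posnP #|src G|; first exact: Hi tG (iso_empty tG nc s0) He.
move/card_gt0P => [p0 _].
have [cT|] := eqVneq (compo p0) setT.
  have cG : connected G.
    apply: (linked_connected tG nc (ex_intro _ p0 I)).
    have H p : connect (@linked G) p0 p by have := in_setT p; rewrite -cT inE.
    move=> p p'; apply: connect_trans (H p').
    have sym : connect_sym (@linked G) by apply: sym_connect_sym => x y; exact: linked_sym.
    by rewrite sym.
  have [t I] := ex_tgraph tG cG (no_bigon_net tG nb) (no_quad_net tG nq).
  exact: Hi tG I (Ht t).
move=> cT; have I := subweb_dunion p0 tG nc.
have [t1 t2] := trivalent_dunionE (iso_trivalent (iso_sym I) tG).
have h1 : 0 < #|compo p0| by apply/card_gt0P; exists p0; exact: compo_refl.
have h2 : 0 < #|~: compo p0|.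
  by rewrite card_gt0; apply: contra cT => /eqP h; rewrite -[compo p0]setCK h setC0.
have h3 := cardsC (compo p0).
by apply: (Hi _ _ tG I); apply: Hu => //; apply: IH => //; rewrite card_subweb /=; lia.
Qed.

(** * Containment *)

Lemma embeds_trans G H K : embeds G H -> embeds H K -> embeds G K.
Proof.
move=> [i [j [k [[ii ij ik] [h1 h2 h3]]]]] [i' [j' [k' [[ii' ij' ik'] [h1' h2' h3']]]]].
exists (i' \o i), (j' \o j), (k' \o k); split; first by split; apply: inj_comp.
by split=> [e|e|] /=; [rewrite h1' h1 | rewrite h2' h2 | apply: leq_trans h3 h3'].
Qed.

Lemma contains_embeds T G H : contains G T -> embeds G H -> contains H T.
Proof. by move=> [T1 s e] GH; exists T1 => //; apply: embeds_trans e GH. Qed.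

Lemma iso_embeds G H : iso G H -> embeds G H.
Proof.
move=> [i [j [k [[bi bj bk] [h1 h2 h3]]]]]; exists i, j, k; split.
  by split; apply: bij_inj.
by split=> //; rewrite h3.
Qed.

Lemma subdivision_ncirc T T1 : subdivision T T1 -> ncirc T = 0 -> ncirc T1 = 0.
Proof. by elim=> // H x _ IH cx /IH n0 /=; case: x cx => [//|]; rewrite n0. Qed.

Lemma subdivision_src T T1 : subdivision T T1 -> #|src T| <= #|src T1|.
Proof. by elim=> // H x _ IH cx /=; rewrite card_option; apply: leqW. Qed.

Lemma contains_src G T : contains G T -> #|src T| <= #|src G|.
Proof.
move=> [T1 /subdivision_src h [i [j [k [[ii _ _] _]]]]].
exact: leq_trans h (leq_card i ii).
Qed.

Lemma contains_refl G H : iso G H -> contains G H.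
Proof. by move=> I; exists H; [exact: subdivision_refl | apply/iso_embeds/iso_sym]. Qed.

(** If the subdivided edge is used by the subdivided copy of T, subdivide this copy
    as well; otherwise it is still there. A circle of T could be lost, as the circle
    that is cut may be the only one. *)
Lemma contains_subdivide G (x : option (edge G)) T : ncirc T = 0 ->
  contains G T -> contains (subdivide x) T.
Proof.
move=> nT [T1 s [i [j [k [[ii ij ik] [h1 h2 h3]]]]]].
have n1 := subdivision_ncirc s nT.
have [[e' E]|ne] := pselect (exists e', x = Some (k e')).
  exists (subdivide (Some e')); first by apply: subdivision_step.
  exists (omap i), (omap j), (fun e => match e with inl e => inl (omap k e) | inr u => inr u end).
  split; split.
  - by move=> [p|] [q|] //= [/ii ->].
  - by move=> [p|] [q|] //= [/ij ->].
  - by move=> [[p|]|u] [[q|]|v] //= []; [move=> /ik -> | move=> ->].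
  - by move=> [[e|]|u] //=; rewrite h1.
  - move=> [[e|]|u] //=; last by rewrite E /= h2.
    by rewrite E (inj_eq Some_inj) (inj_eq ik) (inj_eq Some_inj); case: eqP => //=; rewrite h2.
  - by rewrite /= n1.
exists T1 => //; exists (Some \o i), (Some \o j), (inl \o Some \o k); split; split.
- by move=> p q /= [/ii].
- by move=> p q /= [/ij].
- by move=> p q /= [/ik].
- by move=> e /=; rewrite h1.
- by move=> e /=; rewrite h2; case: eqP => // E; case: ne; exists e.
- by rewrite n1.
Qed.

(** Inserting a bigon in an edge adds an edge to a subdivision of it. *)
Lemma contains_bigon G (x : option (edge G)) T : ncirc T = 0 ->
  contains G T -> contains (insert_bigon x) T.
Proof.
move=> nT /(contains_subdivide x nT) H; apply: contains_embeds H _.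
exists id, id, (fun e => match e with inl e => inl e | inr u => inr true end); split; split=> //.
- by move=> [p|[]] [q|[]] //= [->].
- by move=> [].
- by move=> [].
Qed.

(** Seen from one of its resolutions, a quadrilateral is two subdivided edges together
    with two further edges.  The parameter s tells which pair of opposite edges is
    the added one, so that both resolutions are covered. *)
Lemma contains_quad G1 (x1 : option (edge G1)) (y1 : option (edge (cut x1)))
    G2 (x2 : option (edge G2)) (y2 : option (edge (cut x2))) T s i j k :
  @is_iso (cut y1) (cut y2) i j k -> i (Some None) = Some None -> i None = None ->
  j (Some None) = (if s then None else Some None) -> j None = (if s then Some None else None) ->
  ncirc T = 0 -> contains G1 T -> contains (insert_quad y2) T.
Proof.
move=> [[bi bj bk] [h1 h2 h3]] iS iN jS jN nT H.
pose y : option (edge (subdivide x1)) := omap inl y1.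
have := contains_subdivide y nT (contains_subdivide x1 nT H).
move/contains_embeds; apply.
pose k' (e : edge (subdivide y)) : edge (insert_quad y2) := match e with
  | inl None => inl (k None)
  | inl (Some (inl e)) => inl (k (Some e))
  | inl (Some (inr _)) => inr (false, s)
  | inr _ => inr (true, ~~ s) end.
exists i, j, k'; split; split.
- exact: bij_inj.
- exact: bij_inj.
- by move=> [[[e|[]]|]|[]] [[[e'|[]]|]|[]] //= [] /(bij_inj bk) => [[->]||].
- move=> [[[e|[]]|]|[]]; rewrite /k' /=; [exact: (h1 (Some e)) | by rewrite iS | exact: (h1 None) | by rewrite iN].
- move=> [[[e|[]]|]|[]]; rewrite /k' /=.
  + apply: etrans (h2 (Some e)) _; congr j; rewrite /y /=; by case: (y1).
  + by rewrite /y; case: (y1) => [z|] /=; rewrite jS; case: (s).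
  + apply: etrans (h2 None) _; congr j; rewrite /y /=; by case: (y1).
  + by rewrite jN; case: (s).
- by rewrite -h3 /= /y; case: (y1).
Qed.
Local Open Scope ring_scope.

(** * The reduction map *)

Lemma varAK : varA * varAV = 1.
Proof.
apply: val_inj; rewrite /= mulfV // tofrac_eq0; by rewrite polyX_eq0.
Qed.

Definition bigonM : moduleM := constM (varA ^+ 3 + varAV ^+ 3).
Definition circleM : moduleM := constM (varA ^+ 6 + 1 + varAV ^+ 6).

(** (A^3 + A^-3)^2 = A^6 + 2 + A^-6: the two weights satisfy the relation needed for
    confluence. *)
Lemma bigonME : bigonM * bigonM = circleM + 1.
Proof.
rewrite /bigonM /circleM /constM -mpolyCM -mpolyC1E -monalgUD; congr mkmalgU.
have h := varAK; move: varA varAV h => a b h.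
have -> : (a ^+ 3 + b ^+ 3) * (a ^+ 3 + b ^+ 3) = a ^+ 6 + (a * b) ^+ 3 + (a * b) ^+ 3 + b ^+ 6 by ring.
by rewrite h; ring.
Qed.

(** The value of a component; 0 is a dummy value for the webs which are not
    isomorphic to one of the t. *)
Definition class_of (G : web) : moduleM :=
  if pselect (exists t, iso G (tgraph_web t)) is left h then varM (projT1 (cid h)) else 0.

Lemma class_ofE G t : iso G (tgraph_web t) -> class_of G = varM t.
Proof.
move=> I; rewrite /class_of; case: pselect => [h|[]]; last by exists t.
case: cid => t' I' /=; congr varM; apply: tgraph_inj; exact: iso_trans (iso_sym I') I.
Qed.

Lemma class_of_iso G H : iso G H -> class_of G = class_of H.
Proof.
move=> I; have [[t It]|ne] := pselect (exists t, iso H (tgraph_web t)).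
  by rewrite (class_ofE It) (class_ofE (iso_trans I It)).
rewrite /class_of; case: pselect => [[t It]|_]; last by case: pselect.
by case: ne; exists t; apply: iso_trans (iso_sym I) It.
Qed.

Definition web_value : web -> moduleM := @reduce moduleM bigonM circleM class_of.

Lemma web_value_reduction : reduction_map web_value.
Proof.
split; split.
- exact: @reduce_iso moduleM _ _ bigonME _ class_of_iso.
- split; first exact: @reduce_empty moduleM _ _ bigonME _ class_of_iso.
  exact: @reduce_dunion moduleM _ _ bigonME _ class_of_iso.
- move=> t; have [tr ct nb nq] := tgraphP t.
  rewrite /web_value (@reduce_connected moduleM _ _ bigonME _ class_of_iso) //.
  exact/class_ofE/iso_refl.
- exact: @reduce_circle moduleM _ _ bigonME _ class_of_iso.
- exact: @reduce_bigon moduleM _ _ bigonME _ class_of_iso.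
- exact: @reduce_quad moduleM _ _ bigonME _ class_of_iso.
Qed.

(** The axioms prescribe the value in each case of [trivalent_ind]. *)
Lemma reduction_map_unique f g : reduction_map f -> reduction_map g ->
  forall G, trivalent G -> g G = f G.
Proof.
move=> [[fi [fe fu] ft] [fc fb fq]] [[gi [ge gu] gt] [gc gb gq]].
apply: trivalent_ind.
- by move=> G H tG I E; rewrite (fi _ _ tG I) (gi _ _ tG I).
- exact: etrans ge (esym fe).
- exact: etrans gc (esym fc).
- by move=> t; exact: etrans (gt t) (esym (ft t)).
- move=> G H tG tH EG EH; apply: etrans (gu _ _ tG tH) _.
  by apply: etrans (esym (fu _ _ tG tH)); congr (_ * _).
- move=> G x tG cx E; apply: etrans (gb _ _ tG cx) _.
  by apply: etrans (esym (fb _ _ tG cx)); congr (_ * _).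
- move=> G1 x1 y1 G2 x2 y2 t1 t2 Q E1 E2; apply: etrans (gq _ _ _ _ _ _ t1 t2 Q) _.
  by apply: etrans (esym (fq _ _ _ _ _ _ t1 t2 Q)); congr (_ + _).
Qed.

(** * Graphs with a given coefficient *)

(** A variable is not a product of two nontrivial monomials.  Hence, if t occurs in a
    product of two values, it occurs in one of the factors. *)
Lemma mul_ucm (t : tgraph) (m1 m2 : {cmonom tgraph}) : ucm t = mmul m1 m2 ->
  m1 = ucm t \/ m2 = ucm t.
Proof.
move=> E; have : mdeg (ucm t) = (mdeg m1 + mdeg m2)%N by rewrite E mdegM.
rewrite mdegU; case E1 : (mdeg m1) => [|n].
  by move=> _; right; rewrite E (mdeg_eq0I E1) mul1m.
by move=> [] h; left; rewrite E (_ : m2 = mone) ?mulm1 //; apply: mdeg_eq0I; lia.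
Qed.

Lemma mcoeffM_neq0 (K : monomType) (R : nzRingType) (g h : {malg R[K]}) k : mcoeff k (g * h) != 0 ->
  exists k1 k2, [/\ mcoeff k1 g != 0, mcoeff k2 h != 0 & k = mmul k1 k2].
Proof.
rewrite mcoeff_neq0 => /msuppM_le [k1 [k2 [h1 h2 E]]]; exists k1, k2.
by rewrite !mcoeff_neq0.
Qed.

Lemma tcoefM (z1 z2 : moduleM) t : tcoef (z1 * z2) t != 0 -> tcoef z1 t != 0 \/ tcoef z2 t != 0.
Proof.
move=> /(@mcoeffM_neq0 {cmonom tgraph} laurent) [k1 [k2 [h1 h2 E]]].
case: (mul_ucm E) => Et; [left | right].
  by rewrite Et in h1; exact: h1.
by rewrite Et in h2; exact: h2.
Qed.

Lemma tcoefC a t : tcoef (constM a) t = 0.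
Proof.
apply: etrans (@mcoeffC {cmonom tgraph} laurent a (ucm t)) _.
by have := cm1_eq1 t => ->.
Qed.

Lemma tcoefD (z1 z2 : moduleM) t : tcoef (z1 + z2) t = tcoef z1 t + tcoef z2 t.
Proof. exact: (@mcoeffD {cmonom tgraph} laurent (ucm t) z1 z2). Qed.

Lemma tcoefCM a (z : moduleM) t : tcoef (constM a * z) t = a * tcoef z t.
Proof. exact: (@mcoeffCM {cmonom tgraph} laurent a z (ucm t)). Qed.

Lemma tcoefV t t' : tcoef (varM t') t = (t' == t)%:R.
Proof.
apply: etrans (@mcoeffU {cmonom tgraph} laurent (ucm t') 1 (ucm t)) _.
congr (_%:R); congr nat_of_bool; apply/eqP/eqP => [E|-> //].
by have := ucmE t' t; rewrite E ucmE eqxx; case: eqP.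
Qed.

(** By induction on the construction of G from its reductions: a nonzero coefficient
    comes from one of the graphs to which G reduces, and t is still contained in G
    after the reduction is undone. *)
Lemma tcoef_contains f t G : reduction_map f -> trivalent G ->
  tcoef (f G) t != 0 -> contains G (tgraph_web t).
Proof.
move=> [[fi [fe fu] ft] [fc fb fq]].
have nt : ncirc (tgraph_web t) = 0%N by [].
move: G; apply: trivalent_ind.
- move=> G H tG I IH; rewrite (fi _ _ tG I) => /IH h.
  by apply: contains_embeds h _; apply/iso_embeds/iso_sym.
- have -> : f empty_web = constM 1 by exact: fe.
  by rewrite tcoefC eqxx.
- have -> : f circle = constM (varA ^+ 6 + 1 + varAV ^+ 6) by exact: fc.
  by rewrite tcoefC eqxx.
- move=> t'; have -> := ft t'; rewrite tcoefV; case: (eqVneq t' t) => [-> _|_]; last by rewrite eqxx.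
  exact/contains_refl/iso_refl.
- move=> G H tG tH IG IH; have -> := fu _ _ tG tH; move=> /tcoefM [/IG|/IH] h; apply: contains_embeds h _.
    exists inl, inl, inl; split; split=> //; first by move=> ? ? [].
    + by move=> ? ? [].
    + by move=> ? ? [].
    + exact: leq_addr.
  exists inr, inr, inr; split; split=> //; first by move=> ? ? [].
  + by move=> ? ? [].
  + by move=> ? ? [].
  + exact: leq_addl.
- move=> G x tG cx IH; have -> := fb _ _ tG cx; move=> /tcoefM [|/IH]; first by rewrite tcoefC eqxx.
  exact: contains_bigon.
- move=> G1 x1 y1 G2 x2 y2 t1 t2 Q I1 I2; have -> := fq _ _ _ _ _ _ t1 t2 Q; rewrite tcoefD => h.
  have [h1|h1] := eqVneq (tcoef (f G1) t) 0; last first.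
    apply: (@contains_quad _ _ y1 _ _ y1 _ false id id id) (I1 h1) => //.
    by split; split=> //; exists id.
  move: h; rewrite h1 add0r => h.
  have [_ [i [j [k [I [iS iN jS jN]]]]]] := Q.
  have [[[i' iK i'K] [j' jK j'K] [k' kK k'K]] [E1 E2 nc]] := I.
  apply: (@contains_quad _ _ y2 _ _ y1 _ true i' j' k') (I2 h) => //.
  + split; first by split; [exists i | exists j | exists k].
    by split=> // e; [rewrite -{2}(k'K e) E1 iK | rewrite -{2}(k'K e) E2 jK].
  + by rewrite -iS iK.
  + by rewrite -iN iK.
  + by rewrite -jN jK.
  + by rewrite -jS jK.
Qed.

(** * Coefficients modulo two at A = 1 *)

Lemma laurent_fraction (x : laurent) : exists pn : {poly int} * nat,
  laurent_val x == tofrac pn.1 / tofrac 'X^(pn.2).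
Proof. by have /asboolP [p [n E]] := laurent_valP x; exists (p, n); apply/eqP. Qed.

(** The reduction modulo 2 of the value at A = 1, computed on any representative p / X^n. *)
Definition eval2 (x : laurent) : 'F_2 := (xchoose (laurent_fraction x)).1.[1]%:~R.

Lemma eval2E (x : laurent) p n : laurent_val x = tofrac p / tofrac 'X^n -> eval2 x = p.[1]%:~R.
Proof.
move=> E; rewrite /eval2; have /eqP := xchooseP (laurent_fraction x).
case: xchoose => q m /=; rewrite E => {}E; congr (_%:~R).
have X0 k : tofrac ('X^k : {poly int}) != 0.
  by rewrite tofrac_eq0 monic_neq0 // monicXn.
move/eqP: E; rewrite eqr_div // -!tofracM tofrac_eq => /eqP E.
have := congr1 (horner_eval 1) E; rewrite /horner_eval !hornerM !hornerXn !expr1n !mulr1.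
by move=> ->.
Qed.

Lemma eval2_fraction x : exists p n, laurent_val x = tofrac p / tofrac 'X^n /\ eval2 x = p.[1]%:~R.
Proof.
have [[p n] /eqP E] := laurent_fraction x; exists p, n; split=> //; exact: eval2E E.
Qed.

Lemma eval2D x y : eval2 (x + y) = eval2 x + eval2 y.
Proof.
have X0 k : tofrac ('X^k : {poly int}) != 0.
  by rewrite tofrac_eq0 monic_neq0 // monicXn.
have [p [n [E1 ->]]] := eval2_fraction x; have [q [m [E2 ->]]] := eval2_fraction y.
rewrite (@eval2E _ (p * 'X^m + q * 'X^n) (n + m)).
  by rewrite hornerD !hornerM !hornerXn !expr1n !mulr1 rmorphD.
by rewrite /= E1 E2 exprD tofracM tofracD !tofracM addf_div.
Qed.

Lemma eval2M x y : eval2 (x * y) = eval2 x * eval2 y.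
Proof.
have [p [n [E1 ->]]] := eval2_fraction x; have [q [m [E2 ->]]] := eval2_fraction y.
rewrite (@eval2E _ (p * q) (n + m)).
  by rewrite hornerM rmorphM.
by rewrite /= E1 E2 exprD !tofracM mulf_div.
Qed.

Lemma eval2_0 : eval2 0 = 0.
Proof. by rewrite (@eval2E _ 0 0) ?horner0 // tofrac0 mul0r. Qed.

Lemma eval2_1 : eval2 1 = 1.
Proof. by rewrite (@eval2E _ 1 0) ?hornerC // expr0 tofrac1 divr1. Qed.

Lemma eval2_A : eval2 varA = 1.
Proof. by rewrite (@eval2E _ 'X 0) ?hornerX // expr0 tofrac1 divr1. Qed.

Lemma eval2_AV : eval2 varAV = 1.
Proof. by have := eval2_1; rewrite -varAK eval2M eval2_A mul1r. Qed.

Definition tcoef2 t (z : moduleM) : 'F_2 := eval2 (tcoef z t).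

Lemma tcoef2D t z1 z2 : tcoef2 t (z1 + z2) = tcoef2 t z1 + tcoef2 t z2.
Proof. by rewrite /tcoef2 tcoefD eval2D. Qed.

Lemma tcoef2C t a z : tcoef2 t (constM a * z) = eval2 a * tcoef2 t z.
Proof. by rewrite /tcoef2 tcoefCM eval2M. Qed.

Lemma F2_addrr (x : 'F_2) : x + x = 0.
Proof. by case: x => -[|[|]] // i; apply: val_inj. Qed.

Lemma eval2X x n : eval2 (x ^+ n) = eval2 x ^+ n.
Proof. by elim: n => [|n IH]; rewrite ?expr0 ?eval2_1 // !exprS eval2M IH. Qed.

(** A^3 + A^-3 is 2 at A = 1. *)
Lemma tcoef2_bigon t z : tcoef2 t (bigonM * z) = 0.
Proof.
by rewrite tcoef2C eval2D !eval2X eval2_A eval2_AV !expr1n F2_addrr mul0r.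
Qed.

(** A^6 + 1 + A^-6 is 3 at A = 1. *)
Lemma tcoef2_circle t z : tcoef2 t (circleM * z) = tcoef2 t z.
Proof.
by rewrite tcoef2C !eval2D !eval2X eval2_A eval2_AV eval2_1 !expr1n F2_addrr add0r mul1r.
Qed.

Lemma tcoef2_circles t n z : tcoef2 t (circleM ^+ n * z) = tcoef2 t z.
Proof.
elim: n => [|n IH]; first by rewrite expr0 mul1r.
rewrite exprS -mulrA; move: IH; move: (circleM ^+ n * z) => y <-.
exact: tcoef2_circle.
Qed.

Lemma tcoef2_var t : tcoef2 t (varM t) = 1.
Proof. by rewrite /tcoef2 tcoefV eqxx eval2_1. Qed.

Lemma tcoef2_neq0 t z : tcoef2 t z != 0 -> tcoef z t != 0.
Proof. by apply: contraNneq => E; rewrite /tcoef2 E eval2_0. Qed.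

Local Close Scope ring_scope.

(** * State sums of nets with crossings *)

(** A crossing of the strands a and b, by the names of its four ends; [mid] names the
    edge which the unoriented state adds. *)
Record crossing := Crossing { in_a : nat; out_a : nat; in_b : nat; out_b : nat; mid : nat }.

Definition crossing_names c := (in_a c, out_a c, in_b c, out_b c, mid c).

Lemma crossing_namesK :
  cancel crossing_names (fun t => Crossing t.1.1.1.1 t.1.1.1.2 t.1.1.2 t.1.2 t.2).
Proof. by case. Qed.

HB.instance Definition _ := Equality.copy crossing (can_type crossing_namesK).

(** The strands go straight through a virtual crossing, and they are exchanged by the
    oriented state of a classical one. *)
Definition wiresV c : wires := [:: (in_a c, out_a c); (in_b c, out_b c)].
Definition wiresO c : wires := [:: (in_a c, out_b c); (in_b c, out_a c)].
(** The unoriented state: the sink receives the two incoming edges, the source emits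
    the two outgoing ones. *)
Definition srcU c : seq nat := [:: mid c; out_a c; out_b c].
Definition snkU c : seq nat := [:: mid c; in_a c; in_b c].

(** Crossings with a mark, true for those to be resolved. *)
Notation kinds := (seq (bool * crossing)).
Definition srcsU (L : kinds) : names := [seq srcU x.2 | x <- L].
Definition snksU (L : kinds) : names := [seq snkU x.2 | x <- L].

(** Well-formedness of the net in which all the crossings are unoriented.  It implies
    that of the nets of all the states, by [wfZ_O], [wfZ_V] and [wfZ_U]. *)
Definition wfZ (L : kinds) S T w := wf (srcsU L ++ S) (snksU L ++ T) w.

Ltac lin H := split=> //= z; have := H z; rewrite /outn /inn /= ?occ_cat ?in1_cat ?in2_cat /=; glia.

Lemma wfZ_O k c L S T w : wfZ ((k, c) :: L) S T w -> wfZ L S T (wiresO c ++ w).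
Proof. by case=> H /andP[_ h1] /andP[_ h2]; lin H. Qed.

Lemma wfZ_V k c L S T w : wfZ ((k, c) :: L) S T w -> wfZ L S T (wiresV c ++ w).
Proof. by case=> H /andP[_ h1] /andP[_ h2]; lin H. Qed.

Lemma wfZ_U k c L S T w : wfZ ((k, c) :: L) S T w -> wfZ L (srcU c :: S) (snkU c :: T) w.
Proof.
case=> H h1 h2; split.
- move=> z; have := H z; rewrite /outn /inn /= ?occ_cat /=; glia.
- move: h1; rewrite /cubic /= !all_cat /= => ->; by [].
- move: h2; rewrite /cubic /= !all_cat /= => ->; by [].
Qed.

Lemma wf_perm S T w S' T' w' : wf S T w -> perm_eq S S' -> perm_eq T T' -> perm_eq w w' -> wf S' T' w'.
Proof. by move=> W ES ET Ew; apply: wf_eqv W (eqv_perm ES) (eqv_perm ET) Ew. Qed.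

Lemma wfZ_perm L L' S T w : perm_eq L L' -> wfZ L S T w -> wfZ L' S T w.
Proof.
move=> P W; apply: wf_perm W _ _ _ => //; apply: perm_cat => //; exact: perm_map.
Qed.

Lemma wfZ_eqv L S T w S' T' w' : wfZ L S T w -> S ≡ S' -> T ≡ T' -> perm_eq w w' -> wfZ L S' T' w'.
Proof.
by move=> W ES ET Ew; apply: wf_eqv W _ _ Ew; apply: eqv_cat => //; exact: eqv_refl.
Qed.

(** A wire (a, b) is absorbed by renaming the strand at the place where it is emitted. *)
Definition ren_out (r : nat -> nat) (c : crossing) : crossing :=
  Crossing (in_a c) (r (out_a c)) (in_b c) (r (out_b c)) (r (mid c)).

Definition ren_all (r : nat -> nat) (c : crossing) : crossing :=
  Crossing (r (in_a c)) (r (out_a c)) (r (in_b c)) (r (out_b c)) (r (mid c)).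

Definition on_snd (f : crossing -> crossing) (L : kinds) : kinds := [seq (x.1, f x.2) | x <- L].

Definition flip (c : crossing) : crossing := Crossing (in_b c) (out_b c) (in_a c) (out_a c) (mid c).

Lemma perm_catCA' (X : eqType) (a b c : seq X) : perm_eq (a ++ b ++ c) (b ++ a ++ c).
Proof. by rewrite perm_catCA. Qed.

(** Local pictures are evaluated by naming the positions of the stars and wires to
    which a rule is applied. *)
Fixpoint rm (X : Type) (j : nat) (s : seq X) : seq X :=
  match s, j with
  | [::], _ => [::]
  | _ :: s', 0 => s'
  | x :: s', j'.+1 => x :: rm j' s'
  end.

Fixpoint upd (X : Type) (j : nat) (y : X) (s : seq X) : seq X :=
  match s, j with
  | [::], _ => [::]
  | _ :: s', 0 => y :: s'
  | x :: s', j'.+1 => x :: upd j' y s'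
  end.

Lemma perm_rm (X : eqType) (x0 : X) j s : j < size s -> perm_eq s (nth x0 s j :: rm j s).
Proof.
elim: s j => //= x s IH [|j] //= H.
apply: perm_trans (perm_catCA' [:: x] [:: nth x0 s j] (rm j s)); rewrite /= perm_cons; exact: IH.
Qed.

Lemma perm_upd (X : eqType) j y (s : seq X) : j < size s -> perm_eq (upd j y s) (y :: rm j s).
Proof.
elim: s j => //= x s IH [|j] //= H.
apply: perm_trans (perm_catCA' [:: x] [:: y] (rm j s)); rewrite /= perm_cons; exact: IH.
Qed.

Lemma eqv_rm T i k : i < size T -> k < size (nth [::] T i) ->
  T ≡ (nth 0 (nth [::] T i) k :: rm k (nth [::] T i)) :: rm i T.
Proof.
move=> hi hk; apply: eqv_trans (eqv_perm (perm_rm [::] hi)) _.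
by apply: eqv_cons; [exact: perm_rm | exact: eqv_refl].
Qed.

Lemma eqv_upd T i k a : i < size T -> k < size (nth [::] T i) ->
  upd i (upd k a (nth [::] T i)) T ≡ (a :: rm k (nth [::] T i)) :: rm i T.
Proof.
move=> hi hk; apply: eqv_trans (eqv_perm (perm_upd _ hi)) _.
by apply: eqv_cons; [exact: perm_upd | exact: eqv_refl].
Qed.

Lemma eqv_c2 v v1 v2 S S' : perm_eq v v2 -> S ≡ v1 :: S' -> v :: S ≡ v1 :: v2 :: S'.
Proof. by move=> E H; apply: eqv_trans (eqv_swap _ _ _); apply: eqv_cons. Qed.

Lemma eqv_c3 v v1 v2 v3 S S' : perm_eq v v3 -> S ≡ v1 :: v2 :: S' -> v :: S ≡ v1 :: v2 :: v3 :: S'.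
Proof.
move=> E H; apply: eqv_trans (eqv_cons (perm_refl v1) (eqv_swap _ _ _)).
exact: eqv_c2.
Qed.

Ltac eqvt := first [exact: eqv_refl | apply: eqv_cons; [pm | eqvt]
  | apply: eqv_c2; [pm | eqvt] | apply: eqv_c3; [pm | eqvt]].

(** The properties of the coefficient of t modulo 2 on which the invariance of the
    state sum relies; [rule_bigon] and [rule_loop] give a bigon the value 0 and a
    circle the value 1. *)
Record net_rules (Phi : names -> names -> wires -> 'F_2) : Prop := NetRules {
  rule_eqv : forall S S' T T' w w', wf S T w ->
  S ≡ S' -> T ≡ T' -> perm_eq w w' -> Phi S T w = Phi S' T' w';
  rule_ren : forall r S T w, wf S T w -> injon r S w ->
  Phi (ren r S) (ren r T) (renw r w) = Phi S T w;
  rule_wire2 : forall S T w a b, wf S T ((a, b) :: w) -> a != b ->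
  Phi S T ((a, b) :: w) = Phi (ren (ren1 a b) S) T (resnd (ren1 a b) w);
  rule_in : forall S T w a b v, wf S ((b :: v) :: T) ((a, b) :: w) ->
  Phi S ((b :: v) :: T) ((a, b) :: w) = Phi S ((a :: v) :: T) w;
  rule_ww : forall S T w a b c, wf S T ((a, b) :: (b, c) :: w) ->
  Phi S T ((a, b) :: (b, c) :: w) = Phi S T ((a, c) :: w);
  rule_out : forall S T w a b v, wf ((a :: v) :: S) T ((a, b) :: w) ->
  Phi ((a :: v) :: S) T ((a, b) :: w) = Phi ((b :: v) :: S) T w;
  rule_loop : forall S T w a, wf S T ((a, a) :: w) -> Phi S T ((a, a) :: w) = Phi S T w;
  rule_bigon : forall a b c d S T w, wf ([:: a; b; c] :: S) ([:: a; b; d] :: T) w ->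
  Phi ([:: a; b; c] :: S) ([:: a; b; d] :: T) w = 0%R;
  rule_quad : forall a b c d p q r o S T w,
  wf ([:: a; b; p] :: [:: c; d; r] :: S) ([:: b; c; q] :: [:: d; a; o] :: T) w ->
  Phi ([:: a; b; p] :: [:: c; d; r] :: S) ([:: b; c; q] :: [:: d; a; o] :: T) w =
  (Phi S T ((q, p) :: (o, r) :: w) + Phi S T ((q, r) :: (o, p) :: w))%R }.

Section StateSum.
Local Open Scope ring_scope.

Variable Phi : names -> names -> wires -> 'F_2.
Hypothesis HPhi : net_rules Phi.

Let Phi_eqv := rule_eqv HPhi.
Let Phi_ren := rule_ren HPhi.
Let Phi_wire2 := rule_wire2 HPhi.
Let Phi_in := rule_in HPhi.
Let Phi_ww := rule_ww HPhi.
Let Phi_out := rule_out HPhi.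
Let Phi_loop := rule_loop HPhi.
Let Phi_bigon := rule_bigon HPhi.
Let Phi_quad := rule_quad HPhi.

(** The sum over the states of the crossings in L, the context being described by S,
    T and w. *)
Fixpoint Z (L : kinds) S T w : 'F_2 :=
  match L with
  | [::] => Phi S T w
  | (k, c) :: L' => if k then Z L' S T (wiresO c ++ w) + Z L' (srcU c :: S) (snkU c :: T) w
                    else Z L' S T (wiresV c ++ w)
  end.

Lemma Z_eqv L S S' T T' w w' : wfZ L S T w -> S ≡ S' -> T ≡ T' -> perm_eq w w' ->
  Z L S T w = Z L S' T' w'.
Proof.
elim: L S S' T T' w w' => [|[k c] L IH] S S' T T' w w' W ES ET Ew /=; first exact: Phi_eqv.
have eO v : perm_eq (v ++ w) (v ++ w') by apply: perm_cat.
case: k W => W; last by apply: (IH) => //; [exact: wfZ_V W | exact: (eO (wiresV c))].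
congr (_ + _); first by apply: (IH) => //; [exact: wfZ_O W | exact: (eO (wiresO c))].
by apply: (IH) => //; [exact: wfZ_U W | apply: eqv_cons | apply: eqv_cons].
Qed.

Lemma Z_swap x y L S T w : wfZ (x :: y :: L) S T w ->
  Z (x :: y :: L) S T w = Z (y :: x :: L) S T w.
Proof.
case: x => k c; case: y => l d W.
have W1 := wfZ_perm (perm_catCA' [:: (k, c)] [:: (l, d)] L) W.
case: k W W1 => W W1; case: l W W1 => W W1 /=.
- rewrite -!addrA; congr (_ + _).
    apply: Z_eqv (eqv_refl _) (eqv_refl _) (perm_catCA' (wiresO d) (wiresO c) w).
    exact: wfZ_O (wfZ_O W).
  rewrite addrCA; congr (_ + (_ + _)).
  apply: Z_eqv (eqv_swap _ _ _) (eqv_swap _ _ _) (perm_refl _).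
  exact: wfZ_U (wfZ_U W).
- congr (_ + _).
  apply: Z_eqv (eqv_refl _) (eqv_refl _) (perm_catCA' (wiresV d) (wiresO c) w).
  exact: wfZ_V (wfZ_O W).
- congr (_ + _).
  apply: Z_eqv (eqv_refl _) (eqv_refl _) (perm_catCA' (wiresO d) (wiresV c) w).
  exact: wfZ_O (wfZ_V W).
- apply: Z_eqv (eqv_refl _) (eqv_refl _) (perm_catCA' (wiresV d) (wiresV c) w).
  exact: wfZ_V (wfZ_V W).
Qed.

Lemma Z_cons x L L' S T w : (forall S T w, wfZ L S T w -> Z L S T w = Z L' S T w) ->
  wfZ (x :: L) S T w -> Z (x :: L) S T w = Z (x :: L') S T w.
Proof.
case: x => -[] c H W /=; last by apply: H; exact: wfZ_V W.
by rewrite (H _ _ _ (wfZ_O W)) (H _ _ _ (wfZ_U W)).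
Qed.

Lemma Z_move x L1 L2 S T w : wfZ (L1 ++ x :: L2) S T w ->
  Z (L1 ++ x :: L2) S T w = Z (x :: L1 ++ L2) S T w.
Proof.
elim: L1 S T w => //= y L1 IH S T w W.
rewrite -[RHS]Z_swap.
  by apply: Z_cons W => S' T' w' W'; apply: IH.
apply: wfZ_perm W; rewrite /= perm_cons; exact: perm_catCA' L1 [:: x] L2.
Qed.

Lemma Z_perm L L' S T w : perm_eq L L' -> wfZ L S T w -> Z L S T w = Z L' S T w.
Proof.
elim: L L' S T w => [|x L IH] L' S T w; first by rewrite perm_sym => /perm_nilP ->.
move=> P W; have xL : x \in L' by rewrite -(perm_mem P) mem_head.
have W' := wfZ_perm P W.
case/splitPr: xL P W' => L1 L2 P W'; rewrite Z_move //.
apply: Z_cons W => S' T' w' W2; apply: IH W2.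
by move: P; rewrite perm_sym perm_catC /= perm_cons perm_catC perm_sym.
Qed.

(** A local identity may be applied within any diagram. *)
Lemma Z_local L L1 L2 S T w :
  (forall S T w, wfZ L1 S T w -> wfZ L2 S T w -> Z L1 S T w = Z L2 S T w) ->
  wfZ (L ++ L1) S T w -> wfZ (L ++ L2) S T w -> Z (L ++ L1) S T w = Z (L ++ L2) S T w.
Proof.
move=> H; elim: L S T w => [|[k c] L IH] S T w W1 W2 /=; first exact: H.
case: k W1 W2 => W1 W2; last by apply: IH; [exact: wfZ_V W1 | exact: wfZ_V W2].
by rewrite (IH _ _ _ (wfZ_O W1) (wfZ_O W2)) (IH _ _ _ (wfZ_U W1) (wfZ_U W2)).
Qed.

Lemma flip_srcU c : perm_eq (srcU (flip c)) (srcU c).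
Proof. by rewrite /srcU /=; pm. Qed.

Lemma flip_snkU c : perm_eq (snkU (flip c)) (snkU c).
Proof. by rewrite /snkU /=; pm. Qed.

Lemma Z_flip (b : bool) k c L S T w : wfZ ((k, c) :: L) S T w ->
  Z ((k, if b then flip c else c) :: L) S T w = Z ((k, c) :: L) S T w.
Proof.
case: b => // W; case: k W => W /=; [congr (_ + _) | ]; apply: esym.
- by apply: Z_eqv (wfZ_O W) _ _ _; rewrite ?eqv_refl // /wiresO /=; pm.
- by apply: Z_eqv (wfZ_U W) _ _ _ => //; apply: eqv_cons; rewrite ?eqv_refl // perm_sym ?flip_srcU ?flip_snkU.
- by apply: Z_eqv (wfZ_V W) _ _ _; rewrite ?eqv_refl // /wiresV /=; pm.
Qed.

Lemma wfZ_flip (b : bool) k c L S T w : wfZ ((k, c) :: L) S T w ->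
  wfZ ((k, if b then flip c else c) :: L) S T w.
Proof.
case: b => // W; apply: wf_eqv W _ _ (perm_refl _); apply: eqv_cons; rewrite ?eqv_refl // perm_sym.
- exact: flip_srcU.
- exact: flip_snkU.
Qed.

Lemma Z_flips (I : Type) (k : I -> bool) (c : I -> crossing) (b : I -> bool) (s : seq I) S T w :
  wfZ [seq (k i, c i) | i <- s] S T w ->
  Z [seq (k i, if b i then flip (c i) else c i) | i <- s] S T w = Z [seq (k i, c i) | i <- s] S T w.
Proof.
elim: s S T w => //= i s IH S T w W; apply: etrans _ (Z_flip (b i) W).
have W' := wfZ_flip (b i) W; move: W'; set c' := (if b i then _ else _) => W'.
apply/esym; apply: Z_cons W' => S' T' w' W'; apply/esym; exact: IH W'.
Qed.

Lemma Z_ren r L S T w : wfZ L S T w -> injon r (srcsU L ++ S) w ->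
  Z (on_snd (ren_all r) L) (ren r S) (ren r T) (renw r w) = Z L S T w.
Proof.
elim: L S T w => [|[k c] L IH] S T w W inj /=; first exact: Phi_ren.
have inj' L' S' w' : (forall x, outn x (srcsU L' ++ S') w' <= outn x (srcsU ((k, c) :: L) ++ S) w)%N ->
    injon r (srcsU L' ++ S') w'.
  by move=> H x y hx hy; apply: inj; [apply: leq_trans hx (H x) | apply: leq_trans hy (H y)].
have hO : injon r (srcsU L ++ S) (wiresO c ++ w).
  by apply: inj' => x; rewrite /outn /= !occ_cat /=; lia.
have hV : injon r (srcsU L ++ S) (wiresV c ++ w).
  by apply: inj' => x; rewrite /outn /= !occ_cat /=; lia.
have hU : injon r (srcsU L ++ srcU c :: S) w.
  by apply: inj' => x; rewrite /outn /= !occ_cat /=; lia.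
rewrite -(IH _ _ _ (wfZ_O W) hO) -(IH _ _ _ (wfZ_U W) hU) -(IH _ _ _ (wfZ_V W) hV) //.
Qed.

Lemma in1_resnd r y w : in1 y (resnd r w) = in1 y w.
Proof. by elim: w => //= -[c d] w ->. Qed.

Lemma in2_resnd1 b a y w : a != b -> in2 y (resnd (ren1 b a) w) =
  (if y == b then 0 else in2 y w + (y == a) * in2 b w)%N.
Proof.
move=> ab; elim: w => [|[c d] w IH] /=; first by case: ifP => //; rewrite muln0.
by rewrite IH /ren1 /=; ifs; lia.
Qed.

Lemma wf_wire2 S T w a b : wf S T ((a, b) :: w) -> a != b ->
  wf (ren (ren1 a b) S) T (resnd (ren1 a b) w).
Proof.
case=> L cS cT ab; split=> //; last by rewrite cubic_ren.
have ba : b != a by rewrite eq_sym.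
move=> y; have := L y; have := L a; have := L b.
rewrite /outn /inn /= in1_resnd occ_ren1 // in2_resnd1 // !eqxx (negbTE ab) (negbTE ba).
by ifs; lia.
Qed.

(** A wire can be removed by renaming; this is how nodes are erased. *)
Lemma Z_wire2 L S T w a b : wfZ L S T ((a, b) :: w) -> a != b ->
  Z L S T ((a, b) :: w) =
  Z (on_snd (ren_out (ren1 a b)) L) (ren (ren1 a b) S) T (resnd (ren1 a b) w).
Proof.
move=> W ab; elim: L S T w W => [|[k c] L IH] S T w W /=; first exact: Phi_wire2.
have P v : perm_eq (v ++ (a, b) :: w) ((a, b) :: (v ++ w)).
  by rewrite perm_catC /= perm_cons perm_catC.
have EW v : wfZ L S T (v ++ (a, b) :: w) -> Z L S T (v ++ (a, b) :: w) =
    Z (on_snd (ren_out (ren1 a b)) L) (ren (ren1 a b) S) T (resnd (ren1 a b) (v ++ w)).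
  move=> WO; rewrite (Z_eqv WO (eqv_refl _) (eqv_refl _) (P _)); apply: IH.
  exact: wfZ_eqv WO (eqv_refl _) (eqv_refl _) (P _).
case: k W => W; last exact: EW (wfZ_V W).
rewrite (EW (wiresO c) (wfZ_O W)) (IH _ _ _ (wfZ_U W)).
congr (_ + _); congr Z; rewrite /= /snkU /=; congr ((_ :: _) :: _).
rewrite /ren1; case: eqP => // E.
have [+ _ _] := W => /(_ a); rewrite -E /outn /inn /= eqxx; lia.
Qed.

Lemma Z_loop L S T w a : wfZ L S T ((a, a) :: w) -> Z L S T ((a, a) :: w) = Z L S T w.
Proof.
elim: L S T w => [|[k c] L IH] S T w W /=; first exact: Phi_loop.
have P v : perm_eq (v ++ (a, a) :: w) ((a, a) :: (v ++ w)).
  by rewrite perm_catC /= perm_cons perm_catC.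
have EO : Z L S T (wiresO c ++ (a, a) :: w) = Z L S T (wiresO c ++ w).
  have WO := wfZ_O W; rewrite (Z_eqv WO (eqv_refl _) (eqv_refl _) (P _)); apply: IH.
  exact: wfZ_eqv WO (eqv_refl _) (eqv_refl _) (P _).
have EV : Z L S T (wiresV c ++ (a, a) :: w) = Z L S T (wiresV c ++ w).
  have WO := wfZ_V W; rewrite (Z_eqv WO (eqv_refl _) (eqv_refl _) (P _)); apply: IH.
  exact: wfZ_eqv WO (eqv_refl _) (eqv_refl _) (P _).
by case: k W => W; rewrite ?EV ?EO // (IH _ _ _ (wfZ_U W)).
Qed.

(** Each step lemma applies one rule to stars and wires at given positions and hands
    the resulting net on to the next step. *)
Lemma step_in i k j S T w x : (i < size T)%N -> (k < size (nth [::] T i))%N -> (j < size w)%N ->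
  (nth (0, 0) w j).2 = nth 0 (nth [::] T i) k ->
  (wf S (upd i (upd k (nth (0, 0) w j).1 (nth [::] T i)) T) (rm j w) ->
   Phi S (upd i (upd k (nth (0, 0) w j).1 (nth [::] T i)) T) (rm j w) = x) ->
  wf S T w -> Phi S T w = x.
Proof.
move=> hi hk hj E H W.
have ET := eqv_rm hi hk; have EU := eqv_upd (nth (0, 0) w j).1 hi hk.
have Ew := perm_rm (0, 0) hj; move: ET EU Ew H; rewrite -E; case: (nth (0, 0) w j) => a b /=.
move: (rm i T) (rm k _) (rm j w) (upd i _ T) => T' v w' T2 ET EU Ew H.
have W1 := wf_eqv W (eqv_refl S) ET Ew; have W2 := wf_in W1.
rewrite (Phi_eqv W (eqv_refl S) ET Ew) Phi_in //.
have EU' := EU; rewrite eqv_sym in EU'; rewrite -H; first exact: Phi_eqv (perm_refl _).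
exact: wf_eqv W2 (eqv_refl _) EU' (perm_refl _).
Qed.

Lemma step_out i k j S T w x : (i < size S)%N -> (k < size (nth [::] S i))%N -> (j < size w)%N ->
  (nth (0, 0) w j).1 = nth 0 (nth [::] S i) k ->
  (wf (upd i (upd k (nth (0, 0) w j).2 (nth [::] S i)) S) T (rm j w) ->
   Phi (upd i (upd k (nth (0, 0) w j).2 (nth [::] S i)) S) T (rm j w) = x) ->
  wf S T w -> Phi S T w = x.
Proof.
move=> hi hk hj E H W.
have ET := eqv_rm hi hk; have EU := eqv_upd (nth (0, 0) w j).2 hi hk.
have Ew := perm_rm (0, 0) hj; move: ET EU Ew H; rewrite -E; case: (nth (0, 0) w j) => a b /=.
move: (rm i S) (rm k _) (rm j w) (upd i _ S) => S' v w' S2 ET EU Ew H.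
have W1 := wf_eqv W ET (eqv_refl T) Ew; have W2 := wf_out W1.
rewrite (Phi_eqv W ET (eqv_refl T) Ew) Phi_out //.
have EU' := EU; rewrite eqv_sym in EU'; rewrite -H; first exact: Phi_eqv (perm_refl _).
exact: wf_eqv W2 EU' (eqv_refl _) (perm_refl _).
Qed.

Lemma wf_ww S T w a b c : wf S T ((a, b) :: (b, c) :: w) -> wf S T ((a, c) :: w).
Proof. by case=> L cS cT; split=> // x; have := L x; rewrite /outn /inn /=; glia. Qed.

Lemma wf_loop S T w a : wf S T ((a, a) :: w) -> wf S T w.
Proof. by case=> L cS cT; split=> //; apply: linear_loop L. Qed.

Lemma step_ww i j S T w x : (i < size w)%N -> (j < size (rm i w))%N ->
  (nth (0, 0) w i).2 = (nth (0, 0) (rm i w) j).1 ->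
  (wf S T (((nth (0, 0) w i).1, (nth (0, 0) (rm i w) j).2) :: rm j (rm i w)) ->
   Phi S T (((nth (0, 0) w i).1, (nth (0, 0) (rm i w) j).2) :: rm j (rm i w)) = x) ->
  wf S T w -> Phi S T w = x.
Proof.
move=> hi hj E H W; have E1 := perm_rm (0, 0) hi; have E2 := perm_rm (0, 0) hj.
move: E1 E2 H E; case: (nth (0, 0) w i) => a b; case: (nth (0, 0) (rm i w) j) => b' c /= E1 E2 H E.
subst b'; have E3 : perm_eq w ((a, b) :: (b, c) :: rm j (rm i w)).
  by apply: perm_trans E1 _; rewrite perm_cons.
have W1 := wf_eqv W (eqv_refl S) (eqv_refl T) E3.
rewrite (Phi_eqv W (eqv_refl S) (eqv_refl T) E3) Phi_ww // H //; exact: wf_ww W1.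
Qed.

Lemma step_loop i S T w x : (i < size w)%N -> (nth (0, 0) w i).2 = (nth (0, 0) w i).1 ->
  (wf S T (rm i w) -> Phi S T (rm i w) = x) -> wf S T w -> Phi S T w = x.
Proof.
move=> hi E H W; have E1 := perm_rm (0, 0) hi; move: E1 H E.
case: (nth (0, 0) w i) => a b /= E1 H E; subst b.
have W1 := wf_eqv W (eqv_refl S) (eqv_refl T) E1.
rewrite (Phi_eqv W (eqv_refl S) (eqv_refl T) E1) Phi_loop // H //; exact: wf_loop W1.
Qed.

Lemma step_bigon i j a b c d S T w : (i < size S)%N -> (j < size T)%N ->
  perm_eq (nth [::] S i) [:: a; b; c] -> perm_eq (nth [::] T j) [:: a; b; d] ->
  wf S T w -> Phi S T w = 0.
Proof.
move=> hi hj E1 E2 W.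
have ES : S ≡ [:: a; b; c] :: rm i S.
  by apply: eqv_trans (eqv_perm (perm_rm [::] hi)) _; apply: eqv_cons E1 _; exact: eqv_refl.
have ET : T ≡ [:: a; b; d] :: rm j T.
  by apply: eqv_trans (eqv_perm (perm_rm [::] hj)) _; apply: eqv_cons E2 _; exact: eqv_refl.
rewrite (Phi_eqv W ES ET (perm_refl _)) Phi_bigon //; exact: wf_eqv0 W ES ET.
Qed.

Lemma step_quad i1 i2 j1 j2 a b c d p q r o S T w x :
  (i1 < size S)%N -> (i2 < size (rm i1 S))%N -> (j1 < size T)%N -> (j2 < size (rm j1 T))%N ->
  perm_eq (nth [::] S i1) [:: a; b; p] -> perm_eq (nth [::] (rm i1 S) i2) [:: c; d; r] ->
  perm_eq (nth [::] T j1) [:: b; c; q] -> perm_eq (nth [::] (rm j1 T) j2) [:: d; a; o] ->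
  (wf (rm i2 (rm i1 S)) (rm j2 (rm j1 T)) ((q, p) :: (o, r) :: w) ->
   wf (rm i2 (rm i1 S)) (rm j2 (rm j1 T)) ((q, r) :: (o, p) :: w) ->
   Phi (rm i2 (rm i1 S)) (rm j2 (rm j1 T)) ((q, p) :: (o, r) :: w) +
   Phi (rm i2 (rm i1 S)) (rm j2 (rm j1 T)) ((q, r) :: (o, p) :: w) = x) ->
  wf S T w -> Phi S T w = x.
Proof.
move=> hi1 hi2 hj1 hj2 E1 E2 E3 E4 H W.
have ES : S ≡ [:: a; b; p] :: [:: c; d; r] :: rm i2 (rm i1 S).
  apply: eqv_trans (eqv_perm (perm_rm [::] hi1)) _; apply: eqv_cons E1 _.
  by apply: eqv_trans (eqv_perm (perm_rm [::] hi2)) _; apply: eqv_cons E2 _; exact: eqv_refl.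
have ET : T ≡ [:: b; c; q] :: [:: d; a; o] :: rm j2 (rm j1 T).
  apply: eqv_trans (eqv_perm (perm_rm [::] hj1)) _; apply: eqv_cons E3 _.
  by apply: eqv_trans (eqv_perm (perm_rm [::] hj2)) _; apply: eqv_cons E4 _; exact: eqv_refl.
have W1 := wf_eqv0 W ES ET.
rewrite (Phi_eqv W ES ET (perm_refl _)) Phi_quad // H //.
  exact: wf_quad1 W1.
exact: wf_quad2 W1.
Qed.

Lemma Phi_alpha a b v v' S T w : wf ((a :: v) :: S) ((a :: v') :: T) w ->
  wf ((b :: v) :: S) ((b :: v') :: T) w ->
  Phi ((a :: v) :: S) ((a :: v') :: T) w = Phi ((b :: v) :: S) ((b :: v') :: T) w.
Proof.
case: (eqVneq a b) => [-> //|ab] W W'.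
have Hb : forall x, x = b -> (outn x ((a :: v) :: S) w = 0)%N.
  move=> x ->; have [L _ _] := W'; have := L b; move: ab; rewrite /outn /inn /= eqxx.
  by case: (a == b) => //; glia.
have [L _ _] := W; have := L a; rewrite /outn /inn /= eqxx => La.
have [v0 S0 w2] : [/\ cm a v = 0, occ a S = 0 & in2 a w = 0]%N by move: La; clear; split; lia.
have [v0' T0 w1] : [/\ cm a v' = 0, occ a T = 0 & in1 a w = 0]%N by move: La; clear; split; lia.
rewrite -(Phi_ren (r := ren1 a b) W).
  have Ew : renw (ren1 a b) w = w.
    rewrite /renw -[RHS]map_id; apply/eq_in_map => -[x y] xy; congr (_, _); rewrite /ren1 /=.
      case: eqP => // E; subst x; have : (0 < in1 a w)%N.
        by rewrite in1E -has_count; apply/hasP; exists (a, y) => /=.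
      by rewrite w1.
    case: eqP => // E; subst y; have : (0 < in2 a w)%N.
      by rewrite in2E -has_count; apply/hasP; exists (x, a) => /=.
    by rewrite w2.
  have aE : ren1 a b a = b by rewrite /ren1 eqxx.
  by rewrite Ew /= (ren1_id1 _ v0) (ren1_id1 _ v0') (ren1_id0 _ S0) (ren1_id0 _ T0) aE.
move=> x y hx hy; rewrite /ren1; case: (eqVneq x a) => [xa|xa]; case: (eqVneq y a) => [ya|ya] E.
- by rewrite xa ya.
- by move: hy; rewrite Hb.
- by move: hx; rewrite Hb.
- by [].
Qed.

(** The name of an edge joining two stars is arbitrary, provided that it is fresh. *)
Lemma step_alpha i k i' k' b S T w x : (i < size S)%N -> (k < size (nth [::] S i))%N ->
  (i' < size T)%N -> (k' < size (nth [::] T i'))%N ->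
  nth 0 (nth [::] S i) k = nth 0 (nth [::] T i') k' ->
  wf (upd i (upd k b (nth [::] S i)) S) (upd i' (upd k' b (nth [::] T i')) T) w ->
  (wf (upd i (upd k b (nth [::] S i)) S) (upd i' (upd k' b (nth [::] T i')) T) w ->
   Phi (upd i (upd k b (nth [::] S i)) S) (upd i' (upd k' b (nth [::] T i')) T) w = x) ->
  wf S T w -> Phi S T w = x.
Proof.
move=> hi hk hi' hk' E W' H W; rewrite -H //.
have ES := eqv_rm hi hk; have ES' := eqv_upd b hi hk.
have ET := eqv_rm hi' hk'; have ET' := eqv_upd b hi' hk'.
rewrite (Phi_eqv W ES ET (perm_refl _)) (Phi_eqv W' ES' ET' (perm_refl _)) E.
apply: Phi_alpha; first by rewrite -{1}E; exact: wf_eqv0 W ES ET.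
exact: wf_eqv0 W' ES' ET'.
Qed.

Lemma Phi_fin S T w S' T' w' : S ≡ S' -> T ≡ T' -> perm_eq w w' -> wf S T w ->
  Phi S T w = Phi S' T' w'.
Proof. by move=> ES ET Ew W; apply: Phi_eqv. Qed.

Ltac sin a b c := apply: (step_in (i := a) (k := b) (j := c)) => //=.
Ltac sout a b c := apply: (step_out (i := a) (k := b) (j := c)) => //=.
Ltac sww a b := apply: (step_ww (i := a) (j := b)) => //=.
Ltac sloop a := apply: (step_loop (i := a)) => //=.
Ltac sfin := apply: Phi_fin; [eqvt | eqvt | pm].
Ltac sbig x y a' b' c' d' :=
  apply: (step_bigon (i := x) (j := y) (a := a') (b := b') (c := c') (d := d')) => //=; pm.
Ltac squad x1 x2 y1 y2 a' b' c' d' p' q' r' o' :=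
  apply: (step_quad (i1 := x1) (i2 := x2) (j1 := y1) (j2 := y2)
    (a := a') (b := b') (c := c') (d := d') (p := p') (q := q') (r := r') (o := o'));
  [by [] | by [] | by [] | by [] | rewrite /=; pm | rewrite /=; pm | rewrite /=; pm | rewrite /=; pm
  | rewrite /=; move=> Wa Wb].

Local Close Scope ring_scope.

(** ** The first two moves *)

(** The oriented state of a kink is a strand with a circle, the unoriented one has a
    bigon. *)
Lemma Z_R1 a0 a1 a2 m S T w : let c := Crossing a0 a1 a1 a2 m in
  wfZ [:: (true, c)] S T w -> Z [:: (true, c)] S T w = Z [:: (false, c)] S T w.
Proof.
move=> c W /=.
have -> : Phi S T (wiresV c ++ w) = Phi S T ((a0, a2) :: w).
  by apply: (step_ww (i := 0) (j := 0)) (wfZ_V W).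
have -> : Phi S T (wiresO c ++ w) = Phi S T ((a0, a2) :: w).
  by apply: (step_loop (i := 1)) (wfZ_O W).
rewrite (step_bigon (i := 0) (j := 0) (a := m) (b := a1) (c := a2) (d := a0) _ _ _ _ (wfZ_U W)) ?addr0 //=; pm.
Qed.

(** Strands running in the same direction.  The two states with one unoriented
    crossing are equal and cancel; the one with two has a bigon; the remaining one
    exchanges the strands twice. *)
Lemma Z_R2 a0 a1 a2 b0 b1 b2 m m' S T w :
  let p := Crossing a0 a1 b0 b1 m in let q := Crossing a1 a2 b1 b2 m' in
  wfZ [:: (true, p); (true, q)] S T w ->
  Z [:: (true, p); (true, q)] S T w = Z [:: (false, p); (false, q)] S T w.
Proof.
move=> p q W /=.
have -> : Phi S T (wiresV q ++ wiresV p ++ w) = Phi S T [:: (a0, a2), (b0, b2) & w].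
  have := wfZ_V (wfZ_V W) => /=; rewrite /wiresV /=.
  sww 2 0; sww 2 1; sfin.
have -> : Phi S T (wiresO q ++ wiresO p ++ w) = Phi S T [:: (a0, a2), (b0, b2) & w].
  have := wfZ_O (wfZ_O W) => /=; rewrite /wiresO /=.
  sww 3 0; sww 2 1; sfin.
have W1 := wfZ_O (wfZ_U W).
have -> : Phi (srcU p :: S) (snkU p :: T) (wiresO q ++ w) =
    Phi ([:: m; b2; a2] :: S) ([:: m; a0; b0] :: T) w.
  move: W1 => /=; rewrite /wiresO /srcU /snkU /=.
  sout 0 1 0; sout 0 2 0; sfin.
have -> : Phi (srcU q :: S) (snkU q :: T) (wiresO p ++ w) =
    Phi ([:: m; b2; a2] :: S) ([:: m; a0; b0] :: T) w.
  have := wfZ_U (wfZ_O W) => /=; rewrite /wiresO /srcU /snkU /=.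
  sin 0 2 0; sin 0 1 0.
  apply: (step_alpha (i := 0) (k := 0) (i' := 0) (k' := 0) (b := m)) => //=; last by sfin.
  case: W1 => L /andP[_ cS] /andP[_ cT]; split=> // z.
  by have := L z; rewrite /outn /inn /=; glia.
have -> : Phi (srcU q :: srcU p :: S) (snkU q :: snkU p :: T) w = 0%R.
  apply: (step_bigon (i := 1) (j := 0) (a := a1) (b := b1) (c := m) (d := m')) (wfZ_U (wfZ_U W)) => //=; pm.
by rewrite addr0 -addrA F2_addrr addr0.
Qed.

(** Strands running in opposite directions.  The states with one unoriented crossing
    have a bigon; the one with two has a quadrilateral, one of whose resolutions
    cancels the state without unoriented crossings. *)
Lemma Z_R2' a0 a1 a2 b0 b1 b2 m m' S T w :
  let p := Crossing a0 a1 b1 b2 m in let q := Crossing a1 a2 b0 b1 m' in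
  wfZ [:: (true, p); (true, q)] S T w ->
  Z [:: (true, p); (true, q)] S T w = Z [:: (false, p); (false, q)] S T w.
Proof.
move=> p q W /=.
have -> : Phi S T (wiresV q ++ wiresV p ++ w) = Phi S T [:: (a0, a2), (b0, b2) & w].
  have := wfZ_V (wfZ_V W) => /=; rewrite /wiresV /=.
  sww 2 0; sww 1 1; sfin.
have -> : Phi S T (wiresO q ++ wiresO p ++ w) = Phi S T [:: (b0, a2), (a0, b2) & w].
  have := wfZ_O (wfZ_O W) => /=; rewrite /wiresO /=.
  sww 0 2; sloop 0; sfin.
have -> : Phi (srcU p :: S) (snkU p :: T) (wiresO q ++ w) = 0%R.
  have := wfZ_O (wfZ_U W) => /=; rewrite /wiresO /srcU /snkU /=.
  sin 0 2 0; sbig 0 0 m a1 b2 a0.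
have -> : Phi (srcU q :: S) (snkU q :: T) (wiresO p ++ w) = 0%R.
  have := wfZ_U (wfZ_O W) => /=; rewrite /wiresO /srcU /snkU /=.
  sin 0 1 1; sbig 0 0 m' b1 a2 b0.
have -> : Phi (srcU q :: srcU p :: S) (snkU q :: snkU p :: T) w =
    (Phi S T [:: (b0, a2), (a0, b2) & w] + Phi S T [:: (a0, a2), (b0, b2) & w])%R.
  have := wfZ_U (wfZ_U W); rewrite /srcU /snkU /=.
  squad 0 0 0 0 b1 m' a1 m a2 b0 b2 a0; congr (_ + _)%R; move: Wb; sfin.
by rewrite !addr0 add0r addrA F2_addrr add0r.
Qed.

(** ** The third move *)

Lemma wf_linear S T w : wf S T w -> linear S T w.
Proof. by case. Qed.

(** The two sides of the third move share their outer names; nets which mix names of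
    both sides are linear because the inner names are distinct. *)
Lemma wf_lin S0 T0 w0 S T w : wf S0 T0 w0 -> linear S T w -> (cubic S0 -> cubic S) ->
  (cubic T0 -> cubic T) -> wf S T w.
Proof. by case=> _ c1 c2 L h1 h2; split; [ | exact: h1 | exact: h2]. Qed.

Ltac wfmix W W' U := apply: (wf_lin W); [let z := fresh "z" in move=> z;
  move: (wf_linear W z) (wf_linear W' z) (U z); rewrite /outn /inn /=; clear; glia | by [] | by []].

Lemma sum_cyclic (R : comNzRingType) (a b c d e : R) : (a + a = 0)%R ->
  (a + 0 + (0 + (a + b)) + (0 + (a + c) + (a + d + e)) = b + c + d + e)%R.
Proof.
move=> h; transitivity (a + a + (a + a) + (b + c + d + e))%R; first by ring.
by rewrite h !add0r.
Qed.

Lemma sum_acyclic_left (R : comNzRingType) (a b c d e f : R) : (b + b = 0)%R ->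
  (a + b + (c + e) + (b + 0 + (d + (f + b))) = a + b + c + d + e + f)%R.
Proof.
move=> h; transitivity (b + b + (a + b + c + d + e + f))%R; first by ring.
by rewrite h !add0r.
Qed.

Lemma sum_acyclic_right (R : comNzRingType) (a b c d e f : R) : (c + c = 0)%R ->
  (a + c + (b + e) + (c + 0 + (d + (f + c))) = a + b + c + d + e + f)%R.
Proof.
move=> h; transitivity (c + c + (a + b + c + d + e + f))%R; first by ring.
by rewrite h !add0r.
Qed.

Section ThirdMove.
Variables (s0 s2 t0 t2 u0 u2 : nat).
Variables (s1 t1 u1 mp mq mr s1' t1' u1' mp' mq' mr' : nat).
Variables (S T : names) (w : wires).
Hypothesis inner : uniq [:: s1; t1; u1; mp; mq; mr; s1'; t1'; u1'; mp'; mq'; mr'].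

Lemma inner_count z : cm z [:: s1; t1; u1; mp; mq; mr; s1'; t1'; u1'; mp'; mq'; mr'] <= 1.
Proof. by rewrite cmE count_uniq_mem //; case: (_ \in _). Qed.

Ltac salpha a b c d e :=
  apply: (step_alpha (i := a) (k := b) (i' := c) (k' := d) (b := e));
  [by [] | by [] | by [] | by [] | by [] |
   rewrite /=; match goal with W : wfZ _ _ _ _, W' : wfZ _ _ _ _ |- _ => wfmix W W' inner_count end
   | rewrite /=].

(** The triangle is oriented as a cycle. *)
Section Cyclic.
Local Notation p := (Crossing s0 s1 u1 u2 mp).
Local Notation q := (Crossing t0 t1 s1 s2 mq).
Local Notation r := (Crossing u0 u1 t1 t2 mr).
Local Notation p' := (Crossing s1' s2 u0 u1' mp').
Local Notation q' := (Crossing t1' t2 s0 s1' mq').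
Local Notation r' := (Crossing u1' u2 t0 t1' mr').

Hypothesis W : wfZ [:: (true, p); (true, q); (true, r)] S T w.
Hypothesis W' : wfZ [:: (true, p'); (true, q'); (true, r')] S T w.

Let A := Phi S T [:: (u0, t2), (t0, s2), (s0, u2) & w].
Let A' := Phi S T [:: (t0, u2), (s0, t2), (u0, s2) & w].
Let B1 := Phi S T [:: (s0, u2), (u0, s2), (t0, t2) & w].
Let B2 := Phi S T [:: (t0, s2), (u0, u2), (s0, t2) & w].
Let B3 := Phi S T [:: (u0, t2), (t0, u2), (s0, s2) & w].
Let H := Phi ([:: mr; u1; t2] :: [:: mq; t1; s2] :: [:: mp; s1; u2] :: S)
             ([:: mr; u0; t1] :: [:: mq; t0; s1] :: [:: mp; s0; u1] :: T) w.

(** Three states have a bigon, and the three states with a quadrilateral contribute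
    A + B1, A + B2 and A + B3; the four copies of A cancel. What remains, the hexagon H
    and the three terms B1, B2, B3, is the same on the other side of the move. *)
Lemma cyclic_left : Z [:: (true, p); (true, q); (true, r)] S T w = (B1 + B2 + B3 + H)%R.
Proof.
rewrite /=.
have -> : Phi S T (wiresO r ++ wiresO q ++ wiresO p ++ w) = A.
  have := wfZ_O (wfZ_O (wfZ_O W)); rewrite /wiresO /=.
  sww 5 3; sww 0 1; sloop 0; sfin.
have -> : Phi (srcU r :: S) (snkU r :: T) (wiresO q ++ wiresO p ++ w) = 0%R.
  have := wfZ_U (wfZ_O (wfZ_O W)); rewrite /wiresO /srcU /snkU /=.
  sww 3 1; sout 0 1 0; sbig 0 0 mr t1 t2 u0.
have -> : Phi (srcU q :: S) (snkU q :: T) (wiresO r ++ wiresO p ++ w) = 0%R.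
  have := wfZ_O (wfZ_U (wfZ_O W)); rewrite /wiresO /srcU /snkU /=.
  sww 1 2; sout 0 1 0; sbig 0 0 mq s1 s2 t0.
have -> : Phi (srcU r :: srcU q :: S) (snkU r :: snkU q :: T) (wiresO p ++ w) = (A + B1)%R.
  have := wfZ_U (wfZ_U (wfZ_O W)); rewrite /wiresO /srcU /snkU /=.
  sin 1 2 1; squad 0 0 0 0 u1 mr t1 mq t2 u0 s2 t0; apply: f_equal2; [move: Wa | move: Wb]; sfin.
have -> : Phi (srcU p :: S) (snkU p :: T) (wiresO r ++ wiresO q ++ w) = 0%R.
  have := wfZ_O (wfZ_O (wfZ_U W)); rewrite /wiresO /srcU /snkU /=.
  sww 3 1; sout 0 1 0; sbig 0 0 mp u1 u2 s0.
have -> : Phi (srcU r :: srcU p :: S) (snkU r :: snkU p :: T) (wiresO q ++ w) = (A + B2)%R.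
  have := wfZ_U (wfZ_O (wfZ_U W)); rewrite /wiresO /srcU /snkU /=.
  sin 0 2 1; squad 0 0 0 0 u1 mr s1 mp t2 u0 u2 s0; apply: f_equal2; [move: Wa | move: Wb]; sfin.
have -> : Phi (srcU q :: srcU p :: S) (snkU q :: snkU p :: T) (wiresO r ++ w) = (A + B3)%R.
  have := wfZ_O (wfZ_U (wfZ_U W)); rewrite /wiresO /srcU /snkU /=.
  sin 1 2 1; squad 0 0 0 0 t1 mq s1 mp s2 t0 u2 s0; apply: f_equal2; [move: Wa | move: Wb]; sfin.
exact: sum_cyclic (F2_addrr A).
Qed.

Lemma cyclic_right : Z [:: (true, p'); (true, q'); (true, r')] S T w = (B1 + B2 + B3 + H)%R.
Proof.
rewrite /=.
have -> : Phi S T (wiresO r' ++ wiresO q' ++ wiresO p' ++ w) = A'.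
  have := wfZ_O (wfZ_O (wfZ_O W')); rewrite /wiresO /=.
  sww 0 1; sww 0 2; sloop 0; sfin.
have -> : Phi (srcU r' :: S) (snkU r' :: T) (wiresO q' ++ wiresO p' ++ w) = 0%R.
  have := wfZ_U (wfZ_O (wfZ_O W')); rewrite /wiresO /srcU /snkU /=.
  sww 0 1; sin 0 1 0; sbig 0 0 mr' t1' u2 t0.
have -> : Phi (srcU q' :: S) (snkU q' :: T) (wiresO r' ++ wiresO p' ++ w) = 0%R.
  have := wfZ_O (wfZ_U (wfZ_O W')); rewrite /wiresO /srcU /snkU /=.
  sww 2 0; sin 0 1 0; sbig 0 0 mq' s1' t2 s0.
have -> : Phi (srcU r' :: srcU q' :: S) (snkU r' :: snkU q' :: T) (wiresO p' ++ w) = (A' + B1)%R.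
  have := wfZ_U (wfZ_U (wfZ_O W')); rewrite /wiresO /srcU /snkU /=.
  sin 0 1 0; squad 0 0 0 0 t1' mr' s1' mq' u2 t0 t2 s0; apply: f_equal2; [move: Wa | move: Wb]; sfin.
have -> : Phi (srcU p' :: S) (snkU p' :: T) (wiresO r' ++ wiresO q' ++ w) = 0%R.
  have := wfZ_O (wfZ_O (wfZ_U W')); rewrite /wiresO /srcU /snkU /=.
  sww 0 1; sin 0 1 0; sbig 0 0 mp' u1' s2 u0.
have -> : Phi (srcU r' :: srcU p' :: S) (snkU r' :: snkU p' :: T) (wiresO q' ++ w) = (A' + B2)%R.
  have := wfZ_U (wfZ_O (wfZ_U W')); rewrite /wiresO /srcU /snkU /=.
  sin 1 1 0; squad 0 0 0 0 t1' mr' u1' mp' u2 t0 s2 u0; apply: f_equal2; [move: Wa | move: Wb]; sfin.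
have -> : Phi (srcU q' :: srcU p' :: S) (snkU q' :: snkU p' :: T) (wiresO r' ++ w) = (A' + B3)%R.
  have := wfZ_O (wfZ_U (wfZ_U W')); rewrite /wiresO /srcU /snkU /=.
  sin 0 1 0; squad 0 0 0 0 s1' mq' u1' mp' t2 s0 s2 u0; apply: f_equal2; [move: Wa | move: Wb]; sfin.
have -> : Phi (srcU r' :: srcU q' :: srcU p' :: S) (snkU r' :: snkU q' :: snkU p' :: T) w = H.
  have := wfZ_U (wfZ_U (wfZ_U W')); rewrite /wiresO /srcU /snkU /= /H.
  salpha 0 0 0 0 s1; salpha 0 2 1 1 mp; salpha 2 0 2 0 t1; salpha 2 2 0 1 mq; salpha 1 0 1 0 u1; salpha 1 2 2 1 mr.
  sfin.
exact: sum_cyclic (F2_addrr A').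
Qed.

Lemma Z_R3_cyclic : Z [:: (true, p); (true, q); (true, r)] S T w =
  Z [:: (true, p'); (true, q'); (true, r')] S T w.
Proof. by rewrite cyclic_left cyclic_right. Qed.

End Cyclic.

(** The triangle is not oriented as a cycle.  On the left the extra copies of N1
    cancel, on the right those of N2. *)
Section Acyclic.
Local Notation p := (Crossing s0 s1 u0 u1 mp).
Local Notation q := (Crossing t0 t1 s1 s2 mq).
Local Notation r := (Crossing u1 u2 t1 t2 mr).
Local Notation p' := (Crossing s1' s2 u1' u2 mp').
Local Notation q' := (Crossing t1' t2 s0 s1' mq').
Local Notation r' := (Crossing u0 u1' t0 t1' mr').

Hypothesis W : wfZ [:: (true, p); (true, q); (true, r)] S T w.
Hypothesis W' : wfZ [:: (true, p'); (true, q'); (true, r')] S T w.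

Let N0 := Phi S T [:: (u0, u2), (s0, t2), (t0, s2) & w].
Let N1 := Phi ([:: mp; u2; t2] :: S) ([:: mp; s0; u0] :: T) ((t0, s2) :: w).
Let N2 := Phi ([:: mq; u2; s2] :: S) ([:: mq; t0; u0] :: T) ((s0, t2) :: w).
Let N3 := Phi ([:: mq; u2; s2] :: [:: mp; s1; t2] :: S) ([:: mq; t0; s1] :: [:: mp; s0; u0] :: T) w.
Let N4 := Phi ([:: mr; u2; t2] :: [:: mq; t1; s2] :: S) ([:: mr; s0; t1] :: [:: mq; t0; u0] :: T) w.
Let N5 := Phi ([:: s2; u2; t2] :: S) ([:: t0; s0; u0] :: T) w.

(** One state has a bigon, two states equal N1, and the quadrilateral of the state with
    three unoriented crossings resolves to N5 and to a third copy of N1. *)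
Lemma acyclic_left : Z [:: (true, p); (true, q); (true, r)] S T w = (N0 + N1 + N2 + N3 + N4 + N5)%R.
Proof.
rewrite /=.
have -> : Phi S T (wiresO r ++ wiresO q ++ wiresO p ++ w) = N0.
  have := wfZ_O (wfZ_O (wfZ_O W)); rewrite /wiresO /=.
  sww 4 0; sww 4 3; sww 0 1; sfin.
have -> : Phi (srcU r :: S) (snkU r :: T) (wiresO q ++ wiresO p ++ w) = N1.
  have := wfZ_U (wfZ_O (wfZ_O W)); rewrite /wiresO /srcU /snkU /=.
  sin 0 1 2; sww 2 1; sin 0 2 0; salpha 0 0 0 0 mp; sfin.
have -> : Phi (srcU q :: S) (snkU q :: T) (wiresO r ++ wiresO p ++ w) = N2.
  have := wfZ_O (wfZ_U (wfZ_O W)); rewrite /wiresO /srcU /snkU /=.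
  sout 0 1 1; sin 0 2 2; sww 1 0; sfin.
have -> : Phi (srcU r :: srcU q :: S) (snkU r :: snkU q :: T) (wiresO p ++ w) = N4.
  have := wfZ_U (wfZ_U (wfZ_O W)); rewrite /wiresO /srcU /snkU /=.
  sin 0 1 0; sin 1 2 0; sfin.
have -> : Phi (srcU p :: S) (snkU p :: T) (wiresO r ++ wiresO q ++ w) = N1.
  have := wfZ_O (wfZ_O (wfZ_U W)); rewrite /wiresO /srcU /snkU /=.
  sww 3 1; sout 0 1 0; sout 0 2 0; sfin.
have -> : Phi (srcU r :: srcU p :: S) (snkU r :: snkU p :: T) (wiresO q ++ w) = 0%R.
  have := wfZ_U (wfZ_O (wfZ_U W)); rewrite /wiresO /srcU /snkU /=.
  sin 0 2 1; sbig 1 0 s1 u1 mp mr.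
have -> : Phi (srcU q :: srcU p :: S) (snkU q :: snkU p :: T) (wiresO r ++ w) = N3.
  have := wfZ_O (wfZ_U (wfZ_U W)); rewrite /wiresO /srcU /snkU /=.
  sout 0 1 1; sout 1 2 0; sfin.
have -> : Phi (srcU r :: srcU q :: srcU p :: S) (snkU r :: snkU q :: snkU p :: T) w = (N5 + N1)%R.
  have := wfZ_U (wfZ_U (wfZ_U W)); rewrite /wiresO /srcU /snkU /=.
  squad 1 1 0 0 mq t1 u1 s1 s2 mr mp t0; apply: f_equal2; [move: Wa | move: Wb].
    sout 0 0 0; sin 0 0 0; sfin.
  sout 0 0 0; sfin.
exact: sum_acyclic_left (F2_addrr N1).
Qed.

(** The mirror image of [acyclic_left], with N2 in place of N1. *)
Lemma acyclic_right : Z [:: (true, p'); (true, q'); (true, r')] S T w = (N0 + N1 + N2 + N3 + N4 + N5)%R.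
Proof.
rewrite /=.
have -> : Phi S T (wiresO r' ++ wiresO q' ++ wiresO p' ++ w) = N0.
  have := wfZ_O (wfZ_O (wfZ_O W')); rewrite /wiresO /=.
  sww 0 1; sww 0 2; sww 1 2; sfin.
have -> : Phi (srcU r' :: S) (snkU r' :: T) (wiresO q' ++ wiresO p' ++ w) = N2.
  have := wfZ_U (wfZ_O (wfZ_O W')); rewrite /wiresO /srcU /snkU /=.
  sww 0 1; sout 0 2 0; sout 0 1 1; salpha 0 0 0 0 mq; sfin.
have -> : Phi (srcU q' :: S) (snkU q' :: T) (wiresO r' ++ wiresO p' ++ w) = N1.
  have := wfZ_O (wfZ_U (wfZ_O W')); rewrite /wiresO /srcU /snkU /=.
  sin 0 1 0; sout 0 2 1; sww 0 0; salpha 0 0 0 0 mp; sfin.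
have -> : Phi (srcU r' :: srcU q' :: S) (snkU r' :: snkU q' :: T) (wiresO p' ++ w) = N4.
  have := wfZ_U (wfZ_U (wfZ_O W')); rewrite /wiresO /srcU /snkU /=.
  sout 0 1 1; sout 1 2 0; salpha 0 0 0 0 mq; salpha 0 2 1 1 t1; salpha 1 0 1 0 mr; sfin.
have -> : Phi (srcU p' :: S) (snkU p' :: T) (wiresO r' ++ wiresO q' ++ w) = N2.
  have := wfZ_O (wfZ_O (wfZ_U W')); rewrite /wiresO /srcU /snkU /=.
  sww 0 1; sin 0 1 0; sin 0 2 0; salpha 0 0 0 0 mq; sfin.
have -> : Phi (srcU r' :: srcU p' :: S) (snkU r' :: snkU p' :: T) (wiresO q' ++ w) = 0%R.
  have := wfZ_U (wfZ_O (wfZ_U W')); rewrite /wiresO /srcU /snkU /=.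
  sout 0 2 0; sbig 0 1 s1' u1' mr' mp'.
have -> : Phi (srcU q' :: srcU p' :: S) (snkU q' :: snkU p' :: T) (wiresO r' ++ w) = N3.
  have := wfZ_O (wfZ_U (wfZ_U W')); rewrite /wiresO /srcU /snkU /=.
  sin 0 1 0; sin 1 2 0; salpha 0 0 0 0 mp; salpha 1 0 1 0 mq; salpha 0 2 1 1 s1; sfin.
have -> : Phi (srcU r' :: srcU q' :: srcU p' :: S) (snkU r' :: snkU q' :: snkU p' :: T) w = (N5 + N2)%R.
  have := wfZ_U (wfZ_U (wfZ_U W')); rewrite /wiresO /srcU /snkU /=.
  squad 0 0 1 1 u1' t1' mq' s1' mr' s0 t2 mp'; apply: f_equal2; [move: Wa | move: Wb].
    sin 0 0 0; sout 0 0 0; sfin.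
  sout 0 0 1; salpha 0 0 0 0 mq; sfin.
exact: sum_acyclic_right (F2_addrr N2).
Qed.

Lemma Z_R3_acyclic : Z [:: (true, p); (true, q); (true, r)] S T w =
  Z [:: (true, p'); (true, q'); (true, r')] S T w.
Proof. by rewrite acyclic_left acyclic_right. Qed.

End Acyclic.
End ThirdMove.

End StateSum.

(** * First returns *)

(** First returns as a relation, without reference to orbits: it can be followed while
    the map f is changed. *)
Inductive hits (X : Type) (f : X -> X) (P : pred X) : X -> X -> Prop :=
| hits_now x : P (f x) -> hits f P x (f x)
| hits_later x y : ~~ P (f x) -> hits f P (f x) y -> hits f P x y.

Lemma hits_iter (X : Type) (f : X -> X) (P : pred X) n x :
  (forall k, k < n -> ~~ P (iter k f (f x))) -> P (iter n f (f x)) -> hits f P x (iter n f (f x)).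
Proof.
elim: n x => [|n IH] x H Pn; first exact: hits_now.
apply: hits_later; first exact: (H 0).
by rewrite iterSr; apply: IH => [k kn|]; rewrite -iterSr //; apply: H.
Qed.

Lemma hits_first (X : finType) (f : X -> X) (P : pred X) x : injective f -> P x ->
  hits f P x (first_hit f P x).
Proof.
move=> fI Px; rewrite /first_hit /orbit; set n := order f (f x).
have hP : has P (traject f (f x) n).
  apply/hasP; exists x => //; have := fconnect_orbit f (f x) x; rewrite /orbit -/n => <-.
  by rewrite fconnect_sym // fconnect1.
have fn : find P (traject f (f x) n) < n by rewrite -[n in _ < n](size_traject f (f x)) -has_find.
rewrite (set_nth_default (f x)) ?size_traject // nth_traject //; apply: hits_iter.
  move=> k kn; have := before_find (f x) kn; rewrite nth_traject ?(ltn_trans kn) // => ->.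
  by [].
by have := nth_find (f x) hP; rewrite nth_traject.
Qed.

Lemma hits_inv (X : Type) (f : X -> X) (P : pred X) x y : hits f P x y ->
  if P (f x) then y = f x else hits f P (f x) y.
Proof. by case=> {x y} [x ->|x y /negbTE ->]. Qed.

Lemma hits_det (X : Type) (f : X -> X) (P : pred X) x y z : hits f P x y -> hits f P x z -> y = z.
Proof.
move=> H; elim: H z => {x y} [x Px|x y nP H IH] z Hz; have := hits_inv Hz; first by rewrite Px => ->.
by rewrite (negbTE nP) => /IH.
Qed.

Lemma hits_P (X : Type) (f : X -> X) (P : pred X) x y : hits f P x y -> P y.
Proof. by elim. Qed.

(** The map g with x removed from its cycles. *)
Definition skip (X : eqType) (x : X) (g : X -> X) (y : X) : X :=
  if y == x then x else if g y == x then g x else g y.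

Lemma skip_inj (X : eqType) (x : X) g : injective g -> injective (skip x g).
Proof.
move=> gI y z; rewrite /skip.
case: (eqVneq y x) => [->|yx]; case: (eqVneq z x) => [->|zx] //.
- case: (eqVneq (g z) x) => [E E'|ne E]; last by rewrite E eqxx in ne.
  by apply: gI; rewrite E -E'.
- case: (eqVneq (g y) x) => [E E'|ne E]; last by rewrite E eqxx in ne.
  by apply: gI; rewrite E E'.
- case: (eqVneq (g y) x) => [E|ne]; case: (eqVneq (g z) x) => [E'|ne'].
  + by move=> _; apply: gI; rewrite E E'.
  + by move/gI => E2; rewrite E2 eqxx in zx.
  + by move/gI => E2; rewrite E2 eqxx in yx.
  + exact: gI.
Qed.

(** Removing a point at which P fails does not affect first returns. *)
Lemma skip_hits (X : eqType) (x : X) g (P : pred X) y z : injective g -> ~~ P x ->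
  hits g P y z -> y != x -> hits (skip x g) P y z.
Proof.
move=> gI nPx H.
suff : (y != x -> hits (skip x g) P y z) /\ (y = x -> forall y', y' != x -> g y' = x -> hits (skip x g) P y' z) by case.
elim: H => {y z} [y Py|y z nP H [IH1 IH2]].
  split=> [yx|E y' y'x gy'].
    have E : skip x g y = g y.
      by rewrite /skip (negbTE yx); case: eqP => // E; rewrite E (negbTE nPx) in Py.
    by rewrite -E; apply: hits_now; rewrite E.
  have E' : skip x g y' = g y by rewrite /skip (negbTE y'x) gy' eqxx E.
  by rewrite -E'; apply: hits_now; rewrite E'.
split=> [yx|E y' y'x gy'].
  case: (eqVneq (g y) x) => [E|ne]; first exact: (IH2 E y yx E).
  have E : skip x g y = g y by rewrite /skip (negbTE yx) (negbTE ne).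
  by apply: hits_later; rewrite E //; apply: IH1.
subst y; have ne : g x != x.
  by apply: contraNneq y'x => E; apply/eqP; apply: gI; rewrite gy' E.
have E' : skip x g y' = g x by rewrite /skip (negbTE y'x) gy' eqxx.
by apply: hits_later; rewrite E' //; apply: IH1.
Qed.

(** * Nets of framed graphs *)

(** Names for the edges (by the port that they enter) and for the edges inserted at
    the nodes.  The bit k gives a second, disjoint family of names. *)
Definition nm (N : finType) (k : bool) (e : N * bool + N) : nat :=
  enum_rank e + k * #|{: N * bool + N}|.

Lemma block_inj B r r' (k k' : bool) : r < B -> r' < B -> r + k * B = r' + k' * B -> k = k' /\ r = r'.
Proof. by case: k; case: k' => /= h h' E; split=> //; try (exfalso; lia); lia. Qed.

Lemma nm_inj2 (N : finType) k k' (e e' : N * bool + N) : nm k e = nm k' e' -> k = k' /\ e = e'.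
Proof.
move/(block_inj (ltn_ord _) (ltn_ord _)) => [kk r]; split=> //.
by apply: enum_rank_inj; apply: val_inj.
Qed.

(** mu names the edge entering a port, mn the edge inserted at a node. *)
Definition naming (N : finType) (mu : N * bool -> nat) (mn : N -> nat) : Prop :=
  [/\ injective mu, injective mn & forall x v, mu x != mn v].

Lemma naming_nm (N : finType) (k : N * bool -> bool) (l : N -> bool) :
  naming (fun x => nm (k x) (inl x)) (fun v => nm (l v) (inr v)).
Proof.
split.
- by move=> x y /nm_inj2 [_ []].
- by move=> x y /nm_inj2 [_ []].
- by move=> x v; apply/eqP => /nm_inj2 [].
Qed.

Definition cr (N : finType) (mu : N * bool -> nat) (mn : N -> nat) (g : N * bool -> N * bool)
    (v : N) : crossing :=
  Crossing (mu (v, false)) (mu (g (v, false))) (mu (v, true)) (mu (g (v, true))) (mn v).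

Lemma sum_eq_inj (X : finType) (Y : eqType) (h : X -> Y) z : injective h ->
  \sum_x (h x == z : nat) <= 1.
Proof.
move=> hI; case: (pickP (fun x => h x == z)) => [x /eqP <-|ne].
  rewrite (bigD1 x) //= eqxx big1 // => y yx; rewrite (inj_eq hI).
  by rewrite (negbTE yx).
by rewrite big1 // => x _; rewrite ne.
Qed.

Lemma occ_srcsU (I : Type) (k : I -> bool) (c : I -> crossing) (s : seq I) z :
  occ z (srcsU [seq (k i, c i) | i <- s]) =
  \sum_(i <- s) ((mid (c i) == z) + ((out_a (c i) == z) + (out_b (c i) == z))).
Proof.
elim: s => [|i s IH]; first by rewrite big_nil.
by rewrite big_cons /= IH addn0.
Qed.

Lemma occ_snksU (I : Type) (k : I -> bool) (c : I -> crossing) (s : seq I) z :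
  occ z (snksU [seq (k i, c i) | i <- s]) =
  \sum_(i <- s) ((mid (c i) == z) + ((in_a (c i) == z) + (in_b (c i) == z))).
Proof.
elim: s => [|i s IH]; first by rewrite big_nil.
by rewrite big_cons /= IH addn0.
Qed.

Lemma cubicU (L : kinds) : cubic (srcsU L) && cubic (snksU L).
Proof. by elim: L => [|x L /andP[IH1 IH2]] //=; rewrite /cubic /= -!/(cubic _) IH1 IH2. Qed.

Lemma sum_ports (N : finType) (F : N * bool -> nat) :
  \sum_(v <- enum N) F (v, false) + \sum_(v <- enum N) F (v, true) = \sum_x F x.
Proof.
rewrite -big_split big_enum /= (eq_bigr (fun v => \sum_b F (v, b))); last by move=> v _; rewrite big_bool addnC.
by rewrite pair_bigA; apply: eq_big => [[v b]|[v b] _].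
Qed.

(** Each edge leaves one port and enters one port, as the map g is injective. *)
Lemma wf_cr (N : finType) (k : N -> bool) mu mn g : naming mu mn -> injective g ->
  wfZ [seq (k v, @cr N mu mn g v) | v <- enum N] [::] [::] [::].
Proof.
move=> [mI nI mn0] gI; rewrite /wfZ !cats0; case/andP: (cubicU [seq (k v, cr mu mn g v) | v <- enum N]) => c1 c2.
split=> // z; rewrite /outn /inn /= !addn0 occ_srcsU occ_snksU !big_split /=.
rewrite (sum_ports (fun x => mu (g x) == z)) (sum_ports (fun x => mu x == z)).
have -> : \sum_x (mu (g x) == z : nat) = \sum_x (mu x == z : nat).
  by rewrite [RHS](reindex_inj gI).
split=> //; case: (pickP (fun v => mn v == z)) => [v /eqP E|ne].
  rewrite [X in _ + X]big1 ?addn0 ?big_enum; last by move=> x _; rewrite -E (negbTE (mn0 x v)).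
  apply: leq_trans (sum_eq_inj z nI); rewrite leq_eqVlt; apply/orP; left; apply/eqP.
  exact: eq_bigl.
by rewrite [X in X + _]big1 ?add0n; [exact: sum_eq_inj | move=> v _; rewrite ne].
Qed.

Definition ports (N : Type) (s : seq N) : seq (N * bool) :=
  flatten [seq [:: (v, false); (v, true)] | v <- s].

Lemma mem_ports (N : eqType) (s : seq N) x : (x \in ports s) = (x.1 \in s).
Proof.
case: x => v b; apply/flatten_mapP/idP => [[u us] /=|vs].
  by rewrite !inE => /orP[] /eqP [-> _].
by exists v => //; case: b vs; rewrite !inE eqxx ?orbT.
Qed.

Lemma uniq_ports (N : eqType) (s : seq N) : uniq s -> uniq (ports s).
Proof.
elim: s => //= v s IH /andP[vs /IH U]; rewrite -/(ports s) U andbT.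
by rewrite inE xpair_eqE andbF /= !mem_ports /= vs.
Qed.

Definition port_wires (N : finType) (mu : N * bool -> nat) (g : N * bool -> N * bool) ds : wires :=
  [seq (mu x, mu (g x)) | x <- ds].

Lemma uniq_enum_filter (N : finType) (a : pred N) : uniq [seq v <- enum N | a v].
Proof. exact: filter_uniq (enum_uniq N). Qed.

Lemma perm_enum_split (N : finType) (vs : seq N) : uniq vs ->
  perm_eq (enum N) (vs ++ [seq v <- enum N | v \notin vs]).
Proof.
move=> U; apply: uniq_perm; first exact: enum_uniq.
  rewrite cat_uniq U uniq_enum_filter andbT.
  by apply/hasPn => v; rewrite mem_filter => /andP[].
by move=> v; rewrite mem_cat mem_filter mem_enum inE andbT; case: (v \in vs).
Qed.

Section Graphs.
Variable Phi : names -> names -> wires -> 'F_2.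
Hypothesis HPhi : net_rules Phi.

Local Notation ZZ L := (Z Phi L [::] [::]).

(** An unresolved node consists of two wires. *)
Lemma Z_virtual (N : finType) (k : N -> bool) mu mn g (vs s : seq N) w :
  {in vs, forall v, ~~ k v} ->
  ZZ [seq (k v, @cr N mu mn g v) | v <- vs ++ s] w =
  ZZ [seq (k v, cr mu mn g v) | v <- s] (port_wires mu g (ports (rev vs)) ++ w).
Proof.
elim: vs w => [|v vs IH] w H //=; rewrite (negbTE (H v (mem_head _ _))).
rewrite IH; last by move=> u us; apply: H; rewrite inE us orbT.
by rewrite rev_cons -cats1 /ports map_cat flatten_cat /port_wires map_cat -catA.
Qed.

Lemma wfZ_virtual (N : finType) (k : N -> bool) mu mn g (vs s : seq N) w :
  wfZ [seq (k v, @cr N mu mn g v) | v <- vs ++ s] [::] [::] w ->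
  wfZ [seq (k v, cr mu mn g v) | v <- s] [::] [::] (port_wires mu g (ports (rev vs)) ++ w).
Proof.
elim: vs w => [|v vs IH] w W //; have := IH _ (wfZ_V W).
by rewrite rev_cons -cats1 /ports map_cat flatten_cat /port_wires map_cat -catA.
Qed.

Lemma wfZ_wire2 L S T w a b : wfZ L S T ((a, b) :: w) -> a != b ->
  (forall c, c \in map snd L -> mid c != a) ->
  wfZ (on_snd (ren_out (ren1 a b)) L) (ren (ren1 a b) S) T (resnd (ren1 a b) w).
Proof.
move=> W ab H; have := wf_wire2 W ab; rewrite /wfZ /ren map_cat -!/(ren _ _).
have -> : ren (ren1 a b) (srcsU L) = srcsU (on_snd (ren_out (ren1 a b)) L).
  by rewrite /ren /srcsU /on_snd -!map_comp; apply: eq_map => -[k c].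
suff -> : snksU (on_snd (ren_out (ren1 a b)) L) = snksU L by [].
rewrite /snksU /on_snd -map_comp; apply/eq_in_map => -[k c] kc /=.
rewrite /snkU /= /ren1 ifN //; apply: H; apply/mapP; by exists (k, c).
Qed.

(** The ports in ds have become wires (mu x, mu (g x)).  A wire is absorbed by
    renaming, which amounts to removing x from the cycles of g; a fixed point of g
    is a circle, of value 1. *)
Lemma erase_ports (N : finType) (k : N -> bool) mu mn (g : N * bool -> N * bool) s ds :
  naming mu mn -> injective g -> uniq ds -> (forall v b, v \in s -> (v, b) \notin ds) ->
  wfZ [seq (k v, cr mu mn g v) | v <- s] [::] [::] (port_wires mu g ds) ->
  exists g', [/\ injective g', forall y, g y = y -> g' y = y, forall y, y \in ds -> g' y = y,
    ZZ [seq (k v, cr mu mn g v) | v <- s] (port_wires mu g ds) = ZZ [seq (k v, cr mu mn g' v) | v <- s] [::]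
    & forall (P : pred (N * bool)) y z, (forall x, x \in ds -> ~~ P x) -> y \notin ds ->
      hits g P y z -> hits g' P y z].
Proof.
move=> nam; have [mI nI mn0] := nam.
elim: ds g => [|x ds IH] g gI U sd W; first by exists g.
have {U} /andP[xds U] := U; pose g1 := skip x g; have g1I : injective g1 by apply: skip_inj.
have sx v b : v \in s -> (v, b) != x by move=> /(sd _ b); rewrite inE negb_or => /andP[].
have sd' v b : v \in s -> (v, b) \notin ds by move=> /(sd _ b); rewrite inE negb_or => /andP[].
suff [E W1] : ZZ [seq (k v, cr mu mn g v) | v <- s] (port_wires mu g (x :: ds)) =
      ZZ [seq (k v, cr mu mn g1 v) | v <- s] (port_wires mu g1 ds) /\
    wfZ [seq (k v, cr mu mn g1 v) | v <- s] [::] [::] (port_wires mu g1 ds).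
  have [g' [g'I h1 h2 h3 h4]] := IH g1 g1I U sd' W1; exists g'; split=> //.
  - move=> y gy; apply: h1; rewrite /g1 /skip; case: eqVneq => // yx.
    by rewrite gy (negbTE yx).
  - move=> y; rewrite inE => /orP[/eqP ->|/h2 //]; apply: h1; by rewrite /g1 /skip eqxx.
  - by rewrite E.
  - move=> P y z nP; rewrite inE negb_or => /andP[yx yds] Hy; apply: h4 => //.
      by move=> x' xd; apply: nP; rewrite inE xd orbT.
    by apply: skip_hits => //; apply: nP; rewrite mem_head.
(* A fixed point of g gives the loop (mu x, mu x). *)
case: (eqVneq (g x) x) => [gx|gx].
  have g1E y : y != x -> g1 y = g y.
    move=> yx; rewrite /g1 /skip (negbTE yx); case: eqP => // E.
    by move: yx; rewrite (gI y x) ?eqxx // E gx.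
  have Ew : port_wires mu g ds = port_wires mu g1 ds.
    apply/eq_in_map => y yd; rewrite g1E //; by apply: contraNneq xds => <-.
  have Ec : [seq (k v, cr mu mn g v) | v <- s] = [seq (k v, cr mu mn g1 v) | v <- s].
    by apply/eq_in_map => v vs; rewrite /cr !g1E // sx.
  move: W; rewrite /port_wires /= gx -!/(port_wires _ _ _) -Ew -Ec => W; split.
    exact: Z_loop W.
  by case: W => L c1 c2; split=> //; apply: linear_loop L.
have g1E y : y != x -> ren1 (mu x) (mu (g x)) (mu (g y)) = mu (g1 y).
  by move=> yx; rewrite /g1 /skip (negbTE yx) /ren1 (inj_eq mI); case: eqP.
have Ew : resnd (ren1 (mu x) (mu (g x))) (port_wires mu g ds) = port_wires mu g1 ds.
  rewrite /resnd /port_wires -map_comp; apply/eq_in_map => y yd /=; rewrite g1E //.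
  by apply: contraNneq xds => <-.
have Ec : on_snd (ren_out (ren1 (mu x) (mu (g x)))) [seq (k v, cr mu mn g v) | v <- s] =
    [seq (k v, cr mu mn g1 v) | v <- s].
  rewrite /on_snd -map_comp; apply/eq_in_map => v vs /=; rewrite /cr /ren_out /= !g1E ?sx //.
  by rewrite [ren1 _ _ (mn v)]/ren1 eq_sym (negbTE (mn0 x v)).
have ab : mu x != mu (g x) by rewrite (inj_eq mI) eq_sym.
rewrite -Ew -Ec; split; first exact: Z_wire2 W ab.
apply: (wfZ_wire2 W ab) => c /mapP[[k' c'] /mapP[v vs [_ ->]] ->] /=.
by rewrite eq_sym.
Qed.

(** * The state sum of a framed graph *)

(** The state sum of a framed graph in which the nodes in C are resolved. *)
Definition ZG (G : framed) (C : {set node G}) : 'F_2 :=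
  ZZ [seq (v \in C, cr (fun x => nm false (inl x)) (fun v => nm false (inr v)) (@nxt G) v) | v <- enum (node G)] [::].

(** The sum does not depend on the names of the edges. *)
Lemma ZG_naming (G : framed) (C : {set node G}) mu mn : injective (@nxt G) -> naming mu mn ->
  ZZ [seq (v \in C, cr mu mn (@nxt G) v) | v <- enum (node G)] [::] = ZG C.
Proof.
move=> gI nam; have [mI nI mn0] := nam.
pose r z := if [pick x | nm false (inl x) == z] is Some x then mu x
  else if [pick v | nm false (inr v) == z] is Some v then mn v else 0.
have rp x : r (nm false (inl x)) = mu x.
  rewrite /r; case: pickP => [y /eqP /nm_inj2 [_ [->]] //|/(_ x)]; by rewrite eqxx.
have rn v : r (nm false (inr v)) = mn v.
  rewrite /r; case: pickP => [y /eqP /nm_inj2 [] //|_].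
  by case: pickP => [y /eqP /nm_inj2 [_ [->]] //|/(_ v)]; rewrite eqxx.
have W := wf_cr (fun v => v \in C) (naming_nm (fun=> false) (fun=> false)) gI.
rewrite /ZG -(Z_ren HPhi (r := r) W).
  congr Z; rewrite /on_snd -map_comp; apply: eq_map => v.
  by rewrite /ren_all /= !rp rn.
move=> z z'; rewrite /outn !cats0 /= !addn0 !occ_gt0 => hz hz'.
have H y : y \in flatten (srcsU [seq (v \in C, cr (fun x => nm false (inl x)) (fun v => nm false (inr v)) (@nxt G) v) | v <- enum (node G)]) ->
    (exists x : node G * bool, y = nm false (inl x)) \/ (exists v : node G, y = nm false (inr v)).
  rewrite /srcsU -map_comp => /flatten_mapP [v _]; rewrite /srcU /= !inE => /or3P[] /eqP ->.
  - by right; exists v.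
  - by left; exists (nxt (v, false)).
  - by left; exists (nxt (v, true)).
case: (H _ hz) => [[x ->]|[v ->]]; case: (H _ hz') => [[x' ->]|[v' ->]]; rewrite ?rp ?rn.
- by move/mI => ->.
- by move=> E; have := mn0 x v'; rewrite E eqxx.
- by move=> E; have := mn0 x' v; rewrite E eqxx.
- by move/nI => ->.
Qed.

Lemma wfZ_flips (I : Type) (k : I -> bool) (c : I -> crossing) (b : I -> bool) (s : seq I) S T w :
  wfZ [seq (k i, c i) | i <- s] S T w ->
  wfZ [seq (k i, if b i then flip (c i) else c i) | i <- s] S T w.
Proof.
move=> W; apply: wf_eqv W _ _ (perm_refl _); apply: eqv_cat (eqv_refl _).
  elim: s => //= i s IH; apply: eqv_cons => //; case: (b i) => //; rewrite perm_sym; exact: flip_srcU.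
elim: s => //= i s IH; apply: eqv_cons => //; case: (b i) => //; rewrite perm_sym; exact: flip_snkU.
Qed.

(** Changing the crossings at the nodes in vs only, by a local identity.  The map b
    tells at which nodes the two strands are listed in the other order, so that the
    local identities can be stated for one order. *)
Lemma Z_replace (N : finType) (k k' : N -> bool) (c c' : N -> crossing) (b : N -> bool) vs :
  uniq vs -> (forall v, v \notin vs -> k v = k' v /\ c v = c' v) ->
  wfZ [seq (k v, c v) | v <- enum N] [::] [::] [::] ->
  wfZ [seq (k' v, c' v) | v <- enum N] [::] [::] [::] ->
  (forall S T w, wfZ [seq (k v, if b v then flip (c v) else c v) | v <- vs] S T w ->
     wfZ [seq (k' v, if b v then flip (c' v) else c' v) | v <- vs] S T w ->
     Z Phi [seq (k v, if b v then flip (c v) else c v) | v <- vs] S T w =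
     Z Phi [seq (k' v, if b v then flip (c' v) else c' v) | v <- vs] S T w) ->
  ZZ [seq (k v, c v) | v <- enum N] [::] = ZZ [seq (k' v, c' v) | v <- enum N] [::].
Proof.
move=> U E W W' H.
have P : perm_eq (enum N) ([seq v <- enum N | v \notin vs] ++ vs).
  by apply: perm_trans (perm_enum_split U) _; rewrite perm_catC.
have P1 := perm_map (fun v => (k v, c v)) P; have P2 := perm_map (fun v => (k' v, c' v)) P.
have W1 := wfZ_perm P1 W; have W2 := wfZ_perm P2 W'.
rewrite (Z_perm HPhi P1 W) (Z_perm HPhi P2 W').
rewrite -(Z_flips HPhi b W1) -(Z_flips HPhi b W2).
have := wfZ_flips b W1; have := wfZ_flips b W2; rewrite !map_cat.
have -> : [seq (k' v, if b v then flip (c' v) else c' v) | v <- [seq v <- enum N | v \notin vs]] =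
    [seq (k v, if b v then flip (c v) else c v) | v <- [seq v <- enum N | v \notin vs]].
  by apply/eq_in_map => v; rewrite mem_filter => /andP[/E [-> ->]].
by move=> h1 h2; apply: (Z_local H).
Qed.

(** Nodes which are not resolved may be erased.  This covers isomorphisms, the
    virtual crossings removed by a detour, and the crossings which a first or second
    move has turned into unresolved ones. *)
Lemma ZG_erases (G H : framed) (D : {set node G}) i t (C : {set node G}) :
  injective (@nxt G) -> [disjoint D & C] -> @erases G H D i t ->
  injective (@nxt H) /\ ZG C = ZG (i @^-1: C).
Proof.
move=> gI DC [iI iD E].
set mu := fun x : node G * bool => nm false (inl x); set mn := fun v : node G => nm false (inr v).
have nam : naming mu mn by apply: (naming_nm (fun=> false) (fun=> false)).
have W := wf_cr (fun v => v \in C) nam gI.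
pose s := [seq v <- enum (node G) | v \notin D].
have P : perm_eq (enum (node G)) (enum D ++ s).
  have -> : s = [seq v <- enum (node G) | v \notin enum D].
    by apply: eq_filter => v; rewrite mem_enum.
  exact: perm_enum_split (enum_uniq _).
have P1 := perm_map (fun v => (v \in C, cr mu mn (@nxt G) v)) P.
have kD : {in enum D, forall v, ~~ (v \in C)}.
  by move=> v; rewrite mem_enum => vD; rewrite (disjointFr DC vD).
have W1 := wfZ_virtual (wfZ_perm P1 W).
pose ds := ports (rev (enum D)).
have sds v b : v \in s -> (v, b) \notin ds.
  by rewrite mem_filter mem_ports mem_rev mem_enum => /andP[].
have Uds : uniq ds by rewrite uniq_ports // rev_uniq enum_uniq.
rewrite cats0 -/ds in W1.
have [g' [g'I h1 h2 h3 h4]] := erase_ports nam gI Uds sds W1.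
have dsE x : (x \in ds) = (x.1 \in D) by rewrite mem_ports mem_rev mem_enum.
(* Outside D, the map g' is the first return of nxt, that is, nxt of H. *)
have g'E x : lift i t (@nxt H x) = g' (lift i t x).
  have xD : (lift i t x).1 \notin D by rewrite -iD; exact: codom_f.
  pose Q (y : node G * bool) := y.1 \notin D.
  have Hx := @hits_first _ _ Q _ gI xD; rewrite E.
  have xds : lift i t x \notin ds by rewrite dsE.
  have nQ y : y \in ds -> ~~ Q y by rewrite dsE negbK.
  apply: hits_det (h4 Q _ _ nQ xds Hx) (hits_now _).
  rewrite /Q -dsE; apply: contraNN xds => yd.
  by have := h2 _ yd => /g'I <-.
have liftI : injective (lift i t).
  by move=> [u b] [u' b'] [/iI <-] /addIb ->.
have nI : injective (@nxt H).
  by move=> x y /(congr1 (lift i t)); rewrite !g'E => /g'I /liftI.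
split=> //.
rewrite {1}/ZG -/mu -/mn (Z_perm HPhi P1 W) (@Z_virtual _ (fun v => v \in C) mu mn _ (enum D) s [::] kD) cats0 -/ds h3.
have namH : naming (fun x => mu (lift i t x)) (fun v => mn (i v)).
  have [mI mnI mn0] := nam; split.
  - by move=> x y /mI /liftI.
  - by move=> x y /mnI /iI.
  - by move=> x v; apply: mn0.
rewrite -(ZG_naming _ nI namH).
have WH := wf_cr (fun v => v \in i @^-1: C) namH nI.
rewrite -(Z_flips HPhi t WH).
have PH : perm_eq s (map i (enum (node H))).
  apply: uniq_perm; [exact: uniq_enum_filter | by rewrite map_inj_uniq ?enum_uniq |].
  move=> v; rewrite mem_filter mem_enum inE andbT -iD.
  by apply/codomP/mapP => [[u ->]|[u _ ->]]; [exists u; rewrite ?mem_enum | exists u].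
(* The labelling of the strands chosen in H is accounted for by flips. *)
have E2 : [seq (v \in i @^-1: C, if t v then flip (cr (fun x => mu (lift i t x)) (fun v => mn (i v)) (@nxt H) v)
       else cr (fun x => mu (lift i t x)) (fun v => mn (i v)) (@nxt H) v) | v <- enum (node H)] =
    [seq (v \in C, cr mu mn g' v) | v <- map i (enum (node H))].
  rewrite -map_comp; apply: eq_map => v /=; rewrite !inE; congr (_, _).
  by rewrite /cr !g'E /lift /=; case: (t v).
rewrite E2; apply: Z_perm => //; first exact: perm_map.
have W2 := wfZ_flips t WH; rewrite E2 in W2; apply: wfZ_perm W2.
by apply: perm_map; rewrite perm_sym.
Qed.

(** * The Reidemeister moves on framed graphs *)

(** The crossing at the node of x, the strand of x being listed first. *)
Definition crx (N : finType) (mu : N * bool -> nat) (mn : N -> nat) (g : N * bool -> N * bool)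
    (x : N * bool) : crossing :=
  Crossing (mu x) (mu (g x)) (mu (x.1, ~~ x.2)) (mu (g (x.1, ~~ x.2))) (mn x.1).

Lemma crxE (N : finType) mu mn g (x : N * bool) :
  (if x.2 then flip (cr mu mn g x.1) else cr mu mn g x.1) = crx mu mn g x.
Proof. by case: x => v []. Qed.

Local Notation nm0 G := (fun x : node G * bool => nm false (inl x)).
Local Notation nn0 G := (fun v : node G => nm false (inr v)).

Lemma naming0 (G : framed) : naming (nm0 G) (nn0 G).
Proof. exact: (naming_nm (fun=> false) (fun=> false)). Qed.

(** The node of a kink may be left unresolved. *)
Lemma ZG_R1 (G : framed) (C : {set node G}) (x : node G * bool) : injective (@nxt G) -> x.1 \in C ->
  nxt x = opposite x -> ZG C = ZG (C :\ x.1).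
Proof.
move=> gI xC E; apply: (Z_replace (b := fun=> x.2) (vs := [:: x.1])) => //.
- by move=> v; rewrite !inE => vx; rewrite vx.
- exact: wf_cr (naming0 G) gI.
- exact: wf_cr (naming0 G) gI.
- move=> S T w /=; rewrite !crxE xC !inE eqxx /=; rewrite /crx -/(opposite x) E => W _.
  exact: Z_R1 W.
Qed.

(** Both nodes of a second move may be left unresolved: the strands then cross twice,
    as if they did not meet. *)
Lemma ZG_R2_first (G : framed) (C : {set node G}) (x y : node G * bool) : injective (@nxt G) ->
  x.1 \in C -> y.1 \in C -> x.1 != y.1 -> nxt x = y -> consecutive (opposite x) (opposite y) ->
  ZG C = ZG (C :\: [set x.1; y.1]).
Proof.
move=> gI xC yC xy E E2.
apply: (Z_replace (b := fun v => if v == x.1 then x.2 else y.2) (vs := [:: x.1; y.1])) => //.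
- by rewrite /= inE xy.
- by move=> v; rewrite !inE => /negbTE ->.
- exact: wf_cr (naming0 G) gI.
- exact: wf_cr (naming0 G) gI.
- move=> S T w /=; rewrite eqxx [y.1 == x.1]eq_sym (negbTE xy) !crxE xC yC !inE !eqxx orbT /=.
  rewrite /crx -/(opposite x) -/(opposite y) E; case/orP: E2 => /eqP E2; rewrite E2 => W _.
    exact: Z_R2 W.
  exact: Z_R2' W.
Qed.

Lemma oppositeK (G : framed) (x : node G * bool) : opposite (opposite x) = x.
Proof. by case: x => v b; rewrite /opposite /= negbK. Qed.

Lemma consecutiveC (G : framed) (x y : node G * bool) : consecutive x y = consecutive y x.
Proof. by rewrite /consecutive orbC. Qed.

Lemma ZG_R2 (G : framed) (C : {set node G}) (x y : node G * bool) : injective (@nxt G) ->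
  x.1 \in C -> y.1 \in C -> x.1 != y.1 -> consecutive x y -> consecutive (opposite x) (opposite y) ->
  ZG C = ZG (C :\: [set x.1; y.1]).
Proof.
move=> gI xC yC xy /orP[] /eqP E E2; first exact: ZG_R2_first.
by rewrite setUC; apply: ZG_R2_first => //; rewrite 1?eq_sym // consecutiveC.
Qed.

(** The properties of the exchange tau of ports along the three sides of the triangle,
    in a form which is visibly symmetric under rotation. *)
Definition third_triangle (G : framed) (tau : node G * bool -> node G * bool) (x y z : node G * bool) : Prop :=
  [/\ tau x = opposite y, tau y = opposite z, tau z = opposite x &
      [/\ tau (opposite y) = x, tau (opposite z) = y, tau (opposite x) = z
        & forall u, u.1 \notin [:: x.1; y.1; z.1] -> tau u = u]].

(** The crossings after the move, placed at the old nodes.  Edges along the triangle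
    and inserted edges get fresh names. *)
Definition moved (G : framed) (tau : node G * bool -> node G * bool) (I : seq (node G * bool)) (J : seq (node G)) (v : node G) : crossing :=
  let mu u := nm (u \in I) (inl u) in
  Crossing (mu (tau (v, false))) (mu (nxt (tau (v, false)))) (mu (tau (v, true))) (mu (nxt (tau (v, true))))
    (nm (v \in J) (inr v)).

Definition movedx (G : framed) (tau : node G * bool -> node G * bool) (I : seq (node G * bool)) (J : seq (node G)) (x : node G * bool) : crossing :=
  let mu u := nm (u \in I) (inl u) in
  Crossing (mu (tau x)) (mu (nxt (tau x))) (mu (tau (opposite x))) (mu (nxt (tau (opposite x))))
    (nm (x.1 \in J) (inr x.1)).

Lemma movedxE (G : framed) tau I J (x : node G * bool) :
  (if x.2 then flip (@moved G tau I J x.1) else moved tau I J x.1) = movedx tau I J x.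
Proof. by case: x => v []. Qed.

Lemma uniq_names (N : finType) (X : seq (N * bool)) (V : seq N) : uniq X -> uniq V ->
  uniq ([seq nm false (inl x : N * bool + N) | x <- X] ++ [seq nm false (inr v : N * bool + N) | v <- V] ++
        [seq nm true (inl x : N * bool + N) | x <- X] ++ [seq nm true (inr v : N * bool + N) | v <- V]).
Proof.
move=> UX UV.
have -> : [seq nm false (inl x : N * bool + N) | x <- X] ++ [seq nm false (inr v : N * bool + N) | v <- V] ++
        [seq nm true (inl x : N * bool + N) | x <- X] ++ [seq nm true (inr v : N * bool + N) | v <- V] =
   [seq nm e.1 e.2 | e <- [seq (b, e) | b <- [:: false; true], e <- map inl X ++ map inr V]].
  by rewrite /= !map_cat -!map_comp cats0 -!catA.
have U : uniq (map (@inl _ N) X ++ map (@inr (N * bool) _) V).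
  rewrite cat_uniq !map_inj_uniq ?UX ?UV ?andbT; try by move=> ? ? [].
  by apply/hasPn => e /mapP[v _ ->]; apply/mapP => -[].
rewrite map_inj_uniq; last by move=> [b e] [b' e'] /= /nm_inj2 [-> ->].
by apply: allpairs_uniq => //; move=> [b e] [b' e'] _ _ [-> ->].
Qed.

Section Triangle.
Variables (G : framed) (C : {set node G}) (tau : node G * bool -> node G * bool) (x y z : node G * bool).
Hypotheses (gI : injective (@nxt G)) (tauI : injective tau) (HT : third_triangle tau x y z).
Hypotheses (Uxyz : uniq [:: x.1; y.1; z.1]) (xC : x.1 \in C) (yC : y.1 \in C) (zC : z.1 \in C).

Local Notation V := [:: x.1; y.1; z.1].
Local Notation X := (opposite x).
Local Notation Y := (opposite y).
Local Notation W := (opposite z).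

(** I lists the ports which are entered from a side of the triangle. *)
Definition sides (I : seq (node G * bool)) : Prop :=
  forall u, u \in I -> u.1 \in V /\ exists2 u0, u0.1 \in V & nxt u0 = u.

Lemma wf_moved I : sides I -> wfZ [seq (v \in C, moved tau I V v) | v <- enum (node G)] [::] [::] [::].
Proof.
move=> _; have [mI mnI mn0] := naming_nm (fun u : node G * bool => u \in I) (fun v : node G => v \in V).
have nam : naming (fun u => nm (tau u \in I) (inl (tau u))) (fun v : node G => nm (v \in V) (inr v)).
  by split=> // u u' /mI /tauI.
have gI' : injective (fun u => finv tau (nxt (tau u))).
  by move=> u u' /(finv_inj tauI) /gI /tauI.
have := wf_cr (fun v => v \in C) nam gI'; congr wf; congr (_ ++ _);
  rewrite ?/srcsU ?/snksU -!map_comp; apply: eq_map => v //.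
by rewrite /= /srcU /= !f_finv.
Qed.

Lemma ZG_moved I : sides I ->
  (forall S T w, wfZ [:: (true, crx (nm0 G) (nn0 G) (@nxt G) x); (true, crx (nm0 G) (nn0 G) (@nxt G) y);
      (true, crx (nm0 G) (nn0 G) (@nxt G) z)] S T w ->
    wfZ [:: (true, movedx tau I V x); (true, movedx tau I V y); (true, movedx tau I V z)] S T w ->
    Z Phi [:: (true, crx (nm0 G) (nn0 G) (@nxt G) x); (true, crx (nm0 G) (nn0 G) (@nxt G) y);
      (true, crx (nm0 G) (nn0 G) (@nxt G) z)] S T w =
    Z Phi [:: (true, movedx tau I V x); (true, movedx tau I V y); (true, movedx tau I V z)] S T w) ->
  ZG C = ZZ [seq (v \in C, moved tau I V v) | v <- enum (node G)] [::].
Proof.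
move=> HI H; have [_ _ _ [_ _ _ fix_]] := HT.
pose b v := if v == x.1 then x.2 else if v == y.1 then y.2 else z.2.
apply: (Z_replace (b := b) Uxyz).
- move=> v vV; split=> //; rewrite /moved /cr !fix_ // (negbTE vV).
  have n1 c : ((v, c) \in I) = false.
    by apply/negP => /HI [] /=; rewrite (negbTE vV).
  have n2 c : (nxt (v, c) \in I) = false.
    by apply/negP => /HI [_ [u0 u0V /gI E]]; move: u0V; rewrite E /= (negbTE vV).
  by rewrite !n1 !n2.
- exact: wf_cr (naming0 G) gI.
- exact: wf_moved.
- move=> S T w; have bx : b x.1 = x.2 by rewrite /b eqxx.
  have by_ : b y.1 = y.2.
    by rewrite /b eqxx; case: eqP Uxyz => //= ->; rewrite inE eqxx.
  have bz : b z.1 = z.2.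
    rewrite /b; case: eqP Uxyz => [->|_]; first by rewrite /= !inE eqxx orbT.
    by case: eqP => [->|_ //]; rewrite /= !inE eqxx andbF.
  rewrite /= bx by_ bz !crxE !movedxE xC yC zC; exact: H.
Qed.

(** The six ports of the triangle are distinct; as a multirule this decides all
    comparisons among them. *)
Lemma facts :
  ((x == y) = false) * ((x == z) = false) * ((x == X) = false) * ((x == Y) = false) *
  ((x == W) = false) * ((y == x) = false) * ((y == z) = false) * ((y == X) = false) *
  ((y == Y) = false) * ((y == W) = false) * ((z == x) = false) * ((z == y) = false) *
  ((z == X) = false) * ((z == Y) = false) * ((z == W) = false) * ((X == x) = false) *
  ((X == y) = false) * ((X == z) = false) * ((X == Y) = false) * ((X == W) = false) *
  ((Y == x) = false) * ((Y == y) = false) * ((Y == z) = false) * ((Y == X) = false) *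
  ((Y == W) = false) * ((W == x) = false) * ((W == y) = false) * ((W == z) = false) *
  ((W == X) = false) * ((W == Y) = false).
Proof.
have ne (a b : node G * bool) : a.1 != b.1 -> (a == b) = false by move=> ab; apply/negP => /eqP E; rewrite E eqxx in ab.
have op (a : node G * bool) : ((a == opposite a) = false) * ((opposite a == a) = false).
  by case: a => v []; split; apply/eqP => -[].
have [xy xz yz] : [/\ x.1 != y.1, x.1 != z.1 & y.1 != z.1].
  by move: Uxyz; rewrite /= !inE negb_or => /andP[/andP[-> ->] /andP[-> _]].
have [yx zx zy] : [/\ y.1 != x.1, z.1 != x.1 & z.1 != y.1] by split; rewrite eq_sym.
by do !split; rewrite ?op ?ne.
Qed.
Lemma taus : (tau x = Y) * (tau y = W) * (tau z = X) * (tau Y = x) * (tau W = y) * (tau X = z).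
Proof. by case: HT => -> -> -> [-> -> -> _]. Qed.

Lemma nextE (a c : node G * bool) : nxt a = c -> forall u : node G * bool, (nxt u == c) = (u == a).
Proof. by move=> <- u; rewrite inj_eq. Qed.

Lemma sidesP (a1 a2 a3 b1 b2 b3 : node G * bool) : nxt a1 = b1 -> nxt a2 = b2 -> nxt a3 = b3 ->
  all (fun u => u.1 \in V) [:: a1; a2; a3; b1; b2; b3] -> sides [:: b1; b2; b3].
Proof.
move=> E1 E2 E3 /= /and4P[h1 h2 h3 /and4P[h4 h5 h6 _]] u.
rewrite inE => /orP[/eqP ->|]; first by split; [ | exists a1].
rewrite inE => /orP[/eqP ->|]; first by split; [ | exists a2].
by rewrite inE => /eqP ->; split; [ | exists a3].
Qed.

Ltac names1 E1 E2 E3 :=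
  rewrite /crx /movedx -!/(opposite _) !taus !(E1, E2, E3) !inE;
  rewrite !(nextE E1, nextE E2, nextE E3) !facts !eqxx ?orbT /=.

(** The sides of the triangle can be oriented in eight ways.  Up to a rotation there are
    four, two cyclic ones and two others, which are matched with the two local
    identities read from left to right and from right to left. *)
Lemma ZG_R3_cyclic1 : nxt x = Y -> nxt y = W -> nxt z = X ->
  sides [:: Y; W; X] /\ ZG C = ZZ [seq (v \in C, moved tau [:: Y; W; X] V v) | v <- enum (node G)] [::].
Proof.
move=> E1 E2 E3; have HI : sides [:: Y; W; X].
  by apply: sidesP E1 E2 E3 _; rewrite /= !inE !eqxx ?orbT.
split=> //; apply: ZG_moved => // S T w; names1 E1 E2 E3.
apply: (Z_R3_cyclic HPhi); apply: (uniq_names (X := [:: Y; W; X]) (V := V)) => //.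
by rewrite /= !inE !facts.
Qed.

Lemma ZG_R3_cyclic2 : nxt Y = x -> nxt W = y -> nxt X = z ->
  sides [:: x; y; z] /\ ZG C = ZZ [seq (v \in C, moved tau [:: x; y; z] V v) | v <- enum (node G)] [::].
Proof.
move=> E1 E2 E3; have HI : sides [:: x; y; z].
  by apply: sidesP E1 E2 E3 _; rewrite /= !inE !eqxx ?orbT.
split=> //; apply: ZG_moved => // S T w; names1 E1 E2 E3 => h1 h2.
apply/esym; apply: (Z_R3_cyclic HPhi) h2 h1.
have := uniq_names (X := [:: x; y; z]) (V := V); rewrite catA uniq_catC; apply=> //.
by rewrite /= !inE !facts.
Qed.

Lemma ZG_R3_acyclic1 : nxt x = Y -> nxt y = W -> nxt X = z ->
  sides [:: Y; W; z] /\ ZG C = ZZ [seq (v \in C, moved tau [:: Y; W; z] V v) | v <- enum (node G)] [::].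
Proof.
move=> E1 E2 E3; have HI : sides [:: Y; W; z].
  by apply: sidesP E1 E2 E3 _; rewrite /= !inE !eqxx ?orbT.
split=> //; apply: ZG_moved => // S T w; names1 E1 E2 E3.
apply: (Z_R3_acyclic HPhi); apply: (uniq_names (X := [:: Y; W; z]) (V := V)) => //.
by rewrite /= !inE !facts.
Qed.

Lemma ZG_R3_acyclic2 : nxt Y = x -> nxt W = y -> nxt z = X ->
  sides [:: x; y; X] /\ ZG C = ZZ [seq (v \in C, moved tau [:: x; y; X] V v) | v <- enum (node G)] [::].
Proof.
move=> E1 E2 E3; have HI : sides [:: x; y; X].
  by apply: sidesP E1 E2 E3 _; rewrite /= !inE !eqxx ?orbT.
split=> //; apply: ZG_moved => // S T w; names1 E1 E2 E3 => h1 h2.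
apply/esym; apply: (Z_R3_acyclic HPhi) h2 h1.
have := uniq_names (X := [:: x; y; X]) (V := V); rewrite catA uniq_catC; apply=> //.
by rewrite /= !inE !facts.
Qed.

End Triangle.

Lemma third_triangle_rot (G : framed) tau (x y z : node G * bool) :
  third_triangle tau x y z -> third_triangle tau y z x.
Proof.
case=> h1 h2 h3 [h4 h5 h6 h7]; split=> //; split=> // u hu; apply: h7.
by apply: contra hu; rewrite !inE => /or3P[] ->; rewrite ?orbT.
Qed.

Lemma perm_rot3 (X : eqType) (a b c : X) : perm_eq [:: a; b; c] [:: b; c; a].
Proof. by rewrite -(perm_rot 1). Qed.

(** The side at which the enumeration of the triangle starts is immaterial. *)
Lemma moved_rot (G : framed) tau I (x y z : node G * bool) :
  moved tau I [:: x.1; y.1; z.1] =1 moved tau I [:: y.1; z.1; x.1].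
Proof. by move=> v; rewrite /moved (perm_mem (perm_rot3 _ _ _)). Qed.

Lemma ZG_R3_moved (G : framed) (C : {set node G}) tau (x y z : node G * bool) :
  injective (@nxt G) -> injective tau -> third_triangle tau x y z -> uniq [:: x.1; y.1; z.1] ->
  x.1 \in C -> y.1 \in C -> z.1 \in C ->
  consecutive x (opposite y) -> consecutive y (opposite z) -> consecutive z (opposite x) ->
  exists I, ZG C = ZZ [seq (v \in C, moved tau I [:: x.1; y.1; z.1] v) | v <- enum (node G)] [::].
Proof.
move=> gI tI HT U xC yC zC.
have HT1 := third_triangle_rot HT; have HT2 := third_triangle_rot HT1.
have U1 : uniq [:: y.1; z.1; x.1] by rewrite -(perm_uniq (perm_rot3 _ _ _)).
have U2 : uniq [:: z.1; x.1; y.1] by rewrite -(perm_uniq (perm_rot3 _ _ _)).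
have r1 I : ZZ [seq (v \in C, moved tau I [:: y.1; z.1; x.1] v) | v <- enum (node G)] [::] =
    ZZ [seq (v \in C, moved tau I [:: x.1; y.1; z.1] v) | v <- enum (node G)] [::].
  by congr (Z _ _ _ _ _); apply: eq_map => v; rewrite -moved_rot.
have r2 I : ZZ [seq (v \in C, moved tau I [:: z.1; x.1; y.1] v) | v <- enum (node G)] [::] =
    ZZ [seq (v \in C, moved tau I [:: x.1; y.1; z.1] v) | v <- enum (node G)] [::].
  by rewrite -r1; congr (Z _ _ _ _ _); apply: eq_map => v; rewrite -moved_rot.
(* The position of the side with the exceptional orientation decides the rotation. *)
move=> /orP[] /eqP E1 /orP[] /eqP E2 /orP[] /eqP E3.
- by have [_ ->] := ZG_R3_cyclic1 gI tI HT U xC yC zC E1 E2 E3; eexists.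
- by have [_ ->] := ZG_R3_acyclic1 gI tI HT U xC yC zC E1 E2 E3; eexists.
- by have [_ ->] := ZG_R3_acyclic1 gI tI HT2 U2 zC xC yC E3 E1 E2; rewrite r2; eexists.
- by have [_ ->] := ZG_R3_acyclic2 gI tI HT1 U1 yC zC xC E2 E3 E1; rewrite r1; eexists.
- by have [_ ->] := ZG_R3_acyclic1 gI tI HT1 U1 yC zC xC E2 E3 E1; rewrite r1; eexists.
- by have [_ ->] := ZG_R3_acyclic2 gI tI HT2 U2 zC xC yC E3 E1 E2; rewrite r2; eexists.
- by have [_ ->] := ZG_R3_acyclic2 gI tI HT U xC yC zC E1 E2 E3; eexists.
- by have [_ ->] := ZG_R3_cyclic2 gI tI HT U xC yC zC E1 E2 E3; eexists.
Qed.

(** The graph H is obtained by exchanging the ports on the sides; naming its edges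
    through this exchange presents it by the crossings [moved]. *)
Lemma ZG_R3 (G H : framed) (C : {set node G}) (x y z : node G * bool) i t :
  injective (@nxt G) -> injective (@nxt H) -> uniq [:: x.1; y.1; z.1] ->
  x.1 \in C -> y.1 \in C -> z.1 \in C ->
  consecutive x (opposite y) -> consecutive y (opposite z) -> consecutive z (opposite x) ->
  @exchanges G H x (opposite y) y (opposite z) z (opposite x) i t -> ZG C = ZG (i @^-1: C).
Proof.
pose tau u := tperm x (opposite y) (tperm y (opposite z) (tperm z (opposite x) u)).
move=> gI hI U xC yC zC c1 c2 c3 [bi E0]; have iI := bij_inj bi.
have E u : lift i t (@nxt H u) = tau (nxt (tau (lift i t u))) by exact: E0.
have F := facts U.
have HT : third_triangle tau x y z.
  have D (a b c : node G * bool) : (a == c) = false -> (b == c) = false -> tperm a b c = c.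
    by move=> ac bc; rewrite tpermD ?ac ?bc.
  split; rewrite /tau; last split.
  - by rewrite (D z (opposite x) x) ?F // (D y (opposite z) x) ?F // tpermL.
  - by rewrite (D z (opposite x) y) ?F // tpermL D ?F.
  - by rewrite tpermL (D y (opposite z)) ?F // D ?F.
  - by rewrite (D z) ?F // (D y) ?F // tpermR.
  - by rewrite (D z) ?F // tpermR D ?F.
  - by rewrite tpermR (D y) ?F // D ?F.
  move=> u; rewrite !inE !negb_or => /and3P[ux uy uz].
  have ne (a b : node G * bool) : a.1 != b.1 -> (a == b) = false.
    by move=> ab; apply/negP => /eqP E'; rewrite E' eqxx in ab.
  by rewrite (D z) ?(D y) ?(D x) // ne // eq_sym.
have tauI : injective tau by move=> u u' /perm_inj /perm_inj /perm_inj.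
have tK : involutive tau.
  move=> u; case: HT => h1 h2 h3 [h4 h5 h6 h7].
  have [uV|uV] := boolP (u.1 \in [:: x.1; y.1; z.1]); last by rewrite !h7.
  have ou (a : node G * bool) : u.1 = a.1 -> u = a \/ u = opposite a.
    by case: u a {uV} => v b [v' b'] /= ->; case: b; case: b'; [left | right | right | left].
  by move: uV; rewrite !inE => /or3P[] /eqP /ou [] ->; rewrite ?h1 ?h4 ?h2 ?h5 ?h3 ?h6 ?h1 ?h4 ?h2 ?h5 ?h3 ?h6.
have [I ->] := ZG_R3_moved gI tauI HT U xC yC zC c1 c2 c3.
have liftI : injective (lift i t).
  by move=> [u b] [u' b'] [/iI <-] /addIb ->.
pose mu u := nm (u \in I) (inl u : node G * bool + node G).
pose mn v := nm (v \in [:: x.1; y.1; z.1]) (inr v : node G * bool + node G).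
have nam : naming (fun u => mu (tau (lift i t u))) (fun v => mn (i v)).
  have [mI mnI mn0] := naming_nm (fun u : node G * bool => u \in I) (fun v : node G => v \in [:: x.1; y.1; z.1]).
  by split=> [u u' /mI /tauI /liftI|v v' /mnI /iI|u v]; last exact: mn0.
rewrite -(ZG_naming (i @^-1: C) hI nam).
have WH := wf_cr (fun v => v \in i @^-1: C) nam hI.
rewrite -(Z_flips HPhi t WH).
have PH : perm_eq (map i (enum (node H))) (enum (node G)).
  apply: uniq_perm; [by rewrite map_inj_uniq // enum_uniq | exact: enum_uniq | move=> v].
  rewrite mem_enum inE; have [i' iK i'K] := bi.
  by apply/mapP; exists (i' v); rewrite ?mem_enum ?i'K.
have E2 : [seq (v \in i @^-1: C, if t v then flip (cr (fun u => mu (tau (lift i t u))) (fun v => mn (i v)) (@nxt H) v)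
       else cr (fun u => mu (tau (lift i t u))) (fun v => mn (i v)) (@nxt H) v) | v <- enum (node H)] =
    [seq (v \in C, moved tau I [:: x.1; y.1; z.1] v) | v <- map i (enum (node H))].
  rewrite -map_comp; apply: eq_map => v /=; rewrite !inE; congr (_, _).
  by rewrite /cr !E !tK /moved /lift /=; case: (t v).
rewrite E2; apply/esym/Z_perm => //; first exact: perm_map.
by have := wfZ_flips t WH; rewrite E2.
Qed.

End Graphs.

(** * The coefficient of a graph, as a function of nets *)

Local Notation FF := (@Fw moduleM bigonM circleM (@base moduleM class_of)).

Definition phi (t : tgraph) (S T : names) (w : wires) : 'F_2 := tcoef2 t (FF S T w).

Lemma phi_rules t : net_rules (phi t).
Proof.
have bE := @base_eqv moduleM class_of class_of_iso.
have bR := @base_ren moduleM class_of class_of_iso.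
split.
- move=> S S' T T' w w' W ES ET Ew.
  exact: (f_equal (tcoef2 t) (@F_eqv moduleM _ _ bigonME _ bE bR _ _ _ _ _ _ W ES ET Ew)).
- move=> r S T w W inj; exact: (f_equal (tcoef2 t) (@F_ren moduleM _ _ bigonME _ bE bR _ _ _ _ W inj)).
- move=> S T w a b W ab; exact: (f_equal (tcoef2 t) (@F_wire2 moduleM _ _ bigonME _ bE bR _ _ _ _ _ W ab)).
- move=> S T w a b v W; exact: (f_equal (tcoef2 t) (@F_in moduleM _ _ bigonME _ bE bR _ _ _ _ _ _ W)).
- move=> S T w a b c W; exact: (f_equal (tcoef2 t) (@F_ww moduleM _ _ bigonME _ bE bR _ _ _ _ _ _ W)).
- move=> S T w a b v W; exact: (f_equal (tcoef2 t) (@F_out moduleM _ _ bigonME _ bE bR _ _ _ _ _ _ W)).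
- move=> S T w a W; have E := @Fw_loop moduleM bigonM circleM (@base moduleM class_of) _ _ _ _ W.
  by rewrite /phi E; apply: tcoef2_circle.
- move=> a b c d S T w W; have E := @F_bigon moduleM _ _ bigonME _ bE bR _ _ _ _ _ _ _ W.
  by rewrite /phi E; apply: tcoef2_bigon.
- move=> a b c d p q r o S T w W; have E := @F_quad moduleM _ _ bigonME _ bE bR _ _ _ _ _ _ _ _ _ _ _ W.
  by rewrite /phi E; apply: tcoef2D.
Qed.

(** * States *)

Section States.
Variables (Phi : names -> names -> wires -> 'F_2) (HPhi : net_rules Phi).
Variables (N : finType) (C : {set N}) (c : N -> crossing).

Local Notation kc s := [seq (v \in C, c v) | v <- s].

Definition state_srcs (U : {set N}) (s : seq N) : names := [seq srcU (c v) | v <- s & v \in U].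
Definition state_snks (U : {set N}) (s : seq N) : names := [seq snkU (c v) | v <- s & v \in U].
Definition state_wires (U : {set N}) (s : seq N) : wires :=
  flatten [seq (if v \in C then wiresO (c v) else wiresV (c v)) | v <- s & v \notin U].

Definition state_value U s S T w :=
  Phi (state_srcs U s ++ S) (state_snks U s ++ T) (state_wires U s ++ w).

Lemma wf_state (U : {set N}) s S T w : wfZ (kc s) S T w ->
  wf (state_srcs U s ++ S) (state_snks U s ++ T) (state_wires U s ++ w).
Proof.
rewrite /state_srcs /state_snks /state_wires; elim: s S T w => //= v s IH S T w W.
case: (v \in U) => /=.
  have [L h1 h2] := IH _ _ _ (wfZ_U W); split.
  - by move=> z; have := L z; rewrite /outn /inn /= !occ_cat /=; clear; glia.
  - by move: h1; rewrite /cubic /= !all_cat /=.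
  - by move: h2; rewrite /cubic /= !all_cat /=.
have perm_w x : perm_eq (state_wires U s ++ x ++ w) ((x ++ state_wires U s) ++ w).
  by rewrite -catA perm_catCA.
case: (v \in C) W => W.
  exact: wf_perm (IH _ _ _ (wfZ_O W)) (perm_refl _) (perm_refl _) (perm_w _).
exact: wf_perm (IH _ _ _ (wfZ_V W)) (perm_refl _) (perm_refl _) (perm_w _).
Qed.

Lemma state_value_in (U : {set N}) v s S T w : v \in U -> wfZ (kc (v :: s)) S T w ->
  state_value U (v :: s) S T w = state_value U s (srcU (c v) :: S) (snkU (c v) :: T) w.
Proof.
move=> vU W; have W' := wf_state U W; rewrite /state_value in W' *.
apply: (rule_eqv HPhi W'); rewrite /state_srcs /state_snks /state_wires /= vU //=.
  by apply: eqv_perm; rewrite perm_sym (perm_catCA _ [:: _]).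
by apply: eqv_perm; rewrite perm_sym (perm_catCA _ [:: _]).
Qed.

Lemma state_value_out (U : {set N}) v s S T w : v \notin U -> wfZ (kc (v :: s)) S T w ->
  state_value U (v :: s) S T w =
  state_value U s S T ((if v \in C then wiresO (c v) else wiresV (c v)) ++ w).
Proof.
move=> vU W; have W' := wf_state U W; rewrite /state_value in W' *.
apply: (rule_eqv HPhi W'); rewrite /state_srcs /state_snks /state_wires /= (negbTE vU) /= ?eqv_refl //.
by rewrite -catA perm_catCA.
Qed.

Lemma state_value_ext (U U' : {set N}) s S T w : {in s, U =i U'} ->
  state_value U s S T w = state_value U' s S T w.
Proof.
move=> E; rewrite /state_value /state_srcs /state_snks /state_wires.
rewrite (eq_in_filter E) (@eq_in_filter _ (fun v => v \notin U) (fun v => v \notin U')) // => v vs.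
by rewrite E.
Qed.

(** The state sum has one term for each subset U of C.  If it differs from the term of
    C itself, some other term is nonzero. *)
Lemma lower_state s S T w : uniq s -> wfZ (kc s) S T w ->
  Z Phi (kc s) S T w != state_value C s S T w ->
  exists U : {set N}, [/\ U \subset C, exists2 v, v \in s & (v \in C) && (v \notin U)
    & state_value U s S T w != 0%R].
Proof.
elim: s S T w => [|v s IH] S T w; first by rewrite /state_value /= eqxx.
move=> /= /andP[vs us] W; case vC: (v \in C); last first.
  rewrite state_value_out ?vC // => H.
  have W' : wfZ (kc s) S T (wiresV (c v) ++ w) by exact: wfZ_V W.
  have [U [UC [u us' uP] nz]] := IH _ _ _ us W' H.
  exists U; split=> //; first by exists u; rewrite // inE us' orbT.
  rewrite state_value_out ?vC //.
  by apply: contraFN vC => /(subsetP UC).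
have WU : wfZ (kc s) (srcU (c v) :: S) (snkU (c v) :: T) w by exact: wfZ_U W.
have WO : wfZ (kc s) S T (wiresO (c v) ++ w) by exact: wfZ_O W.
rewrite state_value_in ?vC // => H.
have [E|ne] := eqVneq (Z Phi (kc s) (srcU (c v) :: S) (snkU (c v) :: T) w)
    (state_value C s (srcU (c v) :: S) (snkU (c v) :: T) w); last first.
  have [U [UC [u us' uP] nz]] := IH _ _ _ us WU ne.
  exists (v |: U); split.
  - by rewrite subUset sub1set vC.
  - exists u; first by rewrite inE us' orbT.
    case/andP: uP => -> uU /=; rewrite inE negb_or uU andbT inE.
    by apply: contraNneq vs => <-.
  rewrite state_value_in ?inE ?eqxx //.
  rewrite (@state_value_ext (v |: U) U) // => x xs; rewrite !inE.
  by case: eqP xs => // ->; rewrite (negbTE vs).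
have nz : Z Phi (kc s) S T (wiresO (c v) ++ w) != 0%R.
  by apply: contraNneq H => H0; rewrite H0 E add0r.
have [U [UC nzU]] : exists U : {set N}, U \subset C /\ state_value U s S T (wiresO (c v) ++ w) != 0%R.
  have [E'|ne] := eqVneq (Z Phi (kc s) S T (wiresO (c v) ++ w)) (state_value C s S T (wiresO (c v) ++ w)).
    by exists C; rewrite -E'.
  by have [U [UC _ nzU]] := IH _ _ _ us WO ne; exists U.
exists (U :\ v); split.
- exact: subset_trans (subsetDl _ _) UC.
- by exists v; rewrite ?mem_head // vC !inE eqxx.
rewrite state_value_out ?vC ?inE ?eqxx //.
rewrite (@state_value_ext (U :\ v) U) // => x xs; rewrite !inE.
by case: eqP xs => // ->; rewrite (negbTE vs).
Qed.

End States.

(** * The graphs of the states *)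

(** Following a chain of wires back to its beginning. *)
Lemma root_path S T w s p : linear S T w -> path (fun a b => (a, b) \in w) s p ->
  in2 s w = 0 -> in1 (last s p) w = 0 -> root w (last s p) = s.
Proof.
move=> L; have := wf_uniq2 L; have := wf_uniq1 L; move: {S T L} w.
elim/last_ind: p => [|p y IH] w u1 u2 /=; first by move=> _ s0 _; exact: root_id.
rewrite rcons_path last_rcons => /andP[P ay] s0 y0.
set a := last s p in ay *; pose w' := rem (a, y) w.
have Pw : perm_eq w ((a, y) :: w') := perm_to_rem ay.
have v1 z : (a == z) + in1 z w' <= 1 by have := u1 z; rewrite (perm_in1 _ Pw).
have v2 z : (y == z) + in2 z w' <= 1 by have := u2 z; rewrite (perm_in2 _ Pw).
rewrite (root_perm Pw u1 u2 y0) /= (root_id (x := y)); last by have := v2 y; rewrite eqxx; clear; lia.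
rewrite /ren1 eqxx IH //.
- by move=> z; apply: leq_trans (v1 z); apply: leq_addl.
- by move=> z; apply: leq_trans (v2 z); apply: leq_addl.
- have out1 b z : (b, z) \in w -> 0 < in1 b w.
    by move=> bz; rewrite in1E -has_count; apply/hasP; exists (b, z) => /=.
  have a0 : 0 < in1 (last s p) w := out1 _ _ ay.
  move: P a0; clearbody w'; clearbody a; clear -Pw y0 out1; elim: p s => //= b p IHp s /andP[sb P] l0.
  rewrite IHp // andbT; have b0 : 0 < in1 b w.
    by case: p P l0 {IHp} => //= z p /andP[/out1].
  move: sb; rewrite (perm_mem Pw) inE => /orP[/eqP[_ E]|//].
  by move: b0; rewrite E y0.
- by move: s0; rewrite (perm_in2 _ Pw) /=; clear; lia.
- by apply/eqP; rewrite -leqn0 -(leq_add2l 1); have := v1 a; rewrite eqxx.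
Qed.

Section Resolve.
Variables (G : framed) (C U : {set node G}).
Hypothesis gI : injective (@nxt G).

Local Notation port := (node G * bool)%type.
Local Notation mu := (fun x : port => nm false (inl x)).
Local Notation mn := (fun v : node G => nm false (inr v)).
Local Notation c := (cr mu mn (@nxt G)).
Local Notation kc := [seq (v \in C, c v) | v <- enum (node G)].
Local Notation inU := (fun y : port => y.1 \in U).

(** Where the strands are exchanged, the curve leaves along the opposite strand. *)
Definition turn (x : port) : port := if x.1 \in C :\: U then opposite x else x.

Lemma turnK : involutive turn.
Proof.
move=> x; rewrite /turn; case E: (x.1 \in C :\: U); last by rewrite E.
by rewrite /= E oppositeK.
Qed.

Lemma turn1 x : (turn x).1 = x.1. Proof. by rewrite /turn; case: ifP. Qed.

Lemma walkE x : walk C U x = turn (nxt x). Proof. by []. Qed.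

(** One step along the strands of the state, seen from the outgoing side of a node;
    [walk] is the same step seen from the incoming side, where an oriented crossing
    has already been passed. *)
Definition advance (x : port) : port := nxt (turn x).

Lemma advance_inj : injective advance.
Proof. by move=> x y /gI /(can_inj turnK). Qed.

Lemma walk_inj : injective (walk C U).
Proof. by move=> x y; rewrite !walkE => /(can_inj turnK) /gI. Qed.

(** The two points of view have the same first returns to U, where [turn] is the
    identity. *)
Lemma hits_walk x y : hits (walk C U) inU x y -> hits advance inU (turn x) y.
Proof.
elim=> {x y} [x|x y] Hx; rewrite walkE turn1 in Hx.
  rewrite walkE; have -> : turn (nxt x) = advance (turn x).
    by rewrite /advance turnK {1}/turn in_setD Hx.
  by apply: hits_now; rewrite /advance turnK.
move=> _ H; apply: hits_later; first by rewrite /advance turnK.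
have E : advance (turn x) = turn (walk C U x) by rewrite walkE turnK /advance turnK.
by rewrite E.
Qed.

Local Notation SS := (state_srcs c U (enum (node G))).
Local Notation TT := (state_snks c U (enum (node G))).
Local Notation ww := (state_wires C c U (enum (node G))).

Lemma wf_natural : wf SS TT ww.
Proof.
have := wf_state U (wf_cr (fun v => v \in C) (naming0 G) gI).
by rewrite !cats0.
Qed.

Lemma wire_advance x : x.1 \notin U -> (mu x, mu (advance x)) \in ww.
Proof.
move=> xU; apply/flatten_mapP; exists x.1; first by rewrite mem_filter xU mem_enum.
rewrite /advance /turn in_setD xU /=; case: (x.1 \in C); case: x {xU} => v []; rewrite !inE /= eqxx ?orbT //.
Qed.

Lemma wire_target x : x.1 \in U -> in2 (mu (advance x)) ww = 0.
Proof.
move=> xU; apply/eqP; rewrite in2E -leqn0 leqNgt -has_count; apply/hasPn => e.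
case/flatten_mapP => v; rewrite mem_filter => /andP[vU _] ev.
have [b ->] : exists b, e = (mu (v, b), mu (advance (v, b))).
  move: ev; rewrite /advance /turn /= in_setD vU /=; case: (v \in C); rewrite !inE => /orP[] /eqP ->;
    by [exists false | exists true].
apply/eqP => /= /nm_inj2 [_ [/advance_inj E]]; by move: xU; rewrite -E (negbTE vU).
Qed.

Lemma wire_source x : x.1 \in U -> in1 (mu x) ww = 0.
Proof.
move=> xU; apply/eqP; rewrite in1E -leqn0 leqNgt -has_count; apply/hasPn => e.
case/flatten_mapP => v; rewrite mem_filter => /andP[vU _] ev.
have [b ->] : exists b, e.1 = mu (v, b).
  by move: ev; case: (v \in C); rewrite !inE => /orP[] /eqP ->; [exists false | exists true | exists false | exists true].
by apply/eqP => /nm_inj2 [_ [E]]; move: xU; rewrite -E (negbTE vU).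
Qed.

Lemma root_hits x y : x.1 \in U -> hits advance inU x y -> root ww (mu y) = mu (advance x).
Proof.
move=> xU H; have [L _ _] := wf_natural.
have [p P E] : exists2 p, path (fun a b => (a, b) \in ww) (mu (advance x)) p & mu y = last (mu (advance x)) p.
  elim: H => {x y xU} [x|x y] Hx; first by exists [::].
  move=> _ [p P E]; exists (mu (advance (advance x)) :: p) => //=.
  by rewrite P (@wire_advance (advance x)).
have yU : y.1 \in U := hits_P H.
by rewrite E; apply: root_path L P _ _; [exact: wire_target | rewrite -E; exact: wire_source].
Qed.

Definition first_return (x : port) : port := first_hit (walk C U) inU x.

Lemma ret_hits x : x.1 \in U -> hits advance inU x (first_return x).
Proof.
move=> xU; have := hits_walk (@hits_first _ (walk C U) inU x walk_inj xU).
by rewrite {1}/turn in_setD xU.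
Qed.

Lemma ret_in x : x.1 \in U -> (first_return x).1 \in U.
Proof. by move=> xU; exact: (hits_P (ret_hits xU)). Qed.

Lemma turn_in x : x.1 \in U -> turn x = x.
Proof. by move=> xU; rewrite /turn in_setD xU. Qed.

(** The edge which leaves x arrives at its first return: connecting the wires in
    between leaves one edge, under the name given to it at x. *)
Lemma root_return x : x.1 \in U -> root ww (mu (first_return x)) = mu (nxt x).
Proof.
move=> xU; rewrite (root_hits xU (ret_hits xU)).
by rewrite /advance turn_in.
Qed.

(** Two edges do not arrive at the same port, and there are as many ports as edges. *)
Lemma ret_onto y : y.1 \in U -> exists2 x, x.1 \in U & first_return x = y.
Proof.
move=> yU; pose f (x : {x : port | x.1 \in U}) : {x : port | x.1 \in U} :=
  exist _ (first_return (val x)) (ret_in (valP x)).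
have fI : injective f.
  move=> [x xU] [x' x'U] /(congr1 val) /= E; apply: val_inj => /=.
  by have := root_return xU; rewrite E root_return // => /nm_inj2 [_ [/gI]].
have := f_invF fI (exist _ y yU); case: (invF _ _) => x xU /(congr1 val) /= E.
by exists x.
Qed.

(** Each edge of the resolved graph is called as the edge of the diagram with which it
    starts. *)
Definition edge_name (e : edge (resolve C U)) : nat :=
  if e.2 is Some b then mu (nxt (val e.1, b)) else mn (val e.1).

Lemma edge_name_inj : injective edge_name.
Proof.
move=> [[u uU] [b|]] [[u' u'U] [b'|]]; rewrite /edge_name /= => /nm_inj2 [_] //.
  case=> /gI [E E']; congr (_, _); last by rewrite E'.
  exact: val_inj.
by case=> E; congr (_, _); apply: val_inj.
Qed.

Local Notation node_in := {u : node G | u \in U}.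

Lemma perm_nodes : perm_eq [seq val u | u <- enum {: node_in}] [seq v <- enum (node G) | v \in U].
Proof.
apply: uniq_perm; [by rewrite map_inj_uniq ?enum_uniq //; exact: val_inj | exact: uniq_enum_filter |].
move=> v; rewrite mem_filter mem_enum inE andbT; apply/mapP/idP => [[u _ ->]|vU]; first exact: valP.
by exists (exist _ v vU); rewrite ?mem_enum.
Qed.

Lemma star_src (u : node_in) :
  perm_eq [seq e <- enum (edge (resolve C U)) | @org (resolve C U) e == u] [:: (u, None); (u, Some false); (u, Some true)].
Proof.
apply: uniq_perm; [exact: uniq_enum_filter | by rewrite /= !inE !xpair_eqE !eqxx | move=> [u' b]].
rewrite mem_filter mem_enum !inE andbT !xpair_eqE /=.
by case: (u' == u); case: b => [[]|].
Qed.

Lemma ret_inj x y : x.1 \in U -> y.1 \in U -> first_return x = first_return y -> x = y.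
Proof.
move=> xU yU E; have := root_return xU; rewrite E root_return //.
by move=> /nm_inj2 [_ [/gI]].
Qed.

Definition out_edge (x : port) (xU : x.1 \in U) : edge (resolve C U) := (exist _ x.1 xU, Some x.2).

Lemma star_snk (u : node_in) : exists e0 e1 : edge (resolve C U),
  perm_eq [seq e <- enum (edge (resolve C U)) | @dst (resolve C U) e == u] [:: (u, None); e0; e1] /\
  edge_name e0 = root ww (mu (val u, false)) /\ edge_name e1 = root ww (mu (val u, true)).
Proof.
have uU := valP u.
have [x0 x0U E0] := @ret_onto (val u, false) uU; have [x1 x1U E1] := @ret_onto (val u, true) uU.
exists (out_edge x0U), (out_edge x1U); split; last first.
  by rewrite -E0 -E1 !root_return // /edge_name /=; case: x0 {E0 x0U} => ? ?; case: x1 {E1 x1U}.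
have dstE (u' : node_in) b : (dst ((u', Some b) : edge (resolve C U)) == u) = ((first_return (val u', b)).1 == val u).
  rewrite /= -(inj_eq val_inj) insubdK //; exact: (@ret_in (val u', b) (valP u')).
apply: uniq_perm; first exact: uniq_enum_filter.
  rewrite /= !inE !xpair_eqE !andbF /= !andbT; apply/negP => /andP[/eqP E2 /eqP E3].
  have {}E2 : x0.1 = x1.1 by case: E2.
  have {}E3 : x0.2 = x1.2 by case: E3.
  have : x0 = x1 by rewrite [x0]surjective_pairing E2 E3 -surjective_pairing.
  by move=> E; move: E0; rewrite E E1.
move=> [u' [b|]]; rewrite mem_filter mem_enum andbT; last by rewrite /= !inE !xpair_eqE /= andbT !andbF !orbF.
rewrite dstE !inE /=.
have eE x (xU : x.1 \in U) : ((u', Some b) == out_edge xU) = ((val u', b) == x).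
  by rewrite /out_edge; case: x xU => v b' xU; rewrite !xpair_eqE -(inj_eq val_inj).
rewrite !eE; have u'U := valP u'.
apply/eqP/orP => [E|].
  case Er : (first_return (val u', b)) E => [v b'] /= E; subst v.
  case: b' Er => Er; right; apply/orP; [right | left]; apply/eqP.
    by apply: (@ret_inj (val u', b) x1 u'U x1U); rewrite Er E1.
  by apply: (@ret_inj (val u', b) x0 u'U x0U); rewrite Er E0.
by case=> [/eqP []|/orP[] /eqP ->]; rewrite ?E0 ?E1.
Qed.

(** The net of a state presents the graph of this state. *)
Lemma presents_natural : @presents (resolve C U) edge_name SS (ren (root ww) TT).
Proof.
have [L _ _] := wf_natural.
split; first exact: edge_name_inj; rewrite eqv_sym.
  apply: (@eqv_trans _ [seq srcU (c (val u)) | u <- enum {: node_in}]).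
    apply: eqv_map => u _; have := perm_map edge_name (star_src u); exact.
  have -> : [seq srcU (c (val u)) | u <- enum {: node_in}] = [seq srcU (c v) | v <- [seq val u | u <- enum {: node_in}]].
    by rewrite -map_comp.
  by apply: eqv_perm; apply: perm_map; exact: perm_nodes.
apply: (@eqv_trans _ [seq map (root ww) (snkU (c (val u))) | u <- enum {: node_in}]).
  apply: eqv_map => u _; have uU := valP u; have [e0 [e1 [P [n0 n1]]]] := star_snk u.
  apply: perm_trans (perm_map edge_name P) _; rewrite /= n0 n1.
  rewrite [root ww (mn (val u))]root_id //.
  have := L (mn (val u)); have : 0 < occ (mn (val u)) SS.
    rewrite occ_gt0; apply/flatten_mapP; exists (val u); first by rewrite mem_filter uU mem_enum.
    by rewrite /srcU inE eqxx.
  have : 0 < occ (mn (val u)) TT.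
    rewrite occ_gt0; apply/flatten_mapP; exists (val u); first by rewrite mem_filter uU mem_enum.
    by rewrite /snkU inE eqxx.
  by rewrite /outn /inn; lia.
have -> : [seq map (root ww) (snkU (c (val u))) | u <- enum {: node_in}] =
   [seq map (root ww) (snkU (c v)) | v <- [seq val u | u <- enum {: node_in}]].
  by rewrite -map_comp.
apply: eqv_perm; rewrite /ren [X in perm_eq _ (map _ X)]/state_snks -(map_comp (map (root ww))).
by apply: (perm_map (fun v => map (root ww) (snkU (c v)))); exact: perm_nodes.
Qed.

Lemma resolve_trivalent : trivalent (resolve C U).
Proof.
have [_ cS cT] := wf_natural; apply: presents_trivalent presents_natural cS _.
by rewrite cubic_ren.
Qed.

(** The circles of the state are not described by the net; they are worth 1 on both
    sides. *)
Lemma resolve_value t : phi t SS TT ww = tcoef2 t (web_value (resolve C U)).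
Proof.
have E1 := @F_root moduleM bigonM circleM (@base moduleM class_of) SS TT ww.
have E2 := @reduce_presents moduleM _ _ bigonME _ class_of_iso _ _ _ _ presents_natural resolve_trivalent.
rewrite /phi E1 /web_value E2; apply: etrans (tcoef2_circles t _ _) _; apply: esym.
exact: tcoef2_circles.
Qed.

End Resolve.

(** * Unicursal graphs *)

(** Following the curve from nxt y one arrives at y, so that nxt is onto. *)
Lemma unicursal_inj (G : framed) : unicursal G -> injective (@nxt G).
Proof.
move=> uG; have onto (y : node G * bool) : exists x, nxt x == y.
  have /iter_findex E := uG (nxt y) y.
  by exists (iter (findex (@nxt G) (nxt y) y) (@nxt G) y); rewrite -iterS iterSr E.
pose g (y : node G * bool) := xchoose (onto y).
have gK : cancel g (@nxt G) by move=> y; apply/eqP; exact: (xchooseP (onto y)).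
have [h hK Kh] := injF_bij (can_inj gK).
by move=> x y E; rewrite -(Kh x) -(Kh y) -(gK (h x)) -(gK (h y)) !Kh E.
Qed.

Section Unicursal.
Variables (G : framed) (C : {set node G}).
Hypothesis uG : unicursal G.

Local Notation inC := (fun y : node G * bool => y.1 \in C).

Lemma walkCC (x : node G * bool) : walk C C x = nxt x.
Proof. by rewrite /walk setDv inE. Qed.

Lemma adjacent_sym (H : web) : symmetric (@adjacent H).
Proof. by move=> [p|q] [p'|q']. Qed.

(** The edge leaving u arrives at the sink of v, which is joined to the source of v by
    the inserted edge. *)
Lemma resolve_link (u : {u | u \in C}) b (v : {u | u \in C}) :
  (first_hit (walk C C) inC (val u, b)).1 = val v ->
  connect (@adjacent (resolve C C)) (inl u) (inl v).
Proof.
move=> E; apply: (@connect_trans _ _ (inr v : src (resolve C C) + snk (resolve C C))%type).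
  apply: connect1; apply/existsP; exists (u, Some b); rewrite /= eqxx /= E.
  by apply/eqP; apply: val_inj; rewrite insubdK //; exact: (valP v).
by apply: connect1; apply/existsP; exists (v, None); rewrite /= !eqxx.
Qed.

(** Following the curve from u, the last node of C which has been met is always linked
    to u. *)
Lemma resolve_linked (u v : {u | u \in C}) :
  connect (@adjacent (resolve C C)) (inl u) (inl v).
Proof.
have wI := walk_inj (C := C) (U := C) (unicursal_inj uG).
have uC := valP u.
(* x is the last visit of C before y, or y itself if y is in C. *)
pose waits (y : node G * bool) := exists x, [/\ inC x, forall xC : x.1 \in C,
  connect (@adjacent (resolve C C)) (inl u) (inl (exist _ x.1 xC)) &
  y = x \/ ~~ inC y /\ forall z, hits (walk C C) inC y z -> hits (walk C C) inC x z].
suff H n : waits (iter n (walk C C) (val u, true)).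
  have uv : fconnect (walk C C) (val u, true) (val v, true) by rewrite (eq_fconnect walkCC).
  have [x [xC ux []]] := H (findex (walk C C) (val u, true) (val v, true)); rewrite iter_findex //.
    move=> E; have xC' := xC; rewrite -E in xC'.
    have := ux xC; rewrite (_ : exist _ _ _ = v) //; apply: val_inj => /=.
    by rewrite -E.
  by case; rewrite (valP v).
elim: n => [|n [x [xC ux H]]].
  exists (val u, true); split=> //; last by left.
  by move=> uC'; rewrite (_ : exist _ _ _ = u) //; apply: val_inj.
set y := iter n _ _ in H *; rewrite iterS -/y.
have toz z : hits (walk C C) inC y z -> hits (walk C C) inC x z by case: H => [->|[_]] //; apply.
case yC : ((walk C C y).1 \in C).
  have E : first_hit (walk C C) inC x = walk C C y.
    apply: (@hits_det _ (walk C C) inC x); first exact: hits_first.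
    by apply: toz; exact: (@hits_now _ (walk C C) inC y yC).
  exists (walk C C y); split=> //; last by left.
  move=> yC'; apply: connect_trans (ux xC) _.
  by apply: (@resolve_link _ x.2); rewrite -surjective_pairing E.
exists x; split=> //; right; rewrite yC; split=> // z Hz; apply: toz.
by apply: hits_later Hz; rewrite yC.
Qed.

(** A single curve meets all the nodes, and no circle avoids C. *)
Lemma resolve_connected : 0 < #|C| -> connected (resolve C C).
Proof.
move=> C0; have [v vC] := card_gt0P C0; apply/and3P; split.
- rewrite /=; have -> : (#|node G| == 0) = false.
    by apply/negbTE; rewrite -lt0n; exact: leq_trans C0 (max_card _).
  apply/eqP/eq_card0 => x; rewrite !inE; apply/nandP; right; apply/allPn; exists (v, true).
    by rewrite -fconnect_orbit (eq_fconnect walkCC).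
  by rewrite negbK.
- by apply/card_gt0P; exists (inl (exist _ v vC)).
have sym := sym_connect_sym (@adjacent_sym (resolve C C)).
have toS (x : src (resolve C C) + snk (resolve C C)) : connect (@adjacent (resolve C C)) x (inl (exist _ v vC)).
  case: x => u; first exact: resolve_linked.
  apply: (@connect_trans _ _ (inl u : src (resolve C C) + snk (resolve C C))%type); last exact: resolve_linked.
  by apply: connect1; apply/existsP; exists (u, None); rewrite /= !eqxx.
apply/forallP => x; apply/forallP => y; apply: connect_trans (toS x) _.
by rewrite sym; exact: toS.
Qed.

Lemma card_src_resolve (U : {set node G}) : #|src (resolve C U)| = #|U|.
Proof. by rewrite card_sig; apply: eq_card => v. Qed.

End Unicursal.

(** * Invariance of the state sum *)

Section Moves.
Variables (Phi : names -> names -> wires -> 'F_2) (HPhi : net_rules Phi).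

(** First leave the nodes of D unresolved, then erase them. *)
Lemma ZG_erased (G H : framed) (C D : {set node G}) i t : injective (@nxt G) ->
  @erases G H D i t -> ZG Phi C = ZG Phi (C :\: D) -> ZG Phi C = ZG Phi (i @^-1: C).
Proof.
move=> gI HE ->; have dis : [disjoint D & C :\: D].
  by rewrite disjoint_sym disjoints_subset; apply/subsetP => v; rewrite !inE => /andP[].
have [_ ->] := ZG_erases HPhi gI dis HE; congr ZG; apply/setP => v.
have [_ cod _] := HE; by rewrite !inE -cod codom_f.
Qed.

Lemma flat_move_ZG (G H : framed) : injective (@nxt G) -> injective (@nxt H) -> flat_move G H ->
  ZG Phi [set: node G] = ZG Phi [set: node H].
Proof.
move=> gI hI; have T i (D : {set node G}) t : @erases G H D i t ->
    ZG Phi [set: node G] = ZG Phi (setT :\: D) -> ZG Phi [set: node G] = ZG Phi [set: node H].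
  by move=> HE E; rewrite (ZG_erased gI HE E); congr ZG; apply/setP => v; rewrite !inE.
case=> [i t HE | x i t xx HE | x y i t xy c1 c2 HE | x y z i t U c1 c2 c3 HE].
- by apply: T HE _; rewrite setD0.
- by apply: T HE _; apply: ZG_R1.
- by apply: T HE _; apply: ZG_R2.
rewrite (ZG_R3 HPhi gI hI U _ _ _ c1 c2 c3 HE) ?inE //.
by congr ZG; apply/setP => v; rewrite !inE.
Qed.

Lemma mate1 (G : framed) (d : dart G) : injective (@nxt G) -> consecutive d.1 (mate d).1.
Proof.
move=> gI; rewrite /consecutive /mate; case: (d.2) => /=; first by rewrite eqxx.
by rewrite (f_finv gI) eqxx orbT.
Qed.

(** At a corner of a face, the next side is the edge at the neighbouring end of the
    other strand.  This turns faces with one, two or three sides into the combinatorial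
    conditions of the moves on framed graphs. *)
Lemma face_mate (G : framed) (d e : dart G) : face d = e -> (mate d).1 = opposite e.1.
Proof.
rewrite /face /rot => <-; case: (mate d) => [[v b] o] /=.
by rewrite /opposite /= negbK.
Qed.

(** The states of a virtual diagram are those of its framed graph, the classical
    crossings being resolved, so that each Reidemeister move reduces to one on framed
    graphs. In a detour both diagrams have the same state
    sum as the diagram without the arcs. *)
Lemma virtual_move_ZG (K L : virt) : injective (@nxt K) -> injective (@nxt L) -> virtual_move K L ->
  ZG Phi (classical K) = ZG Phi (classical L).
Proof.
move=> gI hI.
have pre (N M : virt) (i : node N -> node M) : (forall v, kind v = kind (i v)) -> i @^-1: classical M = classical N.
  by move=> kE; apply/setP => v; rewrite !inE kE.
have T i (D : {set node K}) : @verases K L D i ->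
    ZG Phi (classical K) = ZG Phi (classical K :\: D) -> ZG Phi (classical K) = ZG Phi (classical L).
  by move=> [HE kE] E; rewrite (ZG_erased gI HE E) pre.
case=> [i HE | d i dd dC HE | d1 d2 i d12 d21 ne sub ov HE | d1 d2 d3 i d12 d23 d31 U sub ov HE kE | [N [D [E [i [j [dD dE HD HE _]]]]]]].
- by apply: T HE _; rewrite setD0.
- apply: T HE _; have := mate1 d gI; rewrite (face_mate dd) => /orP[] /eqP E.
    by apply: ZG_R1.
  by apply: (@ZG_R1 _ HPhi K _ (opposite d.1)); rewrite ?oppositeK.
- have m1 := face_mate d12; have m2 := face_mate d21.
  apply: T HE _; move: sub; rewrite subUset !sub1set => /andP[s1 s2].
  apply: (@ZG_R2 _ HPhi K _ d1.1 (opposite d2.1)) => //; first by rewrite -m1 mate1.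
  by rewrite oppositeK -m2 consecutiveC mate1.
- have := face_mate d12; have := face_mate d23; have := face_mate d31.
  have := mate1 d1 gI; have := mate1 d2 gI; have := mate1 d3 gI.
  move=> c3 c2 c1 m3 m2 m1; rewrite m1 in c1 HE; rewrite m2 in c2 HE; rewrite m3 in c3 HE.
  move: sub; rewrite !subUset !sub1set => /andP[/andP[s1 s2] s3].
  by rewrite (ZG_R3 HPhi gI hI U s1 s2 s3 c1 c2 c3 HE) pre.
have side (M : virt) (B : {set node M}) k : injective (@nxt M) -> [disjoint B & classical M] -> @verases M N B k ->
    ZG Phi (classical M) = ZG Phi (classical N).
  by move=> mI dB [HB kB]; have [_ ->] := ZG_erases HPhi mI dB HB; rewrite pre.
by rewrite (side K D i) // (side L E j).
Qed.

Lemma free_equiv_ZG (K L : fknot) : free_equiv K L -> ZG Phi [set: node K] = ZG Phi [set: node L].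
Proof.
elim=> {K L} [K L|K|K L _ ->|K L M _ -> _ ->] //.
by apply: flat_move_ZG; apply: unicursal_inj; exact: fknot_unicursal.
Qed.

Lemma virtual_equiv_ZG (K L : vknot) : virtual_equiv K L -> ZG Phi (classical K) = ZG Phi (classical L).
Proof.
elim=> {K L} [K L|K|K L _ ->|K L M _ -> _ ->] //.
by apply: virtual_move_ZG; apply: unicursal_inj; exact: vknot_unicursal.
Qed.

End Moves.

(** * Conclusion *)

Lemma iso_subdivide (G H : web) i j k (x : option (edge G)) : @is_iso G H i j k ->
  iso (subdivide x) (subdivide (omap k x)).
Proof.
move=> [[[i' iK i'K] [j' jK j'K] [k' kK k'K]] [Ho Hd Hc]].
exists (omap i), (omap j), (fun e => match e with inl e => inl (omap k e) | inr u => inr u end).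
split; split.
- by exists (omap i') => [[p|]|[p|]] //=; rewrite ?iK ?i'K.
- by exists (omap j') => [[p|]|[p|]] //=; rewrite ?jK ?j'K.
- by exists (fun e => match e with inl e => inl (omap k' e) | inr u => inr u end) => [[[e|]|u]|[[e|]|u]] //=; rewrite ?kK ?k'K.
- by move=> [[e|]|u] //=; rewrite Ho.
- move=> [[e|]|u] //=; last by case: x => //= e; rewrite Hd.
  have E : (omap k x == Some (k e)) = (x == Some e).
    by case: x => //= e'; rewrite (inj_eq (@Some_inj _)) (can_eq kK) (inj_eq (@Some_inj _)).
  by rewrite E; case: ifP => //= _; rewrite Hd.
- by case: x => /=; rewrite Hc.
Qed.

(** Needed to pass from K_us to the representative of its isomorphism class. *)
Lemma subdivision_iso (G G1 H : web) : subdivision G G1 -> iso G H ->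
  exists2 H1, subdivision H H1 & iso G1 H1.
Proof.
elim=> {G1} [|G1 x _ IH cx] GH; first by exists H => //; exact: subdivision_refl.
have [H1 sH [i [j [k I]]]] := IH GH; exists (subdivide (omap k x)); last exact: iso_subdivide I.
apply: subdivision_step sH _; have [_ [_ _ E]] := I.
by move: cx; rewrite /cuttable E; case: (x).
Qed.

Lemma contains_iso (G H K : web) : contains G H -> iso H K -> contains G K.
Proof.
move=> [H1 sH eG] HK; have [K1 sK I] := subdivision_iso sH HK.
by exists K1 => //; apply: embeds_trans (iso_embeds (iso_sym I)) eG.
Qed.

(** The state without unoriented crossings consists of circles, at least one. *)
Lemma circles_gt0 (G : framed) (C : {set node G}) : unicursal G -> 0 < ncirc (resolve C set0).
Proof.
move=> uG; rewrite /=; case: eqP => // /eqP; rewrite -lt0n => /card_gt0P[v _].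
rewrite (@eq_n_comp_r _ _ _ predT); last by move=> x; rewrite !inE; apply/allP => y _; rewrite inE.
by apply/(fcard_gt0P (walk_inj (unicursal_inj uG))) => //; exists (v, true).
Qed.

(** Without crossings to resolve, the diagram is a single circle. *)
Lemma circles_le1 (G : framed) : unicursal G -> ncirc (@resolve G set0 set0) <= 1.
Proof.
move=> uG; rewrite /=; case: eqP => // _.
rewrite (@eq_n_comp_r _ _ _ predT); last by move=> x; rewrite !inE; apply/allP => y _; rewrite inE.
rewrite leqNgt; apply/negP => /(fcard_gt1P (walk_inj (unicursal_inj uG)))[] // x _ [y _].
by rewrite (eq_fconnect (@walkCC G set0)) uG.
Qed.

Lemma eq_or_neq (X : eqType) (a b : X) : a = b \/ a != b.
Proof. by case: eqVneq; [left | right]. Qed.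

Local Notation nm0 G := (fun x : node G * bool => nm false (inl x)).
Local Notation nn0 G := (fun v : node G => nm false (inr v)).

Section Conclusion.
Variables (G H : framed) (C : {set node G}) (D : {set node H}).
Hypotheses (uG : unicursal G) (uH : unicursal H).
Hypotheses (nb : ~~ has_bigon (resolve C C)) (nq : ~~ has_quad (resolve C C)).
Hypothesis E : forall t, ZG (phi t) C = ZG (phi t) D.

Lemma state_resolve (K : framed) (B U : {set node K}) t : unicursal K ->
  state_value (phi t) B (cr (nm0 K) (nn0 K) (@nxt K)) U (enum (node K)) [::] [::] [::] = tcoef2 t (web_value (resolve B U)).
Proof. by move=> uK; rewrite /state_value !cats0; apply: resolve_value (unicursal_inj uK) t. Qed.

Lemma nonzero_state (K : framed) (B : {set node K}) t : unicursal K -> ZG (phi t) B != 0%R ->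
  exists2 U : {set node K}, U \subset B & tcoef2 t (web_value (resolve B U)) != 0%R.
Proof.
move=> uK nz; have W := wf_cr (fun v => v \in B) (naming0 K) (unicursal_inj uK).
have [e|ne] := eq_or_neq (ZG (phi t) B) (tcoef2 t (web_value (resolve B B))).
  by exists B; rewrite -?e.
rewrite -state_resolve // in ne.
have [U [sU _ nU]] := lower_state (phi_rules t) (enum_uniq _) W ne.
by exists U; rewrite -?state_resolve.
Qed.

(** If there are crossings, t is the class of K_us and the state sum is 1 on both sides.
    If there are none, K_us is one circle, which is found in any state that consists of
    circles. *)
Lemma state_contains : exists s : {set node H},
  [/\ s \subset D, contains (resolve D s) (resolve C C), trivalent (resolve D s) &
      0 < #|C| -> exists t, iso (resolve C C) (tgraph_web t) /\ tcoef (web_value (resolve D s)) t <> 0%R].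
Proof.
have tG := resolve_trivalent C C (unicursal_inj uG).
have [C0|C0] := posnP #|C|.
  exists set0; split=> //; first exact: sub0set; last exact: resolve_trivalent D set0 (unicursal_inj uH).
  move/eqP: C0; rewrite cards_eq0 => /eqP C0; exists (resolve C C); first exact: subdivision_refl.
  have noV (X : {u : node G | u \in C} -> Type) : forall u, X u by move=> [u uC]; exfalso; move: uC; rewrite C0 inE.
  exists (noV _), (noV _), (fun e => noV (fun=> edge (resolve D set0)) e.1); split.
    by split=> [u|u|[u b]]; have := noV (fun=> False) u.
  split=> [[u b]|[u b]|]; try by have := noV (fun=> False) u.
  rewrite C0; exact: leq_trans (circles_le1 uG) (circles_gt0 D uH).
have [t I] := ex_tgraph tG (resolve_connected uG C0) nb nq.
(* K_us itself contributes 1 and the other states have fewer vertices than t. *)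
have ZC : ZG (phi t) C = 1%R.
  have v1 : tcoef2 t (web_value (resolve C C)) = 1%R.
    have [[fi _ ft] _] := web_value_reduction.
    have e : web_value (resolve C C) = varM t by exact: etrans (fi _ _ tG I) (ft t).
    exact: etrans (f_equal (tcoef2 t) e) (tcoef2_var t).
  have W := wf_cr (fun v => v \in C) (naming0 G) (unicursal_inj uG).
  have [<-//|ne] := eq_or_neq (tcoef2 t (web_value (resolve C C))) (ZG (phi t) C).
  rewrite eq_sym -state_resolve // in ne.
  have [U [sU [v _ /andP[vC vU]] nU]] := lower_state (phi_rules t) (enum_uniq _) W ne.
  rewrite state_resolve // in nU.
  have tU := resolve_trivalent C U (unicursal_inj uG).
  have := contains_src (contains_iso (tcoef_contains web_value_reduction tU (tcoef2_neq0 nU)) (iso_sym I)).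
  rewrite !card_src_resolve leqNgt => /negP[]; apply: proper_card.
  by apply/properP; split=> //; exists v.
have [|s sD ns] := nonzero_state (B := D) (t := t) uH; first by rewrite -E ZC oner_eq0.
have ts := resolve_trivalent D s (unicursal_inj uH).
have nt := tcoef2_neq0 ns.
exists s; split=> //; last by move=> _; exists t; split=> //; apply/eqP.
exact: contains_iso (tcoef_contains web_value_reduction ts nt) (iso_sym I).
Qed.

End Conclusion.

Theorem corollary3p4 :
  exists f : web -> moduleM,
  reduction_map f /\
  (forall g, reduction_map g -> forall G, trivalent G -> g G = f G) /\
  (forall (n : nat) (K : vknot),
     #|classical K| = n ->
     ~~ has_bigon (virtual_us K) -> ~~ has_quad (virtual_us K) ->
     (forall K' : vknot, virtual_equiv K K' ->
        exists s : {set node K'},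
          [/\ s \subset classical K',
              contains (virtual_state s) (virtual_us K),
              trivalent (virtual_state s)
            & 0 < n -> exists t : tgraph,
                iso (virtual_us K) (tgraph_web t) /\
                tcoef (f (virtual_state s)) t <> 0%R]) /\
     virtual_minimal K /\
     (forall K' : vknot, virtual_equiv K K' -> virtual_minimal K' ->
        #|classical K'| = n)) /\
  (forall (n : nat) (K : fknot),
     #|node K| = n ->
     ~~ has_bigon (free_us K) -> ~~ has_quad (free_us K) ->
     (forall K' : fknot, free_equiv K K' ->
        exists s : {set node K'},
          [/\ contains (free_state s) (free_us K),
              trivalent (free_state s)
            & 0 < n -> exists t : tgraph,
                iso (free_us K) (tgraph_web t) /\
                tcoef (f (free_state s)) t <> 0%R]) /\
     free_minimal K /\
     (forall K' : fknot, free_equiv K K' -> free_minimal K' ->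
        #|node K'| = n)).
Proof.
exists web_value; split; first exact: web_value_reduction.
split; first by move=> g rg; apply: reduction_map_unique web_value_reduction rg.
split=> n K Kn nb nq.
  have states (L : vknot) (KL : virtual_equiv K L) := state_contains (@vknot_unicursal K) (@vknot_unicursal L)
    nb nq (fun t => virtual_equiv_ZG (phi_rules t) KL).
  have Kmin : virtual_minimal K.
    move=> L /states[s [sL /contains_src h _ _]].
    by rewrite !card_src_resolve in h; exact: leq_trans h (subset_leq_card sL).
  split; first by move=> L KL; rewrite -Kn; exact: states L KL.
  split=> // L KL Lmin; apply/eqP; rewrite -Kn eqn_leq Kmin // andbT.
  by apply: Lmin; exact: rst_sym.
have nK : #|[set: node K]| = n by rewrite cardsT.
have states (L : fknot) (KL : free_equiv K L) := state_contains (@fknot_unicursal K) (@fknot_unicursal L)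
  nb nq (fun t => free_equiv_ZG (phi_rules t) KL).
have Kmin : free_minimal K.
  move=> L /states[s [_ /contains_src h _ _]].
  by rewrite !card_src_resolve cardsT in h; exact: leq_trans h (max_card _).
split.
  by move=> L KL; have [s [_ h1 h2 h3]] := states L KL; exists s; rewrite -nK.
split=> // L KL Lmin; apply/eqP; rewrite -Kn eqn_leq Kmin // andbT.
by apply: Lmin; exact: rst_sym.
Qed.
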